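(* For every $s\in[0,1]$ and every $N\in\frac12\mathbb Z$, $N\ne0$, the dimension spectrum of the regular even spectral triple $(\mathcal A(S^2_{qs}),\mathcal H,D,\gamma)$, where $D|l,m;\pm N\rangle=(l-|N|+1)|l,m;\mp N\rangle$, is $\Sigma=\{1,2\}$.
   Context: Fix $0<q<1$; $[x]=(q^x-q^{-x})/(q-q^{-1})$. For $0\le s\le1$, $\mathcal A(S^2_{qs})$ is the unital $*$-algebra generated by $A=A^*,B,B^*$ with relations $AB=q^2BA$, $BB^*+(A+s^2)(A-1)=0$, $B^*B+(q^2A+s^2)(q^2A-1)=0$ (Podle\'s sphere). For nonzero $M\in\frac12\mathbb Z$ let $\mathcal H_M$ be the Hilbert space with orthonormal basis $|l,m;M\rangle$, $l-|M|\in\mathbb N$, $m\in\{-l,-l+1,\dots,l\}$. Put $x_1=(q[2])^{1/2}B$, $x_0=1-s^2-q[2]A$. The $*$-representation of $\mathcal A(S^2_{qs})$ on $\mathcal H_M$ is $$x_1|l,m;M\rangle=q^{-l+m}\sqrt{[l+m+1][l+m+2]}\,\alpha_{M,l+1}|l+1,m+1;M\rangle-q^{m+2}\sqrt{[2][l-m][l+m+1]}\,\beta_{M,l}|l,m+1;M\rangle-q^{l+m+1}\sqrt{[l-m][l-m-1]}\,\alpha_{M,l}|l-1,m+1;M\rangle,$$ $$x_0|l,m;M\rangle=q^m\sqrt{[2][l-m+1][l+m+1]}\,\alpha_{M,l+1}|l+1,m;M\rangle+\big([2l]-q^{l+m+1}[2][l-m]\big)\beta_{M,l}|l,m;M\rangle+q^m\sqrt{[2][l-m][l+m]}\,\alpha_{M,l}|l-1,m;M\rangle,$$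 with terms involving vectors outside the index set omitted, where $$\alpha_{M,l}=\frac1{[2l]}\sqrt{\frac{[2][l+M][l-M]}{[2l-1][2l+1]}}\sqrt{(q^{l+M}+q^{-(l+M)}s^2)(q^{l-M}s^2+q^{-(l-M)})},$$ $$\beta_{M,l}=\frac{([2l]-q^{l+M+1}[2][l-M])(1-s^2)+q[2][2M]s^2}{q^2[2l][2l+2]}.$$ Fix $N\in\frac12\mathbb Z$, $N\ne0$. Let $\mathcal H=\mathcal H_{-N}\oplus\mathcal H_N$, and let $\gamma=+1$ on $\mathcal H_{-N}$ and $-1$ on $\mathcal H_N$. For a regular finite-dimensional spectral triple $(\mathcal A,\mathcal H,D)$ with $D$ invertible, put $\delta(T)=[|D|,T]$ and let $\Psi^0$ be the algebra generated by $\bigcup_{k\ge0}\delta^k(\mathcal A\cup[D,\mathcal A])$. For $T\in\Psi^0$ the function $\zeta_T(z)=\mathrm{Tr}(T|D|^{-z})$ is holomorphic for $\mathrm{Re}\,z$ large. If all $\zeta_T$, $T\in\Psi^0$, extend meromorphically to $\mathbb C$ with only poles as singularities, and the union $\Sigma$ of these poles is countable, then $\Sigma$ is called the dimension spectrum. *)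

(* Defs.v *)
From HB Require Import structures.
From mathcomp Require Import all_boot all_order all_algebra.
From mathcomp Require Import generic_quotient complex finmap.
From mathcomp Require Import all_classical all_reals all_analysis.
From mathcomp Require Import ring.
From mathcomp Require summability.

Set Implicit Arguments.
Unset Strict Implicit.
Unset Printing Implicit Defensive.

Import Order.TTheory GRing.Theory Num.Theory numFieldNormedType.Exports.

Local Open Scope classical_set_scope.
Local Open Scope ring_scope.
Local Open Scope complex_scope.
Local Open Scope quotient_scope.

Inductive star_term (K X : Type) : Type :=
| SGen of X
| SScal of K
| SAdd of star_term K X & star_term K X
| SMul of star_term K X & star_term K X
| SStar of star_term K X.
Arguments SGen {K X}.
Arguments SScal {K X}.
Arguments SAdd {K X}.
Arguments SMul {K X}.
Arguments SStar {K X}.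

HB.instance Definition _ (K X : Type) := gen_eqMixin (star_term K X).
HB.instance Definition _ (K X : Type) := gen_choiceMixin (star_term K X).

(* The least congruence that contains rel and makes the quotient a unital
   *-algebra over K, SScal c being the multiple c of the unit. *)
Inductive star_cong (K : numClosedFieldType) (X : Type)
    (rel : star_term K X -> star_term K X -> Prop) :
    star_term K X -> star_term K X -> Prop :=
| sc_rel x y : rel x y -> star_cong rel x y
| sc_refl x : star_cong rel x x
| sc_sym x y : star_cong rel x y -> star_cong rel y x
| sc_trans x y z : star_cong rel x y -> star_cong rel y z -> star_cong rel x z
| sc_add x x' y y' : star_cong rel x x' -> star_cong rel y y' ->
    star_cong rel (SAdd x y) (SAdd x' y')
| sc_mul x x' y y' : star_cong rel x x' -> star_cong rel y y' ->
    star_cong rel (SMul x y) (SMul x' y')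
| sc_star x x' : star_cong rel x x' -> star_cong rel (SStar x) (SStar x')
| sc_addA x y z : star_cong rel (SAdd x (SAdd y z)) (SAdd (SAdd x y) z)
| sc_addC x y : star_cong rel (SAdd x y) (SAdd y x)
| sc_add0 x : star_cong rel (SAdd (SScal 0) x) x
| sc_mulA x y z : star_cong rel (SMul x (SMul y z)) (SMul (SMul x y) z)
| sc_mul1l x : star_cong rel (SMul (SScal 1) x) x
| sc_mul1r x : star_cong rel (SMul x (SScal 1)) x
| sc_mulDl x y z :
    star_cong rel (SMul (SAdd x y) z) (SAdd (SMul x z) (SMul y z))
| sc_mulDr x y z :
    star_cong rel (SMul x (SAdd y z)) (SAdd (SMul x y) (SMul x z))
| sc_mul0 x : star_cong rel (SMul (SScal 0) x) (SScal 0)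
| sc_scalD a b : star_cong rel (SScal (a + b)) (SAdd (SScal a) (SScal b))
| sc_scalM a b : star_cong rel (SScal (a * b)) (SMul (SScal a) (SScal b))
| sc_scalC a x : star_cong rel (SMul (SScal a) x) (SMul x (SScal a))
| sc_starD x y :
    star_cong rel (SStar (SAdd x y)) (SAdd (SStar x) (SStar y))
| sc_starM x y :
    star_cong rel (SStar (SMul x y)) (SMul (SStar y) (SStar x))
| sc_starK x : star_cong rel (SStar (SStar x)) x
| sc_starS a : star_cong rel (SStar (SScal a)) (SScal a^*%R).

Section Presentation.
Variables (K : numClosedFieldType) (X : Type).
Variable rel : star_term K X -> star_term K X -> Prop.

Definition star_congb (x y : star_term K X) : bool := `[< star_cong rel x y >].

Lemma star_congb_refl : reflexive star_congb.
Proof. by move=> x; apply/asboolP; apply: sc_refl. Qed.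

Lemma star_congb_sym : symmetric star_congb.
Proof. by move=> x y; apply/asboolP/asboolP; apply: sc_sym. Qed.

Lemma star_congb_trans : transitive star_congb.
Proof.
move=> y x z /asboolP h /asboolP h'; apply/asboolP; exact: sc_trans h h'.
Qed.

Canonical star_cong_equiv :=
  EquivRel star_congb star_congb_refl star_congb_sym star_congb_trans.

Definition presented := {eq_quot star_cong_equiv}.

HB.instance Definition _ := Choice.on presented.
HB.instance Definition _ := EqQuotient.on presented.

Local Notation cls t := (\pi_presented t).

Lemma presentedP x y : star_cong rel x y -> cls x = cls y.
Proof. by move=> h; apply/eqmodP/asboolP. Qed.

Lemma presentedI x y : cls x = cls y -> star_cong rel x y.
Proof. by move=> /eqmodP/asboolP. Qed.

Lemma repr_cls x : star_cong rel (repr (cls x)) x.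
Proof. by apply: presentedI; rewrite reprK. Qed.

Definition pr_scal (c : K) : presented := cls (SScal c).
Definition pr_add (x y : presented) : presented := cls (SAdd (repr x) (repr y)).
Definition pr_mul (x y : presented) : presented := cls (SMul (repr x) (repr y)).
Definition pr_star (x : presented) : presented := cls (SStar (repr x)).

Lemma pr_addE x y : pr_add (cls x) (cls y) = cls (SAdd x y).
Proof. by apply: presentedP; apply: sc_add; apply: repr_cls. Qed.

Lemma pr_mulE x y : pr_mul (cls x) (cls y) = cls (SMul x y).
Proof. by apply: presentedP; apply: sc_mul; apply: repr_cls. Qed.

Lemma pr_starE x : pr_star (cls x) = cls (SStar x).
Proof. by apply: presentedP; apply: sc_star; apply: repr_cls. Qed.

Lemma pr_addA : associative pr_add.
Proof.
elim/quotW=> x; elim/quotW=> y; elim/quotW=> z.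
rewrite (pr_addE y z) (pr_addE x y) !pr_addE.
by apply: presentedP; apply: sc_addA.
Qed.

Lemma pr_addC : commutative pr_add.
Proof.
elim/quotW=> x; elim/quotW=> y.
by rewrite !pr_addE; apply: presentedP; apply: sc_addC.
Qed.

Lemma pr_add0 : left_id (pr_scal 0) pr_add.
Proof.
by elim/quotW=> x; rewrite pr_addE; apply: presentedP; apply: sc_add0.
Qed.

Lemma pr_mulA : associative pr_mul.
Proof.
elim/quotW=> x; elim/quotW=> y; elim/quotW=> z.
rewrite (pr_mulE y z) (pr_mulE x y) !pr_mulE.
by apply: presentedP; apply: sc_mulA.
Qed.

Lemma pr_mul1l : left_id (pr_scal 1) pr_mul.
Proof.
by elim/quotW=> x; rewrite pr_mulE; apply: presentedP; apply: sc_mul1l.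
Qed.

Lemma pr_mul1r : right_id (pr_scal 1) pr_mul.
Proof.
by elim/quotW=> x; rewrite pr_mulE; apply: presentedP; apply: sc_mul1r.
Qed.

Lemma pr_mulDl : left_distributive pr_mul pr_add.
Proof.
elim/quotW=> x; elim/quotW=> y; elim/quotW=> z.
rewrite (pr_addE x y) (pr_mulE x z) (pr_mulE y z) pr_mulE pr_addE.
by apply: presentedP; apply: sc_mulDl.
Qed.

Lemma pr_mulDr : right_distributive pr_mul pr_add.
Proof.
elim/quotW=> x; elim/quotW=> y; elim/quotW=> z.
rewrite (pr_addE y z) (pr_mulE x y) (pr_mulE x z) pr_mulE pr_addE.
by apply: presentedP; apply: sc_mulDr.
Qed.

Lemma pr_mul0 x : pr_mul (pr_scal 0) x = pr_scal 0.
Proof.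
by elim/quotW: x => x; rewrite pr_mulE; apply: presentedP; apply: sc_mul0.
Qed.

Lemma pr_scalD a b : pr_scal (a + b) = pr_add (pr_scal a) (pr_scal b).
Proof. by rewrite pr_addE; apply: presentedP; apply: sc_scalD. Qed.

Lemma pr_scalM a b : pr_scal (a * b) = pr_mul (pr_scal a) (pr_scal b).
Proof. by rewrite pr_mulE; apply: presentedP; apply: sc_scalM. Qed.

Lemma pr_scalC a x : pr_mul (pr_scal a) x = pr_mul x (pr_scal a).
Proof.
by elim/quotW: x => x; rewrite !pr_mulE; apply: presentedP; apply: sc_scalC.
Qed.

Definition pr_opp (x : presented) : presented := pr_mul (pr_scal (-1)) x.

Lemma pr_addN : left_inverse (pr_scal 0) pr_opp pr_add.
Proof.
move=> x; rewrite /pr_opp -{2}[x]pr_mul1l -pr_mulDl -pr_scalD addNr.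
exact: pr_mul0.
Qed.

HB.instance Definition _ :=
  GRing.isZmodule.Build presented pr_addA pr_addC pr_add0 pr_addN.

HB.instance Definition _ :=
  GRing.Zmodule_isPzRing.Build presented
    pr_mulA pr_mul1l pr_mul1r pr_mulDl pr_mulDr.

Definition pr_scale (c : K) (x : presented) : presented := pr_mul (pr_scal c) x.

Lemma pr_scaleA a b v : pr_scale a (pr_scale b v) = pr_scale (a * b) v.
Proof. by rewrite /pr_scale pr_mulA pr_scalM. Qed.

Lemma pr_scale1 : left_id 1 pr_scale.
Proof. by move=> x; rewrite /pr_scale pr_mul1l. Qed.

Lemma pr_scaleDr : right_distributive pr_scale +%R.
Proof. by move=> a x y; rewrite /pr_scale pr_mulDr. Qed.

Lemma pr_scaleDl v : {morph pr_scale^~ v : a b / a + b}.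
Proof. by move=> a b; rewrite /pr_scale pr_scalD pr_mulDl. Qed.

HB.instance Definition _ :=
  GRing.Zmodule_isLmodule.Build K presented
    pr_scaleA pr_scale1 pr_scaleDr pr_scaleDl.

Lemma pr_scaleAl (a : K) (u v : presented) : a *: (u * v) = (a *: u) * v.
Proof. exact: pr_mulA. Qed.

Lemma pr_scaleAr (a : K) (u v : presented) : a *: (u * v) = u * (a *: v).
Proof.
rewrite [LHS]pr_mulA [_ * (a *: v)]pr_mulA; congr (pr_mul _ v).
exact: pr_scalC.
Qed.

End Presentation.

Inductive podles_gen := GenA | GenB.

Section Podles.
Variables (R : realType) (q s : R).

Local Notation term := (star_term R[i] podles_gen).
Local Notation A := (@SGen R[i] podles_gen GenA).
Local Notation B := (@SGen R[i] podles_gen GenB).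
Local Notation scal r := (@SScal R[i] podles_gen (r : R)%:C).

Inductive podles_rel : term -> term -> Prop :=
| podles_A : podles_rel (SStar A) A
| podles_AB : podles_rel (SMul A B) (SMul (scal (q ^+ 2)) (SMul B A))
| podles_BBs : podles_rel
    (SAdd (SMul B (SStar B))
          (SMul (SAdd A (scal (s ^+ 2))) (SAdd A (scal (-1)))))
    (scal 0)
| podles_BsB : podles_rel
    (SAdd (SMul (SStar B) B)
          (SMul (SAdd (SMul (scal (q ^+ 2)) A) (scal (s ^+ 2)))
                (SAdd (SMul (scal (q ^+ 2)) A) (scal (-1)))))
    (scal 0).

Definition podles := presented podles_rel.
HB.instance Definition _ := GRing.PzRing.on podles.
HB.instance Definition _ := GRing.Lmodule.on podles.

Definition podles_star (a : podles) : podles := pr_star a.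

Fixpoint podles_char (t : term) : R[i] :=
  match t with
  | SGen GenA => 0
  | SGen GenB => s%:C
  | SScal c => c
  | SAdd x y => podles_char x + podles_char y
  | SMul x y => podles_char x * podles_char y
  | SStar x => (podles_char x)^*%R
  end.

Lemma podles_charP x y : star_cong podles_rel x y ->
  podles_char x = podles_char y.
Proof.
have sC : (s%:C)^*%R = s%:C :> R[i].
  by apply: conj_Creal; rewrite complex_real.
elim=> {x y} /=.
- move=> x y [] /=.
  + by rewrite conjC0.
  + by rewrite mul0r !mulr0.
  + rewrite sC add0r add0r rmorphN1 mulrN1 rmorphXn /= -expr2 subrr.
    by rewrite rmorph0.
  + rewrite sC mulr0 !add0r rmorphN1 mulrN1 rmorphXn /= -expr2 subrr.
    by rewrite rmorph0.
- by [].
- by move=> x y _ ->.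
- by move=> x y z _ -> _ ->.
- by move=> x x' y y' _ -> _ ->.
- by move=> x x' y y' _ -> _ ->.
- by move=> x x' _ ->.
- by move=> x y z; rewrite addrA.
- by move=> x y; rewrite addrC.
- by move=> x; rewrite add0r.
- by move=> x y z; rewrite mulrA.
- by move=> x; rewrite mul1r.
- by move=> x; rewrite mulr1.
- by move=> x y z; rewrite mulrDl.
- by move=> x y z; rewrite mulrDr.
- by move=> x; rewrite mul0r.
- by [].
- by [].
- by move=> a x; rewrite mulrC.
- by move=> x y; rewrite rmorphD.
- by move=> x y; rewrite rmorphM mulrC.
- by move=> x; rewrite conjCK.
- by [].
Qed.

Lemma podles_nz : (1 : podles) != 0.
Proof.
apply/eqP => /(@presentedI _ _ podles_rel) /podles_charP /= /eqP.
by rewrite oner_eq0.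
Qed.

HB.instance Definition _ := GRing.PzSemiRing_isNonZero.Build podles podles_nz.
HB.instance Definition _ :=
  GRing.Lmodule_isLalgebra.Build R[i] podles (@pr_scaleAl _ _ podles_rel).
HB.instance Definition _ :=
  GRing.Lalgebra_isAlgebra.Build R[i] podles (@pr_scaleAr _ _ podles_rel).

End Podles.

Definition abs2 (R : realType) (z : R[i]) : R :=
  complex.Re z ^+ 2 + complex.Im z ^+ 2.

(* R[i]^o is R[i] as a normed module over itself. *)
Definition l2_pred (R : realType) (I : choiceType) : {pred I -> R[i]^o} :=
  fun u => `[< summable [set: I] (fun i => (abs2 (u i))%:E) >].

Lemma abs2_ge0 (R : realType) (z : R[i]) : 0 <= abs2 z.
Proof. by rewrite addr_ge0 ?sqr_ge0. Qed.

Lemma l2_predP (R : realType) (I : choiceType) (u : I -> R[i]^o) :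
  reflect (\esum_(i in [set: I]) (abs2 (u i))%:E < +oo)%E (u \in @l2_pred R I).
Proof.
have E : (\esum_(i in [set: I]) `|(abs2 (u i))%:E| =
          \esum_(i in [set: I]) (abs2 (u i))%:E)%E.
  by apply: eq_esum => i _; rewrite /= ger0_norm ?abs2_ge0.
by apply: (iffP (asboolP _)); rewrite /summable E.
Qed.

Lemma l2_submod (R : realType) (I : choiceType) : submod_closed (@l2_pred R I).
Proof.
split.
  apply/l2_predP; rewrite esum1 ?ltry// => i _.
  by rewrite /abs2 /= expr0n addr0.
move=> a u v /l2_predP hu /l2_predP hv; apply/l2_predP.
pose k := 2 * abs2 a.
have k0 : 0 <= k by rewrite mulr_ge0 ?abs2_ge0.
apply: (@le_lt_trans _ _ (\esum_(i in [set: I])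
    (k%:E * (abs2 (u i))%:E + 2%:E * (abs2 (v i))%:E))%E).
  apply: le_esum => i _; rewrite -!EFinM -EFinD lee_fin /k /abs2.
  rewrite [(a *: u + v) i]/(a * u i + v i).
  case: (a) (u i) (v i) => [a1 a2] [u1 u2] [v1 v2] /=.
  rewrite -subr_ge0.
  set d := (X in 0 <= X).
  have -> : d = (a1 * u1 - a2 * u2 - v1) ^+ 2 + (a1 * u2 + a2 * u1 - v2) ^+ 2.
    by rewrite /d; ring.
  by rewrite addr_ge0 ?sqr_ge0.
have esumZ (c : R) (f : I -> R) : 0 <= c -> (forall i, 0 <= f i) ->
    (\esum_(i in [set: I]) (f i)%:E < +oo ->
     \esum_(i in [set: I]) (c%:E * (f i)%:E) < +oo)%E.
  move=> c0 f0 hf.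
  apply: (@le_lt_trans _ _ (c%:E * \esum_(i in [set: I]) (f i)%:E)%E).
    apply: ub_ereal_sup => _ [X XI <-].
    rewrite -ge0_mule_fsumr; last by move=> i; rewrite lee_fin.
    apply: lee_wpmul2l; first by rewrite lee_fin.
    by apply: ereal_sup_ubound; exists X.
  have : (\esum_(i in [set: I]) (f i)%:E \is a fin_num)%E.
    by rewrite ge0_fin_numE// esum_ge0// => i _; rewrite lee_fin.
  by case: (\esum_(i in [set: I]) (f i)%:E)%E => // r _; rewrite -EFinM ltry.
rewrite esumD; first last.
- by move=> i _; rewrite -EFinM lee_fin mulr_ge0 ?abs2_ge0.
- by move=> i _; rewrite -EFinM lee_fin mulr_ge0 ?abs2_ge0.
by rewrite lte_add_pinfty// esumZ// => i; exact: abs2_ge0.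
Qed.

HB.instance Definition _ (R : realType) (I : choiceType) :=
  GRing.isSubmodClosed.Build R[i] (I -> R[i]^o) (@l2_pred R I) (@l2_submod R I).

Record l2 (R : realType) (I : choiceType) :=
  L2 { l2_fun :> I -> R[i]^o ; l2_funP : l2_fun \in @l2_pred R I }.

HB.instance Definition _ (R : realType) (I : choiceType) :=
  [isSub for @l2_fun R I].
HB.instance Definition _ (R : realType) (I : choiceType) :=
  [Choice of l2 R I by <:].
HB.instance Definition _ (R : realType) (I : choiceType) :=
  [SubChoice_isSubLmodule of l2 R I by <:].

Lemma l2_delta_subproof (R : realType) (I : choiceType) (i : I) :
  (fun j => (j == i)%:R : R[i]^o) \in @l2_pred R I.
Proof.
apply/l2_predP.
have -> : (fun j => (abs2 ((j == i)%:R : R[i]))%:E) =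
          (fun j => if j \in [set i] then 1%E else 0%E) :> (I -> \bar R).
  apply/funext => j; rewrite /abs2; case: eqP => [->|ji].
    by rewrite mem_set//= expr1n expr0n addr0.
  by rewrite memNset//= expr0n addr0.
by rewrite -esum_mkcond esum_set1 ?ltry.
Qed.

Definition l2_delta (R : realType) (I : choiceType) (i : I) : l2 R I :=
  L2 (l2_delta_subproof R i).

Section Operators.
Variables (R : realType) (I : choiceType).
Local Notation H := (l2 R I).

(* Antilinear in the first argument. *)
Definition inner (u v : H) : R[i] :=
  summability.sum (fun i => (u i)^*%R * v i : R[i]^o).

Definition hnorm (u : H) : R := Num.sqrt (complex.Re (inner u u)).

Definition bounded_op (T : H -> H) : Prop :=
  linear T /\ exists M : R, forall u, hnorm (T u) <= M * hnorm u.

Definition is_adjoint (T S : H -> H) : Prop :=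
  forall u v, inner (S u) v = inner u (T v).

Definition adjoint (T : H -> H) : H -> H :=
  xget (fun=> 0) [set S | bounded_op S /\ is_adjoint T S].

(* The bounded operator with prescribed values on the standard basis. *)
Definition op_of_basis (f : I -> H) : H -> H :=
  xget (fun=> 0) [set T | bounded_op T /\ forall i, T (l2_delta R i) = f i].

(* The image of the unit ball is totally bounded, i.e. relatively compact. *)
Definition compact_op (K : H -> H) : Prop :=
  bounded_op K /\ forall e : R, 0 < e -> exists ws : seq H,
    forall u, hnorm u <= 1 -> exists2 w, w \in ws & hnorm (K u - w) < e.

(* An unbounded operator is given by its graph. *)
Definition unbounded := set (H * H).

Definition graph_adjoint (G : unbounded) : unbounded :=
  [set p | forall x, G x -> inner x.2 p.1 = inner x.1 p.2].

Definition graph_comp (G F : unbounded) : unbounded :=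
  [set p | exists w, F (p.1, w) /\ G (w, p.2)].

Definition densely_defined (G : unbounded) : Prop :=
  forall w, (forall x, G x -> inner x.1 w = 0) -> w = 0.

Definition selfadjoint (G : unbounded) : Prop :=
  densely_defined G /\ graph_adjoint G = G.

Definition positive (G : unbounded) : Prop :=
  forall x, G x -> 0 <= inner x.1 x.2.

(* The closure of the operator that is defined on the linear span of the
   standard basis and has prescribed values there: the double adjoint of a set
   of pairs is its closed linear span in H * H. *)
Definition closed_op_of_basis (f : I -> H) : unbounded :=
  graph_adjoint (graph_adjoint (range (fun i => (l2_delta R i, f i)))).

(* |G|, the positive square root of G^* G. *)
Definition modulus (G : unbounded) : unbounded :=
  xget set0 [set P | [/\ selfadjoint P, positive P &
                         graph_comp P P = graph_comp (graph_adjoint G) G]].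

(* S is the bounded extension of the commutator [P, T]. *)
Definition is_commutator (P : unbounded) (T S : H -> H) : Prop :=
  bounded_op S /\ forall u v, P (u, v) -> P (T u, T v + S u).

(* x ^ z for x > 0. *)
Definition cpower (x : R) (z : R[i]) : R[i] :=
  (expR (complex.Re z * ln x))%:C *
  (cos (complex.Im z * ln x) +i* sin (complex.Im z * ln x)).

(* P ^ z, for P positive with compact resolvent and Re z <= 0: such a P has an
   orthonormal basis of eigenvectors, so that the bounded operator P ^ z is
   determined by its values on them. *)
Definition op_power (P : unbounded) (z : R[i]) : H -> H :=
  xget (fun=> 0) [set Q | bounded_op Q /\ forall (x : R) u,
    0 < x -> P (u, x%:C *: u) -> Q u = cpower x z *: u].

Definition has_trace (T : H -> H) (t : R[i]) : Prop :=
  summability.partial_sum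
    (fun i => inner (l2_delta R i) (T (l2_delta R i)) : R[i]^o)
    @ summability.totally --> (t : R[i]^o).

End Operators.

Section Meromorphic.
Variable R : realType.
Implicit Types (g : R[i]^o -> R[i]^o) (z : R[i]^o).

Definition holomorphic_at g z : Prop := \forall w \near z, derivable g w 1.

Definition pole g z : Prop :=
  (\forall w \near z^', derivable g w 1) /\
  exists k : nat, exists c : R[i]^o,
    [/\ (0 < k)%N, c != 0 & (w - z) ^+ k * g w @[w --> z^'] --> c].

Definition meromorphic g : Prop := forall z, holomorphic_at g z \/ pole g z.

End Meromorphic.

Section SpectralTriples.
Variables (R : realType) (Alg : algType R[i]) (star : Alg -> Alg).
Variables (I : choiceType) (rep : Alg -> l2 R I -> l2 R I).
Variable D : unbounded R I.
Local Notation op := (l2 R I -> l2 R I).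

Record star_representation : Prop := StarRepresentation {
  rep_bounded : forall a, bounded_op (rep a);
  rep_one : rep 1 = id;
  rep_lin : forall c a b u, rep (c *: a + b) u = c *: rep a u + rep b u;
  rep_mul : forall a b, rep (a * b) = rep a \o rep b;
  rep_star : forall a, is_adjoint (rep a) (rep (star a)) }.

Record spectral_triple : Prop := SpectralTriple {
  st_rep : star_representation;
  st_selfadjoint : selfadjoint D;
  st_commutator : forall a, exists S, is_commutator D (rep a) S;
  (* K = (D + i)^-1, that is, D has compact resolvent. *)
  st_resolvent : exists2 K, compact_op K &
    forall u v, D (u, v) <-> u = K (v + 'i *: u) }.

Record even_spectral_triple (gamma : op) : Prop := EvenSpectralTriple {
  even_st : spectral_triple;
  even_bounded : bounded_op gamma;
  even_selfadjoint : is_adjoint gamma gamma;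
  even_involutive : involutive gamma;
  even_rep : forall a, gamma \o rep a = rep a \o gamma;
  even_D : forall u v, D (u, v) -> D (gamma u, - gamma v) }.

(* D^-1 is everywhere defined and bounded. *)
Definition invertible_D : Prop :=
  exists2 K, bounded_op K & forall u v, D (u, v) <-> u = K v.

(* S = delta^k T, where delta = [|D|, .]. *)
Fixpoint delta_iter (k : nat) (T S : op) : Prop :=
  if k is k'.+1 then
    exists2 S', delta_iter k' T S' & is_commutator (modulus D) S' S
  else S = T.

Definition base_ops : set op :=
  [set T | (exists a, T = rep a) \/
           (exists a, is_commutator D (rep a) T)].

Definition regular_triple : Prop :=
  forall T, base_ops T -> forall k, exists S, delta_iter k T S.

Inductive Psi0 : op -> Prop :=
| Psi0_gen k T S : base_ops T -> delta_iter k T S -> Psi0 S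
| Psi0_add S T : Psi0 S -> Psi0 T -> Psi0 (fun u => S u + T u)
| Psi0_scale c S : Psi0 S -> Psi0 (fun u => c *: S u)
| Psi0_mul S T : Psi0 S -> Psi0 T -> Psi0 (S \o T).

Definition finite_dimensional : Prop :=
  exists2 p : R, 0 < p & exists t, has_trace (op_power (modulus D) (- p)%:C) t.

(* zeta T is the meromorphic continuation of z |-> Tr (T |D|^-z), which is
   unique by the identity theorem. *)
Definition dimension_spectrum (Sigma : set R[i]) : Prop :=
  exists zeta : op -> R[i]^o -> R[i]^o,
    [/\ forall T, Psi0 T ->
          meromorphic (zeta T) /\
          exists r : R, forall z, r < complex.Re z ->
            has_trace (T \o op_power (modulus D) (- z)) (zeta T z) /\
            holomorphic_at (zeta T) z,
        Sigma = [set z | exists2 T, Psi0 T & pole (zeta T) z] &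
        countable Sigma].

End SpectralTriples.

Section PodlesTriple.
Variables (R : realType) (q s : R) (N : rat).

(* (l, m, M) labels the basis vector |l, m; M>. *)
Definition is_ket (x : rat * rat * rat) : bool :=
  let: (l, m, M) := x in
  [&& (M == N) || (M == - N), l - `|M| \is a Num.nat,
      l + m \is a Num.nat & l - m \is a Num.nat].

Definition ket_index := {x | is_ket x}.

Local Notation H := (l2 R ket_index).

(* |l, m; M>, or 0 outside the index set. *)
Definition ket (l m M : rat) : H :=
  if insub (l, m, M) is Some i then l2_delta R i else 0.

Definition qnum (x : R) : R := (q `^ x - q `^ (- x)) / (q - q^-1).
Local Notation "[ x ]" := (qnum x) : ring_scope.
Local Notation "√ x" := (Num.sqrt x) (at level 35, x at level 35).

Definition alpha (M l : R) : R :=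
  [2 * l]^-1
  * √([2] * [l + M] * [l - M] / ([2 * l - 1] * [2 * l + 1]))
  * √((q `^ (l + M) + q `^ (- (l + M)) * s ^+ 2)
      * (q `^ (l - M) * s ^+ 2 + q `^ (- (l - M)))).

Definition beta (M l : R) : R :=
  (([2 * l] - q `^ (l + M + 1) * [2] * [l - M]) * (1 - s ^+ 2)
   + q * [2] * [2 * M] * s ^+ 2)
  / (q ^+ 2 * [2 * l] * [2 * l + 2]).

Definition x1_ket (x : ket_index) : H :=
  let: (l', m', M') := val x in
  let l : R := ratr l' in let m : R := ratr m' in let M : R := ratr M' in
  (q `^ (- l + m) * √([l + m + 1] * [l + m + 2]) * alpha M (l + 1))%:C
    *: ket (l' + 1) (m' + 1) M'
  - (q `^ (m + 2) * √([2] * [l - m] * [l + m + 1]) * beta M l)%:C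
    *: ket l' (m' + 1) M'
  - (q `^ (l + m + 1) * √([l - m] * [l - m - 1]) * alpha M l)%:C
    *: ket (l' - 1) (m' + 1) M'.

Definition x0_ket (x : ket_index) : H :=
  let: (l', m', M') := val x in
  let l : R := ratr l' in let m : R := ratr m' in let M : R := ratr M' in
  (q `^ m * √([2] * [l - m + 1] * [l + m + 1]) * alpha M (l + 1))%:C
    *: ket (l' + 1) m' M'
  + (([2 * l] - q `^ (l + m + 1) * [2] * [l - m]) * beta M l)%:C
    *: ket l' m' M'
  + (q `^ m * √([2] * [l - m] * [l + m]) * alpha M l)%:C
    *: ket (l' - 1) m' M'.

(* x_1 = (q [2])^(1/2) B and x_0 = 1 - s^2 - q [2] A, solved for A and B. *)
Definition rep_gen (g : podles_gen) (u : H) : H :=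
  match g with
  | GenA => (q * [2])^-1%:C *: ((1 - s ^+ 2)%:C *: u - op_of_basis x0_ket u)
  | GenB => (√(q * [2]))^-1%:C *: op_of_basis x1_ket u
  end.

Fixpoint rep_term (t : star_term R[i] podles_gen) : H -> H :=
  match t with
  | SGen g => rep_gen g
  | SScal c => fun u => c *: u
  | SAdd x y => fun u => rep_term x u + rep_term y u
  | SMul x y => rep_term x \o rep_term y
  | SStar x => adjoint (rep_term x)
  end.

Definition podles_rep (a : podles q s) : H -> H := rep_term (repr a).

Definition podles_D : unbounded R ket_index :=
  closed_op_of_basis (fun x : ket_index =>
    let: (l, m, M) := val x in (ratr (l - `|N| + 1))%:C *: ket l m (- M)).

Definition podles_gamma : H -> H :=
  op_of_basis (fun x : ket_index =>
    let: (l, m, M) := val x in (if M == - N then 1 else -1) *: ket l m M).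

End PodlesTriple.

(* Main.v *)
(** In the coordinates [j = l + m], [k = l - m] and the sign of [M], the generators
    [A] and [B] are finite sums of weighted shifts whose weights are functions of
    [q^j] and [q^k], and [|D|] is multiplication by [n = l - |N| + 1].  Call a weight
    a symbol if it converges exponentially fast when one of [j], [k] goes to infinity
    and the other one is fixed.  Finite sums of shifts with symbol weights form an
    algebra.  It is stable under [[|D|, .]], since a shift changes [n] by a constant,
    and it contains [[D, a]], since the weights of [a] at [M] and [-M] differ by a
    term that decays exponentially in [l].  So it contains [Psi^0].  The trace of such
    an operator [T] on the level [n] is [a n + b] up to an exponentially small error;
    hence the zeta function of [T] is [a zeta(z - 1) + b zeta(z)] plus an entire
    function, with at most simple poles at 2 and 1, of residues [a] and [b].  The pole
    at 2 occurs for [T = 1].  For [T = A^2] the traces on the levels are bounded, since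
    [A e_x = O(q^j)], and bounded away from 0, so that [a = 0] and [b <> 0]: the pole
    at 1 occurs too.  The Riemann zeta function is continued by subtracting from
    [v n^(-v-1)] the differences of an approximate antidifference
    [sum_i c_i(v) n^(-v-i)], which leaves an absolutely convergent series. *)
Require Import Defs.
From mathcomp Require Import all_boot all_order all_algebra complex.
From mathcomp Require Import all_classical all_reals all_analysis.
From mathcomp Require Import finmap generic_quotient ring lra zify.
From mathcomp Require summability.

Set Implicit Arguments.
Unset Strict Implicit.
Unset Printing Implicit Defensive.

Import Order.TTheory GRing.Theory Num.Theory numFieldNormedType.Exports.

Local Open Scope classical_set_scope.
Local Open Scope ring_scope.
Local Open Scope complex_scope.
Local Open Scope quotient_scope.

(** That the formulas define a *-representation is a large part of the work. All coefficients
    contain square roots. The relations are checked one component at a time, according to the change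
    of l; once the roots are squared away, each component is a rational identity in q, s, P =
    q^(2M), J = q^(l+m) and K = q^(l-m), or it follows from one recursion for beta. The boundary of
    the index set is the obstacle: roots of negative numbers and divisions by 0 occur there, both
    with value 0, and the coefficients have to vanish whenever a shift leaves the index set.

    Rates of decay are spent on the way. For s = 0 the root [gam] in alpha tends to 0 only like the
    root of q^(2l), so the algebra has symbols of rate sqrt q. The commutator with D pays for its
    unbounded factor with a further root, and the summation over a level with a third one.

    Adjoints, |D|, its powers and bounded operators given on a basis are defined by choice among all
    solutions, so each is identified by a uniqueness argument. Holomorphy is carried by explicit
    bounds on second-order Taylor remainders, which can be added termwise in a series. *)

Notation nm := (@Normc.normc _).

(** * Unconditional sums and operators on l2 *)

Section ComplexNorm.
Variable R : realType.
Implicit Types z w : R[i].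

Lemma nmE z : `|z| = (nm z)%:C.
Proof. by []. Qed.

Lemma nm_ge0 z : 0 <= nm z.
Proof. by case: z => a b; exact: sqrtr_ge0. Qed.

Lemma nmD z w : nm (z + w) <= nm z + nm w.
Proof. exact: le_normcD. Qed.

Lemma nmN z : nm (- z) = nm z.
Proof. exact: normcN. Qed.

Lemma nmM z w : nm (z * w) = nm z * nm w.
Proof. exact: Normc.normcM. Qed.

Lemma nmB z w : nm (z - w) <= nm z + nm w.
Proof. by rewrite -[nm w]nmN; exact: nmD. Qed.

Lemma nm_distC z w : nm (z - w) = nm (w - z).
Proof. by rewrite -nmN opprB. Qed.

Lemma nm0 : nm (0 : R[i]) = 0.
Proof. exact: Normc.normc0. Qed.

Lemma nm1 : nm (1 : R[i]) = 1.
Proof. exact: Normc.normc1. Qed.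

Lemma nm_eq0 z : (nm z == 0) = (z == 0).
Proof.
by apply/eqP/eqP => [/Normc.eq0_normc//|->]; exact: nm0.
Qed.

Lemma nm_gt0 z : (0 < nm z) = (z != 0).
Proof. by rewrite lt0r nm_eq0 nm_ge0 andbT. Qed.

Lemma nm_real (x : R) : nm x%:C = `|x|.
Proof. by rewrite /= expr0n addr0 sqrtr_sqr. Qed.

Lemma nm_nat n : nm (n%:R : R[i]) = n%:R.
Proof.
by rewrite (_ : n%:R = (n%:R)%:C) ?nm_real ?normr_nat// rmorph_nat.
Qed.

Lemma nmV z : nm z^-1 = (nm z)^-1.
Proof. exact: Normc.normcV. Qed.

Lemma nmX z n : nm (z ^+ n) = nm z ^+ n.
Proof. by elim: n => [|n IH]; rewrite ?expr0 ?nm1// !exprS nmM IH. Qed.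

Lemma nm_conj z : nm z^*%R = nm z.
Proof. by case: z => a b /=; rewrite sqrrN. Qed.

Lemma abs2E z : abs2 z = nm z ^+ 2.
Proof. by case: z => a b /=; rewrite sqr_sqrtr// addr_ge0 ?sqr_ge0. Qed.

Lemma nm_Re z : `|complex.Re z| <= nm z.
Proof.
by case: z => a b /=; rewrite -sqrtr_sqr ler_wsqrtr// lerDl sqr_ge0.
Qed.

Lemma nm_Im z : `|complex.Im z| <= nm z.
Proof.
by case: z => a b /=; rewrite -sqrtr_sqr ler_wsqrtr// lerDr sqr_ge0.
Qed.

Lemma ReD z w : complex.Re (z + w) = complex.Re z + complex.Re w.
Proof. by case: z w => [? ?] []. Qed.

Lemma ImD z w : complex.Im (z + w) = complex.Im z + complex.Im w.
Proof. by case: z w => [? ?] []. Qed.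

Lemma ReN z : complex.Re (- z) = - complex.Re z.
Proof. by case: z. Qed.

Lemma ImN z : complex.Im (- z) = - complex.Im z.
Proof. by case: z. Qed.

Lemma nm_ReIm z : nm z <= `|complex.Re z| + `|complex.Im z|.
Proof.
have -> : z = (complex.Re z)%:C + 'i%C * (complex.Im z)%:C by rewrite -complexE.
apply: (le_trans (nmD _ _)); rewrite nmM !nm_real.
have -> : nm ('i%C : R[i]) = 1 by rewrite /= expr0n add0r expr1n sqrtr1.
by case: z => a b /=; rewrite !(mul0r, mulr0, mul1r, addr0, add0r, subr0).
Qed.

Lemma nm_sum (I : Type) (r : seq I) (P : pred I) (f : I -> R[i]) :
  nm (\sum_(i <- r | P i) f i) <= \sum_(i <- r | P i) nm (f i).
Proof.
apply: (big_ind2 (fun x y => nm x <= y)) => //; first by rewrite nm0.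
by move=> a b c d h1 h2; apply: (le_trans (nmD _ _)); exact: lerD.
Qed.

Lemma realCB (x y : R) : x%:C - y%:C = (x - y)%:C.
Proof. by rewrite rmorphB. Qed.

Lemma realCD (x y : R) : x%:C + y%:C = (x + y)%:C.
Proof. by rewrite rmorphD. Qed.

Lemma realC_sum (I : Type) (r : seq I) (P : pred I) (f : I -> R) :
  \sum_(i <- r | P i) (f i)%:C = (\sum_(i <- r | P i) f i)%:C.
Proof. by rewrite rmorph_sum. Qed.

Lemma nm_triangle z w v : nm (z - w) <= nm (z - v) + nm (v - w).
Proof.
apply: le_trans (nmD _ _).
by rewrite addrA subrK.
Qed.

End ComplexNorm.
Arguments Normc.normc : simpl never.

#[local] Existing Instance summability.totally_filter.

Lemma ler_sum_fsubset (R : realDomainType) (I : choiceType) (f : I -> R)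
    (J K : {fset I}) : (forall i, 0 <= f i) -> (J `<=` K)%fset ->
  \sum_(i <- J) f i <= \sum_(i <- K) f i.
Proof.
move=> f0 JK; rewrite (big_fsetID _ (fun i => i \in J) K)/=.
rewrite (_ : [fset x in K | x \in J]%fset = J) ?lerDl ?sumr_ge0//.
by apply/fsetP => x; rewrite !inE/= andb_idl// => /(fsubsetP JK).
Qed.

Section UnorderedSums.
Variables (R : realType) (I : choiceType).
Implicit Types (f g : I -> R[i]) (t : R[i]).
Local Open Scope fset_scope.
Local Open Scope ring_scope.

(** Convergence along the net of finite sets, with real instead of complex radii. Every
    rearrangement is free, which matters for sums over kets that have no preferred order. *)
Definition hs f t := forall e : R, 0 < e -> exists J : {fset I},
  forall K : {fset I}, J `<=` K -> nm (\sum_(i <- K) f i - t) < e.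

Lemma partial_sumE f (J : {fset I}) :
  summability.partial_sum (f : I -> R[i]^o) J = \sum_(i <- J) f i.
Proof. by rewrite /summability.partial_sum big_seq_fsetE. Qed.

Lemma hsP f t :
  hs f t <-> summability.partial_sum (f : I -> R[i]^o) @ summability.totally
             --> (t : R[i]^o).
Proof.
split.
- move=> h; apply/cvgrPdist_lt => e e0.
  (* Radii in [R[i]^o] are elements of [R[i]]; a positive one has imaginary part 0. *)
  have e0' : e = (complex.Re e)%:C.
    by move: e0; rewrite ltcE => /andP[/eqP]; case: (e) => a b /= -> _.
  have e1 : 0 < complex.Re e by rewrite -ltcR -e0'.
  have [J hJ] := h _ e1; exists J => //= K JK /=.
  rewrite partial_sumE e0' nmE ltcR nm_distC.
  exact: hJ.
- move=> /cvgrPdist_lt h e e0.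
  have [|J _ hJ] := h e%:C; first by rewrite ltcR.
  exists J => K JK; have := hJ K JK.
  by rewrite /= partial_sumE nmE ltcR nm_distC.
Qed.

Lemma hs_uniq f t t' : hs f t -> hs f t' -> t = t'.
Proof.
move=> h h'; apply/eqP; rewrite -subr_eq0 -nm_eq0 -[_ == _]negbK.
apply/negP => tt'.
have e0 : 0 < nm (t - t') / 2.
  by rewrite divr_gt0// lt_neqAle eq_sym tt' nm_ge0.
have [J hJ] := h _ e0; have [J' hJ'] := h' _ e0.
have := hJ (J `|` J') (fsubsetUl _ _).
have := hJ' (J `|` J') (fsubsetUr _ _).
set S := \sum_(i <- _) _ => h1 h2.
have := nm_triangle t t' S; rewrite (nm_distC t S) leNgt => /negP; apply.
by rewrite [ltRHS]splitr; apply: ltrD.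
Qed.

Lemma hs_sumE f t : hs f t -> summability.sum (f : I -> R[i]^o) = t.
Proof.
by move=> /hsP h; apply: (cvg_lim (@norm_hausdorff _ _) h).
Qed.

Lemma hsD f g t u : hs f t -> hs g u -> hs (fun i => f i + g i) (t + u).
Proof.
move=> h h' e e0.
have e2 : 0 < e / 2 by rewrite divr_gt0.
have [J hJ] := h _ e2; have [J' hJ'] := h' _ e2.
exists (J `|` J') => K; rewrite fsubUset => /andP[JK JK'].
rewrite big_split/= opprD addrACA (splitr e).
by apply: (le_lt_trans (nmD _ _)); apply: ltrD; [exact: hJ|exact: hJ'].
Qed.

Lemma hsZ c f t : hs f t -> hs (fun i => c * f i) (c * t).
Proof.
move=> h e e0.
have [J hJ] := h (e / (nm c + 1)) (divr_gt0 e0 (ltr_wpDl (nm_ge0 _) ltr01)).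
exists J => K JK; rewrite -mulr_sumr -mulrBr nmM.
have := hJ K JK; rewrite ltr_pdivlMr ?(ltr_wpDl (nm_ge0 _) ltr01)//.
apply: le_lt_trans; rewrite mulrC ler_wpM2l ?nm_ge0// lerDl.
exact: ler01.
Qed.

Lemma hs_conj f t : hs f t -> hs (fun i => (f i)^*%R) t^*%R.
Proof.
move=> h e e0; have [J hJ] := h _ e0; exists J => K JK.
by rewrite -rmorph_sum -rmorphB nm_conj; exact: hJ.
Qed.

Lemma eq_hs f g t : f =1 g -> hs f t -> hs g t.
Proof. by move=> /funext ->. Qed.

Lemma hs_fin f (J : {fset I}) : (forall i, i \notin J -> f i = 0) ->
  hs f (\sum_(i <- J) f i).
Proof.
move=> f0 e e0; exists J => K JK.
rewrite -(big_fset_incl _ JK) ?subrr ?nm0// => i _; exact: f0.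
Qed.

Lemma hs_delta f i : (forall j, j != i -> f j = 0) -> hs f (f i).
Proof.
move=> f0; rewrite -(big_seq_fset1 (+%R) i f); apply: hs_fin => j.
by rewrite inE => /f0.
Qed.

Lemma hs_le (f : I -> R[i]) t (B : R) : hs f t ->
  (forall J : {fset I}, nm (\sum_(i <- J) f i) <= B) -> nm t <= B.
Proof.
move=> h hB; apply/ler_addgt0Pr => e e0; have [J hJ] := h _ e0.
rewrite -(subrK (\sum_(i <- J) f i) t) addrC.
apply: (le_trans (nmD _ _)); apply: lerD; first exact: hB.
by rewrite nm_distC ltW// hJ.
Qed.

Lemma hs_nneg (f : I -> R) t : (forall i, 0 <= f i) ->
  hs (fun i => (f i)%:C) t ->
  t = (complex.Re t)%:C /\
  forall J : {fset I}, \sum_(i <- J) f i <= complex.Re t.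
Proof.
move=> f0 h.
have tr : t = (complex.Re t)%:C.
  apply: hs_uniq (h) _ => e e0; have [J hJ] := h _ e0; exists J => K JK.
  apply: le_lt_trans (hJ K JK).
  rewrite realC_sum realCB nm_real; apply: le_trans (nm_Re _).
  by rewrite ReD ReN.
split => // J; apply/ler_addgt0Pr => e e0; have [K hK] := h _ e0.
have := hK (J `|` K) (fsubsetUr _ _).
rewrite [in X in X < _]tr realC_sum realCB nm_real.
rewrite ltr_distlC => /andP[+ _]; rewrite ltrBlDr => /ltW.
by apply: le_trans; exact: ler_sum_fsubset (fsubsetUl _ _).
Qed.

Definition asum_le (f : I -> R[i]) (B : R) :=
  forall J : {fset I}, \sum_(i <- J) nm (f i) <= B.

Lemma hs_ex_nneg (f : I -> R) (B : R) : (forall i, 0 <= f i) ->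
  (forall J : {fset I}, \sum_(i <- J) f i <= B) ->
  exists t : R, hs (fun i => (f i)%:C) t%:C.
Proof.
move=> f0 fB.
pose S := [set \sum_(i <- J) f i | J in [set: {fset I}]].
have hS : has_sup S.
  split; first by exists (\sum_(i <- fset0) f i); exists fset0.
  by exists B => _ [J _ <-].
exists (sup S) => e e0.
have [_ [J _ <-] hJ] := sup_adherent e0 hS.
exists J => K JK; rewrite realC_sum realCB nm_real ltr_distl.
apply/andP; split.
  by apply: (lt_le_trans hJ); exact: ler_sum_fsubset.
apply: (@le_lt_trans _ _ (sup S)); last by rewrite ltrDl.
by apply: sup_upper_bound => //; exists K.
Qed.

(** Suprema give the sums of nonnegative families only; [f] is the difference of [|f| + f] and
    [|f|], both nonnegative and bounded. *)
Lemma hs_ex_real (f : I -> R) (B : R) :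
  (forall J : {fset I}, \sum_(i <- J) `|f i| <= B) ->
  exists t, hs (fun i => (f i)%:C) t.
Proof.
move=> fB.
have [||t ht] := @hs_ex_nneg (fun i => `|f i|) B => //.
have [||u hu] := @hs_ex_nneg (fun i => `|f i| + f i) (B + B).
- by move=> i; rewrite -lerBlDr sub0r -normrN ler_norm.
- move=> J; apply: le_trans (lerD (fB J) (fB J)); rewrite -big_split/=.
  by apply: ler_sum => i _; rewrite lerD2l ler_norm.
exists (u%:C + (-1) * t%:C); apply: eq_hs (hsD hu (hsZ (-1) ht)) => i /=.
by rewrite mulN1r realCB addrAC subrr add0r.
Qed.

Lemma hs_ex f (B : R) : asum_le f B -> exists t, hs f t.
Proof.
move=> fB.
have [|t ht] := @hs_ex_real (fun i => complex.Re (f i)) B.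
  move=> J; apply: le_trans (fB J); apply: ler_sum => i _; exact: nm_Re.
have [|u hu] := @hs_ex_real (fun i => complex.Im (f i)) B.
  move=> J; apply: le_trans (fB J); apply: ler_sum => i _; exact: nm_Im.
exists (t + 'i%C * u); apply: eq_hs (hsD ht (hsZ 'i%C hu)) => i /=.
by rewrite [RHS]complexE.
Qed.

End UnorderedSums.

Lemma pmap_inj_uniq (I J : eqType) (psi : J -> option I) (s : seq J) :
  (forall i j j', psi j = Some i -> psi j' = Some i -> j = j') ->
  uniq s -> uniq (pmap psi s).
Proof.
move=> inj; elim: s => //= j s IH /andP[js us].
case E : (psi j) => [i|] /=; last exact: IH.
rewrite IH// andbT mem_pmap; apply: contra js => /mapP[j' js' E'].
by rewrite (inj _ _ _ E (esym E')).
Qed.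

Section Reindexing.
Variables (R : realType) (I J : choiceType).
Local Open Scope fset_scope.
Local Open Scope ring_scope.

(** Needed for partial bijections such as shifts, which leave the index set at its boundary: both
    families vanish outside the domains, so a finite sum over [K] is a sum over its preimage, up to
    zero terms. *)
Lemma hs_reindex (f : I -> R[i]) (g : J -> R[i])
    (phi : I -> option J) (psi : J -> option I) t :
  (forall i j, phi i = Some j <-> psi j = Some i) ->
  (forall i, f i = oapp g 0 (phi i)) -> (forall j, g j = oapp f 0 (psi j)) ->
  hs f t -> hs g t.
Proof.
move=> pp fE gE h e e0; have [A hA] := h _ e0.
exists [fset j in pmap phi (enum_fset A)] => K AK.
pose B : {fset I} := [fset i in pmap psi (enum_fset K)].
have -> : \sum_(j <- K) g j = \sum_(i <- B) f i.
  have -> : \sum_(i <- B) f i = \sum_(i <- pmap psi (enum_fset K)) f i.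
    apply: perm_big; apply: uniq_perm; rewrite ?fset_uniq//.
      apply: pmap_inj_uniq; last exact: fset_uniq.
      by move=> i j j' /pp E1 /pp; rewrite E1 => -[].
    by move=> i; rewrite !inE.
  rewrite big_pmap; apply: eq_bigr => j _; rewrite gE.
  by case: (psi j).
have -> : \sum_(i <- B) f i = \sum_(i <- (A `|` B)) f i.
  apply: big_fset_incl; first exact: fsubsetUr.
  move=> i; rewrite in_fsetU => /orP[iA iB|->//]; rewrite fE.
  case E : (phi i) => [j|]//=.
  exfalso; move/negP: iB; apply; rewrite !inE mem_pmap.
  apply/mapP; exists j; last by apply/esym/pp.
  apply: (fsubsetP AK); rewrite !inE mem_pmap; apply/mapP.
  by exists i.
exact: hA (fsubsetUl _ _).
Qed.

End Reindexing.

Section L2.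
Variables (R : realType) (I : choiceType).
Local Notation H := (l2 R I).
Implicit Types (u v w : H) (c : R[i]).

Lemma l2_predE (u : I -> R[i]^o) : (u \in @l2_pred R I) <->
  exists B : R, forall J : {fset I}, \sum_(i <- J) nm (u i) ^+ 2 <= B.
Proof.
split.
- move=> /l2_predP; set S := (\esum_(_ in _) _)%E => S_fin.
  have S0 : (0 <= S)%E by apply: esum_ge0 => i _; rewrite lee_fin abs2_ge0.
  have Sf : S \is a fin_num by rewrite ge0_fin_numE.
  exists (fine S) => J; rewrite -lee_fin fineK// -sumEFin.
  apply: esum_ge; exists [set` J]; first by split => //; exact: finite_fset.
  rewrite fsbig_finite/=; last exact: finite_fset.
  rewrite set_fsetK; apply: lee_sum => i _.
  by rewrite lee_fin abs2E.
- move=> [B hB]; apply/l2_predP; apply: (@le_lt_trans _ _ B%:E); last exact: ltry.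
  apply: ub_ereal_sup => _ [A [finA _] <-].
  rewrite fsbig_finite//= sumEFin lee_fin; apply: le_trans (hB (fset_set A)).
  by apply: ler_sum => i _; rewrite abs2E.
Qed.

Lemma l2_sqsum u :
  exists B : R, forall J : {fset I}, \sum_(i <- J) nm (u i) ^+ 2 <= B.
Proof. by apply/l2_predE; exact: (l2_funP u). Qed.

Lemma l2_ext u v : (forall i, u i = v i) -> u = v.
Proof. by move=> uv; apply/val_inj/funext. Qed.

Lemma l2_addE u v i : (u + v) i = u i + v i. Proof. by []. Qed.
Lemma l2_oppE u i : (- u) i = - u i. Proof. by []. Qed.
Lemma l2_scaleE c u i : (c *: u) i = c * u i. Proof. by []. Qed.
Lemma l2_0E i : (0 : H) i = 0. Proof. by []. Qed.
Lemma l2_deltaE (i j : I) : (l2_delta R i) j = (j == i)%:R. Proof. by []. Qed.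

Definition l2E := (l2_addE, l2_oppE, l2_scaleE, l2_0E, l2_deltaE).

Lemma l2_sumE (K : Type) (r : seq K) (f : K -> H) i :
  (\sum_(k <- r) f k) i = \sum_(k <- r) f k i.
Proof. by elim/big_rec2: _ => //= k x y _ <-. Qed.

(** Has the value 0 if [f] is not square summable, so that an operator can be written down by a
    formula before its boundedness is known. *)
Definition mkl2 (f : I -> R[i]) : H := insubd 0 (f : I -> R[i]^o).

Lemma mkl2E (f : I -> R[i]) (B : R) :
  (forall J : {fset I}, \sum_(i <- J) nm (f i) ^+ 2 <= B) ->
  forall i, mkl2 f i = f i.
Proof.
move=> hB i.
have fl : (f : I -> R[i]^o) \in @l2_pred R I by apply/l2_predE; exists B.
by rewrite /mkl2 /insubd insubT.
Qed.

(** Takes the place of the Cauchy-Schwarz inequality: inner products only have to converge. *)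
Lemma mulr_le_sqrD (x y : R) : x * y <= x ^+ 2 + y ^+ 2.
Proof. by have := sqr_ge0 x; have := sqr_ge0 y; have := sqr_ge0 (x - y); nra. Qed.

Lemma innerP u v : hs (fun i => (u i)^*%R * v i) (inner u v).
Proof.
have [Bu hu] := l2_sqsum u; have [Bv hv] := l2_sqsum v.
have [|t ht] := @hs_ex _ _ (fun i => (u i)^*%R * v i) (Bu + Bv).
  move=> J; apply: le_trans (lerD (hu J) (hv J)); rewrite -big_split/=.
  by apply: ler_sum => i _; rewrite nmM nm_conj mulr_le_sqrD.
by rewrite /inner (hs_sumE ht).
Qed.

Lemma innerE u v t : hs (fun i => (u i)^*%R * v i) t -> inner u v = t.
Proof. exact: hs_uniq (innerP u v). Qed.

Lemma inner_linr c u v w : inner u (c *: v + w) = c * inner u v + inner u w.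
Proof.
apply: innerE; apply: eq_hs (hsD (hsZ c (innerP u v)) (innerP u w)) => i.
by rewrite !l2E mulrDr mulrCA.
Qed.

Lemma inner_conj u v : inner v u = (inner u v)^*%R.
Proof.
apply: innerE; apply: eq_hs (hs_conj (innerP u v)) => i.
by rewrite rmorphM/= conjCK mulrC.
Qed.

Lemma innerDr u v w : inner u (v + w) = inner u v + inner u w.
Proof. by rewrite -[v]scale1r inner_linr mul1r scale1r. Qed.

Lemma inner0r u : inner u 0 = 0.
Proof. by apply/eqP; rewrite -[_ == _](inj_eq (addrI (inner u 0))) -innerDr !addr0. Qed.

Lemma innerZr c u v : inner u (c *: v) = c * inner u v.
Proof. by rewrite -[c *: v]addr0 inner_linr inner0r addr0. Qed.

Lemma innerNr u v : inner u (- v) = - inner u v.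
Proof. by rewrite -scaleN1r innerZr mulN1r. Qed.

Lemma innerDl u v w : inner (u + v) w = inner u w + inner v w.
Proof. by rewrite inner_conj innerDr rmorphD/= -!inner_conj. Qed.

Lemma innerZl c u w : inner (c *: u) w = c^*%R * inner u w.
Proof. by rewrite inner_conj innerZr rmorphM/= -!inner_conj. Qed.

Lemma inner_deltal i u : inner (l2_delta R i) u = u i.
Proof.
apply: innerE.
have := @hs_delta R I (fun j => ((l2_delta R i) j)^*%R * u j) i.
rewrite !l2E eqxx rmorph1 mul1r; apply => j ji.
by rewrite l2E (negbTE ji) rmorph0 mul0r.
Qed.

Lemma inner_deltar i u : inner u (l2_delta R i) = (u i)^*%R.
Proof. by rewrite inner_conj inner_deltal. Qed.

Lemma conj_mul_self (z : R[i]) : z^*%R * z = (nm z ^+ 2)%:C.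
Proof. by rewrite mulrC -normCK nmE -rmorphXn. Qed.

Lemma inner_selfP u : inner u u = (complex.Re (inner u u))%:C /\
  forall J : {fset I}, \sum_(i <- J) nm (u i) ^+ 2 <= complex.Re (inner u u).
Proof.
apply: (@hs_nneg R I (fun i => nm (u i) ^+ 2)) => [i|]; first exact: sqr_ge0.
by apply: eq_hs (innerP u u) => i; rewrite conj_mul_self.
Qed.

Lemma inner_self_ge0 u : 0 <= complex.Re (inner u u).
Proof.
have [_ /(_ fset0)] := inner_selfP u.
by rewrite big_seq_fset0.
Qed.

Lemma hnorm_ge0 u : 0 <= hnorm u.
Proof. exact: sqrtr_ge0. Qed.

Lemma hnorm_sqr u : hnorm u ^+ 2 = complex.Re (inner u u).
Proof. by rewrite sqr_sqrtr// inner_self_ge0. Qed.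

Lemma hnorm_sum u (J : {fset I}) : \sum_(i <- J) nm (u i) ^+ 2 <= hnorm u ^+ 2.
Proof. by rewrite hnorm_sqr; exact: (inner_selfP u).2. Qed.

Lemma hnorm_le u (B : R) : 0 <= B ->
  (forall J : {fset I}, \sum_(i <- J) nm (u i) ^+ 2 <= B ^+ 2) -> hnorm u <= B.
Proof.
move=> B0 hB; rewrite -(@ler_pXn2r _ 2)// ?nnegrE ?hnorm_ge0// hnorm_sqr.
have := @hs_le R I _ _ (B ^+ 2) (innerP u u).
rewrite (inner_selfP u).1 nm_real ger0_norm ?inner_self_ge0//; apply => J.
under eq_bigr do rewrite conj_mul_self.
by rewrite realC_sum nm_real ger0_norm ?hB// sumr_ge0// => i _; exact: sqr_ge0.
Qed.

Lemma nm_coord u i : nm (u i) <= hnorm u.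
Proof.
rewrite -(@ler_pXn2r _ 2)// ?nnegrE ?hnorm_ge0 ?nm_ge0//.
by have := hnorm_sum u [fset i]%fset; rewrite big_seq_fset1.
Qed.

Lemma inner_self_eq0 u : inner u u = 0 -> u = 0.
Proof.
move=> u0; apply: l2_ext => i; apply/eqP; rewrite -nm_eq0 -sqrf_eq0.
rewrite eq_le sqr_ge0 andbT; have := (inner_selfP u).2 [fset i]%fset.
by rewrite u0 big_seq_fset1.
Qed.

(** From (a + b)^2 <= 2 (a^2 + b^2). The factor 2 is harmless, since only boundedness and smallness
    of norms are ever used. *)
Lemma hnormD u v : hnorm (u + v) <= 2 * (hnorm u + hnorm v).
Proof.
have u0 := hnorm_ge0 u; have v0 := hnorm_ge0 v.
apply: hnorm_le; first by rewrite mulr_ge0// addr_ge0.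
move=> J; apply: (@le_trans _ _ (2 * (hnorm u ^+ 2 + hnorm v ^+ 2))); last by nra.
apply: le_trans (ler_wpM2l _ (lerD (hnorm_sum u J) (hnorm_sum v J))) => //.
rewrite -big_split/= mulr_sumr; apply: ler_sum => i _.
have := nmD (u i) (v i); have := nm_ge0 (u i); have := nm_ge0 (v i).
have := nm_ge0 (u i + v i); rewrite -[(_ + _) i]/(u i + v i).
move: (nm (u i)) (nm (v i)) (nm _) => a b s s0 b0 a0 sab.
apply: (@le_trans _ _ ((a + b) ^+ 2)); first by rewrite lerXn2r// nnegrE addr_ge0.
by have := sqr_ge0 (a - b); nra.
Qed.

Lemma hnormZ c u : hnorm (c *: u) <= nm c * hnorm u.
Proof.
apply: hnorm_le; first by rewrite mulr_ge0 ?nm_ge0 ?hnorm_ge0.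
move=> J; rewrite exprMn; apply: le_trans (ler_wpM2l (sqr_ge0 _) (hnorm_sum u J)).
by rewrite mulr_sumr; apply: ler_sum => i _; rewrite l2E nmM exprMn.
Qed.

End L2.

Section LinearMaps.
Variables (R : realType) (I : choiceType).
Local Notation H := (l2 R I).
Implicit Types (u v w : H) (c : R[i]).
Variables (T : H -> H) (linT : linear T).

Lemma lin0 : T 0 = 0.
Proof. by have := linT (-1) 0 0; rewrite scaler0 addr0 scaleN1r addNr. Qed.

Lemma linD u v : T (u + v) = T u + T v.
Proof. by have := linT 1 u v; rewrite !scale1r. Qed.

Lemma linZ c u : T (c *: u) = c *: T u.
Proof. by have := linT c u 0; rewrite lin0 !addr0. Qed.

Lemma linN u : T (- u) = - T u.
Proof. by rewrite -scaleN1r linZ scaleN1r. Qed.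

Lemma linB u v : T (u - v) = T u - T v.
Proof. by rewrite linD linN. Qed.

Lemma lin_sum (K : Type) (r : seq K) (f : K -> H) :
  T (\sum_(k <- r) f k) = \sum_(k <- r) T (f k).
Proof. by apply: (big_morph T linD lin0). Qed.

End LinearMaps.

Section BoundedOperators.
Variables (R : realType) (I : choiceType).
Local Notation H := (l2 R I).
Local Notation op := (H -> H).
Implicit Types (u v w : H) (c : R[i]) (S T : op).

Lemma bounded_opP T : bounded_op T ->
  linear T /\ exists2 M : R, 0 <= M & forall u, hnorm (T u) <= M * hnorm u.
Proof.
move=> [lT [M hM]]; split => //; exists `|M| => // u.
by apply: (le_trans (hM u)); rewrite ler_wpM2r ?hnorm_ge0// ler_norm.
Qed.

Definition truncate (J : {fset I}) u : H := \sum_(i <- J) u i *: l2_delta R i.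

Lemma truncateE J u i : truncate J u i = if i \in J then u i else 0.
Proof.
rewrite l2_sumE; under eq_bigr do rewrite !l2E.
case: ifP => iJ.
  rewrite (big_fsetD1 i)//= eqxx mulr1 big1_fset ?addr0// => j.
  by rewrite !inE => /andP[/negbTE ji _] _; rewrite eq_sym ji mulr0.
rewrite big1_fset// => j jJ _; case: eqP => [ij|]; last by rewrite mulr0.
by rewrite ij jJ in iJ.
Qed.

Lemma truncate_dense u (e : R) : 0 < e -> exists J, hnorm (u - truncate J u) <= e.
Proof.
move=> e0; have e2 : 0 < e ^+ 2 by rewrite exprn_gt0.
have h := innerP u u; have [J hJ] := h _ e2.
exists J; apply: hnorm_le; first exact: ltW.
move=> K; have := hJ (J `|` K)%fset (fsubsetUl _ _).
under eq_bigr do rewrite conj_mul_self.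
rewrite (inner_selfP u).1 realC_sum realCB nm_real distrC => /ltW h1.
have {h} := hJ J (fsubset_refl _).
under eq_bigr do rewrite conj_mul_self.
rewrite (inner_selfP u).1 realC_sum realCB nm_real distrC => /ltW.
move=> /(le_trans (ler_norm _)); apply: le_trans.
(* The mass on [J] and the mass on the part of [K] outside [J] are disjoint parts of the mass on
   their union, hence together at most the total. *)
rewrite lerBrDr; apply: le_trans ((inner_selfP u).2 (J `|` K)%fset).
rewrite (big_fsetID _ (fun i => i \in J) (J `|` K)%fset)/= addrC.
apply: lerD.
  rewrite (big_fsetID _ (fun i => i \in J) K)/= big1_fset ?add0r; last first.
    move=> i; rewrite !inE/= => /andP[_ iJ] _.
    by rewrite -[(_ - _) i]/(u i - truncate J u i) truncateE iJ subrr nm0 expr0n.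
  apply: (@le_trans _ _ (\sum_(i <- [fset x in K | x \notin J]%fset) nm (u i) ^+ 2)).
    rewrite !big_seq; apply: ler_sum => i; rewrite !inE/= => /andP[_ /negbTE iJ].
    by rewrite -[(_ - _) i]/(u i - truncate J u i) truncateE iJ subr0.
  apply: ler_sum_fsubset => [i|]; first exact: sqr_ge0.
  by apply/fsubsetP => i; rewrite !inE/= => /andP[-> ->]; rewrite orbT.
apply: ler_sum_fsubset => [i|]; first exact: sqr_ge0.
by apply/fsubsetP => i iJ; rewrite !inE/= iJ.
Qed.

(** Finite combinations of the basis are dense. This is the uniqueness behind [op_of_basis],
    [op_power] and the bounded extension of a commutator. *)
Lemma bounded_op_ext S T : bounded_op S -> bounded_op T ->
  (forall i, S (l2_delta R i) = T (l2_delta R i)) -> S = T.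
Proof.
move=> /bounded_opP[lS [MS MS0 hS]] /bounded_opP[lT [MT MT0 hT]] ST.
apply/funext => u; apply: l2_ext => i; apply/eqP; rewrite -subr_eq0 -nm_eq0.
rewrite eq_le nm_ge0 andbT; apply/ler_addgt0Pr => e e0; rewrite add0r.
have M0 : 0 < MS + MT + 1 by rewrite ltr_wpDl// addr_ge0.
have [J hJ] := truncate_dense u (divr_gt0 e0 M0).
set t := truncate J u in hJ.
have tE : S t = T t.
  by rewrite /t /truncate !lin_sum//; apply: eq_bigr => k _; rewrite !linZ// ST.
have -> : S u i - T u i = S (u - t) i - T (u - t) i.
  by rewrite !linB// !l2E tE opprB addrA subrK.
apply: (le_trans (nmB _ _)).
apply: (le_trans (lerD (nm_coord _ _) (nm_coord _ _))).
apply: (le_trans (lerD (hS _) (hT _))); rewrite -mulrDl.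
apply: (@le_trans _ _ ((MS + MT + 1) * hnorm (u - t))).
  by rewrite ler_wpM2r ?hnorm_ge0// lerDl.
by rewrite mulrC -ler_pdivlMr.
Qed.

Lemma op_of_basisE (f : I -> H) T : bounded_op T ->
  (forall i, T (l2_delta R i) = f i) -> op_of_basis f = T.
Proof.
move=> bT Tf; apply: xget_unique => [|S [bS Sf]]; first by split.
by apply: bounded_op_ext => // i; rewrite Tf Sf.
Qed.

Lemma is_adjoint_uniq T S S' : is_adjoint T S -> is_adjoint T S' -> S = S'.
Proof.
move=> h h'; apply/funext => u; apply: l2_ext => i.
by apply: (can_inj (@conjCK _)); rewrite -!inner_deltar h h'.
Qed.

Lemma adjointE T S : bounded_op S -> is_adjoint T S -> adjoint T = S.
Proof.
move=> bS TS; apply: xget_unique => [|S' [_ TS']]; first by split.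
exact: is_adjoint_uniq TS' TS.
Qed.

Lemma is_adjointC T S : is_adjoint T S -> is_adjoint S T.
Proof. by move=> h u v; rewrite inner_conj -h -inner_conj. Qed.

Lemma bounded_opD S T : bounded_op S -> bounded_op T ->
  bounded_op (fun u => S u + T u).
Proof.
move=> /bounded_opP[lS [MS MS0 hS]] /bounded_opP[lT [MT MT0 hT]]; split.
  by move=> c u v; rewrite lS lT scalerDr addrACA.
exists (2 * (MS + MT)) => u; apply: (le_trans (hnormD _ _)).
by rewrite -mulrA [(MS + MT) * _]mulrDl ler_pM2l// lerD.
Qed.

Lemma bounded_opZ c T : bounded_op T -> bounded_op (fun u => c *: T u).
Proof.
move=> /bounded_opP[lT [MT MT0 hT]]; split.
  by move=> a u v; rewrite lT scalerDr !scalerA mulrC.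
exists (nm c * MT) => u; apply: (le_trans (hnormZ _ _)).
by rewrite -mulrA ler_wpM2l ?nm_ge0.
Qed.

Lemma is_adjointD S S' T T' : is_adjoint T S -> is_adjoint T' S' ->
  is_adjoint (fun u => T u + T' u) (fun u => S u + S' u).
Proof. by move=> h h' u v; rewrite innerDl innerDr h h'. Qed.

Lemma is_adjoint_comp S S' T T' : is_adjoint T S -> is_adjoint T' S' ->
  is_adjoint (T \o T') (S' \o S).
Proof. by move=> h h' u v /=; rewrite h' h. Qed.

Definition bdd (c : I -> R[i]) := exists C : R, forall i, nm (c i) <= C.

Definition pinv (phi psi : I -> option I) :=
  forall i j, phi i = Some j <-> psi j = Some i.

Lemma pinvC phi psi : pinv phi psi -> pinv psi phi.
Proof. by move=> h i j; apply: iff_sym. Qed.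

(** The value at [i] reads the coordinate [phi i]: the weight is attached to the target, and basis
    vectors move by the partial inverse of [phi]. *)
Definition wshift (phi : I -> option I) (c : I -> R[i]) : op :=
  fun u => mkl2 (fun i => c i * oapp u 0 (phi i)).

Section WeightedShift.
Variables (phi psi : I -> option I) (pp : pinv phi psi).

Lemma pinv_inj i i' j : phi i = Some j -> phi i' = Some j -> i = i'.
Proof. by move=> /pp h1 /pp; rewrite h1 => -[]. Qed.

Lemma wshift_sum (c : I -> R[i]) (C : R) u (J : {fset I}) : (forall i, nm (c i) <= C) ->
  \sum_(i <- J) nm (c i * oapp u 0 (phi i)) ^+ 2 <= (C * hnorm u) ^+ 2.
Proof.
move=> hC; rewrite exprMn.
have /le_trans : \sum_(i <- J) nm (c i * oapp u 0 (phi i)) ^+ 2 <=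
    C ^+ 2 * \sum_(i <- J) nm (oapp u 0 (phi i)) ^+ 2.
  rewrite mulr_sumr; apply: ler_sum => i _; rewrite nmM exprMn.
  rewrite ler_wpM2r ?sqr_ge0// lerXn2r// nnegrE ?nm_ge0//.
  exact: le_trans (nm_ge0 _) (hC i).
apply; rewrite ler_wpM2l ?sqr_ge0//.
apply: le_trans (hnorm_sum u [fset j in pmap phi (enum_fset J)]%fset).
rewrite [leRHS](perm_big (pmap phi (enum_fset J)))/=; last first.
  apply: uniq_perm; rewrite ?fset_uniq//; last by move=> i; rewrite !inE.
  apply: pmap_inj_uniq; last exact: fset_uniq.
  by move=> i j j' h1 h2; exact: pinv_inj h1 h2.
rewrite big_pmap; apply: ler_sum => i _; case: (phi i) => //=.
by rewrite nm0 expr0n.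
Qed.

Lemma wshiftE (c : I -> R[i]) u i : bdd c -> wshift phi c u i = c i * oapp u 0 (phi i).
Proof.
move=> [C hC]; rewrite (mkl2E (B := (C * hnorm u) ^+ 2))// => J.
exact: wshift_sum.
Qed.

Lemma bounded_wshift (c : I -> R[i]) : bdd c -> bounded_op (wshift phi c).
Proof.
move=> bc; split.
  move=> a u v; apply: l2_ext => i; rewrite !l2E !wshiftE//.
  case: (phi i) => [j|]; last by rewrite !mulr0 addr0.
  change (c i * (a * u j + v j) = a * (c i * u j) + c i * v j).
  by rewrite mulrDr mulrCA.
have [C hC] := bc; exists `|C| => u; apply: hnorm_le.
  by rewrite mulr_ge0 ?hnorm_ge0.
move=> J; under eq_bigr do rewrite wshiftE//.
by apply: wshift_sum => i; exact: le_trans (hC i) (ler_norm _).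
Qed.

End WeightedShift.

Lemma bdd_oapp psi (c : I -> R[i]) : bdd c -> bdd (fun j => oapp c 0 (psi j)).
Proof.
move=> [C hC]; exists `|C| => j; case: (psi j) => [i|]/=; last by rewrite nm0.
exact: le_trans (hC i) (ler_norm _).
Qed.

Lemma bdd_conj (c : I -> R[i]) : bdd c -> bdd (fun j => (c j)^*%R).
Proof. by move=> [C hC]; exists C => j; rewrite nm_conj. Qed.

Lemma adjoint_wshift phi psi (c : I -> R[i]) : pinv phi psi -> bdd c ->
  is_adjoint (wshift phi c) (wshift psi (fun j => (oapp c 0 (psi j))^*%R)).
Proof.
move=> pp bc u v; apply/esym/innerE.
have bc' := bdd_conj (bdd_oapp psi bc); have qq := pinvC pp.
have e1 j : (wshift psi (fun j => (oapp c 0 (psi j))^*%R) u j)^*%R * v j =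
    oapp (fun i => (u i)^*%R * wshift phi c v i) 0 (psi j).
  rewrite (wshiftE qq)//; case E : (psi j) => [i|]/=; last by rewrite mulr0 conjC0 mul0r.
  rewrite (wshiftE pp)//; have /pp -> /= := E.
  by rewrite rmorphM/= conjCK mulrCA mulrA.
apply: hs_reindex (innerP _ v) => [||i]; [exact: qq|exact: e1|].
rewrite (wshiftE pp)//; case E : (phi i) => [j|]/=; last by rewrite mulr0 mulr0.
by rewrite e1; have /pp -> /= := E; rewrite (wshiftE pp)// E.
Qed.

End BoundedOperators.

(** * Continuation of the zeta function *)

Section ComplexExponential.
Variable R : realType.
Implicit Types (a w z : R[i]) (x y t : R).

(** Real and imaginary parts are kept apart so that the real mean value theorem applies to each; the
    price is the factor 2 in [complex_mean_value]. *)
Definition cder (f : R -> R[i]) (t : R) (d : R[i]) :=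
  is_derive t 1 (fun x => complex.Re (f x)) (complex.Re d) /\
  is_derive t 1 (fun x => complex.Im (f x)) (complex.Im d).

Lemma real_mean_value (f df : R -> R) (a b B : R) : a <= b ->
  (forall t, t \in `[a, b] -> is_derive t 1 f (df t) /\ `|df t| <= B) ->
  `|f b - f a| <= B * (b - a).
Proof.
move=> ab h.
have [|c|c cab ->] := @MVT_segment R f df a b ab.
- by move=> x /subset_itv_oo_cc/h[].
- apply: derivable_within_continuous => x xab.
  by have [[]] := h _ xab.
have [_ dB] := h _ cab; rewrite normrM (ger0_norm (_ : 0 <= b - a)) ?subr_ge0//.
by rewrite ler_wpM2r ?subr_ge0.
Qed.

Lemma complex_mean_value (f df : R -> R[i]) (a b B : R) : a <= b ->
  (forall t, t \in `[a, b] -> cder f t (df t) /\ nm (df t) <= B) ->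
  nm (f b - f a) <= 2 * B * (b - a).
Proof.
move=> ab h; apply: (le_trans (nm_ReIm _)).
rewrite !(ReD, ImD, ReN, ImN) -mulrA mulr_natl mulr2n; apply: lerD.
  apply: (@real_mean_value (fun x => complex.Re (f x)) (fun x => complex.Re (df x))) => //.
  move=> t /h[[d _] n]; split => //; exact: le_trans (nm_Re _) n.
apply: (@real_mean_value (fun x => complex.Im (f x)) (fun x => complex.Im (df x))) => //.
move=> t /h[[_ d] n]; split => //; exact: le_trans (nm_Im _) n.
Qed.

Lemma cder_eq f t d d' : cder f t d -> d = d' -> cder f t d'.
Proof. by move=> h <-. Qed.

Lemma cderD f g t d d' : cder f t d -> cder g t d' ->
  cder (fun x => f x + g x) t (d + d').
Proof.
move=> [h1 h2] [h3 h4]; split.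
  rewrite ReD (_ : (fun _ => _) = (fun x => complex.Re (f x)) + (fun x => complex.Re (g x))).
    exact: is_deriveD.
  by apply/funext => x; rewrite ReD.
rewrite ImD (_ : (fun _ => _) = (fun x => complex.Im (f x)) + (fun x => complex.Im (g x))).
  exact: is_deriveD.
by apply/funext => x; rewrite ImD.
Qed.

Lemma cderZ c f t d : cder f t d -> cder (fun x => c * f x) t (c * d).
Proof.
move=> [h1 h2]; case: c => a b; split.
  rewrite (_ : (fun _ => _) =
    (a \*: (fun x => complex.Re (f x))) - (b \*: (fun x => complex.Im (f x)))).
    apply: is_derive_eq.
    by case: (d).
  by apply/funext => x; rewrite !fctE/=; case: (f x).
rewrite (_ : (fun _ => _) =
    (a \*: (fun x => complex.Im (f x))) + (b \*: (fun x => complex.Re (f x)))).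
  apply: is_derive_eq.
  by case: (d).
by apply/funext => x; rewrite !fctE/=; case: (f x).
Qed.

Lemma cderN f t d : cder f t d -> cder (fun x => - f x) t (- d).
Proof.
move=> h; apply: cder_eq (_ : cder _ _ (-1 * d)) _; last by rewrite mulN1r.
by rewrite (_ : (fun _ => _) = (fun x => -1 * f x)); [exact: cderZ|apply/funext=> x; rewrite mulN1r].
Qed.

Lemma cderB f g t d d' : cder f t d -> cder g t d' ->
  cder (fun x => f x - g x) t (d - d').
Proof. by move=> h1 h2; apply: cderD => //; apply: cderN. Qed.

Lemma cder_cst c t : cder (fun=> c) t 0.
Proof. by split; apply: is_derive_cst. Qed.

Lemma cder_real (g : R -> R) t (d : R) : is_derive t 1 g d ->
  cder (fun x => (g x)%:C) t d%:C.
Proof. by move=> h; split => //=; apply: is_derive_cst. Qed.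

Lemma cderM f g t d d' : cder f t d -> cder g t d' ->
  cder (fun x => f x * g x) t (d * g t + f t * d').
Proof.
move=> [h1 h2] [h3 h4]; split.
  rewrite (_ : (fun _ => _) =
    ((fun x => complex.Re (f x)) * (fun x => complex.Re (g x)) -
     (fun x => complex.Im (f x)) * (fun x => complex.Im (g x)))).
    apply: is_derive_eq.
    by case: (f t) (g t) (d) (d') => [? ?] [? ?] [? ?] [? ?] /=; rewrite /GRing.scale/=; ring.
  by apply/funext => x; rewrite !fctE/=; case: (f x) (g x) => [? ?] [].
rewrite (_ : (fun _ => _) =
    ((fun x => complex.Re (f x)) * (fun x => complex.Im (g x)) +
     (fun x => complex.Im (f x)) * (fun x => complex.Re (g x)))).
  apply: is_derive_eq.
  by case: (f t) (g t) (d) (d') => [? ?] [? ?] [? ?] [? ?] /=; rewrite /GRing.scale/=; ring.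
by apply/funext => x; rewrite !fctE/=; case: (f x) (g x) => [? ?] [].
Qed.

Lemma cder_sum n (f : nat -> R -> R[i]) t (d : nat -> R[i]) :
  (forall k, cder (f k) t (d k)) ->
  cder (fun x => \sum_(k < n) f k x) t (\sum_(k < n) d k).
Proof.
move=> h; elim: n => [|n IH].
  rewrite big_ord0 (_ : (fun _ => _) = fun=> 0); first exact: cder_cst.
  by apply/funext => x; rewrite big_ord0.
rewrite big_ord_recr/= (_ : (fun _ => _) = fun x => \sum_(k < n) f k x + f n x).
  exact: cderD.
by apply/funext => x; rewrite big_ord_recr.
Qed.

(** The complex exponential, in the polar form used by [cpower]. *)
Definition cexp a : R[i] :=
  (expR (complex.Re a))%:C * (cos (complex.Im a) +i* sin (complex.Im a)).

Lemma cexp0 : cexp 0 = 1.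
Proof. by rewrite /cexp/= expR0 cos0 sin0 mul1r. Qed.

Lemma cexpD a b : cexp (a + b) = cexp a * cexp b.
Proof.
rewrite /cexp ReD ImD expRD cosD sinD; apply/eqP; rewrite eq_complex/=.
by apply/andP; split; apply/eqP; ring.
Qed.

Lemma nm_cexp a : nm (cexp a) = expR (complex.Re a).
Proof.
rewrite /cexp nmM nm_real ger0_norm ?expR_ge0// /Normc.normc cos2Dsin2 sqrtr1.
by rewrite mulr1.
Qed.

Lemma Re_mul_real a x : complex.Re (a * x%:C) = complex.Re a * x.
Proof. by case: a => ? ? /=; rewrite mulr0 subr0. Qed.

Lemma Im_mul_real a x : complex.Im (a * x%:C) = complex.Im a * x.
Proof. by case: a => ? ? /=; rewrite mulr0 add0r. Qed.

Lemma cder_cexp w (g : R -> R) t (d : R) : is_derive t 1 g d ->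
  cder (fun x => cexp (w * (g x)%:C)) t (w * d%:C * cexp (w * (g t)%:C)).
Proof.
move=> h.
set x := complex.Re w; set y := complex.Im w.
have h1 : is_derive t (1 : R) (fun u => expR (x * g u)) (x * d * expR (x * g t)).
  have hx : is_derive t 1 (x \*: g) (x *: d) by exact: is_deriveZ.
  apply: is_derive_eq (@is_derive1_comp _ expR (x \*: g) t _ _ _ _) _ => //.
  by rewrite /= mulrC.
have h2 : is_derive t (1 : R) (fun u => cos (y * g u)) (- (y * d * sin (y * g t))).
  have hx : is_derive t 1 (y \*: g) (y *: d) by exact: is_deriveZ.
  apply: is_derive_eq (@is_derive1_comp _ cos (y \*: g) t _ _ _ _) _ => //.
  by rewrite /= mulNr mulrC.
have h3 : is_derive t (1 : R) (fun u => sin (y * g u)) (y * d * cos (y * g t)).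
  have hx : is_derive t 1 (y \*: g) (y *: d) by exact: is_deriveZ.
  apply: is_derive_eq (@is_derive1_comp _ sin (y \*: g) t _ _ _ _) _ => //.
  by rewrite /= mulrC.
split.
  rewrite (_ : (fun _ => _) = (fun u => expR (x * g u)) * (fun u => cos (y * g u))).
    apply: is_derive_eq; rewrite /cexp Re_mul_real Im_mul_real -/x -/y.
    rewrite /GRing.scale/= [w](_ : _ = x +i* y); last by rewrite /x /y; case: (w).
    rewrite /=; ring.
  apply/funext => u; rewrite /cexp Re_mul_real Im_mul_real -/x -/y/=.
  by rewrite mul0r subr0.
rewrite (_ : (fun _ => _) = (fun u => expR (x * g u)) * (fun u => sin (y * g u))).
  apply: is_derive_eq; rewrite /cexp Re_mul_real Im_mul_real -/x -/y.
  rewrite /GRing.scale/= [w](_ : _ = x +i* y); last by rewrite /x /y; case: (w).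
  rewrite /=; ring.
apply/funext => u; rewrite /cexp Re_mul_real Im_mul_real -/x -/y/=.
by rewrite mul0r addr0.
Qed.

Lemma cexp_sub1_le a : nm (cexp a - 1) <= 2 * (nm a * expR (nm a)).
Proof.
have := @complex_mean_value (fun x => cexp (a * x%:C)) (fun x => a * cexp (a * x%:C))
  0 1 (nm a * expR (nm a)) ler01 _.
rewrite mulr1 mulr0 cexp0 subr0 mulr1; apply => t; rewrite in_itv/= => /andP[t0 t1].
split.
  by apply: cder_eq (cder_cexp a (is_derive_id _ _)) _; rewrite mulr1.
rewrite nmM nm_cexp ler_wpM2l ?nm_ge0// ler_expR Re_mul_real.
apply: le_trans (ler_norm _) _; rewrite normrM -[leRHS]mulr1.
by rewrite ler_pM ?nm_Re// ger0_norm.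
Qed.

(** The mean value estimate again: along the segment from 0 to [a] the derivative is a (exp(a t) -
    1), for which the first-order bound is at hand. *)
Lemma cexp_sub1_sub_le a :
  nm (cexp a - 1 - a) <= 4 * (nm a ^+ 2 * expR (nm a)).
Proof.
have := @complex_mean_value (fun x => cexp (a * x%:C) - a * x%:C)
  (fun x => a * (cexp (a * x%:C) - 1)) 0 1 (2 * (nm a ^+ 2 * expR (nm a))) ler01 _.
rewrite !mulr1 mulr0 cexp0 !subr0 mulr1 (addrAC _ (- a)).
rewrite (_ : 4 = 2 * 2 :> R); last by rewrite -natrM.
rewrite -[2 * 2 * _]mulrA.
apply => t; rewrite in_itv/= => /andP[t0 t1]; split.
  rewrite mulrBr mulr1; apply: cderB.
    by apply: cder_eq (cder_cexp a (is_derive_id _ _)) _; rewrite mulr1.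
  by apply: cder_eq (cderZ a (cder_real (is_derive_id _ _))) _; rewrite mulr1.
rewrite nmM; apply: (le_trans (ler_wpM2l (nm_ge0 _) (cexp_sub1_le _))).
rewrite mulrCA ler_wpM2l// expr2 -[leRHS]mulrA ler_wpM2l ?nm_ge0//.
have nt : nm (a * t%:C) <= nm a.
  by rewrite nmM nm_real ger0_norm// ler_piMr ?nm_ge0.
by rewrite ler_pM ?nm_ge0 ?expR_ge0 ?ler_expR.
Qed.

End ComplexExponential.

(** * Holomorphy through second-order estimates *)

Section QuadraticEstimates.
Variable R : realType.
Implicit Types (f g : R[i] -> R[i]) (w d c e : R[i]) (B : R).

(* d is the derivative of f at w. *)
Definition Qd f d w B := [/\ nm (f w) <= B, nm d <= B &
  forall e, nm e <= 1 -> nm (f (w + e) - f w - e * d) <= B * nm e ^+ 2].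

(** One constant controls value, derivative and Taylor remainder on the unit disc around [w]. Such
    constants multiply and add, so a convergent series of them differentiates a series termwise,
    without contour integrals. *)
Definition QD f w B := exists d, Qd f d w B.

Lemma Qd_ge0 f d w B : Qd f d w B -> 0 <= B.
Proof. by case=> h _ _; exact: le_trans (nm_ge0 _) h. Qed.

Lemma Qd_le f d w B B' : B <= B' -> Qd f d w B -> Qd f d w B'.
Proof.
move=> BB [h1 h2 h3]; split; [exact: le_trans h1 BB|exact: le_trans h2 BB|].
by move=> e /h3/le_trans; apply; rewrite ler_wpM2r ?sqr_ge0.
Qed.

Lemma eq_Qd f g d w B : f =1 g -> Qd f d w B -> Qd g d w B.
Proof. by move=> /funext ->. Qed.

Lemma Qd_cst c w : Qd (fun=> c) 0 w (nm c).
Proof.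
split=> // [|e _]; first by rewrite nm0 nm_ge0.
by rewrite subrr mulr0 subr0 nm0 mulr_ge0 ?nm_ge0 ?sqr_ge0.
Qed.

Lemma Qd_id w : Qd id 1 w (nm w + 1).
Proof.
split; rewrite ?lerDl ?ler01 ?nm1 ?lerDr ?nm_ge0// => e _.
rewrite /= mulr1 [w + e]addrC addrK subrr nm0 mulr_ge0 ?sqr_ge0//.
by rewrite addr_ge0 ?nm_ge0.
Qed.

Lemma QdD f g d d' w B B' : Qd f d w B -> Qd g d' w B' ->
  Qd (fun v => f v + g v) (d + d') w (B + B').
Proof.
move=> [h1 h2 h3] [k1 k2 k3]; split.
- exact: le_trans (nmD _ _) (lerD h1 k1).
- exact: le_trans (nmD _ _) (lerD h2 k2).
- move=> e e1.
  rewrite (_ : _ - _ = (f (w + e) - f w - e * d) + (g (w + e) - g w - e * d')).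
    rewrite mulrDl; apply: le_trans (nmD _ _) _; apply: lerD; [exact: h3|exact: k3].
  by ring.
Qed.

Lemma QdM f g d d' w B B' : Qd f d w B -> Qd g d' w B' ->
  Qd (fun v => f v * g v) (d * g w + f w * d') w (6 * (B * B')).
Proof.
move=> hf hg; have B0 := Qd_ge0 hf; have B0' := Qd_ge0 hg.
move: hf hg => [h1 h2 h3] [k1 k2 k3].
have BB : 0 <= B * B' by rewrite mulr_ge0.
split.
- by rewrite nmM; apply: (@le_trans _ _ (B * B')); [rewrite ler_pM ?nm_ge0|lra].
- apply: (le_trans (nmD _ _)); rewrite !nmM.
  have : nm d * nm (g w) <= B * B' by rewrite ler_pM ?nm_ge0.
  have : nm (f w) * nm d' <= B * B' by rewrite ler_pM ?nm_ge0.
  lra.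
move=> e e1; have x0 := nm_ge0 e.
set r := f (w + e) - f w - e * d; set s := g (w + e) - g w - e * d'.
have hr : nm r <= B * nm e ^+ 2 by exact: h3.
have hs : nm s <= B' * nm e ^+ 2 by exact: k3.
have hg1 : nm (g (w + e)) <= 3 * B'.
  have -> : g (w + e) = g w + (e * d' + s) by rewrite /s; ring.
  apply: (le_trans (nmD _ _)).
  have := nmD (e * d') s; rewrite nmM.
  have : nm e * nm d' <= 1 * B' by rewrite ler_pM ?nm_ge0.
  have : B' * nm e ^+ 2 <= B' * 1 by rewrite ler_wpM2l// expr_le1.
  lra.
have hf1 : nm (f w + e * d) <= 2 * B.
  apply: (le_trans (nmD _ _)); rewrite nmM.
  have : nm e * nm d <= 1 * B by rewrite ler_pM ?nm_ge0.
  lra.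
(* The three summands are bounded with the constants 1, 3 and 2, whence the 6. *)
have -> : f (w + e) * g (w + e) - f w * g w - e * (d * g w + f w * d') =
    e * e * (d * d') + (r * g (w + e) + (f w + e * d) * s).
  by rewrite /r /s; ring.
apply: (le_trans (nmD _ _)); have := nmD (r * g (w + e)) ((f w + e * d) * s).
rewrite !nmM.
have X1 : nm e * nm e * (nm d * nm d') <= nm e * nm e * (B * B').
  by rewrite ler_wpM2l ?mulr_ge0// ler_pM ?nm_ge0.
have X2 : nm r * nm (g (w + e)) <= B * nm e ^+ 2 * (3 * B').
  by rewrite ler_pM ?nm_ge0.
have X3 : nm (f w + e * d) * nm s <= 2 * B * (B' * nm e ^+ 2).
  by rewrite ler_pM ?nm_ge0.
have -> : 6 * (B * B') * nm e ^+ 2 = nm e * nm e * (B * B') +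
  (B * nm e ^+ 2 * (3 * B') + 2 * B * (B' * nm e ^+ 2)) by ring.
lra.
Qed.

Lemma QdZ c f d w B : Qd f d w B -> Qd (fun v => c * f v) (c * d) w (nm c * B).
Proof.
move=> [h1 h2 h3]; split; rewrite ?nmM ?ler_wpM2l ?nm_ge0// => e e1.
rewrite (_ : _ - _ = c * (f (w + e) - f w - e * d)); last by ring.
by rewrite nmM -mulrA ler_wpM2l ?nm_ge0 ?h3.
Qed.

Lemma QdN f d w B : Qd f d w B -> Qd (fun v => - f v) (- d) w B.
Proof.
move=> /(QdZ (-1)); rewrite nmN nm1 mul1r mulN1r; apply: eq_Qd => v.
by rewrite mulN1r.
Qed.

Lemma Qd_shift f d w c B : Qd f d (w + c) B -> Qd (fun v => f (v + c)) d w B.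
Proof.
by move=> [h1 h2 h3]; split => // e /h3; rewrite [w + c + e]addrAC.
Qed.

Lemma Qd_cexp (x : R) w : Qd (fun v => cexp (v * x%:C)) (x%:C * cexp (w * x%:C)) w
  (4 * ((1 + `|x|) ^+ 2 * (expR (complex.Re w * x) * expR `|x|))).
Proof.
have x0 : 0 <= `|x| by [].
have E0 := expR_ge0 (complex.Re w * x).
have F1 : 1 <= expR `|x| by rewrite -expR0 ler_expR.
have EF : expR (complex.Re w * x) <= expR (complex.Re w * x) * expR `|x|.
  by rewrite ler_peMr.
have G : 0 <= expR (complex.Re w * x) * expR `|x| by rewrite mulr_ge0 ?expR_ge0.
split.
- rewrite nm_cexp Re_mul_real; apply: (le_trans EF).
  rewrite mulrA ler_peMl//; nra.
- rewrite nmM nm_real nm_cexp Re_mul_real.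
  apply: (@le_trans _ _ (`|x| * (expR (complex.Re w * x) * expR `|x|))).
    by rewrite ler_wpM2l.
  rewrite mulrA ler_wpM2r//; nra.
move=> e e1; rewrite mulrDl cexpD.
set z := cexp (w * _).
rewrite (_ : _ - _ = z * (cexp (e * x%:C) - 1 - e * x%:C)); last by ring.
rewrite nmM /z nm_cexp Re_mul_real.
apply: (le_trans (ler_wpM2l E0 (cexp_sub1_sub_le _))).
rewrite nmM nm_real.
have H : expR (nm e * `|x|) <= expR `|x|.
  by rewrite ler_expR ler_piMl.
apply: (@le_trans _ _ (expR (complex.Re w * x) *
    (4 * ((nm e * `|x|) ^+ 2 * expR `|x|)))).
  by rewrite ler_wpM2l// ler_wpM2l// ler_wpM2l// sqr_ge0.
have -> : expR (complex.Re w * x) * (4 * ((nm e * `|x|) ^+ 2 * expR `|x|)) =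
  4 * (`|x| ^+ 2 * (expR (complex.Re w * x) * expR `|x|)) * nm e ^+ 2 by ring.
rewrite ler_wpM2r ?sqr_ge0// ler_wpM2l// ler_wpM2r// lerXn2r// ?nnegrE//.
by rewrite lerDr.
Qed.

Lemma QD_le f w B B' : B <= B' -> QD f w B -> QD f w B'.
Proof. by move=> h [d hd]; exists d; exact: Qd_le hd. Qed.

Lemma eq_QD f g w B : f =1 g -> QD f w B -> QD g w B.
Proof. by move=> /funext ->. Qed.

Lemma QDD f g w B B' : QD f w B -> QD g w B' -> QD (fun v => f v + g v) w (B + B').
Proof. by move=> [d h] [d' h']; exists (d + d'); exact: QdD. Qed.

Lemma QDM f g w B B' : QD f w B -> QD g w B' ->
  QD (fun v => f v * g v) w (6 * (B * B')).
Proof. by move=> [d h] [d' h']; exists (d * g w + f w * d'); exact: QdM. Qed.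

Lemma QDZ c f w B : QD f w B -> QD (fun v => c * f v) w (nm c * B).
Proof. by move=> [d h]; exists (c * d); exact: QdZ. Qed.

Lemma QDN f w B : QD f w B -> QD (fun v => - f v) w B.
Proof. by move=> [d h]; exists (- d); exact: QdN. Qed.

Lemma QD_sum n (f : nat -> R[i] -> R[i]) w (B : nat -> R) :
  (forall k, (k < n)%N -> QD (f k) w (B k)) ->
  QD (fun v => \sum_(k < n) f k v) w (\sum_(k < n) B k).
Proof.
elim: n => [|n IH] h.
  exists 0; rewrite big_ord0 (_ : (fun _ => _) = fun=> 0).
    by have := Qd_cst 0 w; rewrite nm0.
  by apply/funext => v; rewrite big_ord0.
rewrite big_ord_recr/=.
apply: eq_QD (QDD (IH _) (h n _)) => // [v|k kn]; first by rewrite big_ord_recr.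
by apply: h; exact: ltnW.
Qed.

(** The local form, on a disc of any radius: it passes to a function that agrees with [f] near [w],
    as [Zc] agrees with some [Em m]. *)
Definition qderiv f w := exists d B r, 0 < r /\
  forall e, nm e <= r -> nm (f (w + e) - f w - e * d) <= B * nm e ^+ 2.

Lemma QD_qderiv f w B : QD f w B -> qderiv f w.
Proof. by move=> [d [_ _ h]]; exists d, B, 1; split. Qed.

Lemma qderiv_local f g w (r : R) : 0 < r ->
  (forall e, nm e <= r -> f (w + e) = g (w + e)) -> qderiv f w -> qderiv g w.
Proof.
move=> r0 fg [d [B [r1 [r10 h]]]]; exists d, B, (Num.min r r1); split.
  by rewrite lt_min r0.
move=> e; rewrite le_min => /andP[er er1]; rewrite -fg//.
have -> : g w = f w by rewrite -[w]addr0 fg// nm0 ltW.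
exact: h.
Qed.

Lemma qderiv_derivable f w : qderiv f w ->
  derivable (f : R[i]^o -> R[i]^o) (w : R[i]^o) 1.
Proof.
move=> [d [B [r [r0 h]]]]; apply/cvg_ex; exists (d : R[i]^o).
apply/cvgrPdist_lt => eps eps0.
have epsE : eps = (complex.Re eps)%:C.
  by move: eps0; rewrite ltcE => /andP[/eqP]; case: (eps) => a b /= -> _.
have eps1 : 0 < complex.Re eps by rewrite -ltcR -epsE.
pose B' := `|B| + 1; have B0 : 0 < B' by rewrite ltr_wpDl.
pose t := Num.min r (complex.Re eps / B').
have t0 : 0 < t by rewrite lt_min r0 divr_gt0.
have tC : 0 < t%:C by rewrite ltcR.
near=> x.
have x0 : x != 0 by near: x; exact: nbhs_dnbhs_neq.
have xt : `|x : R[i]^o| < t%:C by near: x; exact: dnbhs0_lt.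
have {}xt : nm x < t by rewrite -ltcR -nmE.
have hx : nm x <= r by apply: ltW; apply: lt_le_trans xt _; rewrite ge_min lexx.
have := h x hx.
rewrite epsE nmE ltcR.
have -> : d - x^-1 *: ((f \o shift w) (x *: (1 : R[i]^o)) - f w) =
    - (x^-1 * (f (w + x) - f w - x * d)).
  have -> : (f \o shift w) (x *: (1 : R[i]^o)) = f (w + x).
    by congr f; rewrite addrC; congr (_ + _); exact: mulr1.
  rewrite [_ *: _]/(x^-1 * (f (w + x) - f w)) [in RHS]mulrBr.
  by rewrite (mulKf x0) opprB.
rewrite nmN nmM nmV => hh.
have nx0 : 0 < nm x by rewrite nm_gt0.
rewrite mulrC ltr_pdivrMr//.
apply: (le_lt_trans hh); apply: (@le_lt_trans _ _ (B' * nm x * nm x)).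
  rewrite -mulrA -expr2 ler_wpM2r ?sqr_ge0// /B'.
  by apply: le_trans (ler_norm _) _; rewrite lerDl.
rewrite ltr_pM2r// mulrC -ltr_pdivlMr//.
by apply: lt_le_trans xt _; rewrite ge_min lexx orbT.
Unshelve. all: by end_near. Qed.

(** A Weierstrass test: [b] majorizes the derivatives, which therefore have a sum, and it majorizes
    the remainders, which add up to the remainder of [F]. *)
Lemma QD_series (f : nat -> R[i] -> R[i]) (F : R[i] -> R[i]) w (b : nat -> R) B :
  (forall n, QD (f n) w (b n)) ->
  (forall J : {fset nat}, \sum_(n <- J) b n <= B) ->
  (forall e, nm e <= 1 -> hs (fun n => f n (w + e)) (F (w + e))) -> qderiv F w.
Proof.
move=> fb bB fF.
have [d hd] := choice fb.
have [D hD] : exists D, hs d D.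
  apply: (@hs_ex _ _ _ B) => J; apply: le_trans (bB J); apply: ler_sum => n _.
  by have [] := hd n.
exists D, B, 1; split => // e e1.
have F0 : hs (fun n => f n w) (F w).
  by have := fF 0; rewrite addr0 nm0; apply.
have := hsD (hsD (fF e e1) (hsZ (-1) F0)) (hsZ (- e) hD).
rewrite mulN1r mulNr => /hs_le; apply => J.
apply: (le_trans (nm_sum _ _ _)).
apply: (@le_trans _ _ ((\sum_(n <- J) b n) * nm e ^+ 2)).
  rewrite mulr_suml; apply: ler_sum => n _; have [_ _ h] := hd n.
  by rewrite mulN1r mulNr; exact: h.
by rewrite ler_wpM2r ?sqr_ge0.
Qed.

End QuadraticEstimates.

Section SequenceLimits.
Variable R : realType.
Implicit Types (u v : nat -> R[i]) (s t : R[i]).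

(** Ordered partial sums are enough to identify values, by telescoping and uniqueness of limits;
    existence comes from [hs]. *)
Definition cl u t := forall e : R, 0 < e ->
  exists N, forall n, (N <= n)%N -> nm (u n - t) < e.

Lemma cl_uniq u s t : cl u s -> cl u t -> s = t.
Proof.
move=> h h'; apply/eqP; rewrite -subr_eq0 -nm_eq0 -[_ == _]negbK.
apply/negP => st.
have e0 : 0 < nm (s - t) / 2 by rewrite divr_gt0// lt_neqAle eq_sym st nm_ge0.
have [N hN] := h _ e0; have [N' hN'] := h' _ e0.
have := hN (maxn N N') (leq_maxl _ _); have := hN' (maxn N N') (leq_maxr _ _).
set x := u _ => h1 h2.
have := nm_triangle s t x; rewrite (nm_distC s x) leNgt => /negP; apply.
by rewrite [ltRHS]splitr; apply: ltrD.
Qed.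

Lemma eq_cl u v t : u =1 v -> cl u t -> cl v t.
Proof. by move=> /funext ->. Qed.

Lemma cl_cst t : cl (fun=> t) t.
Proof. by move=> e e0; exists 0 => n _; rewrite subrr nm0. Qed.

Lemma clD u v s t : cl u s -> cl v t -> cl (fun n => u n + v n) (s + t).
Proof.
move=> h h' e e0; have e2 : 0 < e / 2 by rewrite divr_gt0.
have [N hN] := h _ e2; have [N' hN'] := h' _ e2.
exists (maxn N N') => n; rewrite geq_max => /andP[nN nN'].
rewrite opprD addrACA (splitr e); apply: (le_lt_trans (nmD _ _)).
by apply: ltrD; [exact: hN|exact: hN'].
Qed.

Lemma clZ c u t : cl u t -> cl (fun n => c * u n) (c * t).
Proof.
move=> h e e0.
have [N hN] := h (e / (nm c + 1)) (divr_gt0 e0 (ltr_wpDl (nm_ge0 _) ltr01)).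
exists N => n /hN; rewrite ltr_pdivlMr ?(ltr_wpDl (nm_ge0 _) ltr01)//.
rewrite -mulrBr nmM; apply: le_lt_trans.
by rewrite mulrC ler_wpM2l ?nm_ge0// lerDl.
Qed.

Lemma clB u v s t : cl u s -> cl v t -> cl (fun n => u n - v n) (s - t).
Proof.
move=> hu hv; rewrite -mulN1r; apply: eq_cl (clD hu (clZ (-1) hv)) => n.
by rewrite mulN1r.
Qed.

Lemma cl_sum k (u : nat -> nat -> R[i]) (t : nat -> R[i]) :
  (forall i, (i < k)%N -> cl (u i) (t i)) ->
  cl (fun n => \sum_(i < k) u i n) (\sum_(i < k) t i).
Proof.
elim: k => [|k IH] h.
  by rewrite big_ord0; apply: eq_cl (cl_cst 0) => n; rewrite big_ord0.
rewrite big_ord_recr/=; apply: eq_cl (clD (IH _) (h k _)) => //.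
  by move=> n; rewrite big_ord_recr.
by move=> i ik; apply: h; exact: ltnW.
Qed.

Lemma cl_inv_le u t (C : R) :
  (forall n, nm (u n - t) <= C / n.+1%:R) -> cl u t.
Proof.
move=> h e e0; exists (Num.truncn (C / e)) => n hn.
apply: (le_lt_trans (h n)); rewrite ltr_pdivrMr ?ltr0n// mulrC -ltr_pdivrMr//.
apply: lt_le_trans (truncnS_gt _) _.
by rewrite ler_nat ltnS.
Qed.

Lemma hs_cl u t : hs u t -> cl (fun L => \sum_(n < L) u n) t.
Proof.
move=> h e /h[J hJ]; exists (\max_(n <- J) n.+1)%N => L JL.
have := hJ [fset n in iota 0 L]%fset; rewrite -[X in _ -> X]/(is_true _).
rewrite (_ : \sum_(n <- [fset n in iota 0 L]%fset) u n = \sum_(n < L) u n).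
  apply; apply/fsubsetP => n nJ; rewrite !inE/= mem_iota add0n.
  by rewrite leq0n/=; apply: leq_trans JL; rewrite (big_rem n nJ)/= leq_maxl.
rewrite -(big_mkord xpredT u) /index_iota subn0.
apply: perm_big; apply: uniq_perm; rewrite ?fset_uniq ?iota_uniq//.
by move=> n; rewrite !inE.
Qed.

Lemma inv_sq_sum (J : {fset nat}) : \sum_(n <- J) (n.+1%:R ^- 2 : R) <= 2.
Proof.
pose K := [fset n in iota 0 (\max_(n <- J) n.+1)%N]%fset.
apply: (@le_trans _ _ (\sum_(n <- K) (n.+1%:R ^- 2 : R))).
  apply: ler_sum_fsubset => [n|]; first by rewrite invr_ge0 exprn_ge0.
  apply/fsubsetP => n nJ; rewrite !inE/= mem_iota add0n.
  by rewrite leq0n/= (big_rem n nJ)/= leq_maxl.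
rewrite (perm_big (iota 0 (\max_(n <- J) n.+1)%N)); last first.
  apply: uniq_perm; rewrite ?fset_uniq ?iota_uniq//.
  by move=> n; rewrite !inE.
case: (\max_(n <- J) n.+1)%N => [|L]; first by rewrite big_nil.
(* The sharper bound 2 - 1/(L + 1) is what makes the induction close, because 1/(n + 1)^2 <= 1/n -
   1/(n + 1). *)
suff : \sum_(n <- iota 0 L.+1) (n.+1%:R ^- 2 : R) <= 2 - L.+1%:R^-1.
  by move=> /le_trans; apply; rewrite gerBl invr_ge0.
elim: L => [|L IH]; first by rewrite big_seq1 invr1 expr1n invr1; lra.
rewrite -addn1 iotaD big_cat/= big_seq1 add0n addn1.
apply: (le_trans (lerD IH (lexx _))).
have a0 : (0 : R) < L.+1%:R by rewrite ltr0n.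
have -> : (L.+2%:R : R) = L.+1%:R + 1 by rewrite -natr1.
move: (L.+1%:R : R) a0 => a a0.
have a10 : 0 < a + 1 by rewrite addr_gt0.
rewrite -subr_ge0.
have -> : 2 - (a + 1)^-1 - (2 - a^-1 + (a + 1) ^- 2) = (a * (a + 1) ^+ 2)^-1.
  by field; rewrite (gt_eqF a0) (gt_eqF a10).
by rewrite invr_ge0 mulr_ge0 ?exprn_ge0 ?ltW.
Qed.

End SequenceLimits.

(** * Remainders of the binomial series *)

Section Zeta.
Variable R : realType.
Implicit Types (v w z : R[i]) (n m k : nat) (x h : R).

(* pch k v = v (v + 1) ... (v + k - 1) / k! and pch' is its derivative. *)
Fixpoint pch k v : R[i] :=
  if k is k'.+1 then v * pch k' (v + 1) / k%:R else 1.

Fixpoint pch' k v : R[i] :=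
  if k is k'.+1 then (pch k' (v + 1) + v * pch' k' (v + 1)) / k%:R else 0.

Lemma natC_neq0 n : (n.+1%:R : R[i]) != 0.
Proof. by rewrite pnatr_eq0. Qed.

(** Splits off the last factor instead of the first. In [cc_cancel] this factor is v + i + (p - i) =
    v + p, the same for all i. *)
Lemma pchSr k v : pch k.+1 v = (v + k%:R) * pch k v / k.+1%:R.
Proof.
elim: k v => [|k IH] v; first by rewrite /= addr0.
have E j u : pch j.+1 u = u * pch j (u + 1) / j.+1%:R by [].
rewrite (E k.+1 v) IH (E k v) (_ : v + k.+1%:R = v + k%:R + 1); last by rewrite -natr1 addrA.
have a0 := natC_neq0 k; have b0 := natC_neq0 k.+1.
move: (k.+1%:R : R[i]) (k.+2%:R : R[i]) a0 b0 => a b a0 b0; field.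
by rewrite a0 b0.
Qed.

(* The remainder after m terms of the binomial series of (1 - h) ^ -w. *)
Definition binrem m h w : R[i] :=
  cexp (w * (- ln (1 - h))%:C) - \sum_(k < m) pch k w * (h ^+ k)%:C.

Definition binrem' m h w : R[i] :=
  (- ln (1 - h))%:C * cexp (w * (- ln (1 - h))%:C)
  - \sum_(k < m) pch' k w * (h ^+ k)%:C.

Lemma realCM x h : (x * h)%:C = x%:C * h%:C.
Proof. by rewrite rmorphM. Qed.

Lemma realCn n : (n%:R : R)%:C = n%:R.
Proof. by rewrite rmorph_nat. Qed.

Lemma is_derive_nln1B h : h < 1 ->
  is_derive h (1 : R) (fun x => - ln (1 - x)) (1 - h)^-1.
Proof.
move=> h1.
have h0 : 0 < 1 - h by rewrite subr_gt0.
have d1 : is_derive h (1 : R) (fun x => 1 - x) (-1).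
  rewrite (_ : (fun _ => _) = cst 1 - id) //.
  by apply: is_derive_eq; rewrite sub0r.
have d2 : is_derive h (1 : R) (fun x => ln (1 - x)) ((1 - h)^-1 * -1).
  exact: (@is_derive1_comp _ (@ln R) (fun x => 1 - x) h _ _ (is_derive1_ln h0) d1).
rewrite (_ : (fun _ => _) = - (fun x => ln (1 - x)))//.
by apply: is_derive_eq; rewrite mulrN1 opprK.
Qed.

Lemma cexp_nln1B h : h < 1 -> cexp (- ln (1 - h))%:C = ((1 - h)^-1)%:C.
Proof.
move=> h1; rewrite /cexp/= cos0 sin0 expRN lnK ?posrE ?subr_gt0//.
exact: mulr1.
Qed.

Lemma cder_cexp_nln1B h w : h < 1 ->
  cder (fun x => cexp (w * (- ln (1 - x))%:C)) h
    (w * cexp ((w + 1) * (- ln (1 - h))%:C)).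
Proof.
move=> h1; apply: cder_eq (cder_cexp w (is_derive_nln1B h1)) _.
by rewrite [(w + 1) * _]mulrDl mul1r cexpD cexp_nln1B// -mulrA [_%:C * _]mulrC.
Qed.

Lemma cder_exprn k h : cder (fun x => (x ^+ k)%:C) h (k%:R * (h ^+ k.-1)%:C).
Proof.
rewrite -realCn -realCM; apply: cder_real.
rewrite (_ : (fun _ => _) = (id ^+ k)); last by apply/funext => x; rewrite fctE.
by apply: is_derive_eq; rewrite /GRing.scale/= mulr1.
Qed.

Lemma cder_binrem m h w : h < 1 ->
  cder (fun x => binrem m.+1 x w) h (w * binrem m h (w + 1)).
Proof.
move=> h1; apply: cder_eq.
  apply: cderB; first exact: cder_cexp_nln1B.
  exact: (@cder_sum _ m.+1 (fun k x => pch k w * (x ^+ k)%:C) h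
    (fun k => pch k w * (k%:R * (h ^+ k.-1)%:C)) (fun k => cderZ _ (cder_exprn k h))).
rewrite /binrem mulrBr; congr (_ - _).
rewrite big_ord_recl mul0r mulr0 add0r mulr_sumr; apply: eq_bigr => k _.
rewrite lift0/=; have a0 := natC_neq0 k.
by move: (k.+1%:R : R[i]) a0 => a a0; field.
Qed.

Lemma cder_binrem' m h w : h < 1 ->
  cder (fun x => binrem' m.+1 x w) h
    (binrem m h (w + 1) + w * binrem' m h (w + 1)).
Proof.
move=> h1; apply: cder_eq.
  apply: cderB; first apply: cderM.
  - by apply: cder_real; exact: is_derive_nln1B.
  - exact: cder_cexp_nln1B.
  exact: (@cder_sum _ m.+1 (fun k x => pch' k w * (x ^+ k)%:C) h
    (fun k => pch' k w * (k%:R * (h ^+ k.-1)%:C)) (fun k => cderZ _ (cder_exprn k h))).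
rewrite /binrem /binrem' mulrBr addrACA -opprD; congr (_ - _).
  rewrite -cexp_nln1B// -cexpD mulrCA; congr (cexp _ + _).
  by rewrite mulrDl mul1r addrC.
rewrite big_ord_recl mul0r add0r mulr_sumr -big_split.
apply: eq_bigr => k _; rewrite lift0/=; have a0 := natC_neq0 k.
by move: (k.+1%:R : R[i]) a0 => a a0; field.
Qed.

Lemma binrem_at0 m w : binrem m.+1 0 w = 0.
Proof.
rewrite /binrem subr0 ln1 oppr0 mulr0 cexp0 big_ord_recl expr0 mulr1.
by rewrite big1 ?addr0 ?subrr// => k _; rewrite lift0 expr0n/= mulr0.
Qed.

Lemma binrem'_at0 m w : binrem' m.+1 0 w = 0.
Proof.
rewrite /binrem' subr0 ln1 oppr0 mul0r big_ord_recl mul0r.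
by rewrite big1 ?addr0 ?subrr// => k _; rewrite lift0 expr0n/= mulr0.
Qed.

(* By induction on m: the derivative of binrem m.+1 in h is w times binrem m at
   w + 1, so that integrating from 0 gains one power of h. *)
Lemma binrem_bound m w : exists2 B : R, 0 <= B & forall h, 0 <= h -> h <= 2^-1 ->
  Qd (binrem m h) (binrem' m h w) w (B * h ^+ m).
Proof.
elim: m w => [|m IH] w.
  exists (4 * ((1 + 2) ^+ 2 * (expR (nm w * 2) * expR 2))).
    by rewrite !mulr_ge0 ?expR_ge0// sqr_ge0.
  move=> h h0 h2; rewrite expr0 mulr1.
  have l0 : 0 <= - ln (1 - h) by rewrite oppr_ge0 ln_le0// lerBlDr lerDl.
  (* Here ln (1/(1 - h)) <= 1/(1 - h) <= 2, as h is at most 1/2. *)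
  have l2 : - ln (1 - h) <= 2.
    rewrite -lnV ?posrE; last by lra.
    apply: le_trans (ltW (ln_sublinear _)) _; first by rewrite invr_gt0; lra.
    by rewrite invf_ple ?posrE//; lra.
  have := Qd_cexp (- ln (1 - h)) w.
  rewrite (_ : _%:C * _ = binrem' 0 h w); last by rewrite /binrem' big_ord0 subr0.
  rewrite (_ : (fun v => cexp _) = binrem 0 h); last first.
    by apply/funext => v; rewrite /binrem big_ord0 subr0.
  apply: Qd_le; rewrite ler_wpM2l// (ger0_norm l0).
  rewrite ler_pM ?sqr_ge0 ?mulr_ge0 ?expR_ge0//.
    by rewrite lerXn2r// ?nnegrE ?addr_ge0// lerD2l.
  rewrite ler_pM ?expR_ge0// ler_expR//.
  apply: le_trans (ler_norm _) _; rewrite normrM (ger0_norm l0).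
  by rewrite ler_pM// nm_Re.
have [B B0 hB] := IH (w + 1).
pose C := 6 * ((nm w + 1) * B).
have C0 : 0 <= C by rewrite !mulr_ge0// addr_ge0 ?nm_ge0.
exists (2 * C); first by rewrite mulr_ge0.
move=> h h0 h2.
have hQ t : 0 <= t -> t <= h -> Qd (fun v => v * binrem m t (v + 1))
    (1 * binrem m t (w + 1) + w * binrem' m t (w + 1)) w (C * h ^+ m).
  move=> t0 th; have := QdM (Qd_id w) (Qd_shift (hB t t0 (le_trans th h2))).
  apply: Qd_le; rewrite /C -!mulrA !ler_wpM2l ?addr_ge0 ?nm_ge0//.
  by rewrite lerXn2r.
have lt1 t : t <= h -> t < 1 by move=> th; lra.
(* All three quantities in [Qd] vanish at h = 0, so each is bounded by integrating its derivative
   from 0. The factor [b] is 1 for the value and the derivative and |e|^2 for the Taylor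
   remainder. *)
have key (f df : R -> R[i]) (b : R) : 0 <= b -> f 0 = 0 ->
    (forall t, 0 <= t -> t <= h -> cder f t (df t) /\ nm (df t) <= C * h ^+ m * b) ->
    nm (f h) <= 2 * C * h ^+ m.+1 * b.
  move=> b0 f0 hf.
  have := @complex_mean_value _ f df 0 h (C * h ^+ m * b) h0.
  rewrite f0 !subr0 exprSr.
  have -> : 2 * (C * h ^+ m * b) * h = 2 * C * (h ^+ m * h) * b by ring.
  by apply => t; rewrite in_itv/= => /andP[t0 th]; exact: hf.
split.
- have := key (fun t => binrem m.+1 t w) (fun t => w * binrem m t (w + 1)) 1.
  rewrite !mulr1; apply => //; first exact: binrem_at0.
  move=> t t0 th; split; first exact/cder_binrem/lt1.
  by have [] := hQ t t0 th.
- have := key (fun t => binrem' m.+1 t w)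
    (fun t => binrem m t (w + 1) + w * binrem' m t (w + 1)) 1.
  rewrite !mulr1; apply => //; first exact: binrem'_at0.
  move=> t t0 th; split; first exact/cder_binrem'/lt1.
  by have [_] := hQ t t0 th; rewrite mul1r.
move=> e e1.
apply: (key (fun t => binrem m.+1 t (w + e) - binrem m.+1 t w - e * binrem' m.+1 t w)
  (fun t => (w + e) * binrem m t (w + e + 1) - w * binrem m t (w + 1)
     - e * (binrem m t (w + 1) + w * binrem' m t (w + 1)))).
- exact: sqr_ge0.
- by rewrite !binrem_at0 binrem'_at0 mulr0 !subr0.
move=> t t0 th; split.
  apply: cderB; last by apply: cderZ; exact/cder_binrem'/lt1.
  by apply: cderB; exact/cder_binrem/lt1.
by have [_ _ /(_ e e1)] := hQ t t0 th; rewrite mul1r.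
Qed.

End Zeta.

Arguments pch : simpl never.

(** * The approximate antidifference of v n^(-v-1) *)

Section ZetaContinuation.
Variable R : realType.
Implicit Types (v w z : R[i]) (n m k : nat) (x h : R).

(** This is n^(-v), with the sign built in. *)
Definition npow n v : R[i] := cexp (v * (- ln (n%:R : R))%:C).

Lemma npowD n v w : npow n (v + w) = npow n v * npow n w.
Proof. by rewrite /npow mulrDl cexpD. Qed.

Lemma npow0 n : npow n 0 = 1.
Proof. by rewrite /npow mul0r cexp0. Qed.

Lemma npow11 v : npow 1 v = 1.
Proof. by rewrite /npow ln1 oppr0 mulr0 cexp0. Qed.

Lemma npow_nat n k : npow n.+1 k%:R = (n.+1%:R ^- k)%:C.
Proof.
elim: k => [|k IH]; first by rewrite npow0 expr0 invr1.
rewrite -natr1 npowD IH exprSr invfM realCM; congr (_ * _).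
rewrite /npow mul1r /cexp/= cos0 sin0 expRN lnK ?posrE ?ltr0n//.
exact: mulr1.
Qed.

Lemma nm_npow n v : nm (npow n v) = expR (complex.Re v * - ln (n%:R : R)).
Proof. by rewrite nm_cexp Re_mul_real. Qed.

Lemma Re_nat k : complex.Re (k%:R : R[i]) = k%:R.
Proof. by rewrite -realCn. Qed.

Lemma nm_npow_le n k v : k%:R <= complex.Re v -> nm (npow n.+1 v) <= n.+1%:R ^- k.
Proof.
move=> kv; rewrite -[leRHS]ger0_norm ?invr_ge0 ?exprn_ge0// -nm_real -npow_nat.
rewrite !nm_npow ler_expR Re_nat !mulrN lerN2 ler_wpM2r//.
by rewrite ln_ge0// ler1n.
Qed.

Lemma npow_pred n v : npow n.+1 v =
  npow n.+2 v * cexp (v * (- ln (1 - n.+2%:R^-1))%:C).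
Proof.
rewrite /npow -cexpD -mulrDr realCD -opprD -lnM ?posrE ?ltr0n//.
  rewrite mulrBr mulr1 divff ?pnatr_eq0//.
  by rewrite -[in RHS]natr1 addrK.
by rewrite subr_gt0 invf_lt1 ?ltr0n// ltr1n.
Qed.

Lemma QD_npow n w : QD (npow n.+1) w (16 * (n.+1%:R ^+ 3 * nm (npow n.+1 w))).
Proof.
have := Qd_cexp (- ln (n.+1%:R : R)) w => h; exists ((- ln (n.+1%:R : R))%:C * npow n.+1 w).
move: h; apply: Qd_le; rewrite nm_npow.
have l0 : 0 <= ln (n.+1%:R : R) by rewrite ln_ge0// ler1n.
rewrite normrN (ger0_norm l0) lnK ?posrE ?ltr0n//.
have l1 : ln (n.+1%:R : R) <= n.+1%:R by rewrite ltW// ln_sublinear ?ltr0n.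
have n1 : (1 : R) <= n.+1%:R by rewrite ler1n.
set E := expR _; have E0 : 0 <= E by exact: expR_ge0.
(* The square of 1 + ln n is at most (2n)^2, and the unit disc costs exp (ln n) = n; together this
   is the factor n^3. *)
have -> : 16 * (n.+1%:R ^+ 3 * E) = 4 * ((2 * n.+1%:R) ^+ 2 * (E * n.+1%:R)).
  by ring.
rewrite ler_wpM2l// ler_wpM2r ?mulr_ge0// lerXn2r// ?nnegrE ?addr_ge0 ?mulr_ge0//.
lra.
Qed.

Definition hol (f : R[i] -> R[i]) := forall w, exists B, QD f w B.

Lemma hol_cst c : hol (fun=> c).
Proof. by move=> w; exists (nm c), 0; exact: Qd_cst. Qed.

Lemma hol_id : hol id.
Proof. by move=> w; exists (nm w + 1), 1; exact: Qd_id. Qed.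

Lemma holD f g : hol f -> hol g -> hol (fun v => f v + g v).
Proof. by move=> hf hg w; have [B ?] := hf w; have [C ?] := hg w; exists (B + C); exact: QDD. Qed.

Lemma holM f g : hol f -> hol g -> hol (fun v => f v * g v).
Proof. by move=> hf hg w; have [B ?] := hf w; have [C ?] := hg w; exists (6 * (B * C)); exact: QDM. Qed.

Lemma holN f : hol f -> hol (fun v => - f v).
Proof. by move=> hf w; have [B ?] := hf w; exists B; exact: QDN. Qed.

Lemma hol_shift f c : hol f -> hol (fun v => f (v + c)).
Proof. by move=> hf w; have [B [d h]] := hf (w + c); exists B, d; exact: Qd_shift. Qed.

Lemma hol_sum n (f : nat -> R[i] -> R[i]) : (forall k, (k < n)%N -> hol (f k)) ->
  hol (fun v => \sum_(k < n) f k v).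
Proof.
elim: n => [|n IH] h.
  rewrite (_ : (fun _ => _) = fun=> 0); first exact: hol_cst.
  by apply/funext => v; rewrite big_ord0.
rewrite (_ : (fun _ => _) = fun v => \sum_(k < n) f k v + f n v); last first.
  by apply/funext => v; rewrite big_ord_recr.
by apply: holD; [apply: IH => k kn; apply: h; exact: ltnW|exact: h].
Qed.

Lemma hol_npow n : hol (npow n.+1).
Proof. by move=> w; eexists; exact: QD_npow. Qed.

Lemma hol_pch k : hol (@pch R k).
Proof.
elim: k => [|k IH]; first exact: hol_cst.
apply: (@holM (fun v => v * pch k (v + 1)) (fun=> k.+1%:R^-1)); last exact: hol_cst.
by apply: holM; [exact: hol_id|exact: hol_shift].
Qed.

(* The coefficients of an approximate antidifference of v n^(-v-1),
   namely sum_i c_i(v) n^(-v-i). *)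
Definition ccnew p (s : seq (R[i] -> R[i])) v : R[i] :=
  if p == 0%N then 1 else
  - \sum_(i < p) nth (fun=> 0) s i v * pch (p - i) (v + i%:R) / (p - i).+1%:R.

(** Course-of-values recursion: each coefficient depends on all earlier ones, which are therefore
    kept in a list. *)
Fixpoint cseq p : seq (R[i] -> R[i]) :=
  if p is p'.+1 then rcons (cseq p') (ccnew p' (cseq p')) else [::].

Definition cc i : R[i] -> R[i] := nth (fun=> 0) (cseq i.+1) i.

Lemma size_cseq p : size (cseq p) = p.
Proof. by elim: p => //= p IH; rewrite size_rcons IH. Qed.

Lemma nth_cseq p i : (i < p)%N -> nth (fun=> 0) (cseq p) i = cc i.
Proof.
elim: p => // p IH; rewrite ltnS leq_eqVlt => /orP[/eqP->//|ip].
by rewrite /= nth_rcons size_cseq ip IH.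
Qed.

Lemma cc0 v : cc 0 v = 1.
Proof. by []. Qed.

Lemma ccS p v : cc p.+1 v =
  - \sum_(i < p.+1) cc i v * pch (p.+1 - i) (v + i%:R) / (p.+1 - i).+1%:R.
Proof.
rewrite {1}/cc /= nth_rcons size_rcons size_cseq ltnn eqxx /ccnew/=.
congr (- _); apply: eq_bigr => i _.
by rewrite -/(cseq p.+1) nth_cseq.
Qed.

Lemma hol_cc i : hol (cc i).
Proof.
have [n] := ubnP i; elim: n i => // n IH [|p] ip; first exact: hol_cst.
rewrite (_ : cc p.+1 = fun v => - \sum_(i < p.+1)
    (cc i v * pch (p.+1 - i) (v + i%:R) * (p.+1 - i).+1%:R^-1)); last first.
  by apply/funext => v; exact: ccS.
apply: holN; apply: (@hol_sum p.+1
  (fun i v => cc i v * pch (p.+1 - i) (v + i%:R) * (p.+1 - i).+1%:R^-1)) => k kp.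
apply: holM; last exact: hol_cst.
apply: holM; first by apply: IH; apply: leq_trans kp _.
exact/hol_shift/hol_pch.
Qed.

Definition gm m n v : R[i] := \sum_(i < m) cc i v * npow n (v + i%:R).

(** What is left of v n^(-v-1) when the differences of [gm m] are subtracted. Each summand is of
    order n^(-v-i) n^(-(m-i)-1) = n^(-v-m-1), so that a larger [m] gives convergence further to the
    left. *)
Definition rm m n v : R[i] := - \sum_(i < m)
  cc i v * npow n (v + i%:R) * binrem (m - i).+1 n%:R^-1 (v + i%:R).

Lemma sum_triangle m (t : nat -> nat -> R[i]) :
  \sum_(i < m) \sum_(k < m - i) t i k = \sum_(p < m) \sum_(i < p.+1) t i (p - i)%N.
Proof.
elim: m => [|m IH]; first by rewrite !big_ord0.
rewrite [RHS]big_ord_recr/= -IH big_ord_recr/= subSnn big_ord1.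
rewrite [X in _ = _ + X]big_ord_recr/= subnn addrA; congr (_ + _).
rewrite -big_split/=; apply: eq_bigr => i _.
by rewrite subSn ?(ltnW (ltn_ord i))// big_ord_recr.
Qed.

(** The coefficient of n^(-v-p-1) in the difference of the antidifference. By [pchSr] the factor v +
    p comes out of the sum, and the rest is the equation that [ccS] solves for the coefficient of
    index p. *)
Lemma cc_cancel p v : \sum_(i < p.+1) cc i v * pch (p - i).+1 (v + i%:R) =
  if p == 0%N then v else 0.
Proof.
case: p => [|p] /=.
  by rewrite big_ord1 cc0 mul1r pchSr addr0 addr0 mulr1 divr1.
rewrite (eq_bigr (fun i : 'I_p.+2 => (v + p.+1%:R) *
    (cc i v * pch (p.+1 - i) (v + i%:R) / (p.+1 - i).+1%:R))); last first.
  move=> i _; rewrite pchSr -addrA -natrD subnKC ?(leq_ord i)//.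
  by rewrite -!mulrA mulrCA.
rewrite -mulr_sumr big_ord_recr/= ccS subnn mulr1 divr1.
by rewrite addrN mulr0.
Qed.

Lemma telescope_step m n v : (0 < m)%N ->
  v * npow n.+2 (v + 1) = gm m n.+1 v - gm m n.+2 v + rm m n.+2 v.
Proof.
move=> m0; set h : R := n.+2%:R^-1.
have nh k u : npow n.+2 (u + k%:R) = npow n.+2 u * (h ^+ k)%:C.
  by rewrite npowD npow_nat exprVn.
(* The powers of n + 1 are expanded in those of n + 2 by the binomial series with h = 1/(n + 2); the
   remainders of the series are exactly what [rm] collects. *)
have E : gm m n.+1 v + rm m n.+2 v = \sum_(i < m) \sum_(k < (m - i).+1)
    cc i v * pch k (v + i%:R) * npow n.+2 (v + i%:R + k%:R).
  rewrite /gm /rm -sumrB; apply: eq_bigr => i _.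
  rewrite npow_pred /binrem -/h mulrBr opprB mulrA addrC -addrA.
  rewrite [X in _ + X](_ : _ = 0) ?addr0 ?subrr//; last by rewrite addrC subrr.
  by rewrite mulr_sumr; apply: eq_bigr => k _; rewrite (nh k) mulrACA.
rewrite addrAC E.
have -> : \sum_(i < m) \sum_(k < (m - i).+1)
    cc i v * pch k (v + i%:R) * npow n.+2 (v + i%:R + k%:R) =
  gm m n.+2 v + \sum_(i < m) \sum_(k < m - i)
    cc i v * pch k.+1 (v + i%:R) * npow n.+2 (v + i%:R + k.+1%:R).
  rewrite /gm -big_split/=; apply: eq_bigr => i _.
  by rewrite big_ord_recl mulr1 addr0.
rewrite addrAC subrr add0r.
rewrite (sum_triangle m (fun i k => cc i v * pch k.+1 (v + i%:R) *
   npow n.+2 (v + i%:R + k.+1%:R))).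
rewrite (eq_bigr (fun p : 'I_m => (if p == 0%N :> nat then v else 0) *
    npow n.+2 (v + p.+1%:R))); last first.
  move=> p _; rewrite -cc_cancel mulr_suml; apply: eq_bigr => i _.
  by rewrite -addrA -natrD addnS subnKC ?(leq_ord i).
case: m m0 {E} => // m _; rewrite big_ord_recl/= big1 ?addr0// => i _.
by rewrite mul0r.
Qed.

Lemma telescope m L v : (0 < m)%N ->
  \sum_(n < L) rm m n.+2 v =
  \sum_(n < L) v * npow n.+2 (v + 1) - gm m 1 v + gm m L.+1 v.
Proof.
move=> m0; elim: L => [|L IH]; first by rewrite !big_ord0 add0r addNr.
rewrite !big_ord_recr/= IH (telescope_step L v m0); ring.
Qed.

End ZetaContinuation.

(** * The continued zeta function *)

Section ZetaAssembly.
Variable R : realType.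
Implicit Types (v w z e : R[i]) (n m k : nat) (x h : R).

Lemma qderivD (f g : R[i] -> R[i]) w : qderiv f w -> qderiv g w ->
  qderiv (fun v => f v + g v) w.
Proof.
move=> [d [B [r [r0 h]]]] [d' [B' [r' [r0' h']]]].
exists (d + d'), (B + B'), (Num.min r r'); split; first by rewrite lt_min r0.
move=> e; rewrite le_min => /andP[er er'].
rewrite (_ : _ - _ = (f (w + e) - f w - e * d) + (g (w + e) - g w - e * d')).
  rewrite mulrDl; apply: le_trans (nmD _ _) _; apply: lerD; [exact: h|exact: h'].
by ring.
Qed.

Lemma Qd_QD (f : R[i] -> R[i]) d w (B : R) : Qd f d w B -> QD f w B.
Proof. by exists d. Qed.

Lemma hol_qderiv (f : R[i] -> R[i]) w : hol f -> qderiv f w.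
Proof. by move=> /(_ w)[B]; exact: QD_qderiv. Qed.

Lemma asum_inv_sq (f : nat -> R[i]) (C : R) :
  (forall n, nm (f n) <= C * n.+1%:R ^- 2) -> asum_le f (C * 2).
Proof.
move=> h J; have C0 : 0 <= C.
  by have := le_trans (nm_ge0 _) (h 0%N); rewrite expr1n invr1 mulr1.
apply: le_trans (ler_wpM2l C0 (inv_sq_sum R J)).
by rewrite mulr_sumr; apply: ler_sum => n _.
Qed.

Lemma binrem_le_half n : (n.+2%:R^-1 : R) <= 2^-1.
Proof. by rewrite lef_pV2 ?posrE ?ltr0n// ler_nat. Qed.

(** The bound 4 pays for the factor n^3 of [QD_npow]: n^3 n^(-4) n^(-1) = n^(-2) is summable. *)
Lemma QD_rm m w : 4 <= complex.Re w + m%:R ->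
  exists C : R, forall n, QD (rm m n.+2) w (C * n.+1%:R ^- 2).
Proof.
move=> wm.
have term i : exists C : R, (i < m)%N -> forall n,
    QD (fun v => cc i v * npow n.+2 (v + i%:R) *
                 binrem (m - i).+1 n.+2%:R^-1 (v + i%:R)) w (C * n.+1%:R ^- 2).
  have [im|] := boolP (i < m)%N; last by exists 0.
  have [Bc hc] := @hol_cc R i w.
  have [B B0 hb] := binrem_bound (m - i).+1 (w + i%:R).
  have Bc0 : 0 <= Bc by case: hc => d /Qd_ge0.
  exists (6 * (6 * (Bc * 16) * B)) => _ n.
  have [d1 q1] := QD_npow n.+1 (w + i%:R).
  have q2 := hb n.+2%:R^-1 (ltW (_ : 0 < n.+2%:R^-1)) (binrem_le_half n).
  have {}q2 := Qd_shift (q2 _); rewrite ?invr_gt0 ?ltr0n// in q2.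
  have := QDM (QDM hc (Qd_QD (Qd_shift q1))) (Qd_QD (q2 isT)).
  apply: QD_le.
  set N : R := n.+2%:R; set P := nm _.
  have N0 : 0 < N by rewrite ltr0n.
  have P0 : 0 <= P by exact: nm_ge0.
  have K : N ^+ 3 * P * N^-1 ^+ (m - i).+1 <= n.+1%:R ^- 2.
    apply: (@le_trans _ _ (N ^- 2)); last first.
      by rewrite lef_pV2 ?posrE ?exprn_gt0// lerXn2r ?nnegrE// ler_nat.
    have PE : P * N^-1 ^+ (m - i) = nm (npow n.+2 (w + m%:R)).
      rewrite -[in RHS](subnKC (ltnW im)) natrD addrA npowD nmM npow_nat nm_real exprVn.
      by rewrite ger0_norm ?invr_ge0 ?exprn_ge0.
    have /(nm_npow_le n.+1) : 4%:R <= complex.Re (w + m%:R) by rewrite ReD Re_nat.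
    rewrite -PE -/N => hP.
    rewrite [N^-1 ^+ _.+1]exprSr mulrA -(mulrA (N ^+ 3)).
    apply: (@le_trans _ _ (N ^+ 3 * N ^- 4 * N^-1)).
      apply: ler_wpM2r; first by rewrite invr_ge0 ltW.
      by apply: ler_wpM2l hP; rewrite exprn_ge0// ltW.
    have -> : N ^+ 3 / N ^+ 4 / N = N ^- 2; last by [].
    by move: (N) N0 => x x0; field; rewrite gt_eqF.
  have -> : 6 * (6 * (Bc * (16 * (N ^+ 3 * P))) * (B * N^-1 ^+ (m - i).+1)) =
    6 * (6 * (Bc * 16) * B) * (N ^+ 3 * P * N^-1 ^+ (m - i).+1) by ring.
  by rewrite ler_wpM2l// !mulr_ge0.
have [C hC] := choice term.
exists (\sum_(i < m) C i) => n.
have := QDN (QD_sum (n := m) (f := fun i v => cc i v * npow n.+2 (v + i%:R) *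
   binrem (m - i).+1 n.+2%:R^-1 (v + i%:R)) (w := w)
   (B := fun i => C i * n.+1%:R ^- 2) (fun k km => hC k km n)).
by rewrite mulr_suml.
Qed.

Lemma hs_rm m v : 4 <= complex.Re v + m%:R ->
  exists t, hs (fun n => rm m n.+2 v) t.
Proof.
move=> /QD_rm[C hC]; apply: (@hs_ex _ _ _ (C * 2)); apply: asum_inv_sq => n.
by have [d []] := hC n.
Qed.

Definition rm_sum m v : R[i] := summability.sum (fun n => rm m n.+2 v : R[i]^o).

Lemma hs_rm_sum m v : 4 <= complex.Re v + m%:R ->
  hs (fun n => rm m n.+2 v) (rm_sum m v).
Proof. by move=> /hs_rm[t ht]; rewrite /rm_sum (hs_sumE ht). Qed.

(** The limit of the telescoped sum. Where [gm m L.+1 v] tends to 0, it is v times the sum of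
    n^(-v-1) over n >= 2. *)
Definition Em m v : R[i] := gm m 1 v + rm_sum m v.

Lemma hol_gm m n : hol (@gm R m n.+1).
Proof.
apply: (@hol_sum R m (fun i v => cc i v * npow n.+1 (v + i%:R))) => k km.
by apply: holM; [exact: hol_cc|apply: hol_shift; exact: hol_npow].
Qed.

Lemma Re_ge_nm (w e : R[i]) : nm e <= 1 -> complex.Re w - 1 <= complex.Re (w + e).
Proof.
move=> e1; rewrite ReD lerD2l.
have := le_trans (nm_Re e) e1; rewrite ler_norml => /andP[]//.
Qed.

(** 5 instead of 4, because the series has to converge on the whole unit disc around [w]. *)
Lemma qderiv_Em m w : 5 <= complex.Re w + m%:R -> qderiv (Em m) w.
Proof.
move=> wm; apply: qderivD; first exact/hol_qderiv/hol_gm.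
have [|C hC] := @QD_rm m w; first by apply: le_trans wm; lra.
have C0 : 0 <= C.
  by have [d /Qd_ge0] := hC 0%N; rewrite expr1n invr1 mulr1.
apply: (QD_series (B := C * 2) hC).
  by move=> J; rewrite -mulr_sumr ler_wpM2l// inv_sq_sum.
move=> e e1; apply: hs_rm_sum.
by have := Re_ge_nm w e1; lra.
Qed.

Lemma Em_cl m v : (0 < m)%N -> 4 <= complex.Re v + m%:R ->
  cl (fun L => \sum_(n < L) v * npow n.+2 (v + 1) + gm m L.+1 v) (Em m v).
Proof.
move=> m0 /hs_rm_sum/hs_cl h.
apply: eq_cl (clD (cl_cst (gm m 1 v)) h) => L.
rewrite (telescope _ _ m0); ring.
Qed.

Lemma cl_npow0 v : 1 <= complex.Re v -> cl (fun L => npow L.+1 v) 0.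
Proof.
move=> v1; apply: (@cl_inv_le _ _ _ 1) => n; rewrite subr0 mul1r.
by have := @nm_npow_le R n 1 v v1; rewrite expr1.
Qed.

(** The new term c_m(v) n^(-v-m) of the antidifference tends to 0 in this half-plane. So the
    functions for different [m] are continuations of each other. *)
Lemma Em_step m v : (0 < m)%N -> 4 <= complex.Re v + m%:R -> Em m.+1 v = Em m v.
Proof.
move=> m0 vm.
have h1 := Em_cl m0 vm.
have h2 : cl (fun L => \sum_(n < L) v * npow n.+2 (v + 1) + gm m.+1 L.+1 v) (Em m.+1 v).
  by apply: Em_cl => //; rewrite -natr1; lra.
have h3 : cl (fun L => cc m v * npow L.+1 (v + m%:R)) (cc m v * 0).
  by apply: clZ; apply: cl_npow0; rewrite ReD Re_nat; lra.
have := cl_uniq h2 (eq_cl _ (clD h1 h3)); rewrite mulr0 addr0; apply => L.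
by rewrite [gm m.+1 _ _]big_ord_recr/= addrA.
Qed.

Lemma Em_add m k v : (0 < m)%N -> 4 <= complex.Re v + m%:R ->
  Em (m + k) v = Em m v.
Proof.
move=> m0 vm; elim: k => [|k IH]; first by rewrite addn0.
rewrite addnS Em_step ?addn_gt0 ?m0//.
by rewrite natrD; have : (0 : R) <= k%:R by []; lra.
Qed.

Definition mlev v := (Num.truncn `|complex.Re v|).+1 + 4.

Lemma mlevP v : 4 <= complex.Re v + (mlev v)%:R.
Proof.
rewrite /mlev natrD; have := truncnS_gt `|complex.Re v|.
have := ler_norm (- complex.Re v); rewrite normrN; lra.
Qed.

(* The analytic continuation of v |-> v * sum_(n >= 2) n ^ -(v + 1). *)
Definition Zc v : R[i] := Em (mlev v) v.

Lemma ZcE m v : (0 < m)%N -> 4 <= complex.Re v + m%:R -> Zc v = Em m v.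
Proof.
move=> m0 vm; rewrite /Zc -(Em_add (mlev v) m0 vm) addnC Em_add//.
exact: mlevP.
Qed.

Lemma qderiv_Zc w : qderiv Zc w.
Proof.
have := mlevP w => hw.
have m1 : 5 <= complex.Re w + (mlev w).+1%:R by rewrite -natr1; lra.
apply: (qderiv_local ltr01) (qderiv_Em m1) => e e1.
by rewrite [RHS](@ZcE (mlev w).+1)//; have := Re_ge_nm w e1; lra.
Qed.

Lemma Zc_cl v : 1 <= complex.Re v ->
  cl (fun L => \sum_(n < L) v * npow n.+2 (v + 1)) (Zc v).
Proof.
move=> v1; have v4 := mlevP v.
have h1 := Em_cl (_ : (0 < mlev v)%N) v4.
have h2 : cl (fun L => gm (mlev v) L.+1 v) (\sum_(i < mlev v) cc i v * 0).
  apply: (@cl_sum _ (mlev v) (fun i L => cc i v * npow L.+1 (v + i%:R)) (fun i => cc i v * 0)).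
  move=> i _; apply: clZ; apply: cl_npow0; rewrite ReD Re_nat.
  by have : (0 : R) <= i%:R by []; lra.
have := clB (h1 _) h2; rewrite big1 ?subr0; last by move=> i _; rewrite mulr0.
by rewrite addn_gt0 orbT => /(_ isT); apply: eq_cl => L; rewrite addrK.
Qed.

(** At v = 0 every term v n^(-v-1) vanishes and only c_0 = 1 survives. This is the residue of the
    Riemann zeta function, and it makes the poles of [zterm] genuine. *)
Lemma Zc0 : Zc 0 = 1.
Proof.
have r0 : 4 <= complex.Re (0 : R[i]) + 4%:R by rewrite add0r.
have h1 := Em_cl (isT : (0 < 4)%N) r0; rewrite -(@ZcE 4 _ isT r0) in h1.
apply: (cl_uniq h1).
have h2 : cl (fun L => \sum_(i < 4) @cc R i 0 * npow L.+1 (0 + i%:R))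
    (\sum_(i < 4) @cc R i 0 * (i == 0%N :> nat)%:R).
  apply: (@cl_sum _ 4 (fun i L => cc i 0 * npow L.+1 (0 + i%:R))
    (fun i => cc i 0 * (i == 0%N)%:R)).
  move=> [|i] _; apply: clZ.
    by apply: eq_cl (cl_cst 1) => L; rewrite addr0 npow0.
  by apply: cl_npow0; rewrite add0r Re_nat ler1n.
move: h2; rewrite [X in cl _ X]big_ord_recl big1 ?addr0; last by move=> i _; rewrite mulr0.
rewrite cc0 mulr1; apply: eq_cl => L; rewrite [X in _ = X + _]big1 ?add0r// => n _.
by rewrite mul0r.
Qed.

End ZetaAssembly.

(* Closes the side conditions of field up to ring normalization of H. *)
Ltac neq_from H :=
  solve [exact: H | let e := fresh in apply: contra H => /eqP e; apply/eqP; rewrite -[RHS]e; ring].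
Ltac side_conditions := repeat (apply/andP; split);
  match goal with
  | H : is_true (_ != _) |- _ => neq_from H
  end.

(** * Matrix coefficients of the generators *)

Section Identities.
Variable R : realType.
Variables (q s P J K : R).
Local Notation p := (q ^+ 2 + 1).
Local Notation u := (1 - s ^+ 2).

(* alpha^2 and beta up to elementary factors, as functions of W = q^(2l). *)
Definition ghat (W : R) : R := (1 - W * P) * (1 - W / P) *
  (s ^+ 2 * (1 + W ^+ 2) + W * (P + s ^+ 4 / P)) /
  ((1 - W ^+ 2) ^+ 2 * (1 - q ^+ 2 * W ^+ 2)).

Definition hfun (W : R) : R :=
  (p * W * (P - s ^+ 2 / P) - u * (1 + q ^+ 2 * W ^+ 2)) /
  ((1 - W ^+ 2) * (1 - q ^+ 4 * W ^+ 2)).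

(** By [gamW] and [gamqW], [ghat] and [gchk] belong to alpha at l and at l + 1. In [ghat] the factor
    1 - W^2/q^2, which can vanish on the lowest level, is cancelled. *)
Definition gchk (W : R) : R := (1 - q ^+ 2 * W * P) * (1 - q ^+ 2 * W / P) *
  (s ^+ 2 * (1 + q ^+ 4 * W ^+ 2) + q ^+ 2 * W * (P + s ^+ 4 / P)) /
  ((1 - q ^+ 4 * W ^+ 2) ^+ 2 * (1 - q ^+ 2 * W ^+ 2)).

Definition diagA (h J W : R) := u / p - h * (J ^+ 2 - (1 + q ^+ 2 * W ^+ 2) / p).

Lemma p_neq0 : p != 0.
Proof. by rewrite gt_eqF// ltr_wpDl// sqr_ge0. Qed.

Hypothesis P0 : P != 0.

(** The relation between beta at l and at l + 1 to which the components of all three relations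
    reduce when l changes by one. *)
Lemma beta_rec (W : R) : 1 - W ^+ 2 != 0 -> 1 - q ^+ 4 * W ^+ 2 != 0 ->
    1 - q ^+ 8 * W ^+ 2 != 0 ->
  u * (1 - q ^+ 2) - q ^+ 2 * hfun W * (1 - W ^+ 2) +
  hfun (q ^+ 2 * W) * (1 - q ^+ 8 * W ^+ 2) = 0.
Proof.
move=> h1 h2 h3; rewrite /hfun.
have h2' : 1 - (q ^+ 2 * W) ^+ 2 != 0 by rewrite exprMn -exprM.
have h3' : 1 - q ^+ 4 * (q ^+ 2 * W) ^+ 2 != 0 by rewrite exprMn -exprM mulrA -exprD.
by field; side_conditions.
Qed.

Hypotheses (h1 : 1 - (J * K) ^+ 2 != 0) (h2 : 1 - q ^+ 2 * (J * K) ^+ 2 != 0)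
  (h4 : 1 - q ^+ 4 * (J * K) ^+ 2 != 0).

(** The component of a relation that preserves l contains the roots only through their squares, so
    it becomes a rational identity such as this one. *)
Lemma BBs_diag :
  (1 - J ^+ 2) * ghat (J * K) + J ^+ 2 * (1 - q ^+ 2 * K ^+ 2) * gchk (J * K)
  + J ^+ 2 * (1 - q ^+ 2 * K ^+ 2) * (1 - J ^+ 2) * hfun (J * K) ^+ 2
  + diagA (hfun (J * K)) J (J * K) ^+ 2
  - u * diagA (hfun (J * K)) J (J * K) - s ^+ 2 = 0.
Proof.
have hp := p_neq0.
rewrite /diagA /ghat /gchk /hfun.
field; side_conditions.
Qed.

Lemma BsB_diag :
  (1 - q ^+ 2 * J ^+ 2) * gchk (J * K) + q ^+ 2 * J ^+ 2 * (1 - K ^+ 2) * ghat (J * K)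
  + q ^+ 2 * J ^+ 2 * (1 - K ^+ 2) * (1 - q ^+ 2 * J ^+ 2) * hfun (J * K) ^+ 2
  + q ^+ 4 * diagA (hfun (J * K)) J (J * K) ^+ 2
  - q ^+ 2 * u * diagA (hfun (J * K)) J (J * K) - s ^+ 2 = 0.
Proof.
have hp := p_neq0.
rewrite /diagA /ghat /gchk /hfun.
by field; side_conditions.
Qed.

Lemma AB_diag (W : R) : 1 - W ^+ 2 != 0 -> 1 - q ^+ 2 * W ^+ 2 != 0 ->
    1 - q ^+ 4 * W ^+ 2 != 0 ->
  ghat W - gchk W
  + hfun W * (1 - q ^+ 2) * (u + hfun W * (1 + q ^+ 2 * W ^+ 2)) / p = 0.
Proof.
move=> k1 k2 k4; have hp := p_neq0.
rewrite /ghat /gchk /hfun.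
by field; side_conditions.
Qed.

End Identities.

(** * Coefficients of A, B and their squares at a ket *)

Section Coefficients.
Variable R : realType.
Variables (q s P : R).
Local Notation p := (q ^+ 2 + 1).
Local Notation u := (1 - s ^+ 2).
Implicit Types (J K W x : R).

(** By [alphaE], alpha is an elementary factor times [gam]. At W = q, that is l = 1/2, the
    denominator vanishes and the value is 0; the same happens to alpha through [2l - 1]. *)
Definition gfun W : R := (1 - W * P) * (1 - W / P) *
  (s ^+ 2 * (1 + W ^+ 2) + W * (P + s ^+ 4 / P)) /
  ((1 - W ^+ 2) ^+ 2 * (1 - W ^+ 2 / q ^+ 2) * (1 - q ^+ 2 * W ^+ 2)).

Definition gam W : R := Num.sqrt (gfun W).
Definition cs x : R := Num.sqrt (1 - x ^+ 2).
Local Notation h := (hfun q s P).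

(* Matrix coefficients of A, B and B^* as functions of J = q^(l+m) and
   K = q^(l-m): the suffixes m, z, p refer to the coordinates with
   l - 1, l, l + 1, which determine the value of the image at (l, m). *)
Definition coefAm J K : R := - (J / q) * cs K * cs J * gam (J * K).
Definition coefAz J K : R := diagA q s (h (J * K)) J (J * K).
Definition coefAp J K : R := - J * cs (q * K) * cs (q * J) * gam (q ^+ 2 * (J * K)).
Definition coefBm J K : R := cs J * cs (J / q) * gam (J * K).
Definition coefBz J K : R := J * cs (q * K) * cs J * h (J * K).
Definition coefBp J K : R :=
  - q * J ^+ 2 * cs (q ^+ 2 * K) * cs (q * K) * gam (q ^+ 2 * (J * K)).
Definition coefTm J K : R := - q * J ^+ 2 * cs K * cs (K / q) * gam (J * K).
Definition coefTz J K : R := q * J * cs K * cs (q * J) * h (J * K).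
Definition coefTp J K : R := cs (q * J) * cs (q ^+ 2 * J) * gam (q ^+ 2 * (J * K)).

(** The alternatives encode that exponents are integers: either a step down leaves the index set and
    some factor is 0, or it stays where the roots have nonnegative arguments and the denominators
    are not 0. *)
Record ket_params J K : Prop := KetParams {
  kp_q0 : 0 < q; kp_q1 : q < 1; kp_P : 0 < P;
  kp_J0 : 0 < J; kp_K0 : 0 < K;
  kp_J1 : J = 1 \/ J <= q; kp_K1 : K = 1 \/ K <= q;
  kp_WP : J * K * P <= 1; kp_WP' : J * K / P <= 1;
  kp_Wle : J * K <= q;
  kp_low : (1 - J * K * P) * (1 - J * K / P) = 0 \/ J * K <= q ^+ 3 }.

Variables (J K : R) (kp : ket_params J K).
Local Notation W := (J * K).

Let q0 := kp_q0 kp.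
Let q1 := kp_q1 kp.
Let J0 := kp_J0 kp.
Let K0 := kp_K0 kp.

Lemma kp_Jle1 : J <= 1.
Proof. by case: (kp_J1 kp) => [->//|]; move=> /le_trans; apply; exact: ltW. Qed.

Lemma kp_Kle1 : K <= 1.
Proof. by case: (kp_K1 kp) => [->//|]; move=> /le_trans; apply; exact: ltW. Qed.

Lemma kp_W0 : 0 < W. Proof. exact: mulr_gt0. Qed.

Lemma one_sub_gt0 x : 0 <= x -> x < 1 -> 0 < 1 - x ^+ 2.
Proof. by move=> x0 x1; rewrite subr_gt0 expr_lt1. Qed.

Lemma one_sub_qW_gt0 n : 0 < 1 - q ^+ n.*2 * W ^+ 2.
Proof.
have W0 := kp_W0; have Wq := kp_Wle kp.
rewrite -muln2 exprM -exprMn one_sub_gt0 ?mulr_ge0 ?exprn_ge0 ?ltW//.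
apply: (@le_lt_trans _ _ (1 * W)); last by rewrite mul1r (le_lt_trans Wq).
by rewrite ler_wpM2r// ?exprn_ile1// ltW.
Qed.

Lemma cs_sqr x : 0 <= x -> x <= 1 -> cs x ^+ 2 = 1 - x ^+ 2.
Proof. by move=> x0 x1; rewrite /cs sqr_sqrtr// subr_ge0 expr_le1. Qed.

Lemma csJ : cs J ^+ 2 = 1 - J ^+ 2.
Proof. by rewrite cs_sqr ?kp_Jle1 ?ltW. Qed.

Lemma csK : cs K ^+ 2 = 1 - K ^+ 2.
Proof. by rewrite cs_sqr ?kp_Kle1 ?ltW. Qed.

Lemma csqX n x : 0 <= x -> x <= 1 -> cs (q ^+ n * x) ^+ 2 = 1 - q ^+ n.*2 * x ^+ 2.
Proof.
move=> x0 x1; rewrite cs_sqr ?exprMn -?exprM ?muln2//.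
  by rewrite mulr_ge0// exprn_ge0 ?ltW.
by rewrite mulr_ile1// ?exprn_ge0 ?exprn_ile1// ltW.
Qed.

(** For x = 1 the argument of [cs (x / q)] exceeds 1 and the root is 0 by convention; the factor
    [cs 1] = 0 saves the identity. *)
Lemma cs_div x : 0 < x -> x = 1 \/ x <= q ->
  cs x * cs (x / q) ^+ 2 = cs x * (1 - x ^+ 2 / q ^+ 2).
Proof.
move=> x0 [->|xq]; first by rewrite /cs expr1n subrr sqrtr0 !mul0r.
rewrite [X in _ * X]cs_sqr ?expr_div_n//; first by rewrite divr_ge0 ?ltW.
by rewrite ler_pdivrMr ?mul1r.
Qed.

Lemma gfun_ge0 : 0 <= gfun W.
Proof.
have W0 := kp_W0; have Wq := kp_Wle kp; have P0 := kp_P kp.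
rewrite /gfun divr_ge0//.
  apply: mulr_ge0; first by rewrite mulr_ge0 ?subr_ge0 ?(kp_WP kp) ?(kp_WP' kp).
  apply: addr_ge0.
    by apply: mulr_ge0; [exact: sqr_ge0|apply: addr_ge0 => //; exact: sqr_ge0].
  apply: mulr_ge0; first exact: ltW.
  apply: addr_ge0; first exact: ltW.
  by apply: divr_ge0; [rewrite exprn_even_ge0|exact: ltW].
apply: mulr_ge0; last by rewrite ltW// (one_sub_qW_gt0 1).
apply: mulr_ge0; first exact: sqr_ge0.
have Wq0 : 0 <= W / q by apply: divr_ge0; exact: ltW.
by rewrite -expr_div_n subr_ge0 expr_le1// ler_pdivrMr ?mul1r.
Qed.

Lemma gamW : (1 - W ^+ 2 / q ^+ 2) * gam W ^+ 2 = ghat q s P W.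
Proof.
have W0 := kp_W0; have Wq := kp_Wle kp; have P0 := kp_P kp.
rewrite /gam sqr_sqrtr ?gfun_ge0// /gfun /ghat.
have n1 : 1 - W ^+ 2 != 0 by rewrite gt_eqF// -[W ^+ 2]mul1r (one_sub_qW_gt0 0).
have n2 : 1 - q ^+ 2 * W ^+ 2 != 0 by rewrite gt_eqF// (one_sub_qW_gt0 1).
(* On the lowest level a factor of the numerator is 0 and so are both sides, even if 1 - W^2/q^2
   vanishes as well. *)
case: (kp_low kp) => [->|Wlt]; first by rewrite !mul0r mulr0.
have {}Wlt : W < q.
  apply: le_lt_trans Wlt _; rewrite -[ltRHS]expr1 ltr_iXn2l//.
have n3 : q ^+ 2 - W ^+ 2 != 0.
  by rewrite gt_eqF// subr_gt0 ltrXn2r// ?nnegrE ltW.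
have qn : q != 0 by rewrite gt_eqF.
have Pn : P != 0 by rewrite gt_eqF.
move: (W) n1 n2 n3 Pn qn => x n1 n2 n3 Pn qn; field.
by side_conditions.
Qed.

Lemma q2W_le : q ^+ 2 * W <= W.
Proof. by rewrite ler_piMl ?(ltW kp_W0)// exprn_ile1// ltW. Qed.

Lemma gfun_q2W_ge0 : 0 <= gfun (q ^+ 2 * W).
Proof.
have W0 := kp_W0; have P0 := kp_P kp; have Wq2 := q2W_le.
have W20 : 0 < q ^+ 2 * W by rewrite mulr_gt0// exprn_gt0.
rewrite /gfun divr_ge0//.
  apply: mulr_ge0.
    apply: mulr_ge0; rewrite subr_ge0.
      by apply: le_trans (kp_WP kp); rewrite ler_wpM2r// ltW.
    by apply: le_trans (kp_WP' kp); rewrite ler_wpM2r// invr_ge0 ltW.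
  apply: addr_ge0.
    by apply: mulr_ge0; [exact: sqr_ge0|apply: addr_ge0 => //; exact: sqr_ge0].
  apply: mulr_ge0; first exact: ltW.
  apply: addr_ge0; first exact: ltW.
  by apply: divr_ge0; [rewrite exprn_even_ge0|exact: ltW].
apply: mulr_ge0; last first.
  have -> : q ^+ 2 * (q ^+ 2 * W) ^+ 2 = q ^+ 6 * W ^+ 2 by ring.
  exact: ltW (one_sub_qW_gt0 3).
apply: mulr_ge0; first exact: sqr_ge0.
have qn : q != 0 by rewrite gt_eqF.
have -> : (q ^+ 2 * W) ^+ 2 / q ^+ 2 = q ^+ 2 * W ^+ 2 by field.
exact: ltW (one_sub_qW_gt0 1).
Qed.

Lemma gamqW : (1 - q ^+ 6 * W ^+ 2) * gam (q ^+ 2 * W) ^+ 2 = gchk q s P W.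
Proof.
rewrite /gam sqr_sqrtr ?gfun_q2W_ge0// /gfun /gchk.
have n1 : 1 - q ^+ 2 * W ^+ 2 != 0 by rewrite gt_eqF// (one_sub_qW_gt0 1).
have n2 : 1 - q ^+ 4 * W ^+ 2 != 0 by rewrite gt_eqF// (one_sub_qW_gt0 2).
have n3 : 1 - q ^+ 6 * W ^+ 2 != 0 by rewrite gt_eqF// (one_sub_qW_gt0 3).
have qn : q != 0 by rewrite gt_eqF.
have Pn : P != 0 by rewrite gt_eqF// (kp_P kp).
move: (W) n1 n2 n3 Pn qn => x n1 n2 n3 Pn qn; field.
by side_conditions.
Qed.

Let qn : q != 0. Proof. by rewrite gt_eqF. Qed.
Let Pn : P != 0. Proof. by rewrite gt_eqF// (kp_P kp). Qed.
Let Wn1 : 1 - W ^+ 2 != 0.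
Proof. by rewrite gt_eqF// -[W ^+ 2]mul1r (one_sub_qW_gt0 0). Qed.
Let Wn2 : 1 - q ^+ 2 * W ^+ 2 != 0. Proof. by rewrite gt_eqF// (one_sub_qW_gt0 1). Qed.
Let Wn4 : 1 - q ^+ 4 * W ^+ 2 != 0. Proof. by rewrite gt_eqF// (one_sub_qW_gt0 2). Qed.
Let Wn8 : 1 - q ^+ 8 * W ^+ 2 != 0. Proof. by rewrite gt_eqF// (one_sub_qW_gt0 4). Qed.
Let pn : p != 0. Proof. exact: p_neq0. Qed.

(** [beta_rec] one level down. On the lowest level there is no level below, and the factor [gam W] =
    0 takes over. *)
Lemma gam_beta_rec : gam W * (u * (1 - q ^+ 2) - q ^+ 2 * h (W / q ^+ 2) *
  (1 - (W / q ^+ 2) ^+ 2) + h W * (1 - q ^+ 4 * W ^+ 2)) = 0.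
Proof.
case: (kp_low kp) => [e|Wlt].
  by rewrite /gam /gfun e !mul0r sqrtr0 mul0r.
have Wq : W / q ^+ 2 <= q by rewrite ler_pdivrMr ?exprn_gt0// -exprS.
have k1 : 1 - (W / q ^+ 2) ^+ 2 != 0.
  rewrite gt_eqF// one_sub_gt0 ?divr_ge0 ?exprn_ge0 ?(ltW kp_W0) ?(ltW q0)//.
  exact: le_lt_trans Wq q1.
have E : q ^+ 2 * (W / q ^+ 2) = W by rewrite mulrCA divff ?mulr1 ?expf_neq0.
have E4 : q ^+ 8 * (W / q ^+ 2) ^+ 2 = q ^+ 4 * W ^+ 2 by field.
have E5 : q ^+ 4 * (W / q ^+ 2) ^+ 2 = W ^+ 2 by field.
have := @beta_rec R q s P Pn (W / q ^+ 2) k1; rewrite E E4 E5 => ->//.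
by rewrite mulr0.
Qed.

End Coefficients.

(** * Components of the defining relations *)

Section Components.
Variable R : realType.
Variables (q s P : R).
Local Notation p := (q ^+ 2 + 1).
Local Notation u := (1 - s ^+ 2).
Local Notation h := (hfun q s P).
Local Notation gam := (gam q s P).
Local Notation coefAm := (coefAm q s P).
Local Notation coefAz := (coefAz q s P).
Local Notation coefAp := (coefAp q s P).
Local Notation coefBm := (coefBm q s P).
Local Notation coefBz := (coefBz q s P).
Local Notation coefBp := (coefBp q s P).
Local Notation coefTm := (coefTm q s P).
Local Notation coefTz := (coefTz q s P).
Local Notation coefTp := (coefTp q s P).
Variables (J K : R) (kp : ket_params q P J K).
Local Notation W := (J * K).

Let q0 := kp_q0 kp.
Let q1 := kp_q1 kp.
Let J0 := kp_J0 kp.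
Let K0 := kp_K0 kp.
Let qn : q != 0. Proof. by rewrite gt_eqF. Qed.
Let Pn : P != 0. Proof. by rewrite gt_eqF// (kp_P kp). Qed.
Let Wn1 : 1 - W ^+ 2 != 0.
Proof. by rewrite gt_eqF// -[W ^+ 2]mul1r (one_sub_qW_gt0 kp 0). Qed.
Let Wn2 : 1 - q ^+ 2 * W ^+ 2 != 0. Proof. by rewrite gt_eqF// (one_sub_qW_gt0 kp 1). Qed.
Let Wn4 : 1 - q ^+ 4 * W ^+ 2 != 0. Proof. by rewrite gt_eqF// (one_sub_qW_gt0 kp 2). Qed.
Let Wn8 : 1 - q ^+ 8 * W ^+ 2 != 0. Proof. by rewrite gt_eqF// (one_sub_qW_gt0 kp 4). Qed.
Let pn : p != 0. Proof. exact: p_neq0. Qed.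

Lemma shift_args : (J / q * (q * K) = W) * (q * J * (K / q) = W) *
  (q * J * (q * K) = q ^+ 2 * W) * (J * (q ^+ 2 * K) = q ^+ 2 * W) *
  (q ^+ 2 * J * K = q ^+ 2 * W) * (J / q * (K / q) = W / q ^+ 2) *
  (J / q ^+ 2 * K = W / q ^+ 2) * (J * (K / q ^+ 2) = W / q ^+ 2) *
  (q ^+ 2 * (W / q ^+ 2) = W) * (q * (J / q) = J) * (q * (K / q) = K) *
  (q * (q * J) = q ^+ 2 * J) * (q * (q * K) = q ^+ 2 * K) * (q * J / q = J) *
  (q * K / q = K) * (q ^+ 2 * J / q = q * J) * (q ^+ 2 * K / q = q * K) *
  (q ^+ 2 * (J / q) = q * J) * (q ^+ 2 * (K / q) = q * K) *
  (q ^+ 2 * (J / q ^+ 2) = J) * (q ^+ 2 * (K / q ^+ 2) = K) *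
  (q * (J / q ^+ 2) = J / q) * (J / q / q = J / q ^+ 2) * (K / q / q = K / q ^+ 2) *
  (q * (q ^+ 2 * J) = q ^+ 3 * J) * (q ^+ 2 * (q * J) = q ^+ 3 * J) *
  (q * (q ^+ 2 * K) = q ^+ 3 * K) * (q ^+ 2 * (q * K) = q ^+ 3 * K) * (q * (K / q ^+ 2) = K / q).
Proof. by do !split; field. Qed.

Ltac unfold_coefs :=
  rewrite /coefAm /coefAz /coefAp /coefBm /coefBz /coefBp
    /coefTm /coefTz /coefTp;
  rewrite !shift_args.

(** The suffixes p2, p1, z, m1, m2 give the change of l, from 2 to -2. In the extreme components all
    factors match directly; no property of the roots is used. *)
Lemma AB_p2 : coefAp J K * coefBp (q * J) (q * K) =
  q ^+ 2 * (coefBp J K * coefAp J (q ^+ 2 * K)).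
Proof. by unfold_coefs; ring. Qed.

Lemma AB_m2 : coefAm J K * coefBm (J / q) (K / q) =
  q ^+ 2 * (coefBm J K * coefAm (J / q ^+ 2) K).
Proof. by unfold_coefs; field. Qed.

Lemma BBs_p2 : coefBp J K * coefTp J (q ^+ 2 * K) + coefAp J K * coefAp (q * J) (q * K) = 0.
Proof. by unfold_coefs; ring. Qed.

Lemma BBs_m2 : coefBm J K * coefTm (J / q ^+ 2) K + coefAm J K * coefAm (J / q) (K / q) = 0.
Proof. by unfold_coefs; field. Qed.

Lemma BsB_p2 : coefTp J K * coefBp (q ^+ 2 * J) K +
  q ^+ 4 * (coefAp J K * coefAp (q * J) (q * K)) = 0.
Proof. by unfold_coefs; ring. Qed.

Lemma BsB_m2 : coefTm J K * coefBm J (K / q ^+ 2) +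
  q ^+ 4 * (coefAm J K * coefAm (J / q) (K / q)) = 0.
Proof. by unfold_coefs; field. Qed.

Let Jle1 := kp_Jle1 kp.
Let Kle1 := kp_Kle1 kp.
Let csqJ : cs (q * J) ^+ 2 = 1 - q ^+ 2 * J ^+ 2.
Proof. by have := csqX kp 1 (ltW J0) Jle1; rewrite expr1. Qed.
Let csqK : cs (q * K) ^+ 2 = 1 - q ^+ 2 * K ^+ 2.
Proof. by have := csqX kp 1 (ltW K0) Kle1; rewrite expr1. Qed.
Let csq2J : cs (q ^+ 2 * J) ^+ 2 = 1 - q ^+ 4 * J ^+ 2.
Proof. exact: (csqX kp 2 (ltW J0) Jle1). Qed.
Let csq2K : cs (q ^+ 2 * K) ^+ 2 = 1 - q ^+ 4 * K ^+ 2.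
Proof. exact: (csqX kp 2 (ltW K0) Kle1). Qed.
Let csJm : cs J * cs (J / q) ^+ 2 = cs J * (1 - J ^+ 2 / q ^+ 2).
Proof. by apply: (cs_div kp) => //; exact: kp_J1 kp. Qed.
Let csKm : cs K * cs (K / q) ^+ 2 = cs K * (1 - K ^+ 2 / q ^+ 2).
Proof. by apply: (cs_div kp) => //; exact: kp_K1 kp. Qed.
Let brec := beta_rec s Pn Wn1 Wn4 Wn8.
Let brec' := gam_beta_rec s kp.

Lemma AB_p1 : coefAz J K * coefBp J K + coefAp J K * coefBz (q * J) (q * K) =
  q ^+ 2 * (coefBz J K * coefAp (J / q) (q * K) + coefBp J K * coefAz J (q ^+ 2 * K)).
Proof.
unfold_coefs; rewrite /diagA; apply/eqP; rewrite -subr_eq0; apply/eqP.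
have e1 := csqJ; have e2 := csJ kp; have e3 := brec.
set hh := h W in e3 *; set h' := h (q ^+ 2 * W) in e3 *.
(* With the roots as atoms, the difference is a combination of expressions that vanish by the
   squares of the roots and by the recursion for beta. The other components follow the same
   pattern. *)
transitivity (- q * J ^+ 2 * cs (q * K) * cs (q ^+ 2 * K) * gam (q ^+ 2 * W) *
  ((cs (q * J) ^+ 2 - (1 - q ^+ 2 * J ^+ 2)) * h'
   - (cs J ^+ 2 - (1 - J ^+ 2)) * hh
   + (u * (1 - q ^+ 2) - q ^+ 2 * hh * (1 - W ^+ 2) + h' * (1 - q ^+ 8 * W ^+ 2)) / p)).
  by field; rewrite ?qn ?pn.
by rewrite e1 e2 e3 !subrr !mul0r subr0 addr0 mulr0.
Qed.

Lemma BBs_p1 : coefBz J K * coefTp (J / q) (q * K) + coefBp J K * coefTz J (q ^+ 2 * K)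
  + coefAz J K * coefAp J K + coefAp J K * coefAz (q * J) (q * K) - u * coefAp J K = 0.
Proof.
unfold_coefs; rewrite /diagA.
have e1 := csq2K; have e2 := csJ kp; have e3 := brec.
set hh := h W in e3 *; set h' := h (q ^+ 2 * W) in e3 *.
transitivity (- J * cs (q * K) * cs (q * J) * gam (q ^+ 2 * W) *
  (q ^+ 2 * J ^+ 2 * (cs (q ^+ 2 * K) ^+ 2 - (1 - q ^+ 4 * K ^+ 2)) * h'
   - (cs J ^+ 2 - (1 - J ^+ 2)) * hh
   + (u * (1 - q ^+ 2) - q ^+ 2 * hh * (1 - W ^+ 2) + h' * (1 - q ^+ 8 * W ^+ 2)) / p)).
  by field; rewrite ?qn ?pn.
by rewrite e1 e2 e3 !subrr !(mul0r, mulr0, subr0, addr0).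
Qed.

Lemma BsB_p1 : coefTz J K * coefBp (q * J) (K / q) + coefTp J K * coefBz (q ^+ 2 * J) K
  + q ^+ 4 * (coefAz J K * coefAp J K + coefAp J K * coefAz (q * J) (q * K))
  - q ^+ 2 * u * coefAp J K = 0.
Proof.
unfold_coefs; rewrite /diagA.
have e1 := csq2J; have e2 := csK kp; have e3 := brec.
set hh := h W in e3 *; set h' := h (q ^+ 2 * W) in e3 *.
transitivity (- q ^+ 2 * J * cs (q * J) * cs (q * K) * gam (q ^+ 2 * W) *
  (q ^+ 2 * J ^+ 2 * (cs K ^+ 2 - (1 - K ^+ 2)) * hh
   - (cs (q ^+ 2 * J) ^+ 2 - (1 - q ^+ 4 * J ^+ 2)) * h'
   - (u * (1 - q ^+ 2) - q ^+ 2 * hh * (1 - W ^+ 2) + h' * (1 - q ^+ 8 * W ^+ 2)) / p)).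
  by field; rewrite ?qn ?pn.
by rewrite e1 e2 e3 !subrr !(mul0r, mulr0, subr0, addr0).
Qed.

Lemma AB_m1 : coefAz J K * coefBm J K + coefAm J K * coefBz (J / q) (K / q) =
  q ^+ 2 * (coefBz J K * coefAm (J / q) (q * K) + coefBm J K * coefAz (J / q ^+ 2) K).
Proof.
unfold_coefs; rewrite /diagA; apply/eqP; rewrite -subr_eq0; apply/eqP.
have e1 := csqK; have e2 := csK kp; have e3 := brec'.
set hh := h W in e3 *; set h' := h (W / q ^+ 2) in e3 *.
transitivity (cs J * cs (J / q) * (gam W * (J ^+ 2 * (cs (q * K) ^+ 2 - (1 - q ^+ 2 * K ^+ 2)) * hh
   - J ^+ 2 / q ^+ 2 * (cs K ^+ 2 - (1 - K ^+ 2)) * h')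
   + gam W * (u * (1 - q ^+ 2) - q ^+ 2 * h' * (1 - (W / q ^+ 2) ^+ 2) + hh * (1 - q ^+ 4 * W ^+ 2)) / p)).
  by field; rewrite ?qn ?pn.
by rewrite e1 e2 e3 !subrr !(mul0r, mulr0, subr0, addr0).
Qed.

Lemma BBs_m1 : coefBz J K * coefTm (J / q) (q * K) + coefBm J K * coefTz (J / q ^+ 2) K
  + coefAz J K * coefAm J K + coefAm J K * coefAz (J / q) (K / q) - u * coefAm J K = 0.
Proof.
unfold_coefs; rewrite /diagA.
have e1 := csqK; have e2 := csJm; have e3 := brec'.
set hh := h W in e3 *; set h' := h (W / q ^+ 2) in e3 *.
transitivity (- (J / q) * cs K * (cs J * gam W * J ^+ 2 * (cs (q * K) ^+ 2 - (1 - q ^+ 2 * K ^+ 2)) * hh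
   - gam W * h' * (cs J * cs (J / q) ^+ 2 - cs J * (1 - J ^+ 2 / q ^+ 2))
   + cs J * (gam W * (u * (1 - q ^+ 2) - q ^+ 2 * h' * (1 - (W / q ^+ 2) ^+ 2) + hh * (1 - q ^+ 4 * W ^+ 2)) / p))).
  by field; rewrite ?qn ?pn.
by rewrite e1 e2 e3 !subrr !(mul0r, mulr0, subr0, addr0).
Qed.

Lemma BsB_m1 : coefTz J K * coefBm (q * J) (K / q) + coefTm J K * coefBz J (K / q ^+ 2)
  + q ^+ 4 * (coefAz J K * coefAm J K + coefAm J K * coefAz (J / q) (K / q))
  - q ^+ 2 * u * coefAm J K = 0.
Proof.
unfold_coefs; rewrite /diagA.
have e1 := csqJ; have e2 := csKm; have e3 := brec'.
set hh := h W in e3 *; set h' := h (W / q ^+ 2) in e3 *.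
transitivity (- q * J * cs J * (- cs K * gam W * (cs (q * J) ^+ 2 - (1 - q ^+ 2 * J ^+ 2)) * hh
   + gam W * h' * J ^+ 2 * (cs K * cs (K / q) ^+ 2 - cs K * (1 - K ^+ 2 / q ^+ 2))
   - cs K * (gam W * (u * (1 - q ^+ 2) - q ^+ 2 * h' * (1 - (W / q ^+ 2) ^+ 2) + hh * (1 - q ^+ 4 * W ^+ 2)) / p))).
  by field; rewrite ?qn ?pn.
by rewrite e1 e2 e3 !subrr !(mul0r, mulr0, subr0, addr0).
Qed.

Lemma AB_z : coefAz J K * coefBz J K + coefAp J K * coefBm (q * J) (q * K)
  + coefAm J K * coefBp (J / q) (K / q) =
  q ^+ 2 * (coefBz J K * coefAz (J / q) (q * K) + coefBp J K * coefAm J (q ^+ 2 * K)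
    + coefBm J K * coefAp (J / q ^+ 2) K).
Proof.
unfold_coefs; rewrite /diagA; apply/eqP; rewrite -subr_eq0; apply/eqP.
have e1 := csqJ; have e2 := csK kp; have e3 := csq2K; have e4 := csJm.
have g1 := gamW s kp; have g2 := gamqW s kp.
have e5 := AB_diag s Pn Wn1 Wn2 Wn4.
rewrite -g1 -g2 in e5; set hh := h W in e5 *.
transitivity (cs (q * K) * J * (
   - cs J * gam (q ^+ 2 * W) ^+ 2 * (cs (q * J) ^+ 2 - (1 - q ^+ 2 * J ^+ 2))
   + cs J * J ^+ 2 / q ^+ 2 * gam W ^+ 2 * (cs K ^+ 2 - (1 - K ^+ 2))
   - q ^+ 2 * J ^+ 2 * cs J * gam (q ^+ 2 * W) ^+ 2 * (cs (q ^+ 2 * K) ^+ 2 - (1 - q ^+ 4 * K ^+ 2))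
   + gam W ^+ 2 * (cs J * cs (J / q) ^+ 2 - cs J * (1 - J ^+ 2 / q ^+ 2))
   + cs J * ((1 - W ^+ 2 / q ^+ 2) * gam W ^+ 2 - (1 - q ^+ 6 * W ^+ 2) * gam (q ^+ 2 * W) ^+ 2
      + hh * (1 - q ^+ 2) * (u + hh * (1 + q ^+ 2 * W ^+ 2)) / p))).
  by field; rewrite ?qn ?pn.
by rewrite e1 e2 e3 e4 e5 !subrr !(mul0r, mulr0, subr0, addr0).
Qed.

Lemma BBs_z : coefBz J K * coefTz (J / q) (q * K) + coefBp J K * coefTm J (q ^+ 2 * K)
  + coefBm J K * coefTp (J / q ^+ 2) K + coefAz J K ^+ 2
  + coefAp J K * coefAm (q * J) (q * K) + coefAm J K * coefAp (J / q) (K / q)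
  - u * coefAz J K - s ^+ 2 = 0.
Proof.
unfold_coefs.
have e5 := BBs_diag s Pn Wn1 Wn2 Wn4; rewrite -(gamW s kp) -(gamqW s kp) in e5.
set a0 := diagA _ _ _ _ _ in e5 *; set hh := h W in e5 *.
transitivity (J ^+ 2 * cs (q * K) ^+ 2 * cs J ^+ 2 * hh ^+ 2
  + J ^+ 2 * cs (q * K) ^+ 2 * (q ^+ 2 * J ^+ 2 * cs (q ^+ 2 * K) ^+ 2 + cs (q * J) ^+ 2)
     * gam (q ^+ 2 * W) ^+ 2
  + cs J * (cs J * cs (J / q) ^+ 2) * gam W ^+ 2
  + J ^+ 2 / q ^+ 2 * cs K ^+ 2 * cs J ^+ 2 * gam W ^+ 2
  + a0 ^+ 2 - u * a0 - s ^+ 2).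
  by field; rewrite ?qn ?pn.
rewrite csJm csqK csqJ csq2K (csK kp) (mulrA (cs J)) -(expr2 (cs J)) (csJ kp) -[RHS]e5.
by field; rewrite ?qn ?pn.
Qed.

Lemma BsB_z : coefTz J K * coefBz (q * J) (K / q) + coefTp J K * coefBm (q ^+ 2 * J) K
  + coefTm J K * coefBp J (K / q ^+ 2)
  + q ^+ 4 * (coefAz J K ^+ 2 + coefAp J K * coefAm (q * J) (q * K)
              + coefAm J K * coefAp (J / q) (K / q))
  - q ^+ 2 * u * coefAz J K - s ^+ 2 = 0.
Proof.
unfold_coefs.
have e5 := BsB_diag s Pn Wn1 Wn2 Wn4; rewrite -(gamW s kp) -(gamqW s kp) in e5.
set a0 := diagA _ _ _ _ _ in e5 *; set hh := h W in e5 *.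
transitivity (q ^+ 2 * J ^+ 2 * cs K ^+ 2 * cs (q * J) ^+ 2 * hh ^+ 2
  + cs (q * J) ^+ 2 * (cs (q ^+ 2 * J) ^+ 2 + q ^+ 4 * J ^+ 2 * cs (q * K) ^+ 2)
     * gam (q ^+ 2 * W) ^+ 2
  + q ^+ 2 * J ^+ 4 * (cs K * (cs K * cs (K / q) ^+ 2)) * gam W ^+ 2
  + q ^+ 2 * J ^+ 2 * cs K ^+ 2 * cs J ^+ 2 * gam W ^+ 2
  + q ^+ 4 * a0 ^+ 2 - q ^+ 2 * u * a0 - s ^+ 2).
  by field; rewrite ?qn ?pn.
rewrite csKm csqK csqJ csq2J (mulrA (cs K)) -(expr2 (cs K)) (csK kp) (csJ kp) -[RHS]e5.
by field; rewrite ?qn ?pn.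
Qed.

End Components.

(** * Kets in integer coordinates *)

Section KetIndex.
Variable N : rat.
Hypotheses (N_half_int : 2 * N \is a Num.int) (N_neq0 : N != 0).
Local Notation I := (ket_index N).
Implicit Types (x y : I) (t : rat * rat * rat).

(* (a, b, f) shifts (l, m) by (a, b) and changes the sign of M if f holds. *)
Definition dvec := (int * int * bool)%type.

Definition shf (d : dvec) t : rat * rat * rat :=
  (t.1.1 + d.1.1%:~R, t.1.2 + d.1.2%:~R, if d.2 then - t.2 else t.2).

Definition dadd (d e : dvec) : dvec := (d.1.1 + e.1.1, d.1.2 + e.1.2, d.2 (+) e.2).
Definition dopp (d : dvec) : dvec := (- d.1.1, - d.1.2, d.2).
Definition d0 : dvec := (0, 0, false).

Lemma shf_add d e t : shf e (shf d t) = shf (dadd d e) t.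
Proof.
case: d => [[r p] b]; case: e => [[r' p'] b']; case: t => [[l m] M].
rewrite /shf/= !intrD !addrA; congr (_, _).
by case: b b' => [] []; rewrite //= opprK.
Qed.

Lemma shf_d0 t : shf d0 t = t.
Proof. by case: t => [[l m] M]; rewrite /shf/= !addr0. Qed.

Lemma dadd_opp d : dadd d (dopp d) = d0.
Proof. by case: d => [[r p] b]; rewrite /dadd/= !subrr addbb. Qed.

Lemma dopp_add d : dadd (dopp d) d = d0.
Proof. by case: d => [[r p] b]; rewrite /dadd/= !addNr addbb. Qed.

Definition phi (d : dvec) x : option I := insub (shf d (val x)).

Lemma phiE d x y : (phi d x = Some y) <-> (shf d (val x) = val y).
Proof.
split; first by rewrite /phi; case: insubP => // z _ <- [->].
by rewrite /phi => ->; rewrite valK.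
Qed.

Lemma phi_pinv d : pinv (phi d) (phi (dopp d)).
Proof.
move=> x y; split => /phiE h; apply/phiE.
  by rewrite -h shf_add dadd_opp shf_d0.
by rewrite -h shf_add dopp_add shf_d0.
Qed.

Lemma phi_d0 x : phi d0 x = Some x.
Proof. by apply/phiE; rewrite shf_d0. Qed.

Lemma phi_comp d e x y : phi d x = Some y -> phi e y = phi (dadd d e) x.
Proof. by move=> /phiE h; rewrite /phi -h shf_add. Qed.

Definition jx x : nat := Num.truncn ((val x).1.1 + (val x).1.2).
Definition kx x : nat := Num.truncn ((val x).1.1 - (val x).1.2).
Definition lev x : nat := Num.truncn ((val x).1.1 - `|N|).
Definition pos x : bool := 0 < (val x).2.
Definition nu : nat := Num.truncn (2 * `|N|).

Lemma ketP x : [/\ (val x).1.1 + (val x).1.2 = (jx x)%:R,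
  (val x).1.1 - (val x).1.2 = (kx x)%:R, (val x).1.1 - `|N| = (lev x)%:R &
  (val x).2 = if pos x then `|N| else - `|N| ].
Proof.
rewrite /jx /kx /lev /pos; case: x => [[[l m] M]] /= /and4P[hM].
rewrite (_ : `|M| = `|N|); last by case/orP: hM => /eqP ->; rewrite ?normrN.
move=> /truncnK-> /truncnK-> /truncnK->; split => //.
case/orP: hM => /eqP ->.
  by case: (ltrgt0P N) (N_neq0) => [||->]; rewrite ?eqxx ?opprK.
by rewrite oppr_gt0; case: (ltrgt0P N) (N_neq0) => [||->]; rewrite ?eqxx.
Qed.

Lemma nuE : nu%:R = 2 * `|N| :> rat.
Proof.
rewrite /nu truncnK// -[X in X * _]ger0_norm// -normrM.
by rewrite natr_norm_int.
Qed.

Lemma nu_gt0 : (0 < nu)%N.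
Proof. by rewrite -(ltr0n rat) nuE mulr_gt0// normr_gt0. Qed.

(** Both sides are 2 l. *)
Lemma jk_lev x : (jx x + kx x = (lev x).*2 + nu)%N.
Proof.
have [h1 h2 h3 _] := ketP x; apply/eqP.
rewrite -(eqr_nat rat) !natrD -h1 -h2 nuE -muln2 natrM -h3; apply/eqP; ring.
Qed.

Lemma is_ketE l m (b : bool) : is_ket N (l, m, if b then `|N| else - `|N|) =
  [&& l - `|N| \is a Num.nat, l + m \is a Num.nat & l - m \is a Num.nat].
Proof.
rewrite /is_ket (_ : _ || _ = true); last first.
  by case: b; case: (ler0P N) => _; rewrite ?opprK eqxx ?orbT.
by case: b; rewrite ?normrN normr_id.
Qed.

Lemma val_ketE x : val x = ((val x).1.1, (val x).1.2, if pos x then `|N| else - `|N|).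
Proof. by have [_ _ _ <-] := ketP x; case: (val x) => [[? ?] ?]. Qed.

Lemma nat_int_ge0 (a : nat) (r : int) :
  (a%:R + r%:~R \is a @Num.nat rat) = (0 <= a%:Z + r).
Proof. by rewrite -[a%:R]/(a%:~R) -intrD natrEint intr_int ler0z. Qed.

Lemma shf_is_ket d x : is_ket N (shf d (val x)) =
  [&& 0 <= (lev x)%:Z + d.1.1, 0 <= (jx x)%:Z + (d.1.1 + d.1.2) &
      0 <= (kx x)%:Z + (d.1.1 - d.1.2)].
Proof.
have [h1 h2 h3 h4] := ketP x; case: d => [[r p] b].
have -> : shf (r, p, b) (val x) = ((val x).1.1 + r%:~R, (val x).1.2 + p%:~R,
    if b (+) pos x then `|N| else - `|N|).
  by rewrite /shf h4; congr (_, _, _); case: b; case: pos => //=; rewrite opprK.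
rewrite is_ketE -!nat_int_ge0 intrD intrB -h1 -h2 -h3.
congr [&& _, _ & _]; congr (_ \is a _); rewrite /=; ring.
Qed.

Lemma phi_coords d x y : phi d x = Some y ->
  [/\ (jx y)%:Z = (jx x)%:Z + (d.1.1 + d.1.2), (kx y)%:Z = (kx x)%:Z + (d.1.1 - d.1.2),
      (lev y)%:Z = (lev x)%:Z + d.1.1 & pos y = d.2 (+) pos x].
Proof.
move=> /phiE; have [h1 h2 h3 h4] := ketP x; have [g1 g2 g3 g4] := ketP y.
case: d => [[r p] b] e.
have e1 : (val y).1.1 = (val x).1.1 + r%:~R by rewrite -e.
have e2 : (val y).1.2 = (val x).1.2 + p%:~R by rewrite -e.
have e3 : (val y).2 = if b then - (val x).2 else (val x).2 by rewrite -e.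
rewrite e1 in g1 g2 g3; rewrite e2 in g1 g2; rewrite /=.
have inj (a : int) (c : int) : a%:~R = c%:~R :> rat -> a = c by move/intr_inj.
split.
- by apply: inj; rewrite !intrD -[RHS]/((jx x)%:R + _) -h1 -[LHS]/((jx y)%:R) -g1; ring.
- by apply: inj; rewrite !intrD intrN -[RHS]/((kx x)%:R + _) -h2 -[LHS]/((kx y)%:R) -g2; ring.
- by apply: inj; rewrite !intrD -[RHS]/((lev x)%:R + _) -h3 -[LHS]/((lev y)%:R) -g3; ring.
have N0 : 0 < `|N| by rewrite normr_gt0.
rewrite {1}/pos e3 h4.
by case: (b); case: (pos x) => //=; rewrite ?opprK ?oppr_gt0 ?N0 ?ltNge ?(ltW N0).
Qed.

End KetIndex.

(** * Behaviour of the coefficients for small W *)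

Section LinearApproximation.
Variables (R : realType) (D : set R).
Hypothesis D01 : forall w, D w -> 0 < w <= 1.
Implicit Types (f g : R -> R) (a b : R).

(** This is f w = b + O(w), uniformly on [D]. The set [D] will keep the denominators away from 0, so
    that rational functions can be handled factor by factor. *)
Definition lapp f b := exists2 C : R, 0 <= C & forall w, D w -> `|f w - b| <= C * w.

Lemma lapp_cst a : lapp (fun=> a) a.
Proof. by exists 0 => // w _; rewrite subrr normr0 mul0r. Qed.

Lemma lapp_id : lapp id 0.
Proof.
by exists 1 => // w /D01/andP[w0 _]; rewrite subr0 mul1r ger0_norm// ltW.
Qed.

Lemma lappD f g a b : lapp f a -> lapp g b -> lapp (fun w => f w + g w) (a + b).
Proof.
move=> [C C0 hC] [E E0 hE]; exists (C + E); first exact: addr_ge0.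
move=> w wD; rewrite opprD addrACA mulrDl; apply: (le_trans (ler_normD _ _)).
by apply: lerD; [exact: hC|exact: hE].
Qed.

Lemma lappN f a : lapp f a -> lapp (fun w => - f w) (- a).
Proof. by move=> [C C0 hC]; exists C => // w /hC; rewrite -opprD normrN. Qed.

Lemma lapp_bound f a : lapp f a -> exists2 B : R, 0 <= B & forall w, D w -> `|f w| <= B.
Proof.
move=> [C C0 hC]; exists (C + `|a|); first exact: addr_ge0.
move=> w wD; have /andP[w0 w1] := D01 wD.
rewrite -[f w](subrK a); apply: (le_trans (ler_normD _ _)); rewrite lerD2r.
by apply: (le_trans (hC w wD)); rewrite ler_piMr.
Qed.

Lemma lappM f g a b : lapp f a -> lapp g b -> lapp (fun w => f w * g w) (a * b).
Proof.
move=> hf; have [B B0 hB] := lapp_bound hf.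
move: hf => [C C0 hC] [E E0 hE]; exists (B * E + C * `|b|).
  by rewrite addr_ge0 ?mulr_ge0.
move=> w wD; have /andP[w0 w1] := D01 wD.
have -> : f w * g w - a * b = f w * (g w - b) + (f w - a) * b by ring.
apply: (le_trans (ler_normD _ _)); rewrite !normrM mulrDl; apply: lerD.
  by rewrite -mulrA ler_pM// ?hB// hE.
by rewrite mulrAC ler_wpM2r// hC.
Qed.

Lemma lappX f a n : lapp f a -> lapp (fun w => f w ^+ n) (a ^+ n).
Proof.
move=> h; elim: n => [|n IH]; first exact: lapp_cst.
have := lappM h IH; rewrite -exprS; move=> [C C0 hC]; exists C => // w.
by rewrite exprS; exact: hC.
Qed.

Lemma lappV f (d : R) : 0 < d -> (forall w, D w -> d <= f w) -> lapp f 1 ->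
  lapp (fun w => (f w)^-1) 1.
Proof.
move=> d0 hd [C C0 hC]; exists (C / d); first by rewrite divr_ge0// ltW.
move=> w wD; have fd := hd w wD; have f0 : 0 < f w := lt_le_trans d0 fd.
have -> : (f w)^-1 - 1 = - (f w - 1) / f w by field; rewrite gt_eqF.
rewrite normrM normrN normfV (ger0_norm (ltW f0)) mulrAC.
have /andP[w0 _] := D01 wD.
apply: ler_pM => //; first by rewrite invr_ge0 ltW.
  exact: hC.
by rewrite lef_pV2 ?posrE.
Qed.

Lemma lapp_eq f g a b : (forall w, f w = g w) -> a = b -> lapp f a -> lapp g b.
Proof. by move=> /funext -> ->. Qed.

End LinearApproximation.

Section CoefficientAsymptotics.
Variables (R : realType) (q s P : R).
Hypotheses (q0 : 0 < q) (q1 : q < 1) (P0 : 0 < P).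

Lemma hfun_lapp : lapp [set w | 0 < w <= q] (hfun q s P) (- (1 - s ^+ 2)).
Proof.
have D01 w : [set w | 0 < w <= q] w -> 0 < w <= 1.
  by move=> /= /andP[-> /le_trans]; apply; exact: ltW.
have hid := lapp_id D01; have hc := lapp_cst [set w | 0 < w <= q].
have ql : q ^+ 2 < 1 by rewrite expr_lt1// ltW.
have lb n w : [set w | 0 < w <= q] w -> 1 - q ^+ 2 <= 1 - q ^+ n * w ^+ 2.
  move=> /= /andP[w0 wq]; rewrite lerD2l lerN2.
  apply: (@le_trans _ _ (1 * w ^+ 2)).
    by rewrite ler_wpM2r ?sqr_ge0// exprn_ile1// ltW.
  by rewrite mul1r lerXn2r// nnegrE ltW.
have d0 : 0 < 1 - q ^+ 2 by rewrite subr_gt0.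
have l1 n : lapp [set w | 0 < w <= q] (fun w => 1 - q ^+ n * w ^+ 2) 1.
  apply: lapp_eq (lappD (hc 1) (lappN (lappM D01 (hc (q ^+ n)) (lappX D01 2 hid)))) => //.
  by rewrite expr0n mulr0 subr0.
have inv n := lappV D01 d0 (lb n) (l1 n).
have num : lapp [set w | 0 < w <= q] (fun w => (q ^+ 2 + 1) * w * (P - s ^+ 2 / P) -
    (1 - s ^+ 2) * (1 + q ^+ 2 * w ^+ 2)) (- (1 - s ^+ 2)).
  apply: lapp_eq (lappD (lappM D01 (lappM D01 (hc (q ^+ 2 + 1)) hid) (hc (P - s ^+ 2 / P)))
    (lappN (lappM D01 (hc (1 - s ^+ 2)) (lappD (hc 1) (lappM D01 (hc (q ^+ 2)) (lappX D01 2 hid)))))) => //.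
  by rewrite expr0n !(mulr0, mul0r) addr0 mulr1 add0r.
apply: lapp_eq (lappM D01 num (lappM D01 (inv 0%N) (inv 4%N))) => [w|]; last by rewrite !mulr1.
by rewrite /hfun expr0 mul1r invfM.
Qed.

Lemma gfun_lapp2 : lapp [set w | 0 < w <= q ^+ 2] (gfun q s P) (s ^+ 2).
Proof.
have q20 : 0 < q ^+ 2 by rewrite exprn_gt0.
have q2q : q ^+ 2 <= q by rewrite expr2 ler_piMl// ltW.
have D01 w : [set w | 0 < w <= q ^+ 2] w -> 0 < w <= 1.
  by move=> /= /andP[-> /le_trans]; apply; apply: (le_trans q2q); exact: ltW.
have hid := lapp_id D01; have hc := lapp_cst [set w | 0 < w <= q ^+ 2].
have ql : q ^+ 2 < 1 by rewrite expr_lt1// ltW.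
have d0 : 0 < 1 - q ^+ 2 by rewrite subr_gt0.
have lb (a : R) w : 0 <= a -> a <= (q ^+ 2)^-1 -> [set w | 0 < w <= q ^+ 2] w ->
    1 - q ^+ 2 <= 1 - a * w ^+ 2.
  move=> a0 a1 /= /andP[w0 wq]; rewrite lerD2l lerN2.
  apply: (@le_trans _ _ ((q ^+ 2)^-1 * (q ^+ 2) ^+ 2)).
    by rewrite ler_pM ?sqr_ge0// lerXn2r// nnegrE ltW.
  by rewrite expr2 mulKf// gt_eqF.
have i1 : 1 <= (q ^+ 2)^-1 by rewrite invf_ge1// ltW.
have l1 (a : R) : lapp [set w | 0 < w <= q ^+ 2] (fun w => 1 - a * w ^+ 2) 1.
  apply: lapp_eq (lappD (hc 1) (lappN (lappM D01 (hc a) (lappX D01 2 hid)))) => //.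
  by rewrite expr0n mulr0 subr0.
have inv (a : R) (a0 : 0 <= a) (a1 : a <= (q ^+ 2)^-1) :=
  lappV D01 d0 (fun w => @lb a w a0 a1) (l1 a).
have q2i : q ^+ 2 <= (q ^+ 2)^-1 by apply: le_trans i1; exact: ltW.
have f1 (a : R) : lapp [set w | 0 < w <= q ^+ 2] (fun w => 1 - w * a) 1.
  apply: lapp_eq (lappD (hc 1) (lappN (lappM D01 hid (hc a)))) => //.
  by rewrite mul0r subr0.
have f3 : lapp [set w | 0 < w <= q ^+ 2]
    (fun w => s ^+ 2 * (1 + w ^+ 2) + w * (P + s ^+ 4 / P)) (s ^+ 2).
  apply: lapp_eq (lappD (lappM D01 (hc (s ^+ 2)) (lappD (hc 1) (lappX D01 2 hid)))
    (lappM D01 hid (hc (P + s ^+ 4 / P)))) => //.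
  by rewrite expr0n mul0r !addr0 mulr1.
have F := lappM D01 (lappM D01 (lappM D01 (f1 P) (f1 P^-1)) f3)
  (lappM D01 (lappM D01 (lappX D01 2 (inv 1 ler01 i1)) (inv (q ^+ 2)^-1 (ltW (_ : 0 < _)) (lexx _)))
     (inv (q ^+ 2) (ltW q20) q2i)).
apply: lapp_eq (F _) => [w||]; last by rewrite invr_gt0.
  by rewrite /gfun mul1r [w ^+ 2 / q ^+ 2]mulrC exprVn -!invfM.
by rewrite !(mul1r, expr1n, mulr1).
Qed.

(** W is a power of q. The point W = q, where the denominator vanishes, is isolated, and the value
    there is absorbed into the constant. *)
Lemma gfun_approx : exists2 C : R, 0 <= C &
  forall w, 0 < w -> w = q \/ w <= q ^+ 2 -> `|gfun q s P w - s ^+ 2| <= C * w.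
Proof.
have [C C0 hC] := gfun_lapp2.
exists (C + `|gfun q s P q - s ^+ 2| / q).
  by rewrite addr_ge0// divr_ge0// ltW.
move=> w w0 [->|wq]; rewrite mulrDl.
  by rewrite divfK ?gt_eqF// lerDr mulr_ge0// ltW.
apply: (@le_trans _ _ (C * w)); first by apply: hC; rewrite /= w0.
by rewrite lerDl mulr_ge0 ?divr_ge0 ?(ltW q0) ?(ltW w0).
Qed.

Lemma sqrt_dist (a b : R) : `|Num.sqrt a - Num.sqrt b| <= Num.sqrt `|a - b|.
Proof.
wlog ab : a b / b <= a.
  move=> h; case: (leP b a) => [/h//|/ltW/h].
  by rewrite distrC [in X in _ <= X]distrC.
rewrite !ger0_norm ?subr_ge0 ?ler_wsqrtr//.
have [b0|b0] := leP 0 b; last first.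
  rewrite (ler0_sqrtr (ltW b0)) subr0 ler_wsqrtr// lerDl oppr_ge0 ltW//.
rewrite lerBlDr -(@ler_pXn2r _ 2) ?nnegrE ?addr_ge0 ?sqrtr_ge0//.
rewrite sqrrD !sqr_sqrtr ?subr_ge0//; last exact: le_trans ab.
rewrite addrAC subrK lerDl mulrn_wge0// mulr_ge0 ?sqrtr_ge0//.
Qed.

(** For s = 0 the limit of [gfun] is 0, where the root is merely Hölder continuous of exponent 1/2.
    This is the origin of the rate sqrt q of the symbols. *)
Lemma gam_approx : exists2 C : R, 0 <= C &
  forall w, 0 < w -> w = q \/ w <= q ^+ 2 ->
    `|gam q s P w - Num.sqrt (s ^+ 2)| <= C * Num.sqrt w.
Proof.
have [C C0 hC] := gfun_approx; exists (Num.sqrt C); first exact: sqrtr_ge0.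
move=> w w0 hw; apply: (le_trans (sqrt_dist _ _)); rewrite -sqrtrM//.
by rewrite ler_wsqrtr// hC.
Qed.

Lemma cs_approx (x : R) : 0 <= x -> `|cs x - 1| <= x.
Proof.
move=> x0; have := sqrt_dist (1 - x ^+ 2) 1.
have -> : `|1 - x ^+ 2 - 1| = x ^+ 2.
  by rewrite addrAC subrr sub0r normrN ger0_norm ?sqr_ge0.
by rewrite sqrtr1 sqrtr_sqr (ger0_norm x0).
Qed.

End CoefficientAsymptotics.

(** * Symbols *)

Section Symbols.
Variables (R : realType) (N : rat).
Hypotheses (N_half_int : 2 * N \is a Num.int) (N_neq0 : N != 0).
Local Notation I := (ket_index N).
Implicit Types (x y : I) (c : I -> R[i]) (r : R).

(* c converges exponentially fast, as l - m or l + m goes to infinity with the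
   other one fixed. *)
Definition sym r c := exists C : R, [/\ 0 <= C, forall x, nm (c x) <= C,
  forall x y, pos x = pos y -> jx x = jx y ->
    nm (c x - c y) <= C * (r ^+ kx x + r ^+ kx y) &
  forall x y, pos x = pos y -> kx x = kx y ->
    nm (c x - c y) <= C * (r ^+ jx x + r ^+ jx y)].

(** Compares M with -M. The decay is in j + k = 2 l, so that it can compensate the eigenvalue of
    |D|. *)
Definition flip_close r c := exists2 C : R, 0 <= C &
  forall x y, phi (0, 0, true) x = Some y -> nm (c y - c x) <= C * r ^+ (jx x + kx x).

Definition symA r c := sym r c /\ flip_close r c.

Lemma sym_bdd r c : sym r c -> bdd c.
Proof. by move=> [C [_ h _ _]]; exists C. Qed.

Section FixedRate.
Variables (r : R) (r0 : 0 < r) (r1 : r < 1).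

Let rX_ge0 n : 0 <= r ^+ n. Proof. by rewrite exprn_ge0// ltW. Qed.
Let rX_gt0 n : 0 < r ^+ n. Proof. by rewrite exprn_gt0. Qed.
Let rX_le1 n : r ^+ n <= 1. Proof. by rewrite exprn_ile1// ltW. Qed.
Let rX_anti m n : (m <= n)%N -> r ^+ n <= r ^+ m.
Proof. by move=> mn; rewrite ler_wiXn2l// ltW. Qed.

Lemma symD c c' : sym r c -> sym r c' -> sym r (fun x => c x + c' x).
Proof.
move=> [C [C0 h1 h2 h3]] [E [E0 k1 k2 k3]]; exists (C + E); split.
- exact: addr_ge0.
- by move=> x; apply: le_trans (nmD _ _) _; apply: lerD.
- move=> x y p j; rewrite opprD addrACA mulrDl; apply: le_trans (nmD _ _) _.
  by apply: lerD; [exact: h2|exact: k2].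
- move=> x y p j; rewrite opprD addrACA mulrDl; apply: le_trans (nmD _ _) _.
  by apply: lerD; [exact: h3|exact: k3].
Qed.

Lemma nm_mulB (a b a' b' : R[i]) (C E t : R) : nm b <= E -> nm a' <= C ->
  nm (a - a') <= C * t -> nm (b - b') <= E * t -> 0 <= t ->
  nm (a * b - a' * b') <= (2 * (C * E)) * t.
Proof.
move=> hb ha hab hbb t0.
have -> : a * b - a' * b' = (a - a') * b + a' * (b - b') by ring.
apply: (le_trans (nmD _ _)); rewrite !nmM.
have -> : 2 * (C * E) * t = C * t * E + C * (E * t) by ring.
by apply: lerD; rewrite ler_pM ?nm_ge0.
Qed.

Lemma symM c c' : sym r c -> sym r c' -> sym r (fun x => c x * c' x).
Proof.
move=> [C [C0 h1 h2 h3]] [E [E0 k1 k2 k3]]; exists (2 * (C * E)).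
have CE : 0 <= C * E by exact: mulr_ge0.
split; first by rewrite mulr_ge0.
- move=> x; rewrite nmM; apply: (@le_trans _ _ (C * E)); last by lra.
  by rewrite ler_pM ?nm_ge0.
- by move=> x y p j; apply: nm_mulB => //; [exact: h2|exact: k2|exact: addr_ge0].
- by move=> x y p j; apply: nm_mulB => //; [exact: h3|exact: k3|exact: addr_ge0].
Qed.

Lemma flip_closeM c c' : symA r c -> symA r c' -> flip_close r (fun x => c x * c' x).
Proof.
move=> [[C [C0 h1 _ _]] [C' C0' h2]] [[E [E0 k1 _ _]] [E' E0' k2]].
exists (2 * ((C + C') * (E + E'))); first by rewrite !mulr_ge0 ?addr_ge0.
move=> x y xy; apply: nm_mulB => //.
- by apply: le_trans (k1 _) _; rewrite lerDl.
- by apply: le_trans (h1 _) _; rewrite lerDl.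
- by apply: (le_trans (h2 _ _ xy)); rewrite ler_wpM2r// lerDr.
- by apply: (le_trans (k2 _ _ xy)); rewrite ler_wpM2r// lerDr.
Qed.

Lemma symA_M c c' : symA r c -> symA r c' -> symA r (fun x => c x * c' x).
Proof.
by move=> h k; split; [apply: symM; [case: h|case: k]|exact: flip_closeM].
Qed.

(** The limit [b] is the same for both signs of M, which gives closeness under the flip; the bounds
    in each coordinate follow by dropping the other exponent. *)
Lemma symA_near_cst c (b : R[i]) (C : R) : 0 <= C ->
  (forall x, nm (c x - b) <= C * r ^+ (jx x + kx x)) -> symA r c.
Proof.
move=> C0 h.
have h' x y (t : R) : nm (c x - c y) <=
    C * r ^+ (jx x + kx x) + C * r ^+ (jx y + kx y).
  apply: le_trans (nm_triangle _ _ b) _; rewrite (nm_distC b).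
  by apply: lerD; exact: h.
split.
  exists (C + nm b); split.
  - by rewrite addr_ge0 ?nm_ge0.
  - move=> x; rewrite -[c x](subrK b); apply: (le_trans (nmD _ _)).
    by rewrite lerD2r; apply: le_trans (h x) _; rewrite ler_piMr.
  - move=> x y p j; apply: (le_trans (h' x y 0)); rewrite -mulrDr.
    apply: ler_pM => //; rewrite ?addr_ge0 ?lerDl ?nm_ge0//.
    by apply: lerD; apply: rX_anti; exact: leq_addl.
  - move=> x y p j; apply: (le_trans (h' x y 0)); rewrite -mulrDr.
    apply: ler_pM => //; rewrite ?addr_ge0 ?lerDl ?nm_ge0//.
    by apply: lerD; apply: rX_anti; exact: leq_addr.
exists (2 * C); first exact: mulr_ge0.
move=> x y /(phi_coords N_neq0)[/= ej ek _ _].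
have {}ej : jx y = jx x by move: ej; lia.
have {}ek : kx y = kx x by move: ek; lia.
by apply: le_trans (h' y x 0) _; rewrite ej ek -mulrA mulr_natl mulr2n.
Qed.

Lemma symA_cst b : symA r (fun=> b).
Proof. by apply: (@symA_near_cst _ b 0) => // x; rewrite subrr nm0 mul0r. Qed.

Lemma symA_j (f : nat -> R) (b C : R) : (forall n, `|f n - b| <= C * r ^+ n) ->
  symA r (fun x => (f (jx x))%:C).
Proof.
move=> h.
have C0 : 0 <= C by have := le_trans (normr_ge0 _) (h 0%N); rewrite expr0 mulr1.
split.
  exists (C + `|b|); split.
  - exact: addr_ge0.
  - move=> x; rewrite nm_real -[f _](subrK b); apply: (le_trans (ler_normD _ _)).
    by rewrite lerD2r; apply: le_trans (h _) _; rewrite ler_piMr.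
  - by move=> x y _ ->; rewrite subrr nm0 mulr_ge0 ?addr_ge0.
  - move=> x y _ _; rewrite realCB nm_real.
    have -> : f (jx x) - f (jx y) = (f (jx x) - b) - (f (jx y) - b) by ring.
    apply: (le_trans (ler_normB _ _)); apply: (le_trans (lerD (h _) (h _))).
    by rewrite -mulrDr ler_wpM2r ?addr_ge0// lerDl.
exists 0 => // x y /(phi_coords N_neq0)[/= ej _ _ _].
have -> : jx y = jx x by move: ej; lia.
by rewrite subrr nm0 mul0r.
Qed.

Lemma symA_k (f : nat -> R) (b C : R) : (forall n, `|f n - b| <= C * r ^+ n) ->
  symA r (fun x => (f (kx x))%:C).
Proof.
move=> h.
have C0 : 0 <= C by have := le_trans (normr_ge0 _) (h 0%N); rewrite expr0 mulr1.
split.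
  exists (C + `|b|); split.
  - exact: addr_ge0.
  - move=> x; rewrite nm_real -[f _](subrK b); apply: (le_trans (ler_normD _ _)).
    by rewrite lerD2r; apply: le_trans (h _) _; rewrite ler_piMr.
  - move=> x y _ _; rewrite realCB nm_real.
    have -> : f (kx x) - f (kx y) = (f (kx x) - b) - (f (kx y) - b) by ring.
    apply: (le_trans (ler_normB _ _)); apply: (le_trans (lerD (h _) (h _))).
    by rewrite -mulrDr ler_wpM2r ?addr_ge0// lerDl.
  - by move=> x y _ ->; rewrite subrr nm0 mulr_ge0 ?addr_ge0.
exists 0 => // x y /(phi_coords N_neq0)[/= _ ek _ _].
have -> : kx y = kx x by move: ek; lia.
by rewrite subrr nm0 mul0r.
Qed.

Lemma symA_D c c' : symA r c -> symA r c' -> symA r (fun x => c x + c' x).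
Proof.
move=> [h [C C0 k]] [h' [C' C0' k']]; split; first exact: symD.
exists (C + C'); first exact: addr_ge0.
move=> x y xy; rewrite opprD addrACA mulrDl; apply: le_trans (nmD _ _) _.
by apply: lerD; [exact: k|exact: k'].
Qed.

Lemma sym_conj c : sym r c -> sym r (fun x => (c x)^*%R).
Proof.
move=> [C [C0 h1 h2 h3]]; exists C; split => // x.
- by rewrite nm_conj.
- by move=> y p j; rewrite -rmorphB nm_conj; exact: h2.
- by move=> y p j; rewrite -rmorphB nm_conj; exact: h3.
Qed.

Lemma symA_conj c : symA r c -> symA r (fun x => (c x)^*%R).
Proof.
move=> [h [C C0 k]]; split; first exact: sym_conj.
by exists C => // x y /k; rewrite -rmorphB nm_conj.
Qed.

(* Applying a shift d changes the coordinates by at most dsize d, and leaves the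
   index set only where one of the coordinates is at most 2 * dsize d + nu. *)
Definition dsize (d : dvec) : nat := (`|d.1.1| + `|d.1.2|)%N.

Lemma shift_coords d x y : phi d x = Some y ->
  (jx x <= jx y + dsize d)%N /\ (kx x <= kx y + dsize d)%N.
Proof.
case: d => [[a p] b] /(phi_coords N_neq0)[/= ej ek _ _]; rewrite /dsize/=; lia.
Qed.

Lemma shift_out d x y z : phi d x = Some z -> phi d y = None -> jx x = jx y ->
  (kx y <= (dsize d).*2 + nu N)%N.
Proof.
case: d => [[a p] b] xz.
have := phi_coords N_neq0 xz => -[/= ej ek el _] yN jj.
have : ~~ is_ket N (shf (a, p, b) (val y)).
  by move: yN; rewrite /phi; case: insubP.
rewrite shf_is_ket// /dsize/=; have := jk_lev N_half_int N_neq0 y.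
rewrite -!muln2; lia.
Qed.

Lemma shift_out' d x y z : phi d x = Some z -> phi d y = None -> kx x = kx y ->
  (jx y <= (dsize d).*2 + nu N)%N.
Proof.
case: d => [[a p] b] xz.
have := phi_coords N_neq0 xz => -[/= ej ek el _] yN jj.
have : ~~ is_ket N (shf (a, p, b) (val y)).
  by move: yN; rewrite /phi; case: insubP.
rewrite shf_is_ket// /dsize/=; have := jk_lev N_half_int N_neq0 y.
rewrite -!muln2; lia.
Qed.

Let rdiv (C : R) (n m B : nat) : 0 <= C -> (n <= m + B)%N ->
  C * r ^+ m <= C / r ^+ B * r ^+ n.
Proof.
move=> C0 nm; rewrite -mulrA ler_wpM2l// mulrC ler_pdivlMr// -exprD.
exact: rX_anti.
Qed.

Lemma sym_shift d c : sym r c -> sym r (fun x => oapp c 0 (phi d x)).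
Proof.
move=> [C [C0 h1 h2 h3]]; set B := ((dsize d).*2 + nu N)%N.
have CC : C <= C / r ^+ B by rewrite ler_pdivlMr// ler_piMr.
have CB : 0 <= C / r ^+ B by exact: le_trans CC.
have sz : (dsize d <= B)%N by rewrite /B -addnn -addnA leq_addr.
(* When the shift is defined at only one of the two indices, the coordinate that tends to infinity
   is at most [B] at the other one; the jump to 0 costs the factor r^(-B). *)
have far n : (n <= B)%N -> C <= C / r ^+ B * r ^+ n.
  by move=> nB; rewrite -[leLHS]mulr1 -[X in C * X](expr0 r); exact: rdiv.
exists (C / r ^+ B); split => //.
- move=> x; case: (phi d x) => [y|]/=; last by rewrite nm0.
  exact: le_trans (h1 _) _.
- move=> x y p j; case ex : (phi d x) => [x'|]; case ey : (phi d y) => [y'|] /=.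
  + have [_ _ _ px] := phi_coords N_neq0 ex.
    have [_ _ _ py] := phi_coords N_neq0 ey.
    have [jx' _ _ _] := phi_coords N_neq0 ex.
    have [jy' _ _ _] := phi_coords N_neq0 ey.
    have jj : jx x' = jx y' by move: jx' jy'; rewrite j; clear; lia.
    apply: (le_trans (h2 _ _ _ jj)); first by rewrite px py p.
    rewrite !mulrDr; apply: lerD; apply: rdiv => //.
      by apply: leq_trans (shift_coords ex).2 _; rewrite leq_add2l.
    by apply: leq_trans (shift_coords ey).2 _; rewrite leq_add2l.
  + rewrite subr0; apply: (le_trans (h1 _)).
    apply: (le_trans (far _ (shift_out ex ey j))).
    by rewrite ler_wpM2l// lerDr.
  + rewrite sub0r nmN; apply: (le_trans (h1 _)).
    apply: (le_trans (far _ (shift_out ey ex (esym j)))).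
    by rewrite ler_wpM2l// lerDl.
  + by rewrite subr0 nm0 mulr_ge0 ?addr_ge0.
- move=> x y p j; case ex : (phi d x) => [x'|]; case ey : (phi d y) => [y'|] /=.
  + have [_ _ _ px] := phi_coords N_neq0 ex.
    have [_ _ _ py] := phi_coords N_neq0 ey.
    have [_ kx' _ _] := phi_coords N_neq0 ex.
    have [_ ky' _ _] := phi_coords N_neq0 ey.
    have jj : kx x' = kx y' by move: kx' ky'; rewrite j; clear; lia.
    apply: (le_trans (h3 _ _ _ jj)); first by rewrite px py p.
    rewrite !mulrDr; apply: lerD; apply: rdiv => //.
      by apply: leq_trans (shift_coords ex).1 _; rewrite leq_add2l.
    by apply: leq_trans (shift_coords ey).1 _; rewrite leq_add2l.
  + rewrite subr0; apply: (le_trans (h1 _)).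
    apply: (le_trans (far _ (shift_out' ex ey j))).
    by rewrite ler_wpM2l// lerDr.
  + rewrite sub0r nmN; apply: (le_trans (h1 _)).
    apply: (le_trans (far _ (shift_out' ey ex (esym j)))).
    by rewrite ler_wpM2l// lerDl.
  + by rewrite subr0 nm0 mulr_ge0 ?addr_ge0.
Qed.

Lemma symA_shift d c : symA r c -> symA r (fun x => oapp c 0 (phi d x)).
Proof.
move=> [h [C C0 k]]; split; first exact: sym_shift.
exists (C / r ^+ (dsize d).*2); first by rewrite divr_ge0.
move=> x y xy.
(* The flip commutes with the shift and never leaves the index set, so the shift is defined at both
   signs of M or at neither. *)
have E : phi d y = obind (phi (0, 0, true)) (phi d x).
  rewrite (phi_comp _ xy); case ex : (phi d x) => [z|] /=.
    by rewrite (phi_comp _ ex); congr phi; case: d {ex} => [[a p] b]; rewrite /dadd/= !(add0r, addr0) addbT.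
  move: ex; rewrite /phi; case: insubP => // + _.
  rewrite shf_is_ket//; case: insubP => // z + _; rewrite shf_is_ket//.
  by case: d => [[a p] b] /=; rewrite !add0r => ->.
rewrite E; case ex : (phi d x) => [z|] /=; last by rewrite subrr nm0 mulr_ge0 ?divr_ge0.
case ez : (phi (0, 0, true) z) => [w|] /=; last first.
  exfalso; move: ez; rewrite /phi; case: insubP => // + _; rewrite shf_is_ket//=.
apply: (le_trans (k _ _ ez)); apply: rdiv => //.
have [] := shift_coords ex; lia.
Qed.

End FixedRate.

Lemma sym_mono r r' c : 0 < r -> r <= r' -> sym r c -> sym r' c.
Proof.
move=> r0 rr [C [C0 h1 h2 h3]]; exists C; split => // x y p j.
  apply: (le_trans (h2 _ _ p j)); rewrite ler_wpM2l//.
  by apply: lerD; rewrite lerXn2r// nnegrE ltW// (lt_le_trans r0).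
apply: (le_trans (h3 _ _ p j)); rewrite ler_wpM2l//.
by apply: lerD; rewrite lerXn2r// nnegrE ltW// (lt_le_trans r0).
Qed.

End Symbols.

(** * From q-numbers to J, K, P and W *)

Section Link.
Variables (R : realType) (q s : R).
Hypotheses (q0 : 0 < q) (q1 : q < 1).
Implicit Types (x y z l m M : R).
Local Notation kap := (q^-1 - q).
Local Notation "[ x ]" := (qnum q x) : ring_scope.
Local Notation p := (q ^+ 2 + 1).

Let qn : q != 0. Proof. by rewrite gt_eqF. Qed.

Lemma kap_gt0 : 0 < kap.
Proof. by rewrite subr_gt0 (lt_trans q1)// invf_gt1. Qed.

Let kn : kap != 0. Proof. by rewrite gt_eqF// kap_gt0. Qed.

Lemma qpowD x y : q `^ (x + y) = q `^ x * q `^ y.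
Proof. by rewrite powRD// qn implybT. Qed.

Lemma qpowN x : q `^ (- x) = (q `^ x)^-1.
Proof. exact: powRN. Qed.

Lemma qpow1 : q `^ 1 = q.
Proof. by rewrite powRr1// ltW. Qed.

Lemma qpow2 : q `^ 2 = q ^+ 2.
Proof. by rewrite powR_mulrn// ltW. Qed.

Lemma qpow_gt0 x : 0 < q `^ x.
Proof. exact: powR_gt0. Qed.

Lemma qpow_neq0 x : q `^ x != 0.
Proof. by rewrite gt_eqF// qpow_gt0. Qed.

Lemma qpow_le1 x : 0 <= x -> q `^ x <= 1.
Proof. by move=> x0; rewrite -(powRr0 q) ger_powR// (ltW q1) q0. Qed.

Lemma qpow_lt1 x : 0 < x -> q `^ x < 1.
Proof.
by move=> x0; rewrite /powR gt_eqF// expR_lt1 pmulr_rlt0// ln_lt0// q0 q1.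
Qed.

Lemma qnumE x : [x] = (1 - (q `^ x) ^+ 2) / (q `^ x * kap).
Proof.
rewrite /qnum qpowN.
have k2 : q - q^-1 != 0 by rewrite -opprB oppr_eq0.
have := qpow_neq0 x; move: (q `^ x) => t t0.
have k3 : 1 - q ^+ 2 != 0.
  by rewrite (_ : _ - _ = q * kap) ?mulf_neq0//; field.
have k4 : q ^+ 2 - 1 != 0 by rewrite -opprB oppr_eq0.
by field; side_conditions.
Qed.

Lemma qnum_ge0 x : 0 <= x -> 0 <= [x].
Proof.
move=> x0; rewrite qnumE divr_ge0//.
  by rewrite subr_ge0 expr_le1// ?qpow_le1// ltW// qpow_gt0.
by rewrite mulr_ge0 ?ltW ?qpow_gt0 ?kap_gt0.
Qed.

Lemma qnum2 : q * [2] = p.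
Proof.
rewrite qnumE qpow2.
have k3 : 1 - q ^+ 2 != 0.
  by rewrite (_ : _ - _ = q * kap) ?mulf_neq0//; field.
by field; side_conditions.
Qed.

(** The root of q^(x+y) is supplied as [z], so that each use can write it with J, K, q^l and the
    root of q. *)
Lemma sqrt_qnum2 x y z : 0 <= x -> 0 < z -> z ^+ 2 = q `^ x * q `^ y ->
  Num.sqrt ([x] * [y]) = cs (q `^ x) * cs (q `^ y) / (z * kap).
Proof.
move=> x0 z0 zE; rewrite !qnumE.
have -> : (1 - (q `^ x) ^+ 2) / (q `^ x * kap) * ((1 - (q `^ y) ^+ 2) / (q `^ y * kap))
   = (1 - (q `^ x) ^+ 2) * ((1 - (q `^ y) ^+ 2) * ((z * kap)^-1) ^+ 2).
  rewrite exprVn [(z * _) ^+ 2]exprMn zE.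
  have := qpow_neq0 x; have := qpow_neq0 y.
  move: kap kn (q `^ x) (q `^ y) => k k0 a b b0 a0; field.
  by side_conditions.
rewrite sqrtrM; last first.
  by rewrite subr_ge0 expr_le1// ?qpow_le1// ltW// qpow_gt0.
rewrite [_ * (_^-1 ^+ 2)]mulrC (sqrtrM _ (sqr_ge0 _)) sqrtr_sqr ger0_norm.
  by rewrite [_^-1 * _]mulrC mulrA.
by rewrite invr_ge0 mulr_ge0 ?ltW ?kap_gt0.
Qed.

Lemma sqrt_qnum3 a x y z : 0 <= a -> 0 <= x -> 0 < z -> z ^+ 2 = q `^ x * q `^ y ->
  Num.sqrt (a * [x] * [y]) = Num.sqrt a * (cs (q `^ x) * cs (q `^ y) / (z * kap)).
Proof. by move=> a0 x0 z0 zE; rewrite -mulrA sqrtrM// (sqrt_qnum2 x0 z0 zE). Qed.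

Lemma betaE M l : 2^-1 <= l ->
  beta q s M l = - kap * q `^ (2 * l) * hfun q s (q `^ (2 * M)) (q `^ (2 * l)).
Proof.
move=> l2; rewrite /beta !qnumE /hfun.
have -> : q `^ (l + M + 1) = q `^ l * q `^ M * q by rewrite !qpowD qpow1.
have -> : q `^ (l - M) = q `^ l / q `^ M by rewrite qpowD qpowN.
have -> : q `^ (2 * l + 2) = q `^ l ^+ 2 * q ^+ 2.
  by rewrite qpowD qpow2 mulr_natl mulr2n qpowD.
have E x : q `^ (2 * x) = q `^ x ^+ 2 by rewrite mulr_natl mulr2n qpowD.
rewrite !E qpow2.
have a1 : q `^ l < 1 by rewrite qpow_lt1//; lra.
have := qpow_gt0 l; have := qpow_gt0 M; move: (q `^ l) (q `^ M) a1 => a c a1 c0 a0.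
have n1 : 1 - (a ^+ 2) ^+ 2 != 0.
  by rewrite subr_eq0 eq_sym lt_eqF// -exprM expr_lt1// ltW.
have n2 : 1 - q ^+ 4 * (a ^+ 2) ^+ 2 != 0.
  have -> : q ^+ 4 * (a ^+ 2) ^+ 2 = (q * a) ^+ 4 by ring.
  rewrite subr_eq0 eq_sym lt_eqF// expr_lt1//; last by rewrite mulr_ge0 ?ltW.
  by rewrite mulr_ilt1 ?ltW.
have k3 : 1 - q ^+ 2 != 0.
  by rewrite (_ : _ - _ = q * kap) ?mulf_neq0//; field.
have an : a != 0 by rewrite gt_eqF.
have cn : c != 0 by rewrite gt_eqF.
field.
by side_conditions.
Qed.

Lemma alphaE M l : 2^-1 <= l -> `|M| <= l ->
  alpha q s M l = kap * Num.sqrt [2] * q `^ (2 * l) *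
    gam q s (q `^ (2 * M)) (q `^ (2 * l)).
Proof.
move=> l2 Ml; rewrite /alpha.
have [Ml1 Ml2] : 0 <= l + M /\ 0 <= l - M.
  by move: Ml; rewrite ler_norml => /andP[? ?]; lra.
have q20 : 0 <= [2] by rewrite qnum_ge0.
have E x : q `^ (2 * x) = q `^ x ^+ 2 by rewrite mulr_natl mulr2n qpowD.
have l20 : 0 <= [2 * l] by rewrite qnum_ge0//; lra.
set Y := [2] * _ * _ / _; set Z := (q `^ (l + M) + _) * _.
have Y0 : 0 <= Y.
  have h1 : 0 <= [2 * l - 1] by apply: qnum_ge0; lra.
  have h2 : 0 <= [2 * l + 1] by apply: qnum_ge0; lra.
  apply: divr_ge0; last exact: mulr_ge0.
  by apply: mulr_ge0; [exact: mulr_ge0 q20 (qnum_ge0 Ml1)|exact: qnum_ge0].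
have e1 : [2 * l]^-1 = Num.sqrt ([2 * l]^-1 ^+ 2).
  by rewrite sqrtr_sqr ger0_norm ?invr_ge0.
have e2 : kap = Num.sqrt (kap ^+ 2) by rewrite sqrtr_sqr ger0_norm// ltW// kap_gt0.
have e3 : q `^ (2 * l) = Num.sqrt ((q `^ (2 * l)) ^+ 2).
  by rewrite sqrtr_sqr ger0_norm// ltW// qpow_gt0.
transitivity (Num.sqrt ([2 * l]^-1 ^+ 2 * Y * Z)).
  rewrite [RHS]sqrtrM; last by rewrite mulr_ge0 ?sqr_ge0.
  by rewrite [in RHS](sqrtrM Y) ?sqr_ge0// -e1.
transitivity (Num.sqrt (kap ^+ 2 * [2] * (q `^ (2 * l)) ^+ 2 *
    gfun q s (q `^ (2 * M)) (q `^ (2 * l)))); last first.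
  have h1 : 0 <= kap ^+ 2 * [2] by rewrite mulr_ge0 ?sqr_ge0.
  rewrite sqrtrM; last by rewrite mulr_ge0 ?sqr_ge0.
  by rewrite (sqrtrM _ h1) (sqrtrM _ (sqr_ge0 _)) -e2 -e3.
congr Num.sqrt.
rewrite /Y /Z /gfun !qnumE.
have -> : q `^ (2 * l - 1) = q `^ l ^+ 2 / q by rewrite qpowD E qpowN qpow1.
have -> : q `^ (2 * l + 1) = q `^ l ^+ 2 * q by rewrite qpowD E qpow1.
have -> : q `^ (- (l - M)) = q `^ M / q `^ l by rewrite opprB qpowD qpowN.
have -> : q `^ (- (l + M)) = (q `^ l * q `^ M)^-1 by rewrite qpowN qpowD.
have -> : q `^ (l - M) = q `^ l / q `^ M by rewrite qpowD qpowN.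
have -> : q `^ (l + M) = q `^ l * q `^ M by rewrite qpowD.
rewrite !E qpow2.
have a1 : q `^ l ^+ 2 <= q.
  by rewrite -E -[leRHS]qpow1 ger_powR ?q0 ?(ltW q1)//; lra.
have := qpow_gt0 l; have := qpow_gt0 M; move: (q `^ l) (q `^ M) a1 => a c a1 c0 a0.
have a20 : 0 < a ^+ 2 by rewrite exprn_gt0.
(* The case l = 1/2: [2l - 1] = 0 on one side, the denominator of [gfun] is 0 on the other, and both
   quotients are 0. *)
have [e|a1'] := eqVneq (a ^+ 2) q.
  rewrite e divff// divff ?expf_neq0// expr1n subrr.
  by rewrite !(mul0r, mulr0, invr0).
have {}a1 : a ^+ 2 < q by rewrite lt_neqAle a1'.
have a21 := lt_trans a1 q1.
have n1 : 1 - (a ^+ 2) ^+ 2 != 0.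
  by rewrite subr_eq0 eq_sym lt_eqF// expr_lt1// ltW.
have n2 : 1 - q ^+ 2 * (a ^+ 2) ^+ 2 != 0.
  rewrite -exprMn subr_eq0 eq_sym lt_eqF// expr_lt1//; last by rewrite mulr_ge0 ?ltW.
  by rewrite mulr_ilt1 ?ltW.
have n3 : q ^+ 2 - (a ^+ 2) ^+ 2 != 0.
  by rewrite gt_eqF// subr_gt0 ltrXn2r// ltW.
have k3 : 1 - q ^+ 2 != 0.
  by rewrite (_ : _ - _ = q * kap) ?mulf_neq0//; field.
have an : a != 0 by rewrite gt_eqF.
have cn : c != 0 by rewrite gt_eqF.
field.
by side_conditions.
Qed.

Variables (M l m : R).
Hypotheses (l2 : 2^-1 <= l) (Ml : `|M| <= l) (jm : 0 <= l + m) (km : 0 <= l - m).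
Local Notation J := (q `^ (l + m)).
Local Notation K := (q `^ (l - m)).
Local Notation P := (q `^ (2 * M)).

Let JKE : q `^ (2 * l) = J * K.
Proof. by rewrite -qpowD; congr (_ `^ _); ring. Qed.

Let JKa : q `^ l ^+ 2 = J * K.
Proof. by rewrite -JKE mulr_natl mulr2n qpowD. Qed.

Let JKE1 : q `^ (2 * (l + 1)) = q ^+ 2 * (J * K).
Proof.
have -> : 2 * (l + 1) = 2 + 2 * l by ring.
by rewrite (qpowD 2 (2 * l)) JKE qpow2.
Qed.

Let alpha1 : alpha q s M (l + 1) = kap * Num.sqrt [2] * (q ^+ 2 * (J * K)) *
  gam q s P (q ^+ 2 * (J * K)).
Proof.
rewrite alphaE ?JKE1//; first by move: l2; lra.
by apply: le_trans Ml _; rewrite lerDl.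
Qed.

Let alpha0 : alpha q s M l = kap * Num.sqrt [2] * (J * K) * gam q s P (J * K).
Proof. by rewrite alphaE ?JKE. Qed.

Let sq2 : Num.sqrt [2] ^+ 2 = [2].
Proof. by rewrite sqr_sqrtr// qnum_ge0. Qed.

Let q2p : [2] = p / q.
Proof. by rewrite -qnum2 mulrC mulKf. Qed.

Let k3 : 1 - q ^+ 2 != 0.
Proof. by rewrite (_ : _ - _ = q * kap) ?mulf_neq0//; field. Qed.

Let Jn : J != 0. Proof. exact: qpow_neq0. Qed.
Let Kn : K != 0. Proof. exact: qpow_neq0. Qed.
Let an : q `^ l != 0. Proof. exact: qpow_neq0. Qed.

Let qm : q `^ m = J / q `^ l.
Proof. by rewrite qpowD mulrC mulKf. Qed.

Lemma up0_link :
  q `^ m * Num.sqrt ([2] * [l - m + 1] * [l + m + 1]) * alpha q s M (l + 1) =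
  - p * coefAp q s P J K.
Proof.
have E1 : q `^ (l - m + 1) = q * K by rewrite qpowD qpow1 mulrC.
have E2 : q `^ (l + m + 1) = q * J by rewrite qpowD qpow1 mulrC.
rewrite (@sqrt_qnum3 [2] (l - m + 1) (l + m + 1) (q * q `^ l)); first last.
- by rewrite E1 E2 exprMn JKa; ring.
- by rewrite mulr_gt0// qpow_gt0.
- by rewrite addr_ge0.
- exact: qnum_ge0.
rewrite E1 E2 alpha1 qm /coefAp.
transitivity (q * Num.sqrt [2] ^+ 2 * J ^+ 2 * K / q `^ l ^+ 2 * cs (q * K) * cs (q * J) *
  gam q s P (q ^+ 2 * (J * K))).
  by field; side_conditions.
by rewrite sq2 q2p JKa; field; side_conditions.
Qed.

Lemma dn0_link :
  q `^ m * Num.sqrt ([2] * [l - m] * [l + m]) * alpha q s M l =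
  - p * coefAm q s P J K.
Proof.
rewrite (@sqrt_qnum3 [2] (l - m) (l + m) (q `^ l)); first last.
- by rewrite JKa mulrC.
- exact: qpow_gt0.
- by [].
- exact: qnum_ge0.
rewrite alpha0 qm /coefAm.
transitivity (Num.sqrt [2] ^+ 2 * J ^+ 2 * K / q `^ l ^+ 2 * cs K * cs J *
  gam q s P (J * K)).
  by field; side_conditions.
by rewrite sq2 q2p JKa; field; side_conditions.
Qed.

Lemma md0_link :
  ([2 * l] - q `^ (l + m + 1) * [2] * [l - m]) * beta q s M l =
  1 - s ^+ 2 - p * coefAz q s P J K.
Proof.
rewrite betaE// JKE q2p /coefAz /diagA [q `^ (l + m + 1)]qpowD qpow1 !qnumE JKE.
have pn : p != 0 by exact: p_neq0.
by field; side_conditions.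
Qed.

Let sp0 : Num.sqrt p = Num.sqrt [2] * Num.sqrt q.
Proof. by rewrite -sqrtrM ?qnum_ge0// [[2] * q]mulrC qnum2. Qed.

Let sq : Num.sqrt q ^+ 2 = q.
Proof. by rewrite sqr_sqrtr// ltW. Qed.

Let sqn : Num.sqrt q != 0.
Proof. by rewrite gt_eqF// sqrtr_gt0. Qed.

(** The given formula attaches the coefficients of x_1 to the source ket, a weighted shift attaches
    them to the target. Transposition turns the ones of B into those of B^*, hence [coefT]; for x_0
    nothing changes, since A is symmetric. *)
Lemma up1_link :
  q `^ (- l + m) * Num.sqrt ([l + m + 1] * [l + m + 2]) * alpha q s M (l + 1) =
  Num.sqrt p * coefTp q s P J K.
Proof.
have E1 : q `^ (l + m + 1) = q * J by rewrite qpowD qpow1 mulrC.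
have E2 : q `^ (l + m + 2) = q ^+ 2 * J by rewrite qpowD qpow2 mulrC.
have E3 : q `^ (- l + m) = K^-1 by rewrite -qpowN opprB addrC.
rewrite (@sqrt_qnum2 (l + m + 1) (l + m + 2) (J * (q * Num.sqrt q))); first last.
- by rewrite E1 E2 !exprMn sq; ring.
- by rewrite !mulr_gt0 ?qpow_gt0 ?sqrtr_gt0.
- by rewrite addr_ge0.
rewrite E1 E2 E3 alpha1 sp0 /coefTp.
transitivity (q / Num.sqrt q * Num.sqrt [2] * cs (q * J) * cs (q ^+ 2 * J) *
  gam q s P (q ^+ 2 * (J * K))).
  by field; side_conditions.
by rewrite -[X in X / _]sq; field; side_conditions.
Qed.

Lemma md1_link :
  - (q `^ (m + 2) * Num.sqrt ([2] * [l - m] * [l + m + 1]) * beta q s M l) =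
  Num.sqrt p * coefTz q s P J K.
Proof.
have E2 : q `^ (l + m + 1) = q * J by rewrite qpowD qpow1 mulrC.
rewrite (@sqrt_qnum3 [2] (l - m) (l + m + 1) (q `^ l * Num.sqrt q)); first last.
- by rewrite E2 exprMn sq JKa; ring.
- by rewrite mulr_gt0 ?qpow_gt0 ?sqrtr_gt0.
- by [].
- exact: qnum_ge0.
rewrite E2 betaE// JKE qpowD qpow2 qm sp0 /coefTz.
transitivity (q ^+ 2 * J ^+ 2 * K / q `^ l ^+ 2 / Num.sqrt q * Num.sqrt [2] * cs K * cs (q * J) *
  hfun q s P (J * K)).
  by field; side_conditions.
rewrite JKa -[q ^+ 2](_ : q * Num.sqrt q ^+ 2 = _); last by rewrite sq.
by field; side_conditions.
Qed.

Lemma dn1_link :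
  - (q `^ (l + m + 1) * Num.sqrt ([l - m] * [l - m - 1]) * alpha q s M l) =
  Num.sqrt p * coefTm q s P J K.
Proof.
have E1 : q `^ (l - m - 1) = K / q by rewrite qpowD qpowN qpow1.
rewrite (@sqrt_qnum2 (l - m) (l - m - 1) (K / Num.sqrt q)); first last.
- by rewrite E1 exprMn exprVn sq; ring.
- by rewrite divr_gt0 ?qpow_gt0 ?sqrtr_gt0.
- by [].
rewrite E1 alpha0 [q `^ (l + m + 1)]qpowD qpow1 sp0 /coefTm.
by field; side_conditions.
Qed.

End Link.

Section KetCoefficients.
Variables (R : realType) (q s : R) (N : rat).
Hypotheses (q0 : 0 < q) (q1 : q < 1) (N_half_int : 2 * N \is a Num.int) (N_neq0 : N != 0).
Local Notation I := (ket_index N).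
Implicit Types (x y : I).

Definition xJ x : R := q ^+ jx x.
Definition xK x : R := q ^+ kx x.
Definition xP x : R := if pos x then q ^+ nu N else (q ^+ nu N)^-1.

Let qX_gt0 n : 0 < q ^+ n. Proof. by rewrite exprn_gt0. Qed.
Let qX_le n m : (m <= n)%N -> q ^+ n <= q ^+ m.
Proof. by move=> h; rewrite ler_wiXn2l// ltW. Qed.

Lemma xP_gt0 x : 0 < xP x.
Proof. by rewrite /xP; case: pos; rewrite ?invr_gt0. Qed.

Lemma qX_eq1_or n : q ^+ n = 1 \/ q ^+ n <= q.
Proof. by case: n => [|n]; [left|right; rewrite -[leRHS]expr1 qX_le]. Qed.

Lemma ket_kp x : ket_params q (xP x) (xJ x) (xK x).
Proof.
have e := jk_lev N_half_int N_neq0 x; have nu0 := nu_gt0 N_half_int N_neq0.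
have qn : q != 0 by rewrite gt_eqF.
have JK : xJ x * xK x = q ^+ ((lev x).*2 + nu N) by rewrite -e exprD.
have W1 : q ^+ ((lev x).*2 + nu N) * q ^+ nu N <= 1 by rewrite -exprD -[leRHS](expr0 q) qX_le.
have W2 : q ^+ ((lev x).*2 + nu N) / q ^+ nu N <= 1.
  by rewrite exprD mulfK ?expf_neq0// -[leRHS](expr0 q) qX_le.
split => //; rewrite ?JK.
- exact: xP_gt0.
- exact: qX_gt0.
- exact: qX_gt0.
- exact: qX_eq1_or.
- exact: qX_eq1_or.
- by rewrite /xP; case: pos.
- by rewrite /xP; case: pos => //; rewrite invrK.
- by rewrite -[leRHS]expr1 qX_le// addn_gt0 nu0 orbT.
(* Above the lowest level 2 lev + 2|N| >= 3. On it W = q^(2|N|) is P or 1/P, and one of the two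
   factors is 0. *)
- have [l0|l0] := posnP (lev x); last first.
    right; rewrite qX_le//; apply: (@leq_add 2 1) => //.
    by rewrite -[2%N]/(1.*2) leq_double.
  left; rewrite l0 double0 add0n /xP; case: pos.
    by rewrite divff ?expf_neq0// subrr mulr0.
  by rewrite divff ?expf_neq0// subrr mul0r.
Qed.

Lemma phi_None d x : phi d x = None -> ~~ [&& 0 <= (lev x)%:Z + d.1.1,
  0 <= (jx x)%:Z + (d.1.1 + d.1.2) & 0 <= (kx x)%:Z + (d.1.1 - d.1.2)].
Proof. by rewrite -(shf_is_ket N_neq0) /phi; case: insubP => [//|->]. Qed.

Lemma cs1 : cs 1 = 0 :> R. Proof. by rewrite /cs expr1n subrr sqrtr0. Qed.

Lemma gam_lev0 x : lev x = 0%N -> gam q s (xP x) (xJ x * xK x) = 0.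
Proof.
move=> l0; rewrite /gam /gfun /xJ /xK -exprD (jk_lev N_half_int N_neq0) l0 add0n /xP.
have qn : q ^+ nu N != 0 by rewrite expf_neq0// gt_eqF.
by case: pos; rewrite ?divff// subrr !(mul0r, mulr0) sqrtr0.
Qed.

Lemma csJ0 x : jx x = 0%N -> cs (xJ x) = 0.
Proof. by rewrite /xJ => ->; exact: cs1. Qed.
Lemma csK0 x : kx x = 0%N -> cs (xK x) = 0.
Proof. by rewrite /xK => ->; exact: cs1. Qed.
Lemma csJ1 x : jx x = 1%N -> cs (xJ x / q) = 0.
Proof. by rewrite /xJ => ->; rewrite expr1 divff ?cs1// gt_eqF. Qed.
Lemma csK1 x : kx x = 1%N -> cs (xK x / q) = 0.
Proof. by rewrite /xK => ->; rewrite expr1 divff ?cs1// gt_eqF. Qed.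

(** Where the shift leaves the index set, a factor [cs] or [gam] is 0. Hence no intermediate ket is
    lost in a product of two shifts, and [op3_comp] can add the displacements formally. *)
Lemma vanish_Am b x : phi (-1, 0, b) x = None -> coefAm q s (xP x) (xJ x) (xK x) = 0.
Proof.
move=> /phi_None/= h; rewrite /coefAm.
have [l0|l0] := eqVneq (lev x) 0%N; first by rewrite gam_lev0// mulr0.
have [j0|j0] := eqVneq (jx x) 0%N; first by rewrite csJ0// mulr0 mul0r.
have [k0|k0] := eqVneq (kx x) 0%N; first by rewrite csK0// mulr0 !mul0r.
by exfalso; lia.
Qed.

Lemma vanish_Bm b x : phi (-1, -1, b) x = None -> coefBm q s (xP x) (xJ x) (xK x) = 0.
Proof.
move=> /phi_None/= h; rewrite /coefBm.
have [l0|l0] := eqVneq (lev x) 0%N; first by rewrite gam_lev0// mulr0.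
have [j0|j0] := eqVneq (jx x) 0%N; first by rewrite csJ0// !mul0r.
have [j1|j1] := eqVneq (jx x) 1%N; first by rewrite csJ1// mulr0 !mul0r.
by exfalso; lia.
Qed.

Lemma vanish_Bz b x : phi (0, -1, b) x = None -> coefBz q s (xP x) (xJ x) (xK x) = 0.
Proof.
move=> /phi_None/= h; rewrite /coefBz.
have [j0|j0] := eqVneq (jx x) 0%N; first by rewrite csJ0// mulr0 !mul0r.
by exfalso; lia.
Qed.

Lemma vanish_Tm b x : phi (-1, 1, b) x = None -> coefTm q s (xP x) (xJ x) (xK x) = 0.
Proof.
move=> /phi_None/= h; rewrite /coefTm.
have [l0|l0] := eqVneq (lev x) 0%N; first by rewrite gam_lev0// mulr0.
have [k0|k0] := eqVneq (kx x) 0%N; first by rewrite csK0// mulr0 !mul0r.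
have [k1|k1] := eqVneq (kx x) 1%N; first by rewrite csK1// mulr0 !mul0r.
by exfalso; lia.
Qed.

Lemma vanish_Tz b x : phi (0, 1, b) x = None -> coefTz q s (xP x) (xJ x) (xK x) = 0.
Proof.
move=> /phi_None/= h; rewrite /coefTz.
have [k0|k0] := eqVneq (kx x) 0%N; first by rewrite csK0// mulr0 !mul0r.
by exfalso; lia.
Qed.

Lemma phi_plus d x : d.1.1 = 1 -> `|d.1.2|%N = 0%N \/ `|d.1.2|%N = 1%N ->
  phi d x <> None.
Proof. by case: d => [[a p] b] /= -> h /phi_None/=; lia. Qed.

End KetCoefficients.

Section KetSymbols.
Variables (R : realType) (q s : R) (N : rat).
Hypotheses (q0 : 0 < q) (q1 : q < 1) (N_half_int : 2 * N \is a Num.int) (N_neq0 : N != 0).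
Local Notation I := (ket_index N).
Local Notation r := (Num.sqrt q).
Implicit Types (x y : I) (f g : I -> R).
Local Notation xJ := (@xJ R q N).
Local Notation xK := (@xK R q N).
Local Notation xP := (@xP R q N).

Let r0 : 0 < r. Proof. by rewrite sqrtr_gt0. Qed.
Let r1 : r < 1. Proof. by rewrite -sqrtr1 ltr_sqrt. Qed.
Let q_r : q = r ^+ 2. Proof. by rewrite sqr_sqrtr// ltW. Qed.
Let qX_r n : q ^+ n <= r ^+ n.
Proof.
have qr : q <= r by rewrite [leLHS]q_r expr2 ler_piMr// ltW.
by rewrite lerXn2r// nnegrE ltW.
Qed.

Definition rsym f := symA r (fun x => (f x)%:C).

Lemma eq_rsym f g : (forall x, f x = g x) -> rsym f -> rsym g.
Proof. by move=> /funext ->. Qed.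

Lemma rsymM f g : rsym f -> rsym g -> rsym (fun x => f x * g x).
Proof.
move=> hf hg; rewrite /rsym (_ : (fun _ => _) = (fun x => (f x)%:C * (g x)%:C)).
  exact: symA_M.
by apply/funext => x; rewrite realCM.
Qed.

Lemma rsymD f g : rsym f -> rsym g -> rsym (fun x => f x + g x).
Proof.
move=> hf hg; rewrite /rsym (_ : (fun _ => _) = (fun x => (f x)%:C + (g x)%:C)).
  exact: symA_D.
by apply/funext => x; rewrite realCD.
Qed.

Lemma rsym_cst a : rsym (fun=> a).
Proof. exact: (symA_cst N_half_int N_neq0). Qed.

Lemma rsymN f : rsym f -> rsym (fun x => - f x).
Proof.
by move=> hf; apply: (eq_rsym _ (rsymM (rsym_cst (-1)) hf)) => x; rewrite mulN1r.
Qed.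

Lemma rsymB f g : rsym f -> rsym g -> rsym (fun x => f x - g x).
Proof. by move=> hf hg; apply: rsymD => //; exact: rsymN. Qed.

Lemma rsymX f n : rsym f -> rsym (fun x => f x ^+ n).
Proof.
move=> hf; elim: n => [|n IH]; first exact: rsym_cst.
by apply: (eq_rsym _ (rsymM hf IH)) => x; rewrite exprS.
Qed.

Lemma rsym_xJ : rsym xJ.
Proof.
apply: (@symA_j _ _ N_half_int N_neq0 _ r0 r1 (fun n => q ^+ n) 0 1) => n.
by rewrite subr0 mul1r ger0_norm ?exprn_ge0 ?(ltW q0).
Qed.

Lemma rsym_csJ a : 0 <= a -> rsym (fun x => cs (a * xJ x)).
Proof.
move=> a0; apply: (@symA_j _ _ N_half_int N_neq0 _ r0 r1 (fun n => cs (a * q ^+ n)) 1 a) => n.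
apply: le_trans (cs_approx _) _; first by rewrite mulr_ge0 ?exprn_ge0 ?(ltW q0).
by rewrite ler_wpM2l.
Qed.

Lemma rsym_csK a : 0 <= a -> rsym (fun x => cs (a * xK x)).
Proof.
move=> a0; apply: (@symA_k _ _ N_half_int N_neq0 _ r0 r1 (fun n => cs (a * q ^+ n)) 1 a) => n.
apply: le_trans (cs_approx _) _; first by rewrite mulr_ge0 ?exprn_ge0 ?(ltW q0).
by rewrite ler_wpM2l.
Qed.

Lemma rsym_near_cst f (b C : R) : 0 <= C ->
  (forall x, `|f x - b| <= C * r ^+ (jx x + kx x)) -> rsym f.
Proof.
move=> C0 h; apply: (@symA_near_cst _ _ N_half_int N_neq0 _ r0 r1 _ b%:C C) => // x.
by rewrite realCB nm_real.
Qed.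

Lemma xJK x : xJ x * xK x = q ^+ (jx x + kx x).
Proof. by rewrite exprD. Qed.

Lemma jk_gt0 x : (0 < jx x + kx x)%N.
Proof. by rewrite (jk_lev N_half_int) // addn_gt0 (nu_gt0 N_half_int N_neq0) orbT. Qed.

Lemma rsym_W : rsym (fun x => xJ x * xK x).
Proof.
apply: (@rsym_near_cst _ 0 1) => // x; rewrite subr0 mul1r xJK.
by rewrite ger0_norm ?exprn_ge0 ?(ltW q0).
Qed.

Lemma sqrt_qX n : Num.sqrt (q ^+ n) = r ^+ n.
Proof.
rewrite [in LHS]q_r -exprM mulnC exprM sqrtr_sqr ger0_norm// exprn_ge0// ltW//.
Qed.

Lemma rsym_W_fun (F : R -> R -> R) b (P : set R) : (forall x, P (xJ x * xK x)) ->
  (forall p, exists2 C, 0 <= C & forall w, P w -> `|F p w - b| <= C * Num.sqrt w) ->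
  rsym (fun x => F (xP x) (xJ x * xK x)).
Proof.
move=> hP h; have [C C0 hC] := h (q ^+ nu N); have [C' C0' hC'] := h (q ^+ nu N)^-1.
apply: (@rsym_near_cst _ b (C + C')); first exact: addr_ge0.
move=> x; rewrite -sqrt_qX -xJK /xP.
have W0 : 0 <= Num.sqrt (xJ x * xK x) by exact: sqrtr_ge0.
case: pos; [apply: le_trans (hC _ (hP x)) _|apply: le_trans (hC' _ (hP x)) _].
  by rewrite ler_wpM2r// lerDl.
by rewrite ler_wpM2r// lerDr.
Qed.

Lemma W_dom x : 0 < xJ x * xK x /\ (xJ x * xK x = q \/ xJ x * xK x <= q ^+ 2).
Proof.
rewrite xJK; split; first by rewrite exprn_gt0.
case: (jx x + kx x)%N (jk_gt0 x) => [//|[|n]] _; [by left; rewrite expr1|right].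
by rewrite ler_wiXn2l// ltW.
Qed.

Lemma rsym_gam : rsym (fun x => gam q s (xP x) (xJ x * xK x)).
Proof.
apply: (@rsym_W_fun (gam q s) (Num.sqrt (s ^+ 2)) [set w | 0 < w /\ (w = q \/ w <= q ^+ 2)]) => [x|p].
  exact: W_dom.
have [C C0 h] := gam_approx s p q0 q1; exists C => // w [w0 hw]; exact: h.
Qed.

Lemma rsym_gam2 : rsym (fun x => gam q s (xP x) (q ^+ 2 * (xJ x * xK x))).
Proof.
apply: (@rsym_W_fun (fun p w => gam q s p (q ^+ 2 * w)) (Num.sqrt (s ^+ 2)) [set w | 0 < w <= 1]) => [x|p].
  by rewrite /= xJK exprn_gt0//= exprn_ile1 ?ltW.
have [C C0 h] := gam_approx s p q0 q1; exists C => // w /andP[w0 w1].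
have q20 : 0 < q ^+ 2 by rewrite exprn_gt0.
apply: le_trans (h _ _ _) _; first by rewrite mulr_gt0.
  by right; rewrite ler_piMr// ltW.
by rewrite ler_wpM2l// ler_wsqrtr// ler_piMl ?(ltW w0)// exprn_ile1 ?(ltW q0) ?(ltW q1).
Qed.

Lemma rsym_h : rsym (fun x => hfun q s (xP x) (xJ x * xK x)).
Proof.
apply: (@rsym_W_fun (hfun q s) (- (1 - s ^+ 2)) [set w | 0 < w <= q]) => [x|p].
  have [W0 _] := W_dom x; rewrite /= W0 xJK -[leRHS]expr1.
  by rewrite ler_wiXn2l ?jk_gt0// ltW.
have [C C0 h] := hfun_lapp s p q0 q1; exists C => // w /[dup]/h + /andP[w0 w1].
move=> /le_trans; apply; rewrite ler_wpM2l// -{1}[w]sqr_sqrtr ?(ltW w0)// expr2.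
by rewrite ler_piMr ?sqrtr_ge0// -sqrtr1 ler_wsqrtr// (le_trans w1)// (ltW q1).
Qed.

Let q00 : 0 <= q. Proof. exact: ltW. Qed.
Let q200 : 0 <= q ^+ 2. Proof. by rewrite exprn_ge0. Qed.
Let qi00 : 0 <= q^-1. Proof. by rewrite invr_ge0. Qed.
Let csJ_ : rsym (fun x => cs (xJ x)).
Proof. by apply: (eq_rsym _ (@rsym_csJ 1 _)) => // x; rewrite mul1r. Qed.
Let csK_ : rsym (fun x => cs (xK x)).
Proof. by apply: (eq_rsym _ (@rsym_csK 1 _)) => // x; rewrite mul1r. Qed.
Let csJq : rsym (fun x => cs (xJ x / q)).
Proof. by apply: (eq_rsym _ (rsym_csJ qi00)) => // x; rewrite mulrC. Qed.
Let csKq : rsym (fun x => cs (xK x / q)).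
Proof. by apply: (eq_rsym _ (rsym_csK qi00)) => // x; rewrite mulrC. Qed.

Ltac rs := repeat first [exact: csJ_|exact: csK_|exact: csJq|exact: csKq|exact: rsym_h
  |exact: rsym_gam|exact: rsym_gam2|exact: (rsym_csJ q00)|exact: (rsym_csJ q200)
  |exact: (rsym_csK q00)|exact: (rsym_csK q200)|exact: rsym_xJ|exact: rsym_W|exact: rsym_cst
  |apply: rsymB|apply: rsymD|apply: rsymM|apply: rsymX|apply: rsymN].

Definition atx (f : R -> R -> R -> R -> R -> R) x := f q s (xP x) (xJ x) (xK x).

Lemma rsym_Am : rsym (atx (@coefAm R)). Proof. rewrite /atx /coefAm; rs. Qed.
Lemma rsym_Az : rsym (atx (@coefAz R)). Proof. rewrite /atx /coefAz /diagA; rs. Qed.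
Lemma rsym_Ap : rsym (atx (@coefAp R)). Proof. rewrite /atx /coefAp; rs. Qed.
Lemma rsym_Bm : rsym (atx (@coefBm R)). Proof. rewrite /atx /coefBm; rs. Qed.
Lemma rsym_Bz : rsym (atx (@coefBz R)). Proof. rewrite /atx /coefBz; rs. Qed.
Lemma rsym_Bp : rsym (atx (@coefBp R)). Proof. rewrite /atx /coefBp; rs. Qed.
Lemma rsym_Tm : rsym (atx (@coefTm R)). Proof. rewrite /atx /coefTm; rs. Qed.
Lemma rsym_Tz : rsym (atx (@coefTz R)). Proof. rewrite /atx /coefTz; rs. Qed.
Lemma rsym_Tp : rsym (atx (@coefTp R)). Proof. rewrite /atx /coefTp; rs. Qed.

End KetSymbols.

(** * Weighted shifts and the representation *)

Section WeightedShifts.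
Variables (R : realType) (I : choiceType).
Implicit Types (phi psi : I -> option I) (c : I -> R[i]).

Lemma eq_wshift phi c c' : (forall x y, phi x = Some y -> c x = c' x) ->
  wshift phi c = wshift phi c'.
Proof.
move=> h; apply/funext => u; rewrite /wshift; congr mkl2; apply/funext => x.
by case e: (phi x) => [y|] /=; [rewrite (h _ _ e)|rewrite !mulr0].
Qed.

Lemma wshift_delta phi psi c x (a : R[i]) : pinv phi psi -> bdd c ->
  (forall y, psi x = Some y -> c y = a) ->
  wshift phi c (l2_delta R x) = a *: oapp (@l2_delta R _) 0 (psi x).
Proof.
move=> pp bc h; apply: l2_ext => y; rewrite (wshiftE pp)// l2_scaleE.
case e: (psi x) => [z|] /=; last first.
  change (c y * oapp (fun j : I => (j == x)%:R) 0 (phi y) = a * 0).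
  rewrite mulr0; case e': (phi y) => [w|] /=; last by rewrite mulr0.
  case: eqVneq => [wx|]; last by rewrite mulr0.
  by move/pp: e'; rewrite wx e.
case: eqVneq => [->|yz].
  by move/pp: (e) => -> /=; rewrite eqxx (h _ e).
rewrite mulr0; case e': (phi y) => [w|] /=; last by rewrite mulr0.
case: eqVneq => [wx|]; last by rewrite mulr0.
by move/pp: e'; rewrite wx e => -[] /esym/eqP; rewrite (negbTE yz).
Qed.

End WeightedShifts.

(** * The generators as sums of three shifts *)

Section Generators.
Variables (R : realType) (q s : R) (N : rat).
Hypotheses (q0 : 0 < q) (q1 : q < 1) (N_half_int : 2 * N \is a Num.int) (N_neq0 : N != 0).
Local Notation I := (ket_index N).
Local Notation H := (l2 R I).
Local Notation xJ := (@xJ R q N).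
Local Notation xK := (@xK R q N).
Local Notation xP := (@xP R q N).
Local Notation p := (q ^+ 2 + 1).
Implicit Types (x y : I) (u : H) (d : dvec) (f g h : R -> R -> R -> R -> R -> R).

Definition cf f x : R[i] := (atx q s f x)%:C.

Definition op3 (m : int) f g h u : H :=
  wshift (phi (-1, m, false)) (cf f) u + wshift (phi (0, m, false)) (cf g) u +
  wshift (phi (1, m, false)) (cf h) u.

Arguments op3 : simpl never.

Definition opA := op3 0 (@coefAm R) (@coefAz R) (@coefAp R).
(** The displacement is that of the coordinate that is read: B raises m and therefore has -1, its
    adjoint [opT] has 1. *)
Definition opB := op3 (-1) (@coefBm R) (@coefBz R) (@coefBp R).
Definition opT := op3 1 (@coefTm R) (@coefTz R) (@coefTp R).

Let bd f : rsym q (atx (N:=N) q s f) -> bdd (cf f).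
Proof. by case => /sym_bdd. Qed.

Let Am := bd (rsym_Am s q0 q1 N_half_int N_neq0).
Let Az := bd (rsym_Az s q0 q1 N_half_int N_neq0).
Let Ap := bd (rsym_Ap s q0 q1 N_half_int N_neq0).
Let Bm := bd (rsym_Bm s q0 q1 N_half_int N_neq0).
Let Bz := bd (rsym_Bz s q0 q1 N_half_int N_neq0).
Let Bp := bd (rsym_Bp s q0 q1 N_half_int N_neq0).
Let Tm := bd (rsym_Tm s q0 q1 N_half_int N_neq0).
Let Tz := bd (rsym_Tz s q0 q1 N_half_int N_neq0).
Let Tp := bd (rsym_Tp s q0 q1 N_half_int N_neq0).

Let ppi d := @phi_pinv N d.

Lemma op3E m f g h u x : bdd (cf f) -> bdd (cf g) -> bdd (cf h) ->
  op3 m f g h u x = cf f x * oapp u 0 (phi (-1, m, false) x) +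
    cf g x * oapp u 0 (phi (0, m, false) x) + cf h x * oapp u 0 (phi (1, m, false) x).
Proof.
by move=> bf bg bh; rewrite /op3 !l2_addE !(wshiftE (ppi _)).
Qed.

Lemma bounded_op3 m f g h : bdd (cf f) -> bdd (cf g) -> bdd (cf h) ->
  bounded_op (op3 m f g h).
Proof.
move=> bf bg bh; apply: bounded_opD; first apply: bounded_opD;
  exact: (bounded_wshift (ppi _)).
Qed.

Lemma bounded_opA : bounded_op opA. Proof. exact: bounded_op3. Qed.
Lemma bounded_opB : bounded_op opB. Proof. exact: bounded_op3. Qed.
Lemma bounded_opT : bounded_op opT. Proof. exact: bounded_op3. Qed.

Lemma shift_JKP d x y J K : d.2 = false -> phi d x = Some y ->
  q ^ (d.1.1 + d.1.2) * xJ x = J -> q ^ (d.1.1 - d.1.2) * xK x = K ->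
  [/\ xP y = xP x, xJ y = J & xK y = K].
Proof.
move=> d2 /(phi_coords N_neq0)[ej ek _ ep] <- <-; rewrite /xP ep d2 /xJ /xK.
have qn : q != 0 by rewrite gt_eqF.
split => //.
  by rewrite -[LHS]/(q ^ (jx y)%:Z) ej addrC expfzDr.
by rewrite -[LHS]/(q ^ (kx y)%:Z) ek addrC expfzDr.
Qed.

Lemma op3_at d x (c : R[i]) J K m f g h u e1 e2 e3 :
  bdd (cf f) -> bdd (cf g) -> bdd (cf h) ->
  (phi d x = None -> c = 0) -> d.2 = false ->
  q ^ (d.1.1 + d.1.2) * xJ x = J -> q ^ (d.1.1 - d.1.2) * xK x = K ->
  dadd d (-1, m, false) = e1 -> dadd d (0, m, false) = e2 ->
  dadd d (1, m, false) = e3 ->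
  c * oapp (op3 m f g h u) 0 (phi d x) =
  c * ((f q s (xP x) J K)%:C * oapp u 0 (phi e1 x) +
       (g q s (xP x) J K)%:C * oapp u 0 (phi e2 x) +
       (h q s (xP x) J K)%:C * oapp u 0 (phi e3 x)).
Proof.
move=> bf bg bh c0 d2 eJ eK <- <- <-.
case e: (phi d x) => [y|]; last by rewrite c0// !mul0r.
have -> : oapp (op3 m f g h u) 0 (Some y) = op3 m f g h u y by [].
have [yP yJ yK] := shift_JKP d2 e eJ eK.
by rewrite op3E// !(phi_comp _ e) /cf /atx yP yJ yK.
Qed.

Let qn : q != 0. Proof. by rewrite gt_eqF. Qed.

Lemma op3_comp m f g h m' f' g' h' u x :
  bdd (cf f) -> bdd (cf g) -> bdd (cf h) ->
  bdd (cf f') -> bdd (cf g') -> bdd (cf h') ->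
  (phi (-1, m, false) x = None -> cf f x = 0) ->
  (phi (0, m, false) x = None -> cf g x = 0) ->
  (phi (1, m, false) x = None -> cf h x = 0) ->
  let at_ F (r : int) := (F q s (xP x) (q ^ (r + m) * xJ x) (q ^ (r - m) * xK x))%:C in
  let sh (r r' : int) := oapp u 0 (phi (r + r', m + m', false) x) in
  op3 m f g h (op3 m' f' g' h' u) x =
  cf f x * (at_ f' (-1) * sh (-1) (-1) + at_ g' (-1) * sh (-1) 0 + at_ h' (-1) * sh (-1) 1) +
  cf g x * (at_ f' 0 * sh 0 (-1) + at_ g' 0 * sh 0 0 + at_ h' 0 * sh 0 1) +
  cf h x * (at_ f' 1 * sh 1 (-1) + at_ g' 1 * sh 1 0 + at_ h' 1 * sh 1 1).
Proof.
move=> bf bg bh bf' bg' bh' vf vg vh at_ sh.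
rewrite (op3E m _ x bf bg bh) (op3_at u bf' bg' bh' vf erefl erefl erefl erefl erefl erefl).
rewrite (op3_at u bf' bg' bh' vg erefl erefl erefl erefl erefl erefl).
by rewrite (op3_at u bf' bg' bh' vh erefl erefl erefl erefl erefl erefl).
Qed.

Lemma zpowE (t : R) : (q ^ Posz 0 * t = t) * (q ^ Posz 1 * t = q * t) *
  (q ^ Posz 2 * t = q ^+ 2 * t) * (q ^ Negz 0 * t = t / q) * (q ^ Negz 1 * t = t / q ^+ 2).
Proof. by do !split; rewrite ?expr0z ?mul1r ?expr1z// mulrC// exprN1. Qed.

Let vAm x : phi (-1, 0, false) x = None -> cf (@coefAm R) x = 0.
Proof. by move=> e; rewrite /cf /atx (vanish_Am s q0 q1 N_half_int N_neq0 e). Qed.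
Let vBm x : phi (-1, -1, false) x = None -> cf (@coefBm R) x = 0.
Proof. by move=> e; rewrite /cf /atx (vanish_Bm s q0 q1 N_half_int N_neq0 e). Qed.
Let vBz x : phi (0, -1, false) x = None -> cf (@coefBz R) x = 0.
Proof. by move=> e; rewrite /cf /atx (vanish_Bz s q0 q1 N_half_int N_neq0 e). Qed.
Let vTm x : phi (-1, 1, false) x = None -> cf (@coefTm R) x = 0.
Proof. by move=> e; rewrite /cf /atx (vanish_Tm s q0 q1 N_half_int N_neq0 e). Qed.
Let vTz x : phi (0, 1, false) x = None -> cf (@coefTz R) x = 0.
Proof. by move=> e; rewrite /cf /atx (vanish_Tz s q0 q1 N_half_int N_neq0 e). Qed.
Let vz f x : phi (0, 0, false) x = None -> cf f x = 0.
Proof. by rewrite -[(0, 0, false)]/d0 phi_d0. Qed.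
Let v1 (m : int) f x : (`|m| <= 1)%N -> phi (1, m, false) x = None -> cf f x = 0.
Proof.
move=> hm /(@phi_plus _ _ _ q0 q1 N_half_int N_neq0 (1, m, false) x erefl) [].
by case: `|_|%N hm => [|[|]] //=; [left|right].
Qed.

Ltac norm_ints := repeat
  match goal with
  | |- context [phi (?a, ?b, false) ?x] =>
    let r := eval vm_compute in (a, b, false) in progress change (phi (a, b, false) x) with (phi r x)
  | |- context [(exprz q ?a)] =>
    let r := eval vm_compute in a in progress change (exprz q a) with (exprz q r)
  end.

Ltac gen_atoms := repeat
  match goal with
  | |- context [coefAm q s ?a ?b ?c] => generalize (coefAm q s a b c) => ?
  | |- context [coefAz q s ?a ?b ?c] => generalize (coefAz q s a b c) => ?
  | |- context [coefAp q s ?a ?b ?c] => generalize (coefAp q s a b c) => ?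
  | |- context [coefBm q s ?a ?b ?c] => generalize (coefBm q s a b c) => ?
  | |- context [coefBz q s ?a ?b ?c] => generalize (coefBz q s a b c) => ?
  | |- context [coefBp q s ?a ?b ?c] => generalize (coefBp q s a b c) => ?
  | |- context [coefTm q s ?a ?b ?c] => generalize (coefTm q s a b c) => ?
  | |- context [coefTz q s ?a ?b ?c] => generalize (coefTz q s a b c) => ?
  | |- context [coefTp q s ?a ?b ?c] => generalize (coefTp q s a b c) => ?
  end.

Ltac linear_combination5 e1 U1 e2 U2 e3 U3 e4 U4 e5 U5 :=
  lazymatch type of e1 with ?a1 = ?b1 =>
  lazymatch type of e2 with ?a2 = ?b2 =>
  lazymatch type of e3 with ?a3 = ?b3 =>
  lazymatch type of e4 with ?a4 = ?b4 =>
  lazymatch type of e5 with ?a5 = ?b5 =>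
  lazymatch goal with |- ?X = ?Y =>
    let E := fresh in
    (have E : X - Y = (a1 - b1) * U1 + (a2 - b2) * U2 + (a3 - b3) * U3 + (a4 - b4) * U4 +
      (a5 - b5) * U5 by ring);
    apply/eqP; by rewrite -subr_eq0 E {E} e1 e2 e3 e4 e5 !subrr !mul0r !addr0 eqxx
  end end end end end end.

Ltac gen_shifts u x m U1 U2 U3 U4 U5 :=
  move: (oapp u 0 (phi (Negz 1, m, false) x)) => U1;
  move: (oapp u 0 (phi (Negz 0, m, false) x)) => U2;
  move: (oapp u 0 (phi (Posz 0, m, false) x)) => U3;
  move: (oapp u 0 (phi (Posz 1, m, false) x)) => U4;
  move: (oapp u 0 (phi (Posz 2, m, false) x)) => U5.

Local Notation CC := (congr1 (real_complex R)).

Arguments op3_comp m {f g h} m' {f' g' h'} u {x}.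

Lemma opAB u x : opA (opB u) x = (q ^+ 2)%:C * opB (opA u) x.
Proof.
have kp := ket_kp q0 q1 N_half_int N_neq0 x.
rewrite /opA /opB.
rewrite [LHS](op3_comp 0 (-1) u Am Az Ap Bm Bz Bp (@vAm x) (@vz _ x) (@v1 0 _ x isT)).
rewrite [X in _ = _ * X](op3_comp (-1) 0 u Bm Bz Bp Am Az Ap (@vBm x) (@vBz x) (@v1 (-1) _ x isT)).
(* Now the claim is linear in the coordinates of [u] at l - 2, ..., l + 2, called U1 to U5; their
   coefficients agree by the five component identities. *)
norm_ints; rewrite /cf /atx !zpowE; gen_shifts u x (Negz 0) U1 U2 U3 U4 U5.
have := AB_p2 s kp; have := AB_p1 s kp; have := AB_z s kp; have := AB_m1 s kp.
have := AB_m2 s kp; move: (q ^+ 2) => q2; gen_atoms.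
move=> /CC e1 /CC e2 /CC e3 /CC e4 /CC e5; linear_combination5 e1 U1 e2 U2 e3 U3 e4 U4 e5 U5.
Qed.

Lemma oapp0 u x : u x = oapp u 0 (phi (Posz 0, Posz 0, false) x).
Proof. by rewrite -[(_, _, _)]/d0 phi_d0. Qed.

Lemma opBBs u x : opB (opT u) x + opA (opA u) x - (1 - s ^+ 2)%:C * opA u x
  - (s ^+ 2)%:C * u x = 0.
Proof.
have kp := ket_kp q0 q1 N_half_int N_neq0 x.
rewrite [X in X + _ - _ - _ = _](op3_comp (-1) 1 u Bm Bz Bp Tm Tz Tp (@vBm x) (@vBz x) (@v1 (-1) _ x isT)).
rewrite [X in _ + X - _ - _ = _](op3_comp 0 0 u Am Az Ap Am Az Ap (@vAm x) (@vz _ x) (@v1 0 _ x isT)).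
rewrite [X in _ - _ * X - _ = _](@op3E 0 _ _ _ u x Am Az Ap) [X in _ - _ - _ * X = _](oapp0 u x).
norm_ints; rewrite /cf /atx !zpowE; gen_shifts u x (Posz 0) U1 U2 U3 U4 U5.
have := BBs_p2 s kp; have := BBs_p1 s kp; have := BBs_z s kp; have := BBs_m1 s kp.
have := BBs_m2 s kp; gen_atoms; move: (s ^+ 2) (q ^+ 2) => s2 q2.
move=> /CC e1 /CC e2 /CC e3 /CC e4 /CC e5; linear_combination5 e1 U1 e2 U2 e3 U3 e4 U4 e5 U5.
Qed.

Lemma opBsB u x : opT (opB u) x + (q ^+ 4)%:C * opA (opA u) x
  - (q ^+ 2 * (1 - s ^+ 2))%:C * opA u x - (s ^+ 2)%:C * u x = 0.
Proof.
have kp := ket_kp q0 q1 N_half_int N_neq0 x.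
rewrite [X in X + _ - _ - _ = _](op3_comp 1 (-1) u Tm Tz Tp Bm Bz Bp (@vTm x) (@vTz x) (@v1 1 _ x isT)).
rewrite [X in _ + _ * X - _ - _ = _](op3_comp 0 0 u Am Az Ap Am Az Ap (@vAm x) (@vz _ x) (@v1 0 _ x isT)).
rewrite [X in _ - _ * X - _ = _](@op3E 0 _ _ _ u x Am Az Ap) [X in _ - _ - _ * X = _](oapp0 u x).
norm_ints; rewrite /cf /atx !zpowE; gen_shifts u x (Posz 0) U1 U2 U3 U4 U5.
have := BsB_p2 s kp; have := BsB_p1 s kp; have := BsB_z s kp; have := BsB_m1 s kp.
have := BsB_m2 s kp; gen_atoms; move: (s ^+ 2) (q ^+ 2) (q ^+ 4) => s2 q2 q4.
move=> /CC e1 /CC e2 /CC e3 /CC e4 /CC e5; linear_combination5 e1 U1 e2 U2 e3 U3 e4 U4 e5 U5.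
Qed.

End Generators.

Section Representation.
Variables (R : realType) (q s : R) (N : rat).
Hypotheses (q0 : 0 < q) (q1 : q < 1) (N_half_int : 2 * N \is a Num.int) (N_neq0 : N != 0).
Local Notation I := (ket_index N).
Local Notation H := (l2 R I).
Local Notation xJ := (@xJ R q N).
Local Notation xK := (@xK R q N).
Local Notation xP := (@xP R q N).
Local Notation p := (q ^+ 2 + 1).
Implicit Types (x y : I) (u : H) (d : dvec) (f g h : R -> R -> R -> R -> R -> R).
Local Notation cf := (@cf R q s N).
Local Notation opA := (@opA R q s N).
Local Notation opB := (@opB R q s N).
Local Notation opT := (@opT R q s N).
Local Notation op3 := (@op3 R q s N).

Let qn : q != 0. Proof. by rewrite gt_eqF. Qed.

Let bd f : rsym q (atx (N:=N) q s f) -> bdd (cf f).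
Proof. by case => /sym_bdd. Qed.

Let Am := bd (rsym_Am s q0 q1 N_half_int N_neq0).
Let Az := bd (rsym_Az s q0 q1 N_half_int N_neq0).
Let Ap := bd (rsym_Ap s q0 q1 N_half_int N_neq0).
Let Bm := bd (rsym_Bm s q0 q1 N_half_int N_neq0).
Let Bz := bd (rsym_Bz s q0 q1 N_half_int N_neq0).
Let Bp := bd (rsym_Bp s q0 q1 N_half_int N_neq0).
Let Tm := bd (rsym_Tm s q0 q1 N_half_int N_neq0).
Let Tz := bd (rsym_Tz s q0 q1 N_half_int N_neq0).
Let Tp := bd (rsym_Tp s q0 q1 N_half_int N_neq0).

Ltac norm_exprz := repeat
  match goal with
  | |- context [exprz q ?a] =>
    let r := eval vm_compute in a in progress change (exprz q a) with (exprz q r)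
  end.

(** Coefficients are real, so an adjoint is a transpose: its weight at a ket is the weight [f] at
    the ket reached by the opposite shift, written again as a coefficient function. *)
Definition transposes (a b : int) f f' := forall P J K,
  f q s P (q ^ (- a - b) * J) (q ^ (- a + b) * K) = f' q s P J K.

Lemma transposesE (a b : int) f f' x y : transposes a b f f' ->
  phi (- a, - b, false) x = Some y -> cf f y = cf f' x.
Proof.
move=> h e; have [yP yJ yK] := @shift_JKP _ _ _ q0 N_neq0 (- a, - b, false) _ _ _ _ erefl e erefl erefl.
by rewrite /cf /atx yP yJ yK /= opprK h.
Qed.

Lemma adjoint_transposes a b f f' : bdd (cf f) -> transposes a b f f' ->
  is_adjoint (wshift (phi (a, b, false)) (cf f)) (wshift (phi (- a, - b, false)) (cf f')).
Proof.
move=> bf h; have := adjoint_wshift (phi_pinv (a, b, false)) bf.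
congr (is_adjoint _ _); apply: eq_wshift => x y e; rewrite e /=.
by rewrite (transposesE h e) conj_Creal// complex_real.
Qed.

Lemma adjoint_op3 m f g h f' g' h' : bdd (cf f) -> bdd (cf g) -> bdd (cf h) ->
  transposes (-1) m f h' -> transposes 0 m g g' -> transposes 1 m h f' ->
  is_adjoint (op3 m f g h) (op3 (- m) f' g' h').
Proof.
move=> bf bg bh hf hg hh u v.
have e1 : inner (wshift (phi (1, - m, false)) (cf h') u) v =
    inner u (wshift (phi (-1, m, false)) (cf f) v) by exact: (adjoint_transposes bf hf).
have e2 : inner (wshift (phi (0, - m, false)) (cf g') u) v =
    inner u (wshift (phi (0, m, false)) (cf g) v) by exact: (adjoint_transposes bg hg).
have e3 : inner (wshift (phi (-1, - m, false)) (cf f') u) v =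
    inner u (wshift (phi (1, m, false)) (cf h) v) by exact: (adjoint_transposes bh hh).
rewrite /op3 !innerDl !innerDr e1 e2 e3.
move: (inner u (wshift (phi (1, m, false)) _ v)) (inner u (wshift (phi (0, m, false)) _ v)).
move: (inner u (wshift (phi (-1, m, false)) _ v)) => a b c; ring.
Qed.

Let tAm : transposes (-1) 0 (@coefAm R) (@coefAp R).
Proof.
move=> P J K; norm_exprz; rewrite !(@zpowE R q).
by rewrite /coefAm /coefAp; congr (_ * cs _ * cs _ * gam _ _ _ _); field.
Qed.

Let tAz : transposes 0 0 (@coefAz R) (@coefAz R).
Proof. by move=> P J K; norm_exprz; rewrite !(@zpowE R q). Qed.

Let tAp : transposes 1 0 (@coefAp R) (@coefAm R).
Proof.
move=> P J K; norm_exprz; rewrite !(@zpowE R q).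
by rewrite /coefAm /coefAp; congr (_ * cs _ * cs _ * gam _ _ _ _); field.
Qed.

Let tBm : transposes (-1) (-1) (@coefBm R) (@coefTp R).
Proof.
move=> P J K; norm_exprz; rewrite !(@zpowE R q).
rewrite /coefBm /coefTp [cs _ * cs (_ / _)]mulrC.
by congr (cs _ * cs _ * gam _ _ _ _); field.
Qed.

Let tBz : transposes 0 (-1) (@coefBz R) (@coefTz R).
Proof.
move=> P J K; norm_exprz; rewrite !(@zpowE R q).
by rewrite /coefBz /coefTz; congr (_ * cs _ * cs _ * hfun _ _ _ _); field.
Qed.

Let tBp : transposes 1 (-1) (@coefBp R) (@coefTm R).
Proof.
move=> P J K; norm_exprz; rewrite !(@zpowE R q).
by rewrite /coefBp /coefTm; congr (_ * cs _ * cs _ * gam _ _ _ _); field.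
Qed.

Lemma adjoint_opA : is_adjoint opA opA.
Proof. exact: (adjoint_op3 Am Az Ap tAm tAz tAp). Qed.

Lemma adjoint_opB : is_adjoint opB opT.
Proof. exact: (adjoint_op3 Bm Bz Bp tBm tBz tBp). Qed.

Let ppi d := @phi_pinv N d.

Lemma delta_transposes a b f f' x : bdd (cf f) -> transposes a b f f' ->
  wshift (phi (a, b, false)) (cf f) (l2_delta R x) =
  cf f' x *: oapp (@l2_delta R _) 0 (phi (- a, - b, false) x).
Proof. by move=> bf h; apply: wshift_delta (ppi _) bf _ => y /(transposesE h). Qed.

Lemma qpow_ratr x (t : rat) (n : nat) : t = n%:R -> q `^ (ratr t) = q ^+ n.
Proof. by move=> ->; rewrite ratr_nat powR_mulrn// ltW. Qed.

Lemma lev_ge_half x : 2^-1 <= ratr (val x).1.1 :> R.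
Proof.
have [_ _ h _] := ketP N_neq0 x.
have e : (val x).1.1 = (lev x)%:R + `|N| by rewrite -h subrK.
have nu1 : 1 <= 2 * `|N|.
  by rewrite -(nuE N_half_int) -[1]/(1%:R) ler_nat; exact: (nu_gt0 N_half_int N_neq0).
have E : ratr 1 <= ratr ((val x).1.1 + (val x).1.1) :> R.
  by rewrite ler_rat e; move: nu1 (ler0n rat (lev x)); lra.
by move: E; rewrite rmorph1 rmorphD /=; lra.
Qed.

Lemma val_normM x : `|ratr (val x).2| <= ratr (val x).1.1 :> R.
Proof.
have [_ _ h hM] := ketP N_neq0 x.
rewrite -ratr_norm ler_rat hM.
have -> : `|if pos x then `|N| else - `|N| | = `|N| by case: pos; rewrite ?normrN normr_id.
by rewrite -subr_ge0 h ler0n.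
Qed.

Lemma link_JKP x : let l : R := ratr (val x).1.1 in let m : R := ratr (val x).1.2 in
  [/\ q `^ (l + m) = xJ x, q `^ (l - m) = xK x & q `^ (2 * ratr (val x).2) = xP x].
Proof.
have [h1 h2 _ h4] := ketP N_neq0 x; rewrite /= -rmorphD -rmorphB.
split; [exact: (qpow_ratr x h1)|exact: (qpow_ratr x h2)|].
have -> : 2 * ratr (val x).2 = ratr (2 * (val x).2) :> R by rewrite !mulr_natl rmorphMn.
rewrite h4 /xP.
have e : 2 * `|N| = (nu N)%:R by rewrite (nuE N_half_int).
by case: pos; rewrite ?mulrN ?rmorphN ?powRN (qpow_ratr x e).
Qed.

Lemma link_ge0 x : let l : R := ratr (val x).1.1 in let m : R := ratr (val x).1.2 in
  0 <= l + m /\ 0 <= l - m.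
Proof.
have [h1 h2 _ _] := ketP N_neq0 x.
by rewrite /= -rmorphD -rmorphB h1 h2 !rmorph_nat !ler0n.
Qed.

Definition x0_op u : H := (1 - s ^+ 2)%:C *: u - p%:C *: opA u.
Definition x1_op u : H := (Num.sqrt p)%:C *: opB u.

Local Notation ket_at a b x := (oapp (@l2_delta R _) 0 (phi (a, b, false) x)).

Lemma opA_delta x : opA (l2_delta R x) = cf (@coefAp R) x *: ket_at 1 0 x +
  cf (@coefAz R) x *: ket_at 0 0 x + cf (@coefAm R) x *: ket_at (-1) 0 x.
Proof.
by rewrite /opA /op3 (delta_transposes x Am tAm) (delta_transposes x Az tAz)
  (delta_transposes x Ap tAp) oppr0 opprK.
Qed.

Lemma opB_delta x : opB (l2_delta R x) = cf (@coefTp R) x *: ket_at 1 1 x +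
  cf (@coefTz R) x *: ket_at 0 1 x + cf (@coefTm R) x *: ket_at (-1) 1 x.
Proof.
by rewrite /opB /op3 (delta_transposes x Bm tBm) (delta_transposes x Bz tBz)
  (delta_transposes x Bp tBp) oppr0 opprK.
Qed.

Lemma ket_atE a b x l m : l = (val x).1.1 + a%:~R -> m = (val x).1.2 + b%:~R ->
  ket R N l m (val x).2 = ket_at a b x.
Proof. by move=> -> ->. Qed.

Lemma x0_opE x : x0_op (l2_delta R x) = x0_ket q s x.
Proof.
have [J0 K0] := link_ge0 x; have l2 := lev_ge_half x; have Ml := val_normM x.
have up := up0_link s q0 q1 l2 Ml K0.
have md := md0_link s q0 q1 (ratr (val x).2) (ratr (val x).1.2) l2.
have dn := dn0_link s q0 q1 l2 Ml K0.
have [eJ eK eP] := link_JKP x; rewrite eJ eK eP in up md dn.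
have e1 : ket R N ((val x).1.1 + 1) (val x).1.2 (val x).2 = ket_at 1 0 x.
  by apply: ket_atE; rewrite ?addr0.
have e0 : ket R N (val x).1.1 (val x).1.2 (val x).2 = ket_at 0 0 x.
  by apply: ket_atE; rewrite ?addr0.
have em : ket R N ((val x).1.1 - 1) (val x).1.2 (val x).2 = ket_at (-1) 0 x.
  by apply: ket_atE; rewrite ?addr0 ?rmorphN1.
transitivity ((- p * atx q s (@coefAp R) x)%:C *: ket_at 1 0 x +
  (1 - s ^+ 2 - p * atx q s (@coefAz R) x)%:C *: ket_at 0 0 x +
  (- p * atx q s (@coefAm R) x)%:C *: ket_at (-1) 0 x); last first.
  rewrite -e1 -e0 -em /atx -up -md -dn /x0_ket.
  by case: (val x) => [[l m] M].
rewrite /x0_op opA_delta /cf.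
move: (ket_at 1 0 x) (ket_at (-1) 0 x) => Kp Km; rewrite -[(0, 0, false)]/d0 phi_d0 /=.
move: (l2_delta R x) (atx _ _ _ _) (atx _ _ _ _) (atx _ _ _ _) => v a b c.
by apply: l2_ext => y; rewrite !l2E; ring.
Qed.

Lemma x1_opE x : x1_op (l2_delta R x) = x1_ket q s x.
Proof.
have [J0 K0] := link_ge0 x; have l2 := lev_ge_half x; have Ml := val_normM x.
have up := up1_link s q0 q1 l2 Ml J0.
have md := md1_link s q0 q1 (ratr (val x).2) l2 K0.
have dn := dn1_link s q0 q1 l2 Ml K0.
have [eJ eK eP] := link_JKP x; rewrite eJ eK eP in up md dn.
have e1 : ket R N ((val x).1.1 + 1) ((val x).1.2 + 1) (val x).2 = ket_at 1 1 x.
  exact: ket_atE.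
have e0 : ket R N (val x).1.1 ((val x).1.2 + 1) (val x).2 = ket_at 0 1 x.
  by apply: ket_atE; rewrite ?addr0.
have em : ket R N ((val x).1.1 - 1) ((val x).1.2 + 1) (val x).2 = ket_at (-1) 1 x.
  by apply: ket_atE; rewrite ?rmorphN1.
transitivity ((Num.sqrt p * atx q s (@coefTp R) x)%:C *: ket_at 1 1 x +
  (Num.sqrt p * atx q s (@coefTz R) x)%:C *: ket_at 0 1 x +
  (Num.sqrt p * atx q s (@coefTm R) x)%:C *: ket_at (-1) 1 x); last first.
  rewrite -e1 -e0 -em /atx -up -md -dn /x1_ket.
  by case: (val x) => [[l m] M]; rewrite !rmorphN !scaleNr.
rewrite /x1_op opB_delta /cf.
move: (ket_at 1 1 x) (ket_at 0 1 x) (ket_at (-1) 1 x) => Kp Kz Km.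
move: (atx _ _ _ _) (atx _ _ _ _) (atx _ _ _ _) => a b c.
by apply: l2_ext => y; rewrite !l2E; ring.
Qed.

Let bA := @bounded_opA R q s N q0 q1 N_half_int N_neq0.
Let bB := @bounded_opB R q s N q0 q1 N_half_int N_neq0.

Lemma rep_GenA : rep_gen q s GenA = opA :> (H -> H).
Proof.
have pn : p != 0 by exact: p_neq0.
have b0 : bounded_op x0_op.
  have bid : bounded_op (@id H) by split => //; exists 1 => u; rewrite mul1r.
  rewrite /x0_op (_ : (fun _ => _) = (fun u => (1 - s ^+ 2)%:C *: u + (- p%:C) *: opA u)).
    by apply: bounded_opD; [exact: (bounded_opZ _ bid)|exact: bounded_opZ].
  by apply/funext => u; rewrite scaleNr.
apply/funext => u; rewrite /rep_gen (op_of_basisE b0 x0_opE) qnum2// /x0_op opprB.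
by rewrite addrCA subrr addr0 scalerA -realCM mulVf// scale1r.
Qed.

Lemma rep_GenB : rep_gen q s GenB = opB :> (H -> H).
Proof.
have pn : Num.sqrt p != 0.
  by rewrite gt_eqF// sqrtr_gt0 ltr_wpDl// sqr_ge0.
have b1 : bounded_op x1_op by exact: bounded_opZ.
apply/funext => u; rewrite /rep_gen (op_of_basisE b1 x1_opE) qnum2// /x1_op.
by rewrite scalerA -realCM mulVf// scale1r.
Qed.

End Representation.

(** * The algebra of band operators *)

Section BandOperators.
Variables (R : realType) (N : rat).
Hypotheses (N_half_int : 2 * N \is a Num.int) (N_neq0 : N != 0).
Local Notation I := (ket_index N).
Local Notation H := (l2 R I).
Local Notation op := (H -> H).
Local Notation coefs := (I -> R[i]).
Implicit Types (x y : I) (u : H) (d e : dvec) (c : coefs) (S T : op).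
Implicit Types (G : dvec -> coefs -> Prop).

(** An inductive sum avoids a normal form: every property is shown for one shift and then for sums.
    [G] says which weights may accompany which displacement. *)
Inductive bandop G : op -> Prop :=
| band_shift d c : G d c -> bandop G (wshift (phi d) c)
| band_add S T : bandop G S -> bandop G T -> bandop G (fun u => S u + T u).

Record band_class G : Prop := BandClass {
  bc_bdd : forall d c, G d c -> bdd c;
  bc_cst : forall a, G d0 (fun=> a);
  bc_comp : forall d c e c', G d c -> G e c' ->
    G (dadd d e) (fun x => c x * oapp c' 0 (phi d x));
  bc_adj : forall d c, G d c ->
    G (dopp d) (fun x => (oapp c 0 (phi (dopp d) x))^*%R) }.

Lemma wshift_phiE d c u x : bdd c -> wshift (phi d) c u x = c x * oapp u 0 (phi d x).
Proof. exact: (wshiftE (@phi_pinv N d)). Qed.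

Lemma wshift_comp d e c c' : bdd c -> bdd c' ->
  wshift (R := R) (phi d) c \o wshift (phi e) c' =
  wshift (phi (dadd d e)) (fun x => c x * oapp c' 0 (phi d x)).
Proof.
move=> bc bc'; apply/funext => u; apply: l2_ext => x.
have bcc : bdd (fun x => c x * oapp c' 0 (phi d x)).
  have [C hC] := bc; have [E hE] := bdd_oapp (phi d) bc'.
  exists (`|C| * `|E|) => y; rewrite nmM; apply: ler_pM; rewrite ?nm_ge0//.
    exact: le_trans (hC y) (ler_norm _).
  exact: le_trans (hE y) (ler_norm _).
rewrite [LHS](wshift_phiE _ _ _ bc) [RHS](wshift_phiE _ _ _ bcc).
case h: (phi d x) => [y|]; last by rewrite /= !mulr0 mul0r.
rewrite -(phi_comp e h).
have -> : oapp (wshift (phi e) c' u) 0 (Some y) = wshift (phi e) c' u y by [].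
by rewrite (wshift_phiE _ _ _ bc') mulrA.
Qed.

Lemma wshift_cst a : wshift (phi d0) (fun=> a) = (fun u : H => a *: u).
Proof.
apply/funext => u; apply: l2_ext => x; rewrite wshift_phiE ?phi_d0//.
by exists (nm a).
Qed.

Section Class.
Variables (G : dvec -> coefs -> Prop) (bcG : band_class G).

Lemma band_bounded T : bandop G T -> bounded_op T.
Proof.
elim=> [d c /(bc_bdd bcG) bc|S S' _ bS _ bS']; last exact: bounded_opD.
exact: (bounded_wshift (@phi_pinv N d)).
Qed.

Lemma band_cst a : bandop G (fun u => a *: u).
Proof. by rewrite -wshift_cst; apply: band_shift; exact: bc_cst. Qed.

Lemma band_comp S T : bandop G S -> bandop G T -> bandop G (S \o T).
Proof.
move=> hS hT; elim: hS => [d c hc|S1 S2 _ h1 _ h2]; last exact: (band_add h1 h2).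
elim: hT => [e c' hc'|T1 T2 hT1 h1 hT2 h2].
  rewrite (wshift_comp _ _ (bc_bdd bcG hc) (bc_bdd bcG hc')).
  by apply: band_shift; apply: bc_comp.
have [lin _] := bounded_wshift (@phi_pinv N d) (bc_bdd bcG hc).
rewrite (_ : _ \o _ = fun u => (wshift (phi d) c \o T1) u + (wshift (phi d) c \o T2) u).
  exact: (band_add h1 h2).
by apply/funext => u; rewrite /= (linD lin).
Qed.

Lemma band_scale a T : bandop G T -> bandop G (fun u => a *: T u).
Proof. by move=> hT; exact: (band_comp (band_cst a) hT). Qed.

Lemma band_adj T : bandop G T -> exists2 S, bandop G S & is_adjoint T S.
Proof.
elim=> [d c hc|T1 T2 _ [S1 h1 a1] _ [S2 h2 a2]].
  eexists; last exact: (adjoint_wshift (@phi_pinv N d) (bc_bdd bcG hc)).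
  by apply: band_shift; apply: bc_adj.
by exists (fun u => S1 u + S2 u); [exact: band_add|exact: is_adjointD].
Qed.

Lemma band_adjoint T : bandop G T -> bandop G (adjoint T) /\ is_adjoint T (adjoint T).
Proof. by move=> /band_adj[S hS aS]; rewrite (adjointE (band_bounded hS) aS). Qed.

End Class.

Variables (r : R) (r0 : 0 < r) (r1 : r < 1).

(** The class of the represented algebra: it preserves the sign of M, and its weights at M and -M
    are close, which keeps [D, a] bounded. The larger class [symbols] also contains these
    commutators, which exchange the two signs. *)
Definition flip_symbols d c := d.2 = false /\ symA r c.
Definition symbols (d : dvec) c := sym r c.

Lemma class_flip_symbols : band_class flip_symbols.
Proof.
split.
- by move=> d c [_ [/sym_bdd]].
- by move=> a; split => //; exact: (symA_cst N_half_int N_neq0).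
- move=> d c e c' [hd hc] [he hc']; split; first by rewrite /dadd /= hd he.
  by apply: symA_M => //; exact: symA_shift.
- move=> d c [hd hc]; split => //.
  by apply: symA_conj; exact: symA_shift.
Qed.

Lemma class_symbols : band_class symbols.
Proof.
split.
- by move=> d c /sym_bdd.
- by move=> a; exact: (symA_cst N_half_int N_neq0 r0 r1 a).1.
- by move=> d c e c' hc hc'; apply: symM => //; exact: sym_shift.
- by move=> d c hc; apply: sym_conj; exact: sym_shift.
Qed.

End BandOperators.

(** * The representation of the presented algebra *)

Section StarRepresentation.
Variables (R : realType) (q s : R) (N : rat).
Hypotheses (q0 : 0 < q) (q1 : q < 1) (N_half_int : 2 * N \is a Num.int) (N_neq0 : N != 0).
Local Notation I := (ket_index N).
Local Notation H := (l2 R I).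
Local Notation rep_term := (@rep_term R q s N).
Local Notation opA := (@opA R q s N).
Local Notation opB := (@opB R q s N).
Local Notation opT := (@opT R q s N).
Implicit Types (t : star_term R[i] podles_gen).

Let r0 : 0 < Num.sqrt q. Proof. by rewrite sqrtr_gt0. Qed.
Let r1 : Num.sqrt q < 1. Proof. by rewrite -sqrtr1 ltr_sqrt. Qed.
Let GA := @flip_symbols R N (Num.sqrt q).
Let bcGA : band_class GA := class_flip_symbols N_half_int N_neq0 r0 r1.

Lemma band_rep_term t : bandop GA (rep_term t).
Proof.
elim: t => [g|c|x hx y hy|x hx y hy|x hx].
- have sh m f g' h : rsym q (atx (N:=N) q s f) -> rsym q (atx (N:=N) q s g') ->
      rsym q (atx (N:=N) q s h) -> bandop GA (op3 q s (N:=N) m f g' h).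
    by move=> hf hg hh; apply: band_add; [apply: band_add|]; apply: band_shift; split.
  case: g.
    rewrite -[rep_term _]/(rep_gen q s GenA) (rep_GenA s q0 q1 N_half_int N_neq0).
    by apply: sh; [exact: rsym_Am|exact: rsym_Az|exact: rsym_Ap].
  rewrite -[rep_term _]/(rep_gen q s GenB) (rep_GenB s q0 q1 N_half_int N_neq0).
  by apply: sh; [exact: rsym_Bm|exact: rsym_Bz|exact: rsym_Bp].
- exact: band_cst.
- exact: band_add.
- exact: band_comp.
- exact: (band_adjoint bcGA hx).1.
Qed.

Lemma bounded_rep_term t : bounded_op (rep_term t).
Proof. exact: (band_bounded bcGA (band_rep_term t)). Qed.

Lemma adjoint_rep_term t : is_adjoint (rep_term t) (rep_term (SStar t)).
Proof. exact: (band_adjoint bcGA (band_rep_term t)).2. Qed.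

Lemma rep_term_rel x y : podles_rel q s x y -> rep_term x = rep_term y.
Proof.
have bA := bounded_opA s q0 q1 N_half_int N_neq0.
have [linA _] := bA.
have eA : rep_term (SGen GenA) = opA by exact: (rep_GenA s q0 q1 N_half_int N_neq0).
have eB : rep_term (SGen GenB) = opB by exact: (rep_GenB s q0 q1 N_half_int N_neq0).
have eA' : rep_term (SStar (SGen GenA)) = opA.
  rewrite -[LHS]/(adjoint (rep_term (SGen GenA))) eA.
  exact: adjointE bA (adjoint_opA s q0 q1 N_half_int N_neq0).
have eB' : rep_term (SStar (SGen GenB)) = opT.
  rewrite -[LHS]/(adjoint (rep_term (SGen GenB))) eB.
  apply: adjointE (adjoint_opB s q0 q1 N_half_int N_neq0).
  exact: bounded_opT.
case.
- by rewrite eA' eA.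
- apply/funext => u.
  rewrite -[LHS]/(rep_term (SGen GenA) (rep_term (SGen GenB) u)).
  rewrite -[RHS]/((q ^+ 2)%:C *: rep_term (SGen GenB) (rep_term (SGen GenA) u)) eA eB.
  by apply: l2_ext => i; exact: (opAB s q0 q1 N_half_int N_neq0).
- apply/funext => u.
  rewrite -[LHS]/(rep_term (SGen GenB) (rep_term (SStar (SGen GenB)) u) +
    (rep_term (SGen GenA) (rep_term (SGen GenA) u + (-1)%:C *: u) +
     (s ^+ 2)%:C *: (rep_term (SGen GenA) u + (-1)%:C *: u))) -[RHS]/(0%:C *: u).
  rewrite eA eB eB' (linD linA) (linZ linA) scale0r.
  have h : opB (opT u) + opA (opA u) - (1 - s ^+ 2)%:C *: opA u - (s ^+ 2)%:C *: u = 0.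
    by apply: l2_ext => i; exact: (opBBs s q0 q1 N_half_int N_neq0).
  rewrite -[RHS]h; move: (opB (opT u)) (opA (opA u)) (opA u) => {h} a b c.
  by apply: l2_ext => i; rewrite !l2E; ring.
- apply/funext => u.
  rewrite -[LHS]/(rep_term (SStar (SGen GenB)) (rep_term (SGen GenB) u) +
    ((q ^+ 2)%:C *: rep_term (SGen GenA) ((q ^+ 2)%:C *: rep_term (SGen GenA) u + (-1)%:C *: u) +
     (s ^+ 2)%:C *: ((q ^+ 2)%:C *: rep_term (SGen GenA) u + (-1)%:C *: u))) -[RHS]/(0%:C *: u).
  rewrite eA eB eB' (linD linA) !(linZ linA) scale0r.
  have h : opT (opB u) + (q ^+ 4)%:C *: opA (opA u) - (q ^+ 2 * (1 - s ^+ 2))%:C *: opA u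
      - (s ^+ 2)%:C *: u = 0.
    by apply: l2_ext => i; exact: (opBsB s q0 q1 N_half_int N_neq0).
  rewrite -[RHS]h; move: (opT (opB u)) (opA (opA u)) (opA u) => {h} a b c.
  by apply: l2_ext => i; rewrite !l2E; ring.
Qed.

(** [podles_rep] evaluates an arbitrary representative of a class; this makes the result independent
    of it. Each clause for the star is a uniqueness of adjoints. *)
Lemma rep_term_cong x y : star_cong (podles_rel q s) x y -> rep_term x = rep_term y.
Proof.
have lin t : linear (rep_term t) by case: (bounded_rep_term t).
have adj t := adjoint_rep_term t.
have bdt t := bounded_rep_term t.
elim=> {x y}.
- exact: rep_term_rel.
- by [].
- by [].
- by move=> x y z _ -> _ ->.
- by move=> x x' y y' _ hx _ hy; rewrite /= hx hy.
- by move=> x x' y y' _ hx _ hy; rewrite /= hx hy.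
- by move=> x x' _ hx; rewrite /= hx.
- by move=> x y z; apply/funext => u; rewrite /= addrA.
- by move=> x y; apply/funext => u; rewrite /= addrC.
- by move=> x; apply/funext => u; rewrite /= scale0r add0r.
- by [].
- by move=> x; apply/funext => u; rewrite /= scale1r.
- by move=> x; apply/funext => u; rewrite /= scale1r.
- by [].
- by move=> x y z; apply/funext => u /=; rewrite (linD (lin x)).
- by move=> x; apply/funext => u; rewrite /= !scale0r.
- by move=> a b; apply/funext => u; rewrite /= scalerDl.
- by move=> a b; apply/funext => u; rewrite /= scalerA.
- by move=> a x; apply/funext => u /=; rewrite (linZ (lin x)).
- move=> x y; apply: adjointE; first exact: (bdt (SAdd (SStar x) (SStar y))).
  exact: is_adjointD.
- move=> x y; apply: adjointE; first exact: (bdt (SMul (SStar y) (SStar x))).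
  exact: is_adjoint_comp.
- by move=> x; apply: adjointE => //; apply: is_adjointC.
- move=> a; apply: adjointE; first exact: (bdt (SScal a^*%R)).
  by move=> u v; rewrite /= innerZl innerZr conjCK.
Qed.

Local Notation rep := (@podles_rep R q s N).

Lemma podles_rep_cls t : rep (\pi_(podles q s) t) = rep_term t.
Proof. exact: rep_term_cong (repr_cls _ _). Qed.

Lemma podles_star_representation : star_representation (@podles_star R q s) rep.
Proof.
split.
- by move=> a; exact: bounded_rep_term.
- rewrite -[1]/(\pi_(podles q s) (SScal 1)) podles_rep_cls.
  by apply/funext => u; rewrite /= scale1r.
- move=> c a b u.
  have -> : c *: a + b = pr_add (pr_mul (pr_scal (podles_rel q s) c) a) b by [].
  by rewrite podles_rep_cls /= [rep_term _]podles_rep_cls /= [rep_term _]podles_rep_cls.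
- move=> a b; have -> : a * b = pr_mul a b by [].
  by rewrite podles_rep_cls.
- move=> a; rewrite /podles_star podles_rep_cls; exact: adjoint_rep_term.
Qed.

Lemma band_rep a : bandop GA (rep a).
Proof. exact: band_rep_term. Qed.

End StarRepresentation.

(** * The Dirac operator *)

Section FlippedDiagonal.
Variables (R : realType) (I : choiceType).
Local Notation H := (l2 R I).
Implicit Types (u v w : H) (x y : I) (F : I -> I) (n : I -> R).

(* F is meant to be an involution that preserves n. *)
Definition flip_diag n F : unbounded R I :=
  [set p : H * H | forall x, p.2 x = (n x)%:C * p.1 (F x)].

Definition flipw F (c : I -> R[i]) : H -> H := wshift (fun x => Some (F x)) c.

Lemma flip_pinv F : involutive F -> pinv (Some \o F) (Some \o F).
Proof. by move=> Fi x y; split=> -[<-]; rewrite /= Fi. Qed.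

Lemma flipwE F c u x : involutive F -> bdd c -> flipw F c u x = c x * u (F x).
Proof. by move=> Fi bc; rewrite (wshiftE (flip_pinv Fi)). Qed.

Lemma bounded_flipw F c : involutive F -> bdd c -> bounded_op (flipw F c).
Proof. by move=> Fi; exact: (bounded_wshift (flip_pinv Fi)). Qed.

Lemma hnorm_flipw F c (C : R) u : involutive F -> 0 <= C -> (forall x, nm (c x) <= C) ->
  hnorm (flipw F c u) <= C * hnorm u.
Proof.
move=> Fi C0 hC; apply: hnorm_le => [|J]; first by rewrite mulr_ge0// hnorm_ge0.
apply: le_trans (wshift_sum (flip_pinv Fi) u J hC).
rewrite le_eqVlt; apply/orP; left; apply/eqP; apply: eq_bigr => x _.
by rewrite flipwE//; exists C.
Qed.

Lemma conj_real (a : R) : (a%:C)^*%R = a%:C :> R[i].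
Proof. by rewrite conj_Creal// complex_real. Qed.

Section Fixed.
Variables (n : I -> R) (F : I -> I).
Hypotheses (Fi : involutive F) (nF : forall x, n (F x) = n x) (n1 : forall x, 1 <= n x).
Local Notation D := (flip_diag n F).

Let n0 x : 0 < n x. Proof. exact: lt_le_trans ltr01 (n1 x). Qed.
Let nC x : (n x)%:C != 0. Proof. by rewrite eq_complex /= eqxx andbT gt_eqF. Qed.

Definition flip_basis x : H := (n x)%:C *: l2_delta R (F x).

Lemma flip_diag_delta x : D (l2_delta R x, flip_basis x).
Proof.
move=> y; change ((n x)%:C * (y == F x)%:R = (n y)%:C * (F y == x)%:R).
case: (eqVneq y (F x)) => [->|yx]; first by rewrite nF Fi eqxx.
by rewrite (_ : (F y == x) = false) ?mulr0//; apply: contraNF yx => /eqP <-; rewrite Fi.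
Qed.

Lemma flip_diag_adjoint_basis :
  graph_adjoint (range (fun x => (l2_delta R x, flip_basis x))) = D.
Proof.
apply/seteqP; split=> [[u v] h x|[u v] h _ [x _ <-]] /=.
  have := h _ (ex_intro2 _ _ x Logic.I erefl); rewrite /= /flip_basis innerZl conj_real.
  by rewrite !inner_deltal.
by rewrite /flip_basis innerZl conj_real !inner_deltal; exact: esym (h x).
Qed.

Lemma flip_diag_sym u v u' v' : D (u, v) -> D (u', v') -> inner v' u = inner u' v.
Proof.
move=> h h'; apply/esym; have := innerP v' u => hs1; apply: innerE.
apply: (@hs_reindex _ _ _ _ _ (Some \o F) (Some \o F) _ _ _ _ hs1) => [|x|x].
- exact: flip_pinv.
- by rewrite /= (h' x) (h (F x)) Fi nF rmorphM /= conj_real -mulrA mulrCA !mulrA.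
- by rewrite /= (h' (F x)) (h x) Fi nF rmorphM /= conj_real mulrCA !mulrA.
Qed.

(** The basis pairs lie in D and their adjoint is already D; since taking adjoints reverses
    inclusions, the adjoint of D is contained in D. The converse is symmetry. *)
Lemma flip_diag_adjoint : graph_adjoint D = D.
Proof.
apply/seteqP; split=> [p h|[u v] h [u' v'] h'] /=; last exact: flip_diag_sym.
rewrite -{1}flip_diag_adjoint_basis => _ [x _ <-]; apply: h.
exact: flip_diag_delta.
Qed.

Lemma flip_diag_closed : closed_op_of_basis flip_basis = D.
Proof.
by rewrite /closed_op_of_basis flip_diag_adjoint_basis flip_diag_adjoint.
Qed.

Lemma flip_diag_selfadjoint : selfadjoint D.
Proof.
split; last exact: flip_diag_adjoint.
move=> w h; apply: l2_ext => x; have := h _ (flip_diag_delta x).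
by rewrite /= inner_deltal.
Qed.

Lemma bdd_real (c : I -> R) (C : R) : (forall x, `|c x| <= C) -> bdd (fun x => (c x)%:C).
Proof. by move=> h; exists C => x; rewrite nm_real. Qed.

Let ninv x : `|(n x)^-1| <= 1.
Proof. by rewrite ger0_norm ?invr_ge0 ?(ltW (n0 _))// invf_le1. Qed.

Let binv : bdd (fun x => ((n x)^-1)%:C : R[i]). Proof. exact: bdd_real ninv. Qed.

Let nVC x : ((n x)^-1)%:C = ((n x)%:C)^-1 :> R[i].
Proof. by rewrite fmorphV. Qed.

Lemma flip_diag_inverse u v : D (u, v) <-> u = flipw F (fun x => ((n x)^-1)%:C) v.
Proof.
split=> [h|-> x]; last first.
  by rewrite /= flipwE// Fi nF nVC mulrA divff// mul1r.
by apply: l2_ext => x; rewrite flipwE// (h (F x)) Fi nF nVC mulrA mulVf// mul1r.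
Qed.

Lemma flip_diag_sqr : graph_comp D D = flip_diag (fun x => n x ^+ 2) id.
Proof.
apply/seteqP; split=> [[u v] [w [h1 h2]] x|[u v] h] /=.
  by have /= -> := h2 x; rewrite /= (h1 (F x)) /= nF Fi expr2 rmorphM mulrA.
exists (flipw F (fun x => ((n x)^-1)%:C) v); split=> x /=.
  by rewrite flipwE// (h (F x)) /= nF nVC expr2 rmorphM /= mulrA mulKf.
by rewrite flipwE// Fi nF nVC mulrA divff// mul1r.
Qed.

End Fixed.
End FlippedDiagonal.

(** * Modulus, complex powers and resolvent *)

Section Modulus.
Variables (R : realType) (I : choiceType).
Local Notation H := (l2 R I).
Implicit Types (u v w : H) (x y : I) (F : I -> I) (n : I -> R).
Implicit Types (P : unbounded R I).

Lemma adjoint_anti P P' : P `<=` P' -> graph_adjoint P' `<=` graph_adjoint P.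
Proof. by move=> PP' p h x /PP'; exact: h. Qed.

(** A self-adjoint graph is an adjoint, and adjoints are linear subspaces. *)
Lemma selfadjoint_lin P a u v u' v' : selfadjoint P -> P (u, v) -> P (u', v') ->
  P (a *: u + u', a *: v + v').
Proof.
move=> [_ eP] h h'; rewrite -eP => x Px.
rewrite -eP in h h'; have e := h _ Px; have e' := h' _ Px.
by rewrite /= !innerDr !innerZr; congr (_ * _ + _).
Qed.

Lemma inner_self_le0 u : inner u (- u) >= 0 -> u = 0.
Proof.
move=> h; apply: inner_self_eq0; have [e _] := inner_selfP u.
move: h; rewrite innerNr oppr_ge0 e lecR => h.
congr (_%:C); apply: le_anti; rewrite h; exact: inner_self_ge0.
Qed.

Section Fixed.
Variables (n : I -> R) (F : I -> I).
Hypotheses (Fi : involutive F) (nF : forall x, n (F x) = n x) (n1 : forall x, 1 <= n x).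
Local Notation D := (flip_diag n F).
Local Notation L := (flip_diag n id).

Let n0 x : 0 < n x. Proof. exact: lt_le_trans ltr01 (n1 x). Qed.
Let idi : involutive (@id I). Proof. by []. Qed.
Let nid x : n (id x) = n x. Proof. by []. Qed.

Lemma flip_diag_positive : positive L.
Proof.
move=> [u v] h /=.
have e : hs (fun x => (n x * nm (u x) ^+ 2)%:C) (inner u v).
  apply: eq_hs (innerP u v) => x; rewrite (h x) mulrCA conj_mul_self -realCM.
  by [].
have [-> _] := hs_nneg (fun x => mulr_ge0 (ltW (n0 x)) (sqr_ge0 _)) e.
have [_ /(_ fset0)] := hs_nneg (fun x => mulr_ge0 (ltW (n0 x)) (sqr_ge0 _)) e.
by rewrite big_seq_fset0 lecR.
Qed.

(** Uniqueness of the positive root without spectral theory: if P e = w and P w = n^2 e for a basis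
    vector e, then y = w - n e satisfies P y = - n y, and positivity of P forces y = 0. So P agrees
    with [L] on the basis. *)
Lemma modulus_flip_diag : modulus D = L.
Proof.
have DD := flip_diag_sqr Fi nF n1; have LL := flip_diag_sqr idi nid n1.
have aD : graph_adjoint D = D by exact: flip_diag_adjoint.
apply: xget_unique.
  split; [exact: flip_diag_selfadjoint|exact: flip_diag_positive|].
  by rewrite aD LL DD.
move=> P [sP pP PP]; rewrite aD DD in PP.
have Pd x : P (l2_delta R x, flip_basis n id x).
  have : graph_comp P P (l2_delta R x, (n x ^+ 2)%:C *: l2_delta R x).
    rewrite PP => y; change ((n x ^+ 2)%:C * (y == x)%:R = (n y ^+ 2)%:C * (y == x)%:R :> R[i]).
    by case: eqVneq => [->|]; rewrite ?mulr0.
  move=> [w [/= h1 h2]].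
  have := selfadjoint_lin (- (n x)%:C) sP h1 h2.
  set y := _ *: _ + w; set z := _ *: w + _.
  have -> : z = - (n x)%:C *: y.
    by rewrite /y /z; move: (l2_delta R x) w {h1 h2 y z} => a b; apply: l2_ext => k;
      rewrite !l2E; ring.
  move=> /pP /=; rewrite innerZr => hy.
  have y0 : y = 0.
    apply: inner_self_le0; rewrite innerNr.
    move: hy; have [-> _] := inner_selfP y.
    rewrite -!rmorphN -realCM !lecR mulNr !oppr_ge0.
    by rewrite pmulr_rle0.
  have -> : flip_basis n id x = w; last by [].
  apply: l2_ext => k; have := congr1 (fun v : H => v k) y0.
  rewrite /y /flip_basis !l2E => /eqP; rewrite addrC mulNr subr_eq0 => /eqP.
  by move=> ->.
(* P contains the basis pairs of [L], whose adjoint is [L]; taking adjoints gives one inclusion, and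
   taking adjoints of that inclusion gives the other. *)
have PL : P `<=` L.
  case: sP => _ <-; rewrite -(flip_diag_adjoint_basis n id).
  by apply: adjoint_anti => _ [x _ <-].
apply/seteqP; split => //; case: (sP) => _ <-.
by rewrite -[X in X `<=` _](flip_diag_adjoint idi nid); exact: adjoint_anti.
Qed.

Definition power_symbol (z : R[i]) x : R[i] := cpower (n x) z.

Lemma nm_cpower (t : R) z : nm (cpower t z) = expR (complex.Re z * ln t).
Proof.
rewrite /cpower nmM nm_real ger0_norm ?expR_ge0//.
by rewrite /Normc.normc cos2Dsin2 sqrtr1 mulr1.
Qed.

Lemma bdd_power z : complex.Re z <= 0 -> bdd (power_symbol z).
Proof.
move=> z0; exists 1 => x; rewrite nm_cpower -expR0 ler_expR.
by rewrite mulr_le0_ge0// ln_ge0.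
Qed.

Lemma op_power_flip_diag z : complex.Re z <= 0 ->
  op_power L z = flipw id (power_symbol z).
Proof.
move=> z0; have bz := bdd_power z0.
have bQ : bounded_op (flipw id (power_symbol z)) by exact: bounded_flipw.
apply: xget_unique => [|Q [bdQ hQ]].
  split => // t u t0 h; apply: l2_ext => x; rewrite flipwE// l2_scaleE.
  have := h x; change (t%:C * u x = (n x)%:C * u x -> power_symbol z x * u x = cpower t z * u x).
  (* An eigenvector for [t] is supported on the indices where [n] takes the value [t]. *)
  move=> /eqP; rewrite -subr_eq0 -mulrBl mulf_eq0 => /orP[|/eqP->]; last by rewrite !mulr0.
  rewrite subr_eq0 /power_symbol => /eqP/(congr1 (@complex.Re R)) /= ->.
  by [].
apply: bounded_op_ext => // x; rewrite (hQ (n x) _ (n0 x)).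
  apply: l2_ext => y; rewrite flipwE//.
  change (cpower (n x) z * (y == x)%:R = cpower (n y) z * (y == x)%:R).
  by case: eqVneq => [->|]; rewrite ?mulr0.
exact: (flip_diag_delta idi nid).
Qed.

Lemma flip_diag_add u v u' v' : D (u, v) -> D (u', v') -> D (u + u', v + v').
Proof. by move=> h h' x; rewrite l2_addE (h x) (h' x) mulrDr. Qed.

Lemma flip_diag_inj u v v' : D (u, v) -> D (u, v') -> v = v'.
Proof. by move=> h h'; apply: l2_ext => x; rewrite (h x) (h' x). Qed.

Lemma commutatorD T T' S S' : is_commutator D T S -> is_commutator D T' S' ->
  is_commutator D (fun u => T u + T' u) (fun u => S u + S' u).
Proof.
move=> [bS hS] [bS' hS']; split; first exact: bounded_opD.
by move=> u v h; rewrite addrACA; apply: flip_diag_add; [exact: hS|exact: hS'].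
Qed.

Lemma commutator_uniq T S S' : is_commutator D T S -> is_commutator D T S' -> S = S'.
Proof.
move=> [bS hS] [bS' hS']; apply: bounded_op_ext => // x.
have Dx := flip_diag_delta Fi nF x.
by have /addrI := flip_diag_inj (hS _ _ Dx) (hS' _ _ Dx).
Qed.

(** (D - i) (D^2 + 1)^(-1), which is (D + i)^(-1). *)
Definition resolvent u := flipw F (fun x => (n x / (n x ^+ 2 + 1))%:C) u +
  flipw id (fun x => - 'i * ((n x ^+ 2 + 1)^-1)%:C) u.

Let m0 x : 0 < n x ^+ 2 + 1. Proof. by rewrite ltr_wpDl// sqr_ge0. Qed.
Let mC x : (n x ^+ 2 + 1)%:C != 0 :> R[i].
Proof. by rewrite eq_complex /= eqxx andbT gt_eqF. Qed.

Lemma resolvent_coef1 x : nm (n x / (n x ^+ 2 + 1))%:C <= (n x)^-1.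
Proof.
rewrite nm_real ger0_norm ?divr_ge0 ?(ltW (m0 x)) ?(ltW (n0 x))//.
by rewrite ler_pdivrMr// mulrDr expr2 mulrA mulVf ?gt_eqF// mul1r lerDl mulr1 invr_ge0 ltW.
Qed.

Lemma resolvent_coef2 x : nm (- 'i * ((n x ^+ 2 + 1)^-1)%:C) <= (n x)^-1.
Proof.
rewrite nmM nmN nm_real ger0_norm ?invr_ge0 ?(ltW (m0 x))//.
have -> : nm ('i : R[i]) = 1.
  apply/eqP; rewrite -(@pexpr_eq1 _ _ 2) ?nm_ge0//.
  by rewrite -nmX sqr_i nmN nm1.
rewrite mul1r lef_pV2 ?posrE//; apply: (@le_trans _ _ (n x ^+ 2)); last by rewrite lerDl.
by rewrite expr2 ler_peMr// ltW.
Qed.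

Let c1 : bdd (fun x => (n x / (n x ^+ 2 + 1))%:C : R[i]).
Proof. by exists 1 => x; apply: le_trans (resolvent_coef1 x) _; rewrite invf_le1. Qed.
Let c2 : bdd (fun x => - 'i * ((n x ^+ 2 + 1)^-1)%:C : R[i]).
Proof. by exists 1 => x; apply: le_trans (resolvent_coef2 x) _; rewrite invf_le1. Qed.

Lemma resolventE u x : resolvent u x =
  ((n x)%:C * u (F x) - 'i * u x) / (n x ^+ 2 + 1)%:C.
Proof. by rewrite /resolvent l2_addE !flipwE// realCM fmorphV /=; ring. Qed.

Lemma resolvent_graph u v : D (u, v) <-> u = resolvent (v + 'i *: u).
Proof.
have ii : 'i * 'i = -1 :> R[i] by rewrite -expr2 sqr_i.
have nC2 x : (n x ^+ 2 + 1)%:C = (n x)%:C ^+ 2 + 1 :> R[i].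
  by rewrite -realCD rmorphXn.
split=> [h|h x].
  apply: l2_ext => x; rewrite resolventE !l2E (h x) (h (F x)) Fi nF.
  apply/eqP; rewrite eq_sym; apply/eqP; apply: (canLR (mulfK (mC x))).
  rewrite nC2; change ((n x)%:C * ((n x)%:C * u x + 'i * u (F x)) -
    'i * ((n x)%:C * u (F x) + 'i * u x) = u x * ((n x)%:C ^+ 2 + 1)).
  move: (u x) (u (F x)) (n x)%:C => a b k; apply/eqP; rewrite -subr_eq0.
  have -> : k * (k * a + 'i * b) - 'i * (k * b + 'i * a) - a * (k ^+ 2 + 1) =
    - ('i * 'i + 1) * a by ring.
  by rewrite ii addNr oppr0 mul0r.
have hx : u x = resolvent (v + 'i *: u) x by exact: (congr1 (fun w : H => w x) h).
have hFx : u (F x) = resolvent (v + 'i *: u) (F x) by exact: (congr1 (fun w : H => w (F x)) h).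
rewrite resolventE !l2E in hx; rewrite resolventE !l2E nF Fi in hFx.
have : u x * (n x ^+ 2 + 1)%:C = (n x)%:C * (v (F x) + 'i * u (F x)) - 'i * (v x + 'i * u x).
  by rewrite [X in X * _]hx divfK.
have : u (F x) * (n x ^+ 2 + 1)%:C = (n x)%:C * (v x + 'i * u x) - 'i * (v (F x) + 'i * u (F x)).
  by rewrite [X in X * _]hFx divfK.
change (u (F x) * (n x ^+ 2 + 1)%:C = (n x)%:C * (v x + 'i * u x) - 'i * (v (F x) + 'i * u (F x)) ->
  u x * (n x ^+ 2 + 1)%:C = (n x)%:C * (v (F x) + 'i * u (F x)) - 'i * (v x + 'i * u x) ->
  v x = (n x)%:C * u (F x)).
move=> {hx hFx}.
have m0' := mC x; rewrite nC2 in m0' *.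
move: (u x) (u (F x)) (v x) (v (F x)) (n x)%:C m0' => a b c d k m0'.
move=> /eqP; rewrite -subr_eq0 => /eqP e2 /eqP; rewrite -subr_eq0 => /eqP e1.
have : (k ^+ 2 + 1) * (k * b - c) = k * (b * (k ^+ 2 + 1) - (k * (c + 'i * a) - 'i * (d + 'i * b)))
  + 'i * (a * (k ^+ 2 + 1) - (k * (d + 'i * b) - 'i * (c + 'i * a)))
  + (1 + 'i * 'i) * (k * b - c - k * b - 'i * a) by ring.
rewrite e1 e2 ii !mulr0 subrr mul0r !addr0 => /eqP.
by rewrite mulf_eq0 (negbTE m0') /= subr_eq0 => /eqP.
Qed.

Lemma bounded_resolvent : bounded_op resolvent.
Proof. by apply: bounded_opD; exact: bounded_flipw. Qed.

Lemma resolvent_truncation (J : {fset I}) (e : R) u : 0 < e ->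
  (forall x, x \notin J -> 4 / e <= n x) -> hnorm u <= 1 ->
  hnorm (resolvent u - truncate J (resolvent u)) <= e.
Proof.
move=> e0 hJ u1.
pose b1 x : R[i] := if x \in J then 0 else (n x / (n x ^+ 2 + 1))%:C.
pose b2 x : R[i] := if x \in J then 0 else - 'i * ((n x ^+ 2 + 1)^-1)%:C.
(* Outside [J] both parts of the resolvent have norm at most e/4, and [hnormD] doubles their sum. *)
have e40 : 0 <= e / 4 by rewrite divr_ge0// ltW.
have small x : x \notin J -> (n x)^-1 <= e / 4.
  by move=> /hJ h; rewrite -[leRHS]invrK lef_pV2 ?posrE ?invr_gt0 ?divr_gt0// invf_div.
have h1 x : nm (b1 x) <= e / 4.
  rewrite /b1; case: ifPn => [_|/small]; first by rewrite nm0.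
  exact: le_trans (resolvent_coef1 x).
have h2 x : nm (b2 x) <= e / 4.
  rewrite /b2; case: ifPn => [_|/small]; first by rewrite nm0.
  exact: le_trans (resolvent_coef2 x).
have -> : resolvent u - truncate J (resolvent u) = flipw F b1 u + flipw id b2 u.
  apply: l2_ext => x; rewrite l2_addE l2_oppE truncateE l2_addE.
  rewrite !flipwE//; [|by exists (e / 4)|by exists (e / 4)].
  rewrite /b1 /b2; case: ifPn => _; first by rewrite subrr !mul0r addr0.
  by rewrite subr0 /resolvent l2_addE !flipwE.
apply: le_trans (hnormD _ _) _.
have k1 := hnorm_flipw u Fi e40 h1; have k2 := hnorm_flipw u idi e40 h2.
have k3 : e / 4 * hnorm u <= e / 4 by rewrite ler_piMr.
have -> : e = 2 * (e / 4 + e / 4) by field.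
by rewrite ler_wpM2l// lerD// (le_trans _ k3).
Qed.

End Fixed.
End Modulus.

(** * Compactness by truncation *)

Section CompactOperators.
Variables (R : realType) (I : choiceType).
Local Notation H := (l2 R I).
Implicit Types (u v w : H) (x : I) (J : seq I).

Lemma real_net (B e : R) : 0 < e ->
  exists s : seq R, forall t, `|t| <= B -> exists2 c, c \in s & `|t - c| <= e.
Proof.
move=> e0; exists [seq k%:R * e - B | k <- iota 0 (Num.truncn (2 * B / e)).+1] => t.
rewrite ler_norml => /andP[t1 t2].
have tB : 0 <= (t + B) / e by rewrite divr_ge0 ?(ltW e0)//; lra.
have /andP[k1 k2] := Num.Theory.truncn_itv tB; set k := Num.truncn _ in k1 k2.
exists (k%:R * e - B).
  apply/mapP; exists k => //; rewrite mem_iota add0n ltnS.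
  apply: Num.Theory.le_truncn; rewrite ler_pM2r ?invr_gt0//; lra.
move: k1 k2; rewrite ler_pdivlMr// ltr_pdivrMr// -natr1 mulrDl mul1r => k1 k2.
by rewrite ler_norml; apply/andP; split; lra.
Qed.

Lemma complex_net (B e : R) : 0 < e ->
  exists s : seq R[i], forall t, nm t <= B -> exists2 c, c \in s & nm (t - c) <= e.
Proof.
move=> e0; have [s hs] := real_net B (divr_gt0 e0 (ltr0n _ 2)).
exists [seq (a +i* b) | a <- s, b <- s] => t tB.
have [a sa ha] := hs _ (le_trans (nm_Re t) tB).
have [b sb hb] := hs _ (le_trans (nm_Im t) tB).
exists (a +i* b); first by apply/allpairsP; exists (a, b).
apply: le_trans (nm_ReIm _) _; rewrite ReD ReN ImD ImN /=.
by rewrite [leRHS]splitr lerD.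
Qed.

Lemma finite_net J (B e : R) : 0 < e -> exists ws : seq H, forall v,
  (forall x, nm (v x) <= B) -> exists2 w, w \in ws &
    (forall x, x \notin J -> w x = 0) /\ forall x, x \in J -> nm (v x - w x) <= e.
Proof.
move=> e0; elim: J => [|x J [ws IH]].
  by exists [:: 0] => v _; exists 0; rewrite ?mem_head//; split=> // x _.
have [s hs] := complex_net B e0.
exists [seq w + (c - w x) *: l2_delta R x | w <- ws, c <- s] => v hv.
have [w hw [w0 we]] := IH v hv; have [c hc ce] := hs _ (hv x).
exists (w + (c - w x) *: l2_delta R x); first by apply/allpairsP; exists (w, c).
split=> y; rewrite in_cons !l2E.
  by rewrite negb_or => /andP[/negbTE-> /w0->]; rewrite mulr0 addr0.
case: eqVneq => [-> _|_ /we]; last by rewrite mulr0 addr0.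
by rewrite mulr1 [w x + _]addrC subrK.
Qed.

Lemma hnorm_supported (J : {fset I}) v (e : R) : 0 <= e -> (forall x, x \notin J -> v x = 0) ->
  (forall x, x \in J -> nm (v x) <= e) -> hnorm v <= e * (#|` J|.+1)%:R.
Proof.
move=> e0 v0 ve; apply: hnorm_le => [|K]; first by rewrite mulr_ge0.
have hv : inner v v = (\sum_(i <- J) nm (v i) ^+ 2)%:C.
  rewrite -realC_sum; apply: innerE.
  rewrite (eq_bigr (fun i => (v i)^*%R * v i)); last by move=> i _; rewrite conj_mul_self.
  by apply: hs_fin => i /v0->; rewrite mulr0.
apply: le_trans (hnorm_sum v K) _; rewrite hnorm_sqr hv /=.
apply: (@le_trans _ _ (\sum_(i <- J) e ^+ 2)).
  rewrite !big_seq; apply: ler_sum => i iJ.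
  by rewrite lerXn2r ?nnegrE ?nm_ge0// ve.
rewrite big_const_seq count_predT iter_addr_0 -[leLHS]mulr_natr exprMn.
apply: ler_wpM2l; first exact: sqr_ge0.
by rewrite -natrX ler_nat (@leq_trans (#|` J|.+1))// expnS expn1 leq_pmulr.
Qed.

(** On the unit ball the operator is uniformly close to its truncations, and a truncation takes
    bounded values in finitely many coordinates, where a finite grid is a net. *)
Lemma compact_truncation (T : H -> H) : bounded_op T ->
  (forall e : R, 0 < e -> exists J : {fset I}, forall u, hnorm u <= 1 ->
    hnorm (T u - truncate J (T u)) <= e) -> compact_op T.
Proof.
move=> bT h; split=> // e e0; have /bounded_opP[_ [M M0 hM]] := bT.
have e8 : 0 < e / 8 by rewrite divr_gt0.
have [J hJ] := h _ e8; set k : R := (#|` J|.+1)%:R.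
have k0 : 0 < k by rewrite ltr0n.
(* A mesh of e/(8k) per coordinate gives norm at most e/8 on [J]; with the truncation error and the
   factor 2 of [hnormD] the total is at most e/2. *)
have [ws hws] := finite_net J M (divr_gt0 e8 k0).
exists ws => u u1; have [|w wws [w0 we]] := hws (T u).
  move=> x; apply: le_trans (nm_coord _ _) _; apply: le_trans (hM u) _.
  by rewrite ler_piMr.
exists w => //; rewrite -(subrK (truncate J (T u)) (T u)) -addrA.
apply: le_lt_trans (hnormD _ _) _.
have h2 : hnorm (truncate J (T u) - w) <= e / 8.
  rewrite -[leRHS](divfK (negbT (gt_eqF k0))); apply: hnorm_supported.
  - by rewrite divr_ge0// ltW.
  - by move=> x xJ; rewrite l2_addE l2_oppE truncateE (negbTE xJ) w0// subr0.
  - by move=> x xJ; rewrite l2_addE l2_oppE truncateE xJ; exact: we.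
have := hJ u u1; move: h2; move: (hnorm _) (hnorm _) => a b; lra.
Qed.

End CompactOperators.

Section DiracOperator.
Variables (R : realType) (q s : R) (N : rat).
Hypotheses (q0 : 0 < q) (q1 : q < 1) (N_half_int : 2 * N \is a Num.int) (N_neq0 : N != 0).
Local Notation I := (ket_index N).
Local Notation H := (l2 R I).
Implicit Types (x y : I) (u v w : H) (d : dvec) (c : I -> R[i]).

Definition flipped : dvec := (0, 0, true).
Definition flip x : I := odflt x (phi flipped x).

Lemma phi_flip x : phi flipped x = Some (flip x).
Proof.
rewrite /flip; case e: (phi flipped x) => [//|].
by exfalso; have := phi_None N_neq0 e; rewrite /flipped /=; lia.
Qed.

Lemma flipK : involutive flip.
Proof.
move=> x; have := phi_flip (flip x); rewrite (phi_comp _ (phi_flip x)).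
by rewrite -[dadd _ _]/d0 phi_d0 => -[].
Qed.

Lemma flip_coords x : [/\ jx (flip x) = jx x, kx (flip x) = kx x, lev (flip x) = lev x &
  pos (flip x) = ~~ pos x].
Proof. by have := phi_coords N_neq0 (phi_flip x) => -[/= *]; split => //; lia. Qed.

Definition lw x : R := (lev x).+1%:R.

Lemma lw_ge1 x : 1 <= lw x. Proof. by rewrite ler1n. Qed.

Lemma lw_flip x : lw (flip x) = lw x.
Proof. by rewrite /lw; have [_ _ ->] := flip_coords x. Qed.

Local Notation D := (@podles_D R N).
Local Notation D' := (flip_diag lw flip).
Local Notation absD := (flip_diag lw id).

Lemma podles_DE : D = D'.
Proof.
rewrite -(flip_diag_closed flipK lw_flip) /podles_D.
congr closed_op_of_basis; apply/funext => x; rewrite /flip_basis.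
have [_ _ hl _] := ketP N_neq0 x; have := phi_flip x; rewrite /phi /shf /lw.
case: (val x) hl => [[l m] M] /= hl; rewrite !addr0 /ket => ->.
by rewrite hl rmorphD /= ratr_nat rmorph1 natr1.
Qed.

Lemma modulus_podles_D : modulus D = absD.
Proof. by rewrite podles_DE modulus_flip_diag//; [exact: flipK|exact: lw_flip|exact: lw_ge1]. Qed.

(** Inverse of the coordinates; [None] unless j + k - 2|N| is an even natural number. *)
Definition mk_ket (b : bool) (j k : nat) : option I :=
  insub ((j%:R + k%:R) / 2, (j%:R - k%:R) / 2, if b then `|N| else - `|N|).

Lemma mk_ketE x : mk_ket (pos x) (jx x) (kx x) = Some x.
Proof.
rewrite /mk_ket -[RHS]valK; congr insub; rewrite [RHS]val_ketE//.
by have [<- <- _ _] := ketP N_neq0 x; congr (_, _, _); field.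
Qed.

Lemma mk_ketP b (j k n : nat) : (j + k = n.*2 + nu N)%N ->
  exists2 x, mk_ket b j k = Some x & [/\ jx x = j, kx x = k, lev x = n & pos x = b].
Proof.
move=> e; have nuN := nuE N_half_int.
have hl : (j%:R + k%:R) / 2 - `|N| = n%:R :> rat.
  by rewrite -natrD e natrD -muln2 natrM nuN; field.
have hj : (j%:R + k%:R) / 2 + (j%:R - k%:R) / 2 = j%:R :> rat by field.
have hk : (j%:R + k%:R) / 2 - (j%:R - k%:R) / 2 = k%:R :> rat by field.
have h : is_ket N ((j%:R + k%:R) / 2, (j%:R - k%:R) / 2, if b then `|N| else - `|N|).
  by rewrite is_ketE// hl hj hk !natr_nat.
exists (Sub _ h); first by rewrite /mk_ket insubT.
rewrite /jx /kx /lev /pos !SubK /= hl hj hk !natrK; split => //.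
by case: b {h}; rewrite ?oppr_gt0 ?normr_gt0 ?normr_lt0.
Qed.

Lemma coords_bounded (t : R) : exists B, forall x, lw x < t -> (jx x < B)%N /\ (kx x < B)%N.
Proof.
exists ((Num.truncn t).+1.*2 + nu N).+1 => x tx.
have e := jk_lev N_half_int N_neq0 x.
have l : (lev x < (Num.truncn t).+1)%N.
  rewrite -(ltr_nat R); apply: lt_trans (Num.Theory.truncnS_gt t); apply: lt_trans tx.
  by rewrite /lw ltr_nat.
by split; lia.
Qed.

Lemma finite_levels (t : R) : exists J : {fset I}, forall x, x \notin J -> t <= lw x.
Proof.
have [B hB] := coords_bounded t.
exists [fset x in pmap id [seq mk_ket b jk.1 jk.2 | b <- [:: true; false],
  jk <- [seq (j, k) | j <- iota 0 B, k <- iota 0 B]]]%fset => x.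
rewrite inE => xJ; rewrite leNgt; apply: contra xJ => /hB[jB kB].
rewrite mem_pmap; apply/mapP; exists (Some x) => //.
rewrite -mk_ketE; apply/allpairsP; exists (pos x, (jx x, kx x)); split => //.
  by rewrite !inE; case: pos.
by apply/allpairsP; exists (jx x, kx x); rewrite !mem_iota !add0n.
Qed.

Local Notation r1 := (Num.sqrt q).
Local Notation rho := (Num.sqrt r1).

Let r10 : 0 < r1. Proof. by rewrite sqrtr_gt0. Qed.
Let r11 : r1 < 1. Proof. by rewrite -sqrtr1 ltr_sqrt. Qed.
Let rho0 : 0 < rho. Proof. by rewrite sqrtr_gt0. Qed.
Let rho1 : rho < 1. Proof. by rewrite -sqrtr1 ltr_sqrt. Qed.
Let r1E : r1 = rho ^+ 2. Proof. by rewrite sqr_sqrtr// ltW. Qed.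
Let r1_rho : r1 <= rho.
Proof. by rewrite [leLHS]r1E expr2 ler_piMr// ltW. Qed.

Let r1X n : r1 ^+ n = rho ^+ n * rho ^+ n.
Proof. by rewrite -exprMn -expr2 sqr_sqrtr// ltW. Qed.

(** 1 - t^n is 1 - t times a sum of n powers of t, each of them at least t^n. *)
Lemma nat_mul_geometric (t : R) n : 0 < t -> t < 1 -> n%:R * t ^+ n * (1 - t) <= 1 - t ^+ n.
Proof.
move=> t0 t1; elim: n => [|n IH]; first by rewrite !mul0r expr0 subrr.
have tn : t ^+ n.+1 <= 1 by rewrite exprn_ile1 ?ltW.
have tn0 : 0 <= t ^+ n.+1 by rewrite exprn_ge0// ltW.
have := ler_wpM2l (ltW t0) IH; rewrite -natr1 !exprS in tn tn0 *.
move: (t ^+ n) (n%:R : R) tn tn0 => a k tn tn0 h; nra.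
Qed.

(** The weight of [D, T] for the shift T: it is lw(x) c(flip x) - lw(y) c(x), where y is the shifted
    index and lw(y) = lw(x) + d.1.1. *)
Definition dirac_symbol d c x : R[i] :=
  (lw x)%:C * (c (flip x) - c x) - d.1.1%:~R * c x.

(** The weights at M and -M differ by O(r1^(j+k)), and r1 = rho^2: one factor rho^(j+k) absorbs the
    eigenvalue [lw], the other one remains as the decay. *)
Lemma sym_dirac d c : symA r1 c -> sym rho (dirac_symbol d c).
Proof.
move=> [hc [C C0 hC]]; have hc' := sym_mono r10 r1_rho hc.
have hcst (a : R[i]) : sym (N := N) rho (fun=> a) by exact: (symA_cst N_half_int N_neq0 rho0 rho1 a).1.
suff h1 : sym rho (fun x => (lw x)%:C * (c (flip x) - c x)).
  rewrite (_ : dirac_symbol d c = fun x => (lw x)%:C * (c (flip x) - c x) + (- d.1.1%:~R) * c x).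
    by apply: symD => //; apply: symM.
  by apply/funext => x; rewrite /dirac_symbol mulNr.
pose E := C * ((1 - rho)^-1 + 1).
have d0 : 0 < 1 - rho by rewrite subr_gt0.
suff : symA rho (fun x => (lw x)%:C * (c (flip x) - c x)) by case.
apply: (@symA_near_cst _ _ N_half_int N_neq0 _ rho0 rho1 _ 0 E).
  by rewrite mulr_ge0// addr_ge0// invr_ge0 ltW.
move=> x; rewrite subr0 nmM nm_real ger0_norm ?ler0n//.
apply: le_trans (ler_wpM2l _ (hC _ _ (phi_flip x))) _; first exact: ler0n.
set n := (jx x + kx x)%N; rewrite r1X /E.
have g := nat_mul_geometric n rho0 rho1.
have p0 : 0 <= rho ^+ n by rewrite exprn_ge0// ltW.
have p1 : rho ^+ n <= 1 by rewrite exprn_ile1// ltW.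
have ln : lw x <= n%:R + 1.
  by rewrite natr1 /lw ler_nat ltnS /n (jk_lev N_half_int N_neq0) -addnn -addnA leq_addr.
have h : (n%:R + 1) * rho ^+ n <= (1 - rho)^-1 + 1.
  rewrite mulrDl mul1r lerD// -[leRHS]mul1r ler_pdivlMr//.
  by apply: le_trans g _; rewrite gerBl.
move: (rho ^+ n) (lw x) ((1 - rho)^-1 + 1) p0 ln h => p l E' p0 ln h.
have -> : l * (C * (p * p)) = C * (l * p) * p by ring.
rewrite ler_wpM2r// ler_wpM2l//; apply: le_trans h.
by rewrite ler_wpM2r.
Qed.

Lemma wshiftE_phi d c u x : bdd c -> wshift (phi d) c u x = c x * oapp u 0 (phi d x).
Proof. exact: wshift_phiE. Qed.

Lemma lw_shift d x y : phi d x = Some y -> (lw y)%:C = (lw x)%:C + d.1.1%:~R :> R[i].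
Proof.
move=> /(phi_coords N_neq0)[_ _ e _]; rewrite /lw !realCn.
rewrite -[(lev y).+1%:R]natr1 -[(lev x).+1%:R]natr1 -addrA [1 + _]addrC addrA.
by congr (_ + 1); rewrite -[LHS]/((lev y)%:~R) e intrD.
Qed.

Lemma commutator_abs_shift d c : bdd c ->
  is_commutator absD (wshift (phi d) c) (wshift (phi d) (fun x => - d.1.1%:~R * c x)).
Proof.
move=> bc; have bc' : bdd (fun x => - d.1.1%:~R * c x).
  have [C hC] := bc; exists (nm (- d.1.1%:~R : R[i]) * C) => x.
  by rewrite nmM ler_wpM2l// nm_ge0.
split; first exact: (bounded_wshift (@phi_pinv N d)).
move=> u v h x; change ((wshift (phi d) c v + wshift (phi d) (fun x => - d.1.1%:~R * c x) u) x =
  (lw x)%:C * wshift (phi d) c u x).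
rewrite l2_addE !(wshiftE_phi _ _ _ bc, wshiftE_phi _ _ _ bc').
case e: (phi d x) => [y|]; last by rewrite /= !mulr0 addr0.
have hy : v y = (lw y)%:C * u y := h y.
have -> : oapp v 0 (Some y) = (lw y)%:C * u y by [].
rewrite (lw_shift e); move: (oapp u 0 (Some y) : R[i]) (erefl (u y) : oapp u 0 (Some y) = u y).
by move=> _ ->; ring.
Qed.

Lemma phi_flip_comm d x : phi d (flip x) = phi (dadd d flipped) x.
Proof.
rewrite (phi_comp _ (phi_flip x)); congr phi; case: d => [[a b] f].
by rewrite /dadd /= !add0r !addr0 addbC.
Qed.

Lemma commutator_D_shift d c : d.2 = false -> symA r1 c ->
  is_commutator D' (wshift (phi d) c) (wshift (phi (dadd d flipped)) (dirac_symbol d c)).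
Proof.
move=> d2 hc; have bc : bdd c by case: hc => /sym_bdd.
have bc' : bdd (dirac_symbol d c) by exact: sym_bdd (sym_dirac d hc).
split; first exact: (bounded_wshift (@phi_pinv N _)).
move=> u v h x; change ((wshift (phi d) c v + wshift (phi (dadd d flipped)) (dirac_symbol d c) u) x =
  (lw x)%:C * wshift (phi d) c u (flip x)).
rewrite l2_addE !(wshiftE_phi _ _ _ bc, wshiftE_phi _ _ _ bc').
rewrite phi_flip_comm.
case e: (phi d x) => [y|].
  rewrite -(phi_comp _ e) phi_flip.
  have -> : oapp v 0 (Some y) = (lw y)%:C * u (flip y) by exact: (h y).
  have -> : oapp u 0 (Some (flip y)) = u (flip y) by [].
  rewrite (lw_shift e) /dirac_symbol; move: (u (flip y)) (c x) (c (flip x)) => a b b'; ring.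
case e': (phi (dadd d flipped) x) => [z|]; last by rewrite /= !mulr0 addr0.
have := phi_comp flipped e'; rewrite phi_flip.
have -> : dadd (dadd d flipped) flipped = d.
  by case: (d) => [[a b] f]; rewrite /dadd /= !addr0; case: f.
by rewrite e.
Qed.

Local Notation GP := (@symbols R N rho).
Local Notation GA := (@flip_symbols R N r1).

Lemma class_GP : band_class GP.
Proof. exact: class_symbols. Qed.

Lemma band_GA_GP T : bandop GA T -> bandop GP T.
Proof.
elim=> [d c [_ [hc _]]|S S' _ h _ h']; last exact: band_add.
by apply: band_shift; exact: sym_mono r1_rho hc.
Qed.

Lemma band_commutator_abs T : bandop GP T ->
  exists2 S, bandop GP S & is_commutator (modulus D) T S.
Proof.
rewrite modulus_podles_D; elim=> [d c hc|S S' _ [T1 h1 c1] _ [T2 h2 c2]].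
  eexists; last exact: (commutator_abs_shift d (sym_bdd hc)).
  apply: band_shift; apply: symM => //.
  by case: (symA_cst (R := R) N_half_int N_neq0 rho0 rho1 (- d.1.1%:~R)).
by exists (fun u => T1 u + T2 u); [exact: band_add|exact: commutatorD].
Qed.

Lemma band_commutator_D T : bandop GA T -> exists2 S, bandop GP S & is_commutator D T S.
Proof.
rewrite podles_DE; elim=> [d c [d2 hc]|S S' _ [T1 h1 c1] _ [T2 h2 c2]].
  eexists; last exact: (commutator_D_shift d2 hc).
  by apply: band_shift; exact: sym_dirac.
by exists (fun u => T1 u + T2 u); [exact: band_add|exact: commutatorD].
Qed.

Local Notation rep := (@podles_rep R q s N).

Lemma commutator_abs_uniq T S S' : is_commutator (modulus D) T S ->
  is_commutator (modulus D) T S' -> S = S'.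
Proof. by rewrite modulus_podles_D; apply: commutator_uniq => // x; exact: lw_ge1. Qed.

Lemma commutator_D_uniq T S S' : is_commutator D T S -> is_commutator D T S' -> S = S'.
Proof.
rewrite podles_DE.
by apply: commutator_uniq => [|x]; [exact: flipK|exact: lw_flip].
Qed.

Lemma base_ops_band T : base_ops rep D T -> bandop GP T.
Proof.
have b a := band_rep q0 q1 N_half_int N_neq0 a.
case=> [[a ->]|[a hT]]; first exact: band_GA_GP.
by have [S hS /(commutator_D_uniq hT)->] := band_commutator_D (b _ a).
Qed.

(** Existence gives regularity. Uniqueness is needed as well, because [Psi0] admits every [S] that
    satisfies [delta_iter], not only the one constructed here. *)
Lemma delta_iter_band k T : bandop GP T -> exists2 S, bandop GP S &
  delta_iter D k T S /\ forall S', delta_iter D k T S' -> S' = S.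
Proof.
move=> hT; elim: k => [|k [S hS [h1 h2]]] /=; first by exists T.
have [S' hS' c'] := band_commutator_abs hS; exists S' => //; split; first by exists S.
by move=> S'' [S1 /h2 ->] h; exact: commutator_abs_uniq h c'.
Qed.

Lemma podles_regular : regular_triple rep D.
Proof. by move=> T /base_ops_band hT k; have [S _ [h _]] := delta_iter_band k hT; exists S. Qed.

Lemma Psi0_band T : Psi0 rep D T -> bandop GP T.
Proof.
elim=> [k S S' /base_ops_band hS h|S S' _ h _ h'|c S _ h|S S' _ h _ h'].
- by have [S1 hS1 [_ /(_ _ h)->]] := delta_iter_band k hS.
- exact: band_add.
- exact: (band_scale class_GP).
- exact: (band_comp class_GP).
Qed.

Lemma podles_invertible_D : invertible_D D.
Proof.
rewrite podles_DE; exists (flipw flip (fun x => ((lw x)^-1)%:C)).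
  apply: bounded_flipw; first exact: flipK.
  exists 1 => x; rewrite nm_real ger0_norm ?invr_ge0 ?ler0n// invf_le1 ?ltr0n//.
  exact: lw_ge1.
by move=> u v; apply: flip_diag_inverse; [exact: flipK|exact: lw_flip|exact: lw_ge1].
Qed.

Lemma podles_spectral_triple : spectral_triple (@podles_star R q s) rep D.
Proof.
split.
- exact: podles_star_representation.
- by rewrite podles_DE; apply: flip_diag_selfadjoint; [exact: flipK|exact: lw_flip].
- move=> a; have [S _ h] := band_commutator_D (band_rep q0 q1 N_half_int N_neq0 a).
  by exists S.
- rewrite podles_DE; exists (resolvent lw flip); last first.
    by move=> u v; apply: resolvent_graph; [exact: flipK|exact: lw_flip|exact: lw_ge1].
  apply: compact_truncation.
    by apply: bounded_resolvent; [exact: flipK|exact: lw_ge1].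
  move=> e e0; have [J hJ] := finite_levels (4 / e); exists J => u u1.
  by apply: resolvent_truncation => //; [exact: flipK|exact: lw_ge1].
Qed.

(** The test says M = N, for either sign of N. *)
Definition chirality x : R[i] := if pos x == (0 < N) then -1 else 1.

Let b_chi : bdd chirality.
Proof. by exists 1 => x; rewrite /chirality; case: eqP; rewrite ?nmN nm1. Qed.

Lemma podles_gammaE : @podles_gamma R N = flipw id chirality.
Proof.
apply: op_of_basisE; first exact: bounded_flipw.
move=> x; have e : val x = ((val x).1.1, (val x).1.2, (val x).2) by case: (val x) => [[]].
rewrite e /ket -e valK; apply: l2_ext => y; rewrite flipwE// l2_scaleE.
have -> : (if (val x).2 == - N then 1 else -1) = chirality x.
  have [_ _ _ ->] := ketP N_neq0 x; rewrite /chirality.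
  have N2 : (N == - N) = false.
    by rewrite -addr_eq0 -mulr2n mulrn_eq0 /= (negbTE N_neq0).
  case: (boolP (0 < N)) => n0.
    by rewrite (gtr0_norm n0); case: pos; rewrite ?eqxx// N2.
  have n1 : N < 0 by rewrite lt_neqAle N_neq0 leNgt.
  by rewrite (ltr0_norm n1); case: pos; rewrite ?opprK ?eqxx// N2.
rewrite l2_deltaE; case: eqVneq => [->|]; last by rewrite !mulr0.
by [].
Qed.

Lemma chirality_sqr x : chirality x * chirality x = 1.
Proof. by rewrite /chirality; case: eqP; rewrite ?mulrNN mulr1. Qed.

Lemma podles_even : even_spectral_triple (@podles_star R q s) rep D (@podles_gamma R N).
Proof.
rewrite podles_gammaE; have gE u x : flipw id chirality u x = chirality x * u x by rewrite flipwE.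
split.
- exact: podles_spectral_triple.
- exact: bounded_flipw.
- move=> u v; apply: innerE; apply: eq_hs (innerP u (flipw id chirality v)) => x.
  rewrite !gE rmorphM /=; have -> : (chirality x)^*%R = chirality x.
    by rewrite /chirality; case: eqP; rewrite ?rmorphN1 ?rmorph1.
  by rewrite mulrCA mulrA.
- by move=> u; apply: l2_ext => x; rewrite !gE mulrA chirality_sqr mul1r.
- move=> a; elim: (band_rep q0 q1 N_half_int N_neq0 a) => [d c [d2 [hs _]]|S S' _ h _ h'].
    have bc := sym_bdd hs.
    apply/funext => u; apply: l2_ext => x; rewrite /= gE !wshiftE_phi// mulrCA.
    case e: (phi d x) => [y|]; last by rewrite /= !mulr0.
    have -> : oapp (flipw id chirality u) 0 (Some y) = chirality y * u y by exact: gE.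
    have [_ _ _ yp] := phi_coords N_neq0 e; rewrite /chirality yp d2 /=.
    by [].
  apply/funext => u; apply: l2_ext => x; have hu := congr1 (fun f => f u) h.
  have hu' := congr1 (fun f => f u) h'; rewrite /= in hu hu' *.
  rewrite gE; change (chirality x * (S u x + S' u x) =
    S (flipw id chirality u) x + S' (flipw id chirality u) x).
  by rewrite -hu -hu' !gE mulrDr.
- move=> u v; rewrite podles_DE => h x.
  change (- (flipw id chirality v x) = (lw x)%:C * flipw id chirality u (flip x)).
  have hx : v x = (lw x)%:C * u (flip x) := h x; rewrite !gE hx.
  have -> : chirality (flip x) = - chirality x.
    by rewrite /chirality; have [_ _ _ ->] := flip_coords x; case: pos; case: (0 < N); rewrite ?opprK.
  ring.
Qed.

End DiracOperator.

(** * Traces on levels *)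

Section GeometricRates.
Variable R : realType.
Implicit Types (t : R) (x : nat -> R[i]) (a b : R[i]).

(** Every factor n + 1 is paid for by the root of the current rate, and the other root is left for
    the remaining factors. *)
Lemma poly_geometric M t : 0 < t -> t < 1 ->
  exists2 C : R, 0 <= C & forall n, n.+1%:R ^+ M * t ^+ n <= C.
Proof.
elim: M t => [|M IH] t t0 t1.
  by exists 1 => // n; rewrite expr0 mul1r exprn_ile1 ?ltW.
have s0 : 0 < Num.sqrt t by rewrite sqrtr_gt0.
have s1 : Num.sqrt t < 1 by rewrite -sqrtr1 ltr_sqrt.
have [C C0 hC] := IH _ s0 s1; have d0 : 0 < 1 - Num.sqrt t by rewrite subr_gt0.
exists (((1 - Num.sqrt t)^-1 + 1) * C) => [|n].
  by rewrite mulr_ge0// addr_ge0// invr_ge0 ltW.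
have -> : t ^+ n = Num.sqrt t ^+ n * Num.sqrt t ^+ n.
  by rewrite -exprMn -expr2 sqr_sqrtr// ltW.
have g := nat_mul_geometric n s0 s1.
have p0 : 0 <= Num.sqrt t ^+ n by rewrite exprn_ge0// ltW.
have p1 : Num.sqrt t ^+ n <= 1 by rewrite exprn_ile1// ltW.
have h : n.+1%:R * Num.sqrt t ^+ n <= (1 - Num.sqrt t)^-1 + 1.
  rewrite -natr1 mulrDl mul1r lerD// -[leRHS]mul1r ler_pdivlMr//.
  by apply: le_trans g _; rewrite gerBl.
by rewrite exprS mulrACA ler_pM ?hC ?mulr_ge0 ?exprn_ge0.
Qed.

Lemma cl_geometric x t (C : R) : 0 < t -> t < 1 ->
  (forall n, nm (x n.+1 - x n) <= C * t ^+ n) ->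
  exists b, exists2 E : R, 0 <= E & forall n, nm (x n - b) <= E * t ^+ n.
Proof.
move=> t0 t1 h; have d0 : 0 < 1 - t by rewrite subr_gt0.
have C0 : 0 <= C by have := le_trans (nm_ge0 _) (h 0); rewrite expr0 mulr1.
have step (n k : nat) : nm (x (n + k)%N - x n) <= C / (1 - t) * t ^+ n * (1 - t ^+ k).
  elim: k => [|k IH]; first by rewrite addn0 !subrr nm0 mulr0.
  rewrite addnS -(subrKA (x (n + k)%N)).
  apply: le_trans (nmD _ _) (le_trans (lerD (h _) IH) _).
  rewrite exprD exprS le_eqVlt; apply/orP; left; apply/eqP; field.
  by rewrite gt_eqF.
have [D _ hD] := poly_geometric 2 t0 t1.
have [v hv] : exists v, hs (fun n => x n.+1 - x n) v.
  apply: (@hs_ex _ _ _ (C * D * 2)); apply: asum_inv_sq => n.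
  apply: le_trans (h n) _; rewrite -mulrA ler_wpM2l// ler_pdivlMr ?exprn_gt0 ?ltr0n//.
  by rewrite mulrC.
exists (x 0 + v), (C / (1 - t)) => [|n]; first by rewrite divr_ge0// ltW.
apply/ler_addgt0Pr => e e0; have [N hN] := hs_cl hv e0.
have eN : \sum_(k < (n + N)%N) (x k.+1 - x k) = x (n + N)%N - x 0.
  by rewrite -(big_mkord xpredT (fun k => x k.+1 - x k)) telescope_sumr.
have := hN (n + N)%N (leq_addl _ _); rewrite eN => hb.
have -> : x n - (x 0 + v) = (x (n + N)%N - x 0 - v) + (x n - x (n + N)%N) by ring.
rewrite addrC; apply: le_trans (nmD _ _) _; rewrite lerD ?(ltW hb)//.
rewrite nm_distC; apply: le_trans (step n N) _.
rewrite ler_piMr ?gerBl ?exprn_ge0 ?(ltW t0)//.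
by rewrite mulr_ge0 ?divr_ge0 ?exprn_ge0 ?(ltW t0) ?(ltW d0).
Qed.

(** [cl_geometric] is used twice: L tends to some a, so that s n - a n has geometrically small
    increments and tends to some b. *)
Lemma affine_geometric (s L : nat -> R[i]) t (C : R) : 0 < t -> t < 1 ->
  (forall n, nm (s n.+1 - s n - L n) <= C * t ^+ n) ->
  (forall n, nm (L n.+1 - L n) <= C * t ^+ n) ->
  exists a b, exists2 E : R, 0 <= E &
    forall n, nm (s n - (a * n%:R + b)) <= E * t ^+ n.
Proof.
move=> t0 t1 hs hL; have [a [E E0 hE]] := cl_geometric t0 t1 hL.
have [|b [E' E0' hE']] := @cl_geometric (fun n => s n - a * n%:R) t (C + E) t0 t1.
  move=> n; rewrite -natr1.
  have -> : s n.+1 - a * (n%:R + 1) - (s n - a * n%:R) = (s n.+1 - s n - L n) + (L n - a) by ring.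
  by apply: le_trans (nmD _ _) _; rewrite mulrDl lerD.
by exists a, b, E' => // n; rewrite opprD addrA.
Qed.

End GeometricRates.

Lemma sum_ord_add (V : nmodType) (F : nat -> V) a b :
  \sum_(i < a + b) F i = \sum_(i < a) F i + \sum_(i < b) F (a + i)%N.
Proof. by rewrite big_split_ord. Qed.

(** * Growth of the sums over one level *)

Section LevelSums.
Variables (R : realType) (N : rat).
Hypotheses (N_half_int : 2 * N \is a Num.int) (N_neq0 : N != 0).
Local Notation I := (ket_index N).
Local Notation nu := (nu N).
Implicit Types (x y : I).

Definition branch (V : nmodType) (g : I -> V) b j k : V := oapp g 0 (@mk_ket N b j k).

Definition branch_sum (V : nmodType) (g : I -> V) b n : V :=
  \sum_(j < (n.*2 + nu).+1) branch g b j (n.*2 + nu - j).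

Definition level_sum (V : nmodType) (g : I -> V) n : V :=
  branch_sum g true n + branch_sum g false n.

(** A branch gains two kets from level n to level n + 1. The kets with j <= n are matched with those
    of the same j, the others with those of the same k. In each pair the coordinate that changes is
    at least n, so the weights differ by O(r^n). The two unmatched kets in the middle contribute a
    convergent sequence, the slope. Since O(n) pairs occur, the rate drops to sqrt r. *)
Lemma branch_sum_affine r (t : I -> R[i]) b : 0 < r -> r < 1 -> sym r t ->
  exists a c, exists2 E : R, 0 <= E &
    forall n, nm (branch_sum t b n - (a * n%:R + c)) <= E * Num.sqrt r ^+ n.
Proof.
move=> r0 r1 [C [C0 hC hJ hK]].
have s0 : 0 < Num.sqrt r by rewrite sqrtr_gt0.
have s1 : Num.sqrt r < 1 by rewrite -sqrtr1 ltr_sqrt.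
pose f := branch t b; pose sg := Num.sqrt r.
have rX n k : (n <= k)%N -> r ^+ k <= r ^+ n by move=> h; rewrite ler_wiXn2l// ltW.
have fJ j k k' n n' m : (j + k = n.*2 + nu)%N -> (j + k' = n'.*2 + nu)%N ->
    (m <= k)%N -> (m <= k')%N -> nm (f j k - f j k') <= C * (2 * r ^+ m).
  move=> e e' mk mk'; rewrite /f /branch.
  have [x -> [xj xk _ xp]] := mk_ketP N_half_int N_neq0 b e.
  have [y -> [yj yk _ yp]] := mk_ketP N_half_int N_neq0 b e'.
  rewrite /=; apply: le_trans (hJ x y _ _) _; rewrite ?xp ?yp ?xj ?yj//.
  by rewrite ler_wpM2l// xk yk mulr_natl mulr2n lerD// rX.
have fK j j' k n n' m : (j + k = n.*2 + nu)%N -> (j' + k = n'.*2 + nu)%N ->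
    (m <= j)%N -> (m <= j')%N -> nm (f j k - f j' k) <= C * (2 * r ^+ m).
  move=> e e' mj mj'; rewrite /f /branch.
  have [x -> [xj xk _ xp]] := mk_ketP N_half_int N_neq0 b e.
  have [y -> [yj yk _ yp]] := mk_ketP N_half_int N_neq0 b e'.
  rewrite /=; apply: le_trans (hK x y _ _) _; rewrite ?xp ?yp ?xk ?yk//.
  by rewrite ler_wpM2l// xj yj mulr_natl mulr2n lerD// rX.
(* The two kets of level n + 1 that have no partner on level n. *)
pose L n := f n.+1 (n + nu).+1 + f n.+2 (n + nu)%N.
have [D D0 hD] := poly_geometric 1 s0 s1.
have rs n : r ^+ n = sg ^+ n * sg ^+ n by rewrite -exprMn -expr2 sqr_sqrtr// ltW.
have sgn0 n : 0 <= sg ^+ n by rewrite exprn_ge0// ltW.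
have sgn1 n : sg ^+ n <= 1 by rewrite exprn_ile1 ?ltW.
have nu0 : (0 : R) <= nu%:R by [].
(* The term with [D] bounds the number of pairs times sg^n; the extra 2 takes care of the increments
   of [L]. *)
pose E := (C * 2) * ((2 + nu%:R) * D + 2).
have CE : C * 2 * 2 <= E.
  by rewrite /E ler_wpM2l ?mulr_ge0// lerDr mulr_ge0 ?addr_ge0.
have hL n : nm (L n.+1 - L n) <= E * sg ^+ n.
  rewrite /L; have -> : f n.+2 (n.+1 + nu).+1 + f n.+3 (n.+1 + nu)%N -
    (f n.+1 (n + nu).+1 + f n.+2 (n + nu)%N) =
    (f n.+2 (n.+1 + nu).+1 - f n.+2 (n + nu)%N) + (f n.+3 (n.+1 + nu)%N - f n.+1 (n + nu).+1).
    by rewrite addSn; ring.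
  have h1 : nm (f n.+2 (n.+1 + nu).+1 - f n.+2 (n + nu)%N) <= C * (2 * r ^+ n).
    by apply: (fJ _ _ _ n.+2 n.+1); clear; lia.
  have h2 : nm (f n.+3 (n.+1 + nu)%N - f n.+1 (n + nu).+1) <= C * (2 * r ^+ n).
    by rewrite addSn; apply: (fK _ _ _ n.+2 n.+1); clear; lia.
  apply: le_trans (nmD _ _) (le_trans (lerD h1 h2) _).
  have -> : C * (2 * r ^+ n) + C * (2 * r ^+ n) = C * 2 * 2 * r ^+ n by ring.
  by apply: ler_pM; rewrite ?mulr_ge0 ?exprn_ge0 ?(ltW r0)// rs ler_piMr.
apply: (@affine_geometric R _ L sg E s0 s1) => // n.
set m := (n.*2 + nu)%N; have mn : (m = n + (n + nu))%N by rewrite /m -addnn addnA.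
have mS : (n.+1.*2 + nu = m.+2)%N by rewrite doubleS.
have e1 : branch_sum t b n = \sum_(j < n.+1) f j (m - j)%N +
    \sum_(i < (n + nu)%N) f (n.+1 + i)%N (n + nu - i.+1)%N.
  pose F j := f j (m - j)%N.
  have -> : branch_sum t b n = \sum_(j < m.+1) F j by [].
  rewrite (_ : m.+1 = n.+1 + (n + nu))%N; last by rewrite /m; clear; lia.
  rewrite sum_ord_add; congr (_ + _).
  apply: eq_bigr => i _; rewrite /F; congr (f _ _); have := ltn_ord i.
  by rewrite /m; move: (nat_of_ord i); clear; lia.
have e2 : branch_sum t b n.+1 = \sum_(j < n.+1) f j (m.+2 - j)%N + L n +
    \sum_(i < (n + nu)%N) f (n.+3 + i)%N (n + nu - i.+1)%N.
  pose F j := f j (m.+2 - j)%N.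
  have -> : branch_sum t b n.+1 = \sum_(j < m.+3) F j by rewrite /branch_sum mS.
  rewrite (_ : m.+3 = n.+1 + (2 + (n + nu)))%N; last by rewrite /m; clear; lia.
  rewrite sum_ord_add -addrA; congr (_ + _).
  rewrite (sum_ord_add (fun j => F (n.+1 + j)%N)) big_ord_recl big_ord1; congr (_ + _ + _).
  - by rewrite /F /=; congr (f _ _); rewrite /m; clear; lia.
  - by rewrite /F /=; congr (f _ _); rewrite /m /bump /=; clear; lia.
  - apply: eq_bigr => i _; rewrite /F; congr (f _ _); have := ltn_ord i;
      rewrite /m; move: (nat_of_ord i); clear; lia.
rewrite e1 e2.
set A1 := \sum_(j < n.+1) _; set A2 := \sum_(i < _) _; set B1 := \sum_(j < n.+1) _;
  set B2 := \sum_(i < _) _.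
have -> : A1 + L n + A2 - (B1 + B2) - L n = (A1 - B1) + (A2 - B2) by ring.
have h1 : nm (A1 - B1) <= n.+1%:R * (C * (2 * r ^+ n)).
  rewrite /A1 /B1 -sumrB; apply: le_trans (nm_sum _ _ _) _.
  apply: (@le_trans _ _ (\sum_(j < n.+1) C * (2 * r ^+ n))).
    apply: ler_sum => j _; apply: (fJ _ _ _ n.+1 n); have := ltn_ord j; rewrite /m; move: (nat_of_ord j); clear; lia.
  by rewrite sumr_const card_ord -[leLHS]mulr_natl.
have h2 : nm (A2 - B2) <= (n + nu)%:R * (C * (2 * r ^+ n)).
  rewrite /A2 /B2 -sumrB; apply: le_trans (nm_sum _ _ _) _.
  apply: (@le_trans _ _ (\sum_(j < n + nu) C * (2 * r ^+ n))).
    apply: ler_sum => j _; apply: (fK _ _ _ n.+1 n); have := ltn_ord j; move: (nat_of_ord j); clear; lia.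
  by rewrite sumr_const card_ord -[leLHS]mulr_natl.
apply: le_trans (nmD _ _) (le_trans (lerD h1 h2) _).
have k := hD n; rewrite expr1 in k.
rewrite -mulrDl rs -natrD.
have kk : (n.+1 + (n + nu))%:R * sg ^+ n <= (2 + nu%:R) * D.
  apply: (@le_trans _ _ ((2 + nu%:R) * (n.+1%:R * sg ^+ n))); last by rewrite ler_wpM2l ?addr_ge0.
  rewrite mulrA ler_wpM2r// -(natrD R 2) -natrM ler_nat; move: nu; clear; lia.
move: (sg ^+ n) (sgn0 n) kk => p p0; rewrite /E.
move: (_%:R) ((2 + nu%:R) * D) => w w' kk.
have -> : w * (C * (2 * (p * p))) = C * 2 * (w * p) * p by ring.
rewrite ler_wpM2r// ler_wpM2l ?mulr_ge0//.
by apply: le_trans kk _; rewrite lerDl.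
Qed.

End LevelSums.

Section LevelSummation.
Variables (R : realType) (N : rat).
Hypotheses (N_half_int : 2 * N \is a Num.int) (N_neq0 : N != 0).
Local Notation I := (ket_index N).
Local Notation nu := (nu N).
Implicit Types (x y : I) (L n : nat).

(** The guard matters: beyond it the truncated subtraction gives k = 0, possibly a ket of a higher
    level. *)
Definition level_ket (z : bool * (nat * nat)) : option I :=
  if (z.2.2 <= z.2.1.*2 + nu)%N then mk_ket N z.1 z.2.2 (z.2.1.*2 + nu - z.2.2) else None.

Lemma level_ketK : ocancel level_ket (fun x => (pos x, (lev x, jx x))).
Proof.
case=> b [n j]; rewrite /level_ket /=; case: ifP => //= h.
by have [x -> [xj _ xl xp]] := mk_ketP N_half_int N_neq0 b (subnKC h); rewrite /= xj xl xp.
Qed.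

Lemma level_ketE x : level_ket (pos x, (lev x, jx x)) = Some x.
Proof.
have e := jk_lev N_half_int N_neq0 x; rewrite /level_ket /= -e leq_addr addKn.
exact: (mk_ketE N_neq0).
Qed.

(** j runs over the range of the levels below L at once; [level_ket] discards the surplus. *)
Definition triples L := [seq (b, nj) | b <- [:: true; false],
  nj <- [seq (n, j) | n <- iota 0 L, j <- iota 0 (L.*2 + nu).+1]].

Lemma triples_uniq L : uniq (triples L).
Proof.
by apply: allpairs_uniq => [//||[? ?] [? ?] _ _ //]; apply: allpairs_uniq => [||[? ?] [? ?] _ _ //];
  exact: iota_uniq.
Qed.

Definition levels_below L : {fset I} := [fset x in pmap level_ket (triples L)]%fset.

Lemma mem_levels_below L x : (x \in levels_below L) = (lev x < L)%N.
Proof.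
rewrite inE mem_pmap; apply/mapP/idP => [[[b [n j]]]|xL].
  move=> /allpairsP[[b' [n' j']] [_ h [-> -> ->]]] /esym e.
  move: h => /allpairsP[[n'' j''] [h _ [en ej]]].
  have := level_ketK (b', (n', j')); rewrite e => -[_ -> _]; rewrite en.
  by move: h; rewrite mem_iota add0n.
exists (pos x, (lev x, jx x)); last by rewrite level_ketE.
apply/allpairsP; exists (pos x, (lev x, jx x)); split => //; first by rewrite !inE; case: pos.
apply/allpairsP; exists (lev x, jx x); rewrite !mem_iota !add0n; split => //=.
have := jk_lev N_half_int N_neq0 x; move: (jx x) (kx x) (lev x) xL => j k l; clear; lia.
Qed.

Lemma sum_levels_below (V : nmodType) (g : I -> V) L :
  \sum_(x <- levels_below L) g x = \sum_(n < L) level_sum g n.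
Proof.
rewrite (perm_big (pmap level_ket (triples L))); last first.
  apply: uniq_perm; rewrite ?fset_uniq ?(pmap_uniq level_ketK) ?triples_uniq//.
  by move=> x; rewrite inE.
transitivity (\sum_(z <- triples L) oapp g 0 (level_ket z)); first exact: big_pmap.
transitivity (\sum_(b <- [:: true; false]) \sum_(n <- iota 0 L)
    \sum_(j <- iota 0 (L.*2 + nu).+1) oapp g 0 (level_ket (b, (n, j)))).
  by rewrite big_allpairs; apply: eq_bigr => b _; rewrite big_allpairs.
rewrite !big_cons big_nil addr0 -big_split /=.
rewrite -(big_mkord xpredT (level_sum g)) /index_iota subn0.
rewrite big_seq [RHS]big_seq; apply: eq_bigr => n; rewrite mem_iota add0n => nL.
have H b : \sum_(j <- iota 0 (L.*2 + nu).+1) oapp g 0 (level_ket (b, (n, j))) =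
    branch_sum g b n.
  have -> : ((L.*2 + nu).+1 = (n.*2 + nu).+1 + (L - n).*2)%N by move: nL; clear; lia.
  have {1}-> m : iota 0 m = index_iota 0 m by rewrite /index_iota subn0.
  rewrite big_mkord (sum_ord_add (fun j => oapp g 0 (level_ket (b, (n, j))))).
  rewrite [X in _ + X]big1 ?addr0 => [|j _]; last first.
    by rewrite /level_ket /= leqNgt ltnS leq_addr.
  by apply: eq_bigr => j _; rewrite /level_ket /branch /= -ltnS ltn_ord.
by rewrite /level_sum -!H.
Qed.

Lemma level_sum_le (g : I -> R) (h : nat -> R) n : (forall x, lev x = n -> g x <= h n) ->
  0 <= h n -> level_sum g n <= 2 * (n.*2 + nu).+1%:R * h n.
Proof.
move=> gh h0.
have B b : branch_sum g b n <= (n.*2 + nu).+1%:R * h n.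
  apply: (@le_trans _ _ (\sum_(j < (n.*2 + nu).+1) h n)); last first.
    by rewrite sumr_const card_ord -[leLHS]mulr_natl.
  apply: ler_sum => j _; rewrite /branch; case e: mk_ket => [x|] //=.
  apply: gh; have jn : (j <= n.*2 + nu)%N by rewrite -ltnS ltn_ord.
  by have [y] := mk_ketP N_half_int N_neq0 b (subnKC jn); rewrite e => -[->] [].
by rewrite /level_sum -mulrA mulr_natl mulr2n lerD.
Qed.

Lemma inv_sq_sum_ord L : \sum_(n < L) (n.+1%:R ^- 2 : R) <= 2.
Proof.
rewrite -(big_mkord xpredT (fun n => n.+1%:R ^- 2 : R)) /index_iota subn0.
rewrite -(perm_big _ (_ : perm_eq [fset n in iota 0 L]%fset _)) ?inv_sq_sum//.
by apply: uniq_perm; rewrite ?fset_uniq ?iota_uniq// => n; rewrite inE.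
Qed.

(** A level has O(n) kets, so its contribution is O(n^(-3)), which is summable. *)
Lemma asum_levels (g : I -> R[i]) (C : R) : 0 <= C ->
  (forall x, nm (g x) <= C * (lev x).+1%:R ^- 4) ->
  asum_le g (2 * (2 + nu%:R) * C * 2).
Proof.
move=> C0 hg J; pose L := (\max_(x <- J) (lev x).+1)%N.
have JL : (J `<=` levels_below L)%fset.
  apply/fsubsetP => x xJ; rewrite mem_levels_below /L (big_rem x xJ) /=.
  exact: leq_maxl.
apply: le_trans (ler_sum_fsubset (fun x => nm_ge0 (g x)) JL) _.
rewrite sum_levels_below.
apply: (@le_trans _ _ (\sum_(n < L) 2 * (2 + nu%:R) * C * (n.+1%:R ^- 2))); last first.
  rewrite -mulr_sumr ler_wpM2l ?inv_sq_sum_ord// !mulr_ge0// addr_ge0//.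
apply: ler_sum => n _.
have a0 : (0 : R) < n.+1%:R by rewrite ltr0n.
have a1 : (1 : R) <= n.+1%:R by rewrite ler1n.
apply: le_trans (@level_sum_le _ (fun n => C * n.+1%:R ^- 4) n _ _) _.
- by move=> x <-.
- by rewrite mulr_ge0// invr_ge0 exprn_ge0.
have h : (n.*2 + nu).+1%:R <= (2 + nu%:R) * n.+1%:R :> R.
  by rewrite -(natrD R 2) -natrM ler_nat; move: nu; clear; lia.
rewrite -!mulrA ler_wpM2l//.
have -> : (2 + nu%:R) * (C * n.+1%:R ^- 2) = (2 + nu%:R) * n.+1%:R * (C * (n.+1%:R ^- 3)) :> R.
  by field; rewrite gt_eqF.
apply: ler_pM; rewrite ?mulr_ge0 ?invr_ge0 ?exprn_ge0//.
rewrite ler_wpM2l// lef_pV2 ?posrE ?exprn_gt0//.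
by rewrite [leRHS]exprS ler_peMl// exprn_ge0// ltW.
Qed.

Lemma hs_levels (g : I -> R[i]) v : hs g v -> cl (fun L => \sum_(n < L) level_sum g n) v.
Proof.
move=> h e e0; have [J hJ] := h _ e0.
exists (\max_(x <- J) (lev x).+1)%N => L JL; rewrite -sum_levels_below.
apply: hJ; apply/fsubsetP => x xJ; rewrite mem_levels_below.
by apply: leq_trans JL; rewrite (big_rem x xJ) /= leq_maxl.
Qed.

Lemma level_sumM (t : I -> R[i]) (w : nat -> R[i]) n :
  level_sum (fun x => t x * w (lev x)) n = level_sum t n * w n.
Proof.
rewrite /level_sum mulrDl; congr (_ + _); rewrite /branch_sum mulr_suml;
  apply: eq_bigr => j _; rewrite /branch;
  (have jn : (j <= n.*2 + nu)%N by rewrite -ltnS ltn_ord).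
  by have [y -> [_ _ /= -> _]] := mk_ketP N_half_int N_neq0 true (subnKC jn).
by have [y -> [_ _ /= -> _]] := mk_ketP N_half_int N_neq0 false (subnKC jn).
Qed.

Lemma hs_zeta_trace (t : I -> R[i]) (C : R) z : 0 <= C -> (forall x, nm (t x) <= C) ->
  4 <= complex.Re z -> exists2 v, hs (fun x => t x * npow (lev x).+1 z) v &
    cl (fun L => \sum_(n < L) level_sum t n * npow n.+1 z) v.
Proof.
move=> C0 ht z4.
have [v hv] : exists v, hs (fun x => t x * npow (lev x).+1 z) v.
  apply: hs_ex; apply: (@asum_levels _ C C0) => x.
  by rewrite nmM ler_pM ?nm_ge0// (@nm_npow_le _ _ 4).
exists v => //; apply: eq_cl (hs_levels hv) => L; apply: eq_bigr => n _.
by rewrite (level_sumM t (fun n => npow n.+1 z)).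
Qed.

Lemma level_sum_affine r (t : I -> R[i]) : 0 < r -> r < 1 -> sym r t ->
  exists a c, exists2 E : R, 0 <= E &
    forall n, nm (level_sum t n - (a * n%:R + c)) <= E * Num.sqrt r ^+ n.
Proof.
move=> r0 r1 ht.
have [a [c [E E0 h]]] := branch_sum_affine N_half_int N_neq0 true r0 r1 ht.
have [a' [c' [E' E0' h']]] := branch_sum_affine N_half_int N_neq0 false r0 r1 ht.
exists (a + a'), (c + c'), (E + E') => [|n]; first exact: addr_ge0.
have -> : level_sum t n - ((a + a') * n%:R + (c + c')) =
  (branch_sum t true n - (a * n%:R + c)) + (branch_sum t false n - (a' * n%:R + c')).
  by rewrite /level_sum; ring.
by apply: le_trans (nmD _ _) _; rewrite mulrDl lerD.
Qed.

Local Notation H := (l2 R I).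

Definition diagonal (T : H -> H) x : R[i] := T (l2_delta R x) x.

(** A displacement other than [d0] moves every ket and contributes nothing to the diagonal, so only
    the weights of trivial shifts remain. *)
Lemma band_diagonal r T : 0 < r -> r < 1 -> bandop (@symbols R N r) T -> sym r (diagonal T).
Proof.
move=> r0 r1; elim=> [d c hc|S S' _ h _ h']; last exact: symD.
have bc : bdd c := sym_bdd hc.
have [d0E|dn] := eqVneq d d0.
  rewrite (_ : diagonal _ = c)//; apply/funext => x.
  rewrite /diagonal wshift_phiE// d0E phi_d0.
  change (c x * (x == x)%:R = c x); by rewrite eqxx mulr1.
rewrite (_ : diagonal _ = fun=> 0).
  exact: (symA_cst (R := R) N_half_int N_neq0 r0 r1 0).1.
apply/funext => x; rewrite /diagonal wshift_phiE//.
case e: (phi d x) => [y|]; last by rewrite mulr0.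
change (c x * (y == x)%:R = 0); case: eqVneq => [yx|]; last by rewrite mulr0.
move: e dn; rewrite yx => /(phi_coords N_neq0).
case: d {hc} => [[a b] f] /= [h1 h2 h3 h4].
have -> : f = false by case: f h4; case: pos.
have -> : a = 0 by move: h3; clear; lia.
have -> : b = 0 by move: h1 h3; clear; lia.
by rewrite eqxx.
Qed.

Lemma cpower_npow n z : cpower (n%:R : R) (- z) = npow n z.
Proof.
rewrite /cpower /npow /cexp Re_mul_real Im_mul_real ReN ImN.
by rewrite !mulrN !mulNr.
Qed.

Lemma diagonal_power T z : 0 <= complex.Re z -> linear T ->
  forall x, inner (l2_delta R x) ((T \o op_power (flip_diag (@lw R N) id) (- z)) (l2_delta R x)) =
    diagonal T x * npow (lev x).+1 z.
Proof.
move=> z0 linT x; rewrite op_power_flip_diag; last by rewrite ReN oppr_le0.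
  rewrite inner_deltal /diagonal /=.
  have -> : flipw id (power_symbol (lw R (N := N)) (- z)) (l2_delta R x) =
      npow (lev x).+1 z *: l2_delta R x.
    apply: l2_ext => y; rewrite flipwE//; last first.
      apply: bdd_power => [w|]; [exact: lw_ge1|by rewrite ReN oppr_le0].
    change (cpower (lw R y) (- z) * (y == x)%:R = npow (lev x).+1 z * (y == x)%:R).
    by case: eqVneq => [->|]; rewrite ?mulr0// /lw cpower_npow.
  by rewrite (linZ linT) l2_scaleE mulrC.
exact: lw_ge1.
Qed.

End LevelSummation.

(** * Zeta functions and their poles *)

Section ZetaFunctions.
Variable R : realType.
Implicit Types (z w v a b c : R[i]) (n m : nat).

Lemma cl_unshift (u : nat -> R[i]) t : cl (fun n => u n.+1) t -> cl u t.
Proof. by move=> h e /h[N hN]; exists N.+1 => -[|n]// Nn; apply: hN. Qed.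

Lemma nm_npow_poly w : exists M, forall n, nm (npow n.+1 w : R[i]) <= n.+1%:R ^+ M.
Proof.
set M := (Num.truncn `|complex.Re w|).+1; exists M => n.
have n0 : (0 : R) < n.+1%:R ^+ M by rewrite exprn_gt0 ?ltr0n.
have : (0%:R : R) <= complex.Re (w + M%:R).
  rewrite ReD Re_nat; have := truncnS_gt `|complex.Re w|; rewrite -/M.
  have := ler_norm (- complex.Re w); rewrite normrN; lra.
move=> /(nm_npow_le n); rewrite expr0 invr1 npowD nmM npow_nat nm_real.
by rewrite ger0_norm ?invr_ge0 ?exprn_ge0// ler_pdivrMr// mul1r.
Qed.

Section GeometricRemainder.
Variables (e : nat -> R[i]) (E t : R).
Hypotheses (t0 : 0 < t) (t1 : t < 1) (E0 : 0 <= E) (he : forall n, nm (e n) <= E * t ^+ n).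

Lemma QD_rem w : exists C : R, forall n,
  QD (fun v => e n * npow n.+1 v) w (C * n.+1%:R ^- 2).
Proof.
(* In M + 5 the [M] bounds n^(-w), 3 is the loss in [QD_npow], and 2 leaves the summable n^(-2). *)
have [M hM] := nm_npow_poly w; have [C C0 hC] := poly_geometric (M + 5) t0 t1.
exists (16 * E * C) => n; apply: QD_le (QDZ (e n) (QD_npow n w)).
have n0 : (0 : R) < n.+1%:R by rewrite ltr0n.
rewrite ler_pdivlMr ?exprn_gt0//.
apply: (@le_trans _ _ (E * t ^+ n * (16 * (n.+1%:R ^+ 3 * n.+1%:R ^+ M)) * n.+1%:R ^+ 2)).
  rewrite ler_wpM2r ?exprn_ge0 ?(ltW n0)//.
  rewrite ler_pM ?nm_ge0 ?mulr_ge0 ?nm_ge0 ?exprn_ge0 ?(ltW n0)//.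
  by rewrite !ler_wpM2l ?exprn_ge0 ?(ltW n0).
have -> : E * t ^+ n * (16 * (n.+1%:R ^+ 3 * n.+1%:R ^+ M)) * n.+1%:R ^+ 2 =
  16 * E * (n.+1%:R ^+ (M + 5) * t ^+ n) :> R by rewrite exprD; ring.
by rewrite ler_wpM2l// mulr_ge0.
Qed.

Definition rem_sum z : R[i] := summability.sum (fun n => e n * npow n.+1 z : R[i]^o).

Lemma hs_rem_sum z : hs (fun n => e n * npow n.+1 z) (rem_sum z).
Proof.
have [C hC] := QD_rem z.
have [v hv] : exists v, hs (fun n => e n * npow n.+1 z) v.
  apply: (@hs_ex _ _ _ (C * 2)); apply: asum_inv_sq => n.
  by have [d []] := hC n.
by rewrite /rem_sum (hs_sumE hv).
Qed.

Lemma qderiv_rem_sum w : qderiv rem_sum w.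
Proof.
have [C hC] := QD_rem w.
have C0 : 0 <= C by have [d /Qd_ge0] := hC 0%N; rewrite expr1n invr1 mulr1.
apply: (QD_series (B := C * 2) hC) => [J|h _]; last exact: hs_rem_sum.
by rewrite -mulr_sumr ler_wpM2l// inv_sq_sum.
Qed.

End GeometricRemainder.

(* The continuation of z |-> c * sum_(n >= 1) n ^ -(z - m + 1). *)
Definition zterm c m z : R[i] := c * (1 + Zc (z - m%:R) / (z - m%:R)).

Lemma zterm_cl c m z : 1 <= complex.Re (z - m%:R) ->
  cl (fun L => \sum_(n < L) c * npow n.+1 (z - m%:R + 1)) (zterm c m z).
Proof.
rewrite /zterm; set v := z - m%:R => v1.
have v0 : v != 0 by apply: contraTneq v1 => ->; rewrite -ltNge ltr01.
have h : cl (fun L => \sum_(n < L) npow n.+1 (v + 1)) (1 + Zc v / v); last first.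
  by apply: eq_cl (clZ c h) => L; rewrite mulr_sumr.
(* [Zc] starts at n = 2; the first term of the zeta series is the 1 in [zterm]. *)
apply: cl_unshift; rewrite [X in 1 + X]mulrC.
apply: eq_cl (clD (cl_cst 1) (clZ v^-1 (Zc_cl v1))) => L.
rewrite big_ord_recl npow11; congr (_ + _); rewrite mulr_sumr.
by apply: eq_bigr => n _; rewrite mulKf.
Qed.

(** The second index of [zterm] is the place of the pole: a n n^(-z) = a n^(-(z-2)-1) and b n^(-z) =
    b n^(-(z-1)-1). *)
Definition zfun a b (e : nat -> R[i]) z : R[i] :=
  zterm a 2 z + zterm b 1 z + rem_sum e z.

Lemma zfun_cl a b (s : nat -> R[i]) (E t : R) z : 0 < t -> t < 1 -> 0 <= E ->
  (forall n, nm (s n - (a * n.+1%:R + b)) <= E * t ^+ n) -> 4 <= complex.Re z ->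
  cl (fun L => \sum_(n < L) s n * npow n.+1 z)
     (zfun a b (fun n => s n - (a * n.+1%:R + b)) z).
Proof.
move=> t0 t1 E0 he z4.
have h1 : 1 <= complex.Re (z - 2%:R) by rewrite ReD ReN Re_nat; lra.
have h2 : 1 <= complex.Re (z - 1%:R) by rewrite ReD ReN Re_nat; lra.
have h3 := hs_cl (hs_rem_sum t0 t1 E0 he z).
apply: eq_cl (clD (clD (zterm_cl a h1) (zterm_cl b h2)) h3) => L.
rewrite -!big_split; apply: eq_bigr => n _ /=.
rewrite subrK.
have -> : npow n.+1 (z - 2%:R + 1) = n.+1%:R * npow n.+1 z.
  have -> : z = (z - 2%:R + 1) + 1%:R by ring.
  rewrite [in RHS]npowD npow_nat expr1 mulrCA.
  have -> : (n.+1%:R : R[i]) * (n.+1%:R^-1 : R)%:C = 1.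
    by rewrite -realCn -realCM divff ?pnatr_eq0.
  by rewrite mulr1; congr npow; ring.
ring.
Qed.

Local Notation C := (R[i]^o).

Lemma qderiv_shift (f : R[i] -> R[i]) c w : qderiv f (w + c) -> qderiv (fun v => f (v + c)) w.
Proof.
by move=> [d [B [r [r0 h]]]]; exists d, B, r; split => // e er; rewrite (addrAC w e c) h.
Qed.

Lemma derivable_Zc m w : derivable (fun v : C => Zc (v - m%:R) : C) (w : C) 1.
Proof. by apply: qderiv_derivable; apply: qderiv_shift; exact: qderiv_Zc. Qed.

Lemma derivable_subr c w : derivable (fun v : C => v - c : C) (w : C) 1.
Proof. by apply: derivableB; [exact: derivable_id|exact: derivable_cst]. Qed.

Lemma derivable_zterm c m w : (c == 0) || (w != m%:R) ->
  derivable (zterm c m : C -> C) (w : C) 1.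
Proof.
have [->|_ /= wm] := eqVneq c 0.
  rewrite (_ : zterm _ _ = cst 0 :> (C -> C)); first by move=> _; exact: derivable_cst.
  by apply/funext => z; rewrite /zterm mul0r.
apply: derivableM; first exact: derivable_cst.
apply: derivableD; first exact: derivable_cst.
apply: derivableM; first exact: derivable_Zc.
by apply: derivableV; [rewrite subr_eq0|exact: derivable_subr].
Qed.

Lemma derivable_zfun a b (e : nat -> R[i]) (E t : R) w : 0 < t -> t < 1 -> 0 <= E ->
  (forall n, nm (e n) <= E * t ^+ n) ->
  (a == 0) || (w != 2) -> (b == 0) || (w != 1) ->
  derivable (zfun a b e : C -> C) (w : C) 1.
Proof.
move=> t0 t1 E0 he aw bw; apply: derivableD; last first.
  exact/qderiv_derivable/(qderiv_rem_sum t0 t1 E0 he).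
by apply: derivableD; exact: derivable_zterm.
Qed.

Lemma derivable_cvg (f : C -> C) (w : C) : derivable f w 1 -> f x @[x --> w^'] --> f w.
Proof.
by move=> /derivable1_diffP/differentiable_continuous/continuous_withinNx.
Qed.

Lemma near_punctured (w z : C) : \forall x \near w^', x != z.
Proof.
have [->|wz] := eqVneq w z; first exact: nbhs_dnbhs_neq.
apply: nbhs_dnbhs; apply/nbhs_ballP; exists `|w - z|.
  by rewrite /= normr_gt0 subr_eq0.
move=> x; rewrite -ball_normE /= => wx; apply: contraTneq wx => ->.
by rewrite ltxx.
Qed.

Lemma pole_simple (f g : C -> C) (z : C) : (\forall w \near z^', derivable f w 1) ->
  derivable g z 1 -> g z != 0 -> (forall w, w != z -> (w - z) * f w = g w) -> pole f z.
Proof.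
move=> hf hg g0 fg; split=> //; exists 1%N, (g z); split=> //.
apply: cvg_trans (derivable_cvg hg); apply: near_eq_cvg; near=> w.
rewrite expr1 fg//; near: w; exact: nbhs_dnbhs_neq.
Unshelve. all: by end_near. Qed.

Lemma derivable_exp_subr (z w : C) k : derivable (fun v : C => (v - z) ^+ k : C) w 1.
Proof.
elim: k => [|k IH].
  rewrite (_ : (fun _ => _) = cst 1); first exact: derivable_cst.
  by apply/funext => v; rewrite expr0.
rewrite (_ : (fun _ => _) = (fun v : C => (v - z) * (v - z) ^+ k)).
  by apply: derivableM; [exact: derivable_subr|exact: IH].
by apply/funext => v; rewrite exprS.
Qed.

(** With k > 0 the factor (w - z)^k forces the limit 0, against c != 0. *)
Lemma derivable_not_pole (f : C -> C) (z : C) : derivable f z 1 -> ~ pole f z.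
Proof.
move=> hf [_ [k [c [k0 c0 hc]]]]; case/eqP: c0.
have /derivable_cvg : derivable (fun w : C => (w - z) ^+ k * f w : C) z 1.
  by apply: derivableM; [exact: derivable_exp_subr|exact: hf].
rewrite [X in _ --> X](_ : _ = 0); last first.
  by change ((z - z) ^+ k * f z = 0); rewrite subrr expr0n eqn0Ngt k0 mul0r.
move=> h0.
exact: (cvg_unique (@norm_hausdorff _ C) hc h0).
Qed.

End ZetaFunctions.

(** * Size of A on the basis vectors *)

Section ModulusSquared.
Variables (R : realType) (q s : R) (N : rat).
Hypotheses (q0 : 0 < q) (q1 : q < 1) (N_half_int : 2 * N \is a Num.int) (N_neq0 : N != 0).
Local Notation I := (ket_index N).
Local Notation H := (l2 R I).
Local Notation xJ := (@xJ R q N).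
Local Notation xK := (@xK R q N).
Local Notation xP := (@xP R q N).
Local Notation p := (q ^+ 2 + 1).
Local Notation u := (1 - s ^+ 2).
Implicit Types (x y : I) (n : nat).
Local Notation cf := (@cf R q s N).
Local Notation opA := (@opA R q s N).

Lemma cs_ge0 (t : R) : 0 <= cs t. Proof. exact: sqrtr_ge0. Qed.

Lemma cs_le1 (t : R) : cs t <= 1.
Proof. by rewrite /cs -[leRHS]sqrtr1 ler_wsqrtr// lerBlDr lerDl sqr_ge0. Qed.

(** P takes only the values q^(2|N|) and q^(-2|N|), so constants depending on P can be made
    uniform. *)
Lemma xP_uniform (F : R -> R -> Prop) : (forall P, exists2 C, 0 <= C & F P C) ->
  (forall P C C', C <= C' -> F P C -> F P C') -> exists2 C, 0 <= C & forall x, F (xP x) C.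
Proof.
move=> hF mono; have [C C0 hC] := hF (q ^+ nu N); have [E E0 hE] := hF (q ^+ nu N)^-1.
exists (C + E) => [|x]; first exact: addr_ge0.
by rewrite /xP; case: pos; [apply: mono hC|apply: mono hE]; rewrite (lerDl, lerDr).
Qed.

Lemma W_gt0 x : 0 < xJ x * xK x. Proof. exact: (W_dom q0 q1 N_half_int N_neq0 x).1. Qed.

Lemma W_leJ x : xJ x * xK x <= xJ x.
Proof.
have kp := ket_kp q0 q1 N_half_int N_neq0 x.
by rewrite ler_piMr ?(kp_Kle1 kp)// ltW// (kp_J0 kp).
Qed.

Lemma hfun_near : exists2 C, 0 <= C & forall x,
  `|hfun q s (xP x) (xJ x * xK x) + u| <= C * (xJ x * xK x).
Proof.
have [||C C0 h] := @xP_uniform (fun P C => forall w, 0 < w <= q -> `|hfun q s P w + u| <= C * w).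
- move=> P; have [C C0 hC] := hfun_lapp s P q0 q1; exists C => // w /hC.
  by rewrite opprK.
- move=> P C C' CC h w hw; apply: le_trans (h w hw) _.
  by rewrite ler_wpM2r//; have /andP[/ltW] := hw.
exists C => // x; apply: h; rewrite W_gt0.
exact: (kp_Wle (ket_kp q0 q1 N_half_int N_neq0 x)).
Qed.

Lemma gam_near : exists2 C, 0 <= C & forall x,
  `|gam q s (xP x) (xJ x * xK x) - Num.sqrt (s ^+ 2)| <= C * Num.sqrt (xJ x * xK x) /\
  `|gam q s (xP x) (q ^+ 2 * (xJ x * xK x)) - Num.sqrt (s ^+ 2)| <= C * Num.sqrt (xJ x * xK x).
Proof.
have [||C C0 h] := @xP_uniform (fun P C => forall w, 0 < w -> w = q \/ w <= q ^+ 2 ->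
    `|gam q s P w - Num.sqrt (s ^+ 2)| <= C * Num.sqrt w).
- by move=> P; exact: (gam_approx s P q0 q1).
- move=> P C C' CC h w w0 hw; apply: le_trans (h w w0 hw) _.
  by rewrite ler_wpM2r// sqrtr_ge0.
have q21 : q ^+ 2 <= 1 by rewrite exprn_ile1// ltW.
exists C => // x; have [w0 hw] := W_dom q0 q1 N_half_int N_neq0 x; split; first exact: h.
have w1 : xJ x * xK x <= 1.
  by apply: le_trans (kp_Wle (ket_kp q0 q1 N_half_int N_neq0 x)) _; exact: ltW.
apply: le_trans (h x _ _ _) _.
- by rewrite mulr_gt0// exprn_gt0.
- by right; rewrite ler_piMr// exprn_ge0// ltW.
- by rewrite ler_wpM2l// ler_wsqrtr// ler_piMl// ltW.
Qed.

Lemma sqrtW_le1 x : Num.sqrt (xJ x * xK x) <= 1.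
Proof.
rewrite -[leRHS]sqrtr1 ler_wsqrtr//; apply: le_trans (ltW q1).
exact: (kp_Wle (ket_kp q0 q1 N_half_int N_neq0 x)).
Qed.

Lemma gam_bounded : exists2 C, 0 <= C & forall x, gam q s (xP x) (xJ x * xK x) <= C /\
  gam q s (xP x) (q ^+ 2 * (xJ x * xK x)) <= C.
Proof.
have [C C0 h] := gam_near; exists (C + Num.sqrt (s ^+ 2)) => [|x].
  by rewrite addr_ge0// sqrtr_ge0.
have CW : C * Num.sqrt (xJ x * xK x) <= C by rewrite ler_piMr// sqrtW_le1.
by have [h1 h2] := h x; split; rewrite -lerBlDr;
  [apply: le_trans (le_trans h1 CW)|apply: le_trans (le_trans h2 CW)]; exact: ler_norm.
Qed.

Lemma coefAz_small : exists2 C, 0 <= C & forall x, `|atx q s (@coefAz R) x| <= C * xJ x.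
Proof.
have [C C0 hC] := hfun_near.
have p1 : 1 <= p by rewrite lerDr sqr_ge0.
have p0 : 0 < p by rewrite (lt_le_trans ltr01).
exists (C + (C + `|u|) * 2) => [|x]; first by rewrite addr_ge0// mulr_ge0// addr_ge0.
have kp := ket_kp q0 q1 N_half_int N_neq0 x.
move: (hC x) (W_gt0 x) (W_leJ x) (kp_J0 kp) (kp_Jle1 kp); rewrite /atx /coefAz /diagA.
move: (xJ x) (xJ x * xK x) (hfun _ _ _ _) => J W h hu W0 WJ J0 J1.
have W1 : W <= 1 by exact: le_trans J1.
have hb : `|h| <= C + `|u|.
  rewrite -[h](addrK u); apply: le_trans (ler_normB _ _) _; rewrite lerD2r.
  by apply: le_trans hu _; rewrite ler_piMr.
(* As h is close to -u, the constants u/p and h/p almost cancel. The rest contains h + u = O(W), W^2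
   or J^2, all of which are O(J). *)
have -> : u / p - h * (J ^+ 2 - (1 + q ^+ 2 * W ^+ 2) / p) =
    (h + u) / p + h * (q ^+ 2 / p * W ^+ 2 - J ^+ 2) by field; rewrite gt_eqF.
apply: le_trans (ler_normD _ _) _; rewrite [X in _ <= X]mulrDl lerD//.
  rewrite normrM normfV (ger0_norm (ltW p0)).
  apply: le_trans (_ : C * W <= _); last by rewrite ler_wpM2l.
  apply: le_trans hu; rewrite ler_piMr// invf_le1//.
rewrite normrM -[X in _ <= X]mulrA ler_pM//.
apply: le_trans (ler_normB _ _) _.
have Q0 : 0 <= q ^+ 2 by exact: sqr_ge0.
have W2 : W ^+ 2 <= W by rewrite expr2 ler_piMr// ltW.
have Q1 : q ^+ 2 / p * W ^+ 2 <= W.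
  by apply: le_trans W2; rewrite ler_piMl ?sqr_ge0// ler_pdivrMr// mul1r lerDl.
rewrite (ger0_norm (sqr_ge0 _)) ger0_norm; last first.
  by apply: mulr_ge0; [exact: divr_ge0 Q0 (ltW p0)|exact: sqr_ge0].
have -> : 2 * J = J + J by ring.
by rewrite lerD ?(le_trans Q1)// expr2 ler_piMr// ltW.
Qed.

Lemma hnorm_delta x : hnorm (l2_delta R x) = 1.
Proof. by rewrite /hnorm inner_deltal l2_deltaE eqxx sqrtr1. Qed.

Lemma hnorm_ket (o : option I) : hnorm (oapp (@l2_delta R _) 0 o) <= 1.
Proof.
case: o => [x|] /=; first by rewrite hnorm_delta.
by rewrite /hnorm inner0r sqrtr0.
Qed.

Lemma opA_small : exists2 C, 0 <= C & forall x, hnorm (opA (l2_delta R x)) <= C * xJ x.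
Proof.
have [G G0 hG] := gam_bounded; have [C C0 hC] := coefAz_small.
exists (2 * (2 * (G + C) + G / q)) => [|x].
  by rewrite mulr_ge0// addr_ge0 ?divr_ge0 ?(ltW q0)// mulr_ge0// addr_ge0.
have kp := ket_kp q0 q1 N_half_int N_neq0 x; have J0 := ltW (kp_J0 kp).
rewrite (opA_delta s q0 q1 N_half_int N_neq0).
have Z (c B : R) o : `|c| <= B -> hnorm (c%:C *: oapp (@l2_delta R I) 0 o) <= B.
  move=> cB; apply: le_trans (hnormZ _ _) _; rewrite nm_real.
  by apply: le_trans cB; rewrite ler_piMr// hnorm_ket.
have csM a b (g t : R) : 0 <= g -> g <= G -> 0 <= t -> `|- t * cs a * cs b * g| <= G * t.
  move=> g0 gG t0; rewrite (_ : _ * g = - (cs a * cs b * g * t)); last by ring.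
  rewrite normrN ger0_norm ?mulr_ge0 ?cs_ge0// ler_wpM2r//; apply: le_trans gG.
  by rewrite ler_piMl// mulr_ile1 ?cs_ge0 ?cs_le1.
have [g1 g2] := hG x.
apply: le_trans (hnormD _ _) _; rewrite -mulrA ler_wpM2l// mulrDl lerD//.
  apply: le_trans (hnormD _ _) _; rewrite -mulrA ler_wpM2l// mulrDl lerD//.
    by apply: Z; apply: csM => //; exact: sqrtr_ge0.
  exact: Z.
rewrite mulrAC -mulrA; apply: Z; apply: csM => //; first exact: sqrtr_ge0.
by rewrite divr_ge0// ltW.
Qed.

(** Since A is self-adjoint, the diagonal of A^2 consists of squared norms. Nothing can cancel in a
    level sum, so a single large ket bounds it from below. *)
Lemma diagonal_opA2 x :
  diagonal (opA \o opA) x = (hnorm (opA (l2_delta R x)) ^+ 2)%:C.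
Proof.
rewrite hnorm_sqr -(inner_selfP _).1 /diagonal -inner_deltal /=.
by rewrite -(adjoint_opA s q0 q1 N_half_int N_neq0).
Qed.

Lemma ket_neq a b x y : a != 0 -> phi (a, b, false) x = Some y -> (y == x) = false.
Proof.
move=> a0 /(phi_coords N_neq0)[_ _ /= e _]; apply/eqP => yx.
by move: e a0; rewrite yx; clear; lia.
Qed.

Lemma opA_coords x : `|atx q s (@coefAz R) x| <= hnorm (opA (l2_delta R x)) /\
  `|atx q s (@coefAp R) x| <= hnorm (opA (l2_delta R x)).
Proof.
have E := opA_delta s q0 q1 N_half_int N_neq0 x.
split; rewrite -nm_real.
  apply: le_trans (nm_coord (opA (l2_delta R x)) x); rewrite E.
  rewrite -[(0, 0, false)]/d0 phi_d0 !l2E.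
  have Z c o : (forall y, o = Some y -> (y == x) = false) ->
      c * (oapp (@l2_delta R I) 0 o) x = 0.
    case: o => [y|] h; last by rewrite mulr0.
    by change (c * (x == y)%:R = 0); rewrite eq_sym h// mulr0.
  rewrite !Z ?addr0 ?add0r.
  - by change (nm (cf (@coefAz R) x) <= nm (cf (@coefAz R) x * (x == x)%:R)); rewrite eqxx mulr1.
  - by move=> y; exact: ket_neq.
  - by move=> y; exact: ket_neq.
case e : (phi (1, 0, false) x) => [y|]; last first.
  by case: (@phi_plus R q N q0 q1 N_half_int N_neq0 (1, 0, false) x erefl _ e); left.
apply: le_trans (nm_coord (opA (l2_delta R x)) y); rewrite E e -[(0, 0, false)]/d0 phi_d0 !l2E.
have -> : (oapp (@l2_delta R I) 0 (phi (-1, 0, false) x)) y = 0.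
  case e' : (phi (-1, 0, false) x) => [z|] //.
  change ((y == z)%:R = 0 :> R[i]); case: eqVneq => // yz; move: e e'; rewrite yz.
  move=> /(phi_coords N_neq0)[_ _ /= e1 _] /(phi_coords N_neq0)[_ _ /= e2 _].
  by move: e1 e2; clear; lia.
change (nm (cf (@coefAp R) x) <= nm (cf (@coefAp R) x * (y == y)%:R +
  cf (@coefAz R) x * (y == x)%:R + cf (@coefAm R) x * 0)).
by rewrite (ket_neq _ e)// eqxx mulr1 !mulr0 !addr0.
Qed.

Lemma eventually_small (C e : R) : 0 <= C -> 0 < e ->
  exists n0, forall n, (n0 <= n)%N -> C * q ^+ n <= e.
Proof.
move=> C0 e0; have [D D0 hD] := poly_geometric 1 q0 q1.
exists (Num.truncn (C * D / e)) => n n0n.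
have n0 : (0 : R) < n.+1%:R by rewrite ltr0n.
have : C * D / e < n.+1%:R by apply: lt_le_trans (truncnS_gt _) _; rewrite ler_nat.
rewrite ltr_pdivrMr// [X in _ < X]mulrC -ltr_pdivrMr// => /ltW; apply: le_trans.
by rewrite -mulrA ler_wpM2l// ler_pdivlMr// mulrC -[n.+1%:R]expr1.
Qed.

Lemma W_small x : xJ x * xK x <= (q ^+ lev x) ^+ 2.
Proof.
rewrite xJK (jk_lev N_half_int N_neq0) -exprM ler_wiXn2l ?(ltW q0) ?(ltW q1)//.
by rewrite muln2 leq_addr.
Qed.

Lemma sqrtW_small x : Num.sqrt (xJ x * xK x) <= q ^+ lev x.
Proof.
have qn : 0 <= q ^+ lev x by rewrite exprn_ge0// ltW.
by rewrite -[leRHS](ger0_norm qn) -sqrtr_sqr ler_wsqrtr// W_small.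
Qed.

(* Two matrix coefficients tend to 1 - s^2 and to - cs q * s along jx = 0, and these
   limits do not vanish simultaneously. *)
Lemma opA_large : exists2 d : R, 0 < d & exists n0, forall x, jx x = 0%N ->
  (n0 <= lev x)%N -> d <= hnorm (opA (l2_delta R x)).
Proof.
have h2 : 0 < 2^-1 :> R by rewrite invr_gt0.
have [s0|s0] := eqVneq s 0.
  have [C C0 hC] := hfun_near; have C1 : 0 <= C + 1 by rewrite addr_ge0.
  have [n0 hn] := eventually_small C1 h2.
  exists 2^-1; [by []|exists n0 => x x0 xn]; apply: le_trans (opA_coords x).1.
  apply: le_trans (ler_norm _).
  have := W_small x; have := W_gt0 x; have := hn _ xn; have := hC x.
  rewrite /atx /coefAz /diagA; have -> : xJ x = 1 by rewrite /xJ x0 expr0.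
  rewrite s0 expr0n subr0 !mul1r.
  move: (xK x) (hfun _ _ _ _) (q ^+ lev x) (exprn_ge0 (lev x) (ltW q0)) (exprn_ile1 (lev x) (ltW q0) (ltW q1)).
  rewrite expr1n => W h t t0 t1 hu ht W0 Wt.
  have {}Wt : W <= t by apply: le_trans Wt _; rewrite expr2 ler_piMr.
  have W1 : W <= 1 := le_trans Wt t1.
  have p0 : 0 < p by rewrite ltr_wpDl// sqr_ge0.
  have W2 : W ^+ 2 <= W by rewrite expr2 ler_piMr// ltW.
  have WW : 0 <= W ^+ 2 by rewrite sqr_ge0.
  have Q0 : 0 <= q ^+ 2 by rewrite sqr_ge0.
  pose z := (1 + q ^+ 2 * W ^+ 2) / p.
  have z0 : 0 <= z by rewrite divr_ge0 ?(ltW p0)// addr_ge0// mulr_ge0.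
  have z1 : z <= 1.
    by rewrite ler_pdivrMr// mul1r addrC lerD2r ler_piMr// (le_trans W2).
  (* For s = 0 the limit of h is -1; the terms 1/p cancel, and the coefficient is 1 up to O(W). *)
  have -> : p^-1 - h * (1 - (1 + q ^+ 2 * W ^+ 2) / p) =
     1 - (h + 1) * (1 - z) - q ^+ 2 / p * W ^+ 2 by rewrite /z; field; rewrite gt_eqF.
  have h3 : (h + 1) * (1 - z) <= C * W.
    apply: le_trans (ler_norm _) _; rewrite normrM.
    apply: le_trans hu; rewrite ler_piMr// ger0_norm ?subr_ge0// lerBlDr lerDl//.
  have h4 : q ^+ 2 / p * W ^+ 2 <= W.
    apply: le_trans W2; rewrite ler_piMl// ler_pdivrMr// mul1r lerDl//.
  have h5 : C * W <= C * t by rewrite ler_wpM2l.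
  have e : 2^-1 = 1 - 2^-1 :> R by field.
  rewrite e -addrA lerD2l -opprD lerN2; apply: le_trans ht; rewrite [X in _ <= X]mulrDl mul1r.
  by rewrite lerD// ?(le_trans h3)// (le_trans h4).
have g0 : 0 < Num.sqrt (s ^+ 2) by rewrite sqrtr_gt0 exprn_even_gt0.
have csq : 0 < cs q by rewrite sqrtr_gt0 subr_gt0 expr_lt1// ltW.
have [C C0 hC] := gam_near.
have g2 : 0 < Num.sqrt (s ^+ 2) / 2 by rewrite divr_gt0.
have [n0 hn] := eventually_small C0 g2.
exists (cs q * cs q * (Num.sqrt (s ^+ 2) / 2)).
  by rewrite !mulr_gt0.
exists n0 => x x0 xn; apply: le_trans (opA_coords x).2.
have [_ hg] := hC x; have {}hg := le_trans hg (ler_wpM2l C0 (sqrtW_small x)).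
have {}hg := le_trans hg (hn _ xn).
have kp := ket_kp q0 q1 N_half_int N_neq0 x.
rewrite /atx /coefAp; move: hg; have -> : xJ x = 1 by rewrite /xJ x0 expr0.
move=> hg; rewrite mulN1r !mulNr normrN mulr1 ger0_norm ?mulr_ge0 ?cs_ge0 ?sqrtr_ge0//.
(* K <= 1 gives cs (q K) >= cs q, and [gam] has reached half of its limit |s|. *)
rewrite ler_pM ?mulr_ge0 ?cs_ge0 ?(ltW g2) ?sqrtr_ge0//.
  rewrite ler_wpM2r ?cs_ge0// /cs ler_wsqrtr// lerD2l lerN2.
  have qK : q * xK x <= q by rewrite ler_piMr ?(ltW q0)// (kp_Kle1 kp).
  by rewrite lerXn2r// nnegrE ?(ltW q0)// mulr_ge0 ?(ltW q0)// ltW// (kp_K0 kp).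
move: hg; rewrite distrC => /(le_trans (ler_norm _)).
move: (gam _ _ _ _) (Num.sqrt (s ^+ 2)) => a b; lra.
Qed.

End ModulusSquared.

(** * Reading off the coefficients of affine growth *)

Section AffineGrowth.
Variables (R : realType) (s : nat -> R[i]) (a c : R[i]) (t E : R).
Hypotheses (t0 : 0 < t) (t1 : t < 1) (E0 : 0 <= E).
Hypothesis hs : forall n, nm (s n - (a * n%:R + c)) <= E * t ^+ n.

Let Et n : E * t ^+ n <= E.
Proof. by rewrite ler_piMr// exprn_ile1// ltW. Qed.

Lemma nat_unbounded (x B : R) : 0 < x -> ~ (forall n, x * n%:R <= B).
Proof.
move=> x0 /(_ (Num.truncn (B / x)).+1); rewrite mulrC -ler_pdivlMr// leNgt.
by rewrite truncnS_gt.
Qed.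

Lemma affine_bounded (B : R) : (forall n, nm (s n) <= B) -> a = 0.
Proof.
move=> hB; apply/eqP; apply: contraT; rewrite -nm_gt0 => a0.
case: (@nat_unbounded (nm a) (E + B + nm c) a0) => n.
rewrite -nm_nat -nmM (_ : a * n%:R = - (s n - (a * n%:R + c)) + s n - c); last by ring.
apply: le_trans (nmB _ _) _; rewrite lerD2r; apply: le_trans (nmD _ _) _.
by rewrite nmN lerD// (le_trans (hs n)).
Qed.

Lemma affine_unbounded : (forall n, n%:R <= nm (s n)) -> a != 0.
Proof.
move=> hn; apply/eqP => a0; case: (@nat_unbounded 1 (E + nm c) ltr01) => n.
rewrite mul1r; apply: le_trans (hn n) _.
rewrite (_ : s n = (s n - (a * n%:R + c)) + c); last by rewrite a0; ring.
by apply: le_trans (nmD _ _) _; rewrite lerD2r (le_trans (hs n)).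
Qed.

Lemma affine_nonzero (d : R) n0 : a = 0 -> 0 < d ->
  (forall n, (n0 <= n)%N -> d <= nm (s n)) -> c != 0.
Proof.
move=> a0 d0 hd; apply/eqP => c0.
have [|n1 h1] := eventually_small t0 t1 E0 (_ : 0 < d / 2); first by rewrite divr_gt0.
have := hs (maxn n0 n1); rewrite a0 c0 mul0r addr0 subr0.
move=> /(le_trans (hd _ (leq_maxl _ _)))/le_trans/(_ (h1 _ (leq_maxr _ _))).
by rewrite ler_pdivlMr// ger_pMr// leNgt ltr1n.
Qed.

End AffineGrowth.

Section LevelSumBounds.
Variables (R : realType) (N : rat).
Hypotheses (N_half_int : 2 * N \is a Num.int) (N_neq0 : N != 0).
Local Notation I := (ket_index N).
Local Notation nu := (nu N).
Implicit Types (x : I) (g : I -> R) (b : bool) (n : nat).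

Lemma level_sum_real g n : level_sum (fun x => (g x)%:C) n = (level_sum g n)%:C.
Proof.
have B b : branch_sum (fun x => (g x)%:C) b n = (branch_sum g b n)%:C.
  rewrite /branch_sum -realC_sum; apply: eq_bigr => j _.
  by rewrite /branch; case: mk_ket.
by rewrite /level_sum !B realCD.
Qed.

Lemma level_sum_geometric g r (C : R) n : 0 <= r -> r < 1 -> 0 <= C ->
  (forall x, g x <= C * r ^+ jx x) -> level_sum g n <= C / (1 - r) + C / (1 - r).
Proof.
move=> r0 r1 C0 hg; have d0 : 0 < 1 - r by rewrite subr_gt0.
have B b : branch_sum g b n <= C / (1 - r).
  apply: (@le_trans _ _ (\sum_(j < (n.*2 + nu).+1) C * r ^+ j)).
    apply: ler_sum => j _; rewrite /branch.
    have jn : (j <= n.*2 + nu)%N by rewrite -ltnS ltn_ord.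
    by have [x -> [xj _ _ _]] := mk_ketP N_half_int N_neq0 b (subnKC jn); rewrite /= -[X in _ ^+ X]xj.
  rewrite -mulr_sumr ler_wpM2l// -[leRHS]mul1r ler_pdivlMr// mulrC.
  have := subrX1 r (n.*2 + nu).+1; move: (\sum_(i < _) _) => S h.
  by rewrite -opprB mulNr -h opprB lerBlDr lerDl exprn_ge0.
exact: lerD.
Qed.

Lemma level_sum_ge g (d : R) n : (forall x, 0 <= g x) ->
  (forall x, jx x = 0%N -> lev x = n -> d <= g x) -> d <= level_sum g n.
Proof.
move=> g0 hd.
have B0 b j k : 0 <= branch g b j k by rewrite /branch; case: mk_ket => [x|] /=.
rewrite /level_sum /branch_sum big_ord_recl -addrA; set rest := (X in _ <= _ + X).
have rest0 : 0 <= rest by rewrite /rest addr_ge0// sumr_ge0.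
apply: (@le_trans _ _ (branch g true 0 (n.*2 + nu - 0))); last by rewrite lerDl.
rewrite /branch; have [x -> [xj _ xl _]] := mk_ketP N_half_int N_neq0 true (subnKC (leq0n (n.*2 + nu))).
exact: hd.
Qed.

Lemma level_sum1 n : n%:R <= level_sum (fun _ : I => 1 : R) n :> R.
Proof.
have B b : n%:R <= branch_sum (fun _ : I => 1 : R) b n :> R.
  rewrite /branch_sum (eq_bigr (fun=> 1)) => [|j _].
    by rewrite sumr_const card_ord ler_nat; move: nu; clear; lia.
  rewrite /branch; have jn : (j <= n.*2 + nu)%N by rewrite -ltnS ltn_ord.
  by have [x -> _] := mk_ketP N_half_int N_neq0 b (subnKC jn).
rewrite -[leLHS]addr0 lerD//; apply: le_trans (B false); exact: ler0n.
Qed.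

End LevelSumBounds.

(** * Poles of the continued zeta functions *)

Section ZetaPoles.
Variable R : realType.
Local Notation C := (R[i]^o).
Implicit Types (f g : C -> C) (z w : C) (a b : R[i]) (m : nat).

Lemma near_neq z w : z != w -> \forall x \near z, x != w.
Proof.
move=> zw; apply/nbhs_ballP; exists `|z - w|; first by rewrite /= normr_gt0 subr_eq0.
by move=> x; rewrite -ball_normE /= => zx; apply: contraTneq zx => ->; rewrite ltxx.
Qed.

Lemma pole_zterm f g a m : a != 0 -> (forall w, f w = zterm a m w + g w) ->
  derivable g (m%:R : C) 1 -> (\forall w \near (m%:R : C)^', derivable f w 1) ->
  pole f (m%:R : C).
Proof.
move=> a0 fE hg hf.
(* The continuation of (w - m) f(w) through w = m, where its value is a Zc(0) = a. *)
pose h (w : C) : C := a * ((w - m%:R) + Zc (w - m%:R)) + (w - m%:R) * g w.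
refine (@pole_simple _ f h _ hf _ _ _).
- apply: derivableD; last by apply: derivableM; [exact: derivable_subr|exact: hg].
  apply: derivableM; first exact: derivable_cst.
  by apply: derivableD; [exact: derivable_subr|exact: derivable_Zc].
- change (a * ((m%:R - m%:R) + Zc (m%:R - m%:R)) + (m%:R - m%:R) * g m%:R != 0).
  by rewrite subrr add0r Zc0 mulr1 mul0r addr0.
move=> w wm; change ((w - m%:R) * f w = a * ((w - m%:R) + Zc (w - m%:R)) + (w - m%:R) * g w).
rewrite fE /zterm mulrDr; congr (_ + _).
have : (w : R[i]) - m%:R != 0 by rewrite subr_eq0.
move: (w - m%:R) (Zc _) => v x v0; rewrite mulrCA mulrDr mulr1.
by rewrite [v * (x / v)]mulrCA divff// mulr1.
Qed.

Section ZetaFunction.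
Variables (a b : R[i]) (e : nat -> R[i]) (E t : R).
Hypotheses (t0 : 0 < t) (t1 : t < 1) (E0 : 0 <= E) (he : forall n, nm (e n) <= E * t ^+ n).
Local Notation f := (zfun a b e : C -> C).

Let der (w : C) : (a == 0) || (w != 2) -> (b == 0) || (w != 1) -> derivable f w 1.
Proof. exact: derivable_zfun t0 t1 E0 he. Qed.

Lemma zfun_holomorphic z : (a == 0) || (z != 2) -> (b == 0) || (z != 1) -> holomorphic_at f z.
Proof.
have K (d : bool) (w : C) : d || (z != w) -> \forall x \near z, d || (x != w).
  case: d => [_|zw]; first by near=> x.
  exact: near_neq zw.
move=> /K h2 /K h1; rewrite /holomorphic_at; near=> w; apply: der; near: w; [exact: h2|exact: h1].
Unshelve. all: by end_near. Qed.

Lemma zfun_pole2 : a != 0 -> pole f 2.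
Proof.
move=> a0; apply: (@pole_zterm _ (fun w => zterm b 1 w + rem_sum e w) a 2 a0).
- by move=> w; rewrite /zfun addrA.
- apply: derivableD; last exact/qderiv_derivable/(qderiv_rem_sum t0 t1 E0 he).
  by apply: derivable_zterm; rewrite eqr_nat orbT.
near=> w; apply: der; first by apply/orP; right; near: w; exact: near_punctured.
by apply/orP; right; near: w; exact: near_punctured.
Unshelve. all: by end_near. Qed.

Lemma zfun_pole1 : b != 0 -> pole f 1.
Proof.
move=> b0; apply: (@pole_zterm _ (fun w => zterm a 2 w + rem_sum e w) b 1 b0).
- by move=> w; rewrite /zfun -addrA addrCA.
- apply: derivableD; last exact/qderiv_derivable/(qderiv_rem_sum t0 t1 E0 he).
  by apply: derivable_zterm; rewrite eqr_nat orbT.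
near=> w; apply: der; first by apply/orP; right; near: w; exact: near_punctured.
by apply/orP; right; near: w; exact: near_punctured.
Unshelve. all: by end_near. Qed.

Lemma zfun_meromorphic : meromorphic f.
Proof.
move=> z; have [/andP[h1 h2]|] := boolP (((a == 0) || (z != 2)) && ((b == 0) || (z != 1))).
  by left; exact: zfun_holomorphic.
rewrite negb_and !negb_or !negbK => /orP[]/andP[h0 /eqP ->]; right.
  exact: zfun_pole2.
exact: zfun_pole1.
Qed.

Lemma zfun_poles z : pole f z -> z = 1 \/ z = 2.
Proof.
have [->|z1] := eqVneq z 1; first by left.
have [->|z2] := eqVneq z 2; first by right.
by move=> /derivable_not_pole; case; apply: der; rewrite ?z1 ?z2 orbT.
Qed.

End ZetaFunction.
End ZetaPoles.

(** * The dimension spectrum *)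

Section DimensionSpectrum.
Variables (R : realType) (q s : R) (N : rat).
Hypotheses (q0 : 0 < q) (q1 : q < 1) (N_half_int : 2 * N \is a Num.int) (N_neq0 : N != 0).
Local Notation I := (ket_index N).
Local Notation H := (l2 R I).
Local Notation rep := (@podles_rep R q s N).
Local Notation D := (@podles_D R N).
Local Notation opA := (@opA R q s N).
Local Notation rho := (Num.sqrt (Num.sqrt q)).
Implicit Types (T : H -> H) (x : I).

Let rho0 : 0 < rho. Proof. by rewrite !sqrtr_gt0. Qed.
Let rho1 : rho < 1. Proof. by rewrite -sqrtr1 ltr_sqrt// -sqrtr1 ltr_sqrt. Qed.

(* The residues at 2 and 1 of the zeta function of T are the coefficients a and b. *)
Definition level_affine T (a b : R[i]) := exists t, exists2 E : R, [/\ 0 < t, t < 1 & 0 <= E] &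
  forall n, nm (level_sum (diagonal T) n - (a * n.+1%:R + b)) <= E * t ^+ n.

Lemma band_zeta T : bandop (@symbols R N rho) T -> exists f a b,
  [/\ level_affine T a b, meromorphic f,
    forall z, 4 < complex.Re z ->
      has_trace (T \o op_power (modulus D) (- z)) (f z) /\ holomorphic_at f z,
    forall z, pole f z -> z = 1 \/ z = 2 &
    (a != 0 -> pole f 2) /\ (b != 0 -> pole f 1)].
Proof.
move=> hT; have sT := band_diagonal N_half_int N_neq0 rho0 rho1 hT.
have [linT _] := band_bounded (class_GP q0 q1 N_half_int N_neq0) hT.
have [B hB] := sym_bdd sT.
have B0 : 0 <= `|B| by [].
have {}hB x : nm (diagonal T x) <= `|B| by apply: le_trans (hB x) (ler_norm _).
have [a [c [E E0 hE]]] := level_sum_affine N_half_int N_neq0 rho0 rho1 sT.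
(* On level n the eigenvalue of |D| is n + 1, so a n + c is rewritten as a (n + 1) + (c - a). *)
pose b := c - a; pose e n := level_sum (diagonal T) n - (a * n.+1%:R + b).
have t0 : 0 < Num.sqrt rho by rewrite sqrtr_gt0.
have t1 : Num.sqrt rho < 1 by rewrite -sqrtr1 ltr_sqrt.
have he n : nm (e n) <= E * Num.sqrt rho ^+ n.
  apply: le_trans (hE n); rewrite /e /b -natr1.
  by rewrite (_ : a * (n%:R + 1) + (c - a) = a * n%:R + c); last by ring.
exists (zfun a b e), a, b; split.
- by exists (Num.sqrt rho), E.
- exact: (zfun_meromorphic a b t0 t1 E0 he).
- move=> z z4; split; last first.
    have zn n : (n%:R : R) < 4 -> z != n%:R.
      by move=> n4; apply: contraTneq z4 => ->; rewrite Re_nat -leNgt ltW.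
    apply: (zfun_holomorphic t0 t1 E0 he); apply/orP; right.
      by apply: (zn 2%N); rewrite ltr_nat.
    by apply: (zn 1%N); rewrite ltr_nat.
  rewrite (modulus_podles_D q0 q1 N_half_int N_neq0); apply/hsP.
  have [v hv hcl] := hs_zeta_trace N_half_int N_neq0 B0 hB (ltW z4).
  rewrite -(cl_uniq hcl (zfun_cl t0 t1 E0 he (ltW z4))).
  apply: eq_hs hv => x; rewrite diagonal_power//.
  by apply: le_trans (ltW z4).
- exact: (zfun_poles t0 t1 E0 he).
- by split; [exact: (zfun_pole2 b t0 t1 E0 he)|exact: (zfun_pole1 a t0 t1 E0 he)].
Qed.

Lemma Psi0_rep a : Psi0 rep D (rep a).
Proof. by apply: (@Psi0_gen _ _ _ _ _ 0%N (rep a)) => //; left; exists a. Qed.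

Let rep_id : rep 1 = id.
Proof. exact: (rep_one (podles_star_representation s q0 q1 N_half_int N_neq0)). Qed.

Lemma id_level_affine a b : level_affine (@id H) a b -> a != 0.
Proof.
move=> [t [E [t0 t1 E0] h]].
apply: (@affine_unbounded R (level_sum (diagonal (@id H))) a (a + b) t E t0 t1 E0).
  move=> n; rewrite (_ : a * n%:R + (a + b) = a * n.+1%:R + b)//.
  by rewrite -natr1; ring.
move=> n; have -> : diagonal (@id H) = (fun _ : I => (1 : R)%:C).
  by apply/funext => x; change ((x == x)%:R = 1 :> R[i]); rewrite eqxx.
rewrite level_sum_real nm_real; apply: le_trans (ler_norm _).
exact: level_sum1.
Qed.

Lemma opA2_level_affine a b : level_affine (opA \o opA) a b -> b != 0.
Proof.
move=> [t [E [t0 t1 E0] h]].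
pose g x : R := hnorm (opA (l2_delta R x)) ^+ 2.
have gE : diagonal (opA \o opA) = (fun x => (g x)%:C).
  by apply/funext => x; exact: diagonal_opA2.
have {}h n : nm (level_sum (diagonal (opA \o opA)) n - (a * n%:R + (a + b))) <= E * t ^+ n.
  rewrite (_ : a * n%:R + (a + b) = a * n.+1%:R + b)//.
  by rewrite -natr1; ring.
have lE n : nm (level_sum (diagonal (opA \o opA)) n) = `|level_sum g n|.
  by rewrite gE level_sum_real nm_real.
have g0 x : 0 <= g x by exact: sqr_ge0.
have L0 n : 0 <= level_sum g n by apply: level_sum_ge.
have [C C0 hC] := opA_small s q0 q1 N_half_int N_neq0.
have q2 : q ^+ 2 < 1 by rewrite expr_lt1// ltW.
have a0 : a = 0.
  apply: (affine_bounded t0 t1 E0 h (B := C ^+ 2 / (1 - q ^+ 2) + C ^+ 2 / (1 - q ^+ 2))) => n.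
  rewrite lE ger0_norm//; apply: level_sum_geometric; rewrite ?sqr_ge0// => x.
  have -> : C ^+ 2 * (q ^+ 2) ^+ jx x = (C * xJ q x) ^+ 2.
    by rewrite [RHS]exprMn /xJ -!exprM mulnC.
  have J0 : 0 <= xJ q x by rewrite exprn_ge0// ltW.
  by rewrite /g lerXn2r ?nnegrE ?hnorm_ge0 ?(mulr_ge0 C0 J0).
have [d d0 [n0 hd]] := opA_large s q0 q1 N_half_int N_neq0.
(* The constant term with respect to n, instead of n + 1, is a + b, which equals b here. *)
rewrite -[b]add0r -{1}a0; apply: (affine_nonzero t0 t1 E0 h a0 (d := d ^+ 2) (n0 := n0)).
  by rewrite exprn_gt0.
move=> n nn; rewrite lE ger0_norm//; apply: level_sum_ge => // x x0 xn.
rewrite /g lerXn2r ?nnegrE ?hnorm_ge0 ?(ltW d0)//; apply: hd => //; by rewrite xn.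
Qed.

Lemma podles_dimension_spectrum : dimension_spectrum rep D [set 1; 2].
Proof.
(* The choice of zeta functions runs over all operators; outside [Psi0] the zero function serves. *)
have ex T : exists f : R[i]^o -> R[i]^o, Psi0 rep D T ->
    [/\ meromorphic f, forall z, 4 < complex.Re z ->
        has_trace (T \o op_power (modulus D) (- z)) (f z) /\ holomorphic_at f z,
      forall z, pole f z -> z = 1 \/ z = 2,
      T = id -> pole f 2 & T = opA \o opA -> pole f 1].
  have [hT|nT] := pselect (Psi0 rep D T); last by exists (fun=> 0) => /nT.
  have [f [a [b [lf mf tf pf [f2 f1]]]]] := band_zeta (Psi0_band q0 q1 N_half_int N_neq0 hT).
  exists f => _; split => // TE; rewrite TE in lf.
    by apply: f2; exact: id_level_affine lf.
  by apply: f1; exact: opA2_level_affine lf.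
have [zeta hz] := choice ex; exists zeta; split.
- by move=> T /hz[mz tz _ _ _]; split=> //; exists 4.
- apply/seteqP; split => [z /= [->|->]|z /= [T /hz[_ _ pz _ _] /pz[]]]; last 2 first.
  + by left.
  + by right.
  + have hA : Psi0 rep D (opA \o opA).
      have := Psi0_rep (\pi_(podles q s) (SMul (SGen GenA) (SGen GenA))).
      by rewrite (podles_rep_cls s q0 q1 N_half_int N_neq0) /= rep_GenA.
    by exists (opA \o opA) => //; have [_ _ _ _] := hz _ hA; exact.
  have h1 : Psi0 rep D id by rewrite -rep_id; exact: Psi0_rep.
  by exists id => //; have [_ _ _ + _] := hz _ h1; exact.
- exact/finite_set_countable/finite_set2.
Qed.

Lemma podles_finite_dimensional : finite_dimensional D.
Proof.
have h1 : Psi0 rep D id by rewrite -rep_id; exact: Psi0_rep.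
have [f [a [b [_ _ tf _ _]]]] := band_zeta (Psi0_band q0 q1 N_half_int N_neq0 h1).
(* [band_zeta] provides traces for Re z > 4. *)
exists 5 => //; exists (f 5%:R).
have [|+ _] := tf 5%:R; first by rewrite Re_nat ltr_nat.
by rewrite (_ : (- 5)%:C = - 5%:R)// rmorphN /= -realCn.
Qed.

End DimensionSpectrum.

Theorem proposition3p13 (R : realType) (q s : R) (N : rat)
    (q_gt0 : 0 < q) (q_lt1 : q < 1) (s_ge0 : 0 <= s) (s_le1 : s <= 1)
    (N_half_int : 2 * N \is a Num.int) (N_neq0 : N != 0) :
  let rep := @podles_rep R q s N in
  let D := @podles_D R N in
  let gamma := @podles_gamma R N in
  [/\ even_spectral_triple (@podles_star R q s) rep D gamma,
      regular_triple rep D,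
      finite_dimensional D,
      invertible_D D &
      dimension_spectrum rep D [set 1; 2]].
Proof.
split.
- exact: podles_even.
- exact: podles_regular.
- exact: (podles_finite_dimensional s q_gt0).
- exact: (podles_invertible_D q_gt0).
- exact: podles_dimension_spectrum.
Qed.
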